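(* Let $2<q<\infty$ and $1<\rho<\infty$. Let $K$ be a kernel on $\mathbb{R}\times\mathbb{R}\setminus\{(x,x):x\in\mathbb{R}\}$ for which there exist constants $\delta>0$ and $C>0$ such that - $|K(x,y)|\le \frac{C}{|x-y|}$ for $x\ne y$; - $|K(x,y)-K(z,y)|\le\frac{C|x-z|^\delta}{|x-y|^{1+\delta}}$ for $|x-y|>2|x-z|$; - $|K(y,x)-K(y,z)|\le\frac{C|x-z|^\delta}{|x-y|^{1+\delta}}$ for $|x-y|>2|x-z|$. Assume that $\mathcal{V}_q\mathcal{K}$ is of type $(p_0,p_0)$ for some $1<p_0<\infty$, i.e. there is a constant $C_0$ with $\int_{\mathbb{R}}(\mathcal{V}_q\mathcal{K}(f)(x))^{p_0}dx\le C_0\int_{\mathbb{R}}|f(x)|^{p_0}dx$ for all $f\in L^{p_0}(\mathbb{R})$. Then: (i) for every $w\in A_1$ there is a constant $C_1$ such that for all sequences $\{f_k\}\subset L^1(\mathbb{R},w)$ and all $\lambda>0$ $$w\Big(\Big\{x:\big(\sum_k(\mathcal{V}_q\mathcal{K}(f_k)(x))^\rho\big)^{1/\rho}>\lambda\Big\}\Big)\le\frac{C_1}{\lambda}\int_{\mathbb{R}}\big(\sum_k|f_k(x)|^\rho\big)^{1/\rho}w(x)dx;$$ (ii) for every $1<p<\infty$ and $w\in A_p$ there is a constant $C_2$ such that for all sequences $\{f_k\}\subset L^p(\mathbb{R},w)$ $$\int_{\mathbb{R}}\big(\sum_k(\mathcal{V}_q\mathcal{K}(f_k)(x))^\rho\big)^{p/\rho}w(x)dx\le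 C_2\int_{\mathbb{R}}\big(\sum_k|f_k(x)|^\rho\big)^{p/\rho}w(x)dx.$$
   Context: For $t>0$ the truncated operators are $K_t(f)(x)=\int_{|x-y|>t}K(x,y)f(y)\,dy$, and $\mathcal{K}(f)(x)=\{K_t(f)(x)\}_{t>0}$. For a family $a=\{a_t\}_{t>0}$ of complex numbers, $\|a\|_{v_q}=\sup\big(\sum_{j=0}^\infty|a_{t_j}-a_{t_{j+1}}|^q\big)^{1/q}$, the supremum over all increasing sequences $\{t_j\}$ of positive numbers. $\mathcal{V}_q\mathcal{K}(f)(x)=\|\mathcal{K}(f)(x)\|_{v_q}$. Weights: $w$ is a (locally integrable, a.e. positive) function on $\mathbb{R}$, $w(E)=\int_E w$, and $L^p(\mathbb{R},w)=L^p(\mathbb{R},w\,dx)$. $w\in A_p$ ($1<p<\infty$) if there is a constant $C$ with $\int_I w\,\big(\int_I w^{-\frac1{p-1}}\big)^{p-1}\le C|I|^p$ for every bounded interval $I\subset\mathbb{R}$; $w\in A_1$ if $M(w)\le Cw$ a.e. for some constant $C$, where $M(f)(x)=\sup_{I\ni x}\frac1{|I|}\int_I|f|$ (supremum over intervals containing $x$). *)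

(* Defs.v *)
From HB Require Import structures.
From mathcomp Require Import all_boot all_order all_algebra.
From mathcomp Require Import all_classical all_reals all_analysis.
From mathcomp Require Export complex.

Set Implicit Arguments.
Unset Strict Implicit.
Unset Printing Implicit Defensive.

Import Order.TTheory GRing.Theory Num.Theory.
Import numFieldNormedType.Exports.

Local Open Scope classical_set_scope.
Local Open Scope ring_scope.

(* Complex numbers are [R[i]], and [normc : R[i] -> R] is the modulus with
   values in [R] (the norm of the numDomainType [R[i]] is itself complex).
   Neither a measurable structure on [R[i]] nor an integral of [R[i]]-valued
   functions is available: both are taken componentwise. *)
Notation normc := Normc.normc.

Section variation.
Context {R : realType}.
Notation mu := (@lebesgue_measure R).

Definition cmeasurable (f : R -> R[i]) : Prop :=
  measurable_fun setT (fun x => complex.Re (f x)) /\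
  measurable_fun setT (fun x => complex.Im (f x)).

Definition cintegral (D : set R) (f : R -> R[i]) : R[i] :=
  Complex (\int[mu]_(y in D) complex.Re (f y)) (\int[mu]_(y in D) complex.Im (f y)).

(* Only the values of [K] off the diagonal matter here and below. The real
   integrals in [cintegral] are [0] by convention when they diverge; if
   [|K x y| <= C / |x - y|] this does not occur here for [f] in [L^p(w)] with
   [w] in [A_p], [1 <= p], since [f] is then integrable against [1 / |x - y|]
   on [|x - y| > t]. *)
Definition truncated (K : R -> R -> R[i]) (t : R) (f : R -> R[i]) (x : R) :
    R[i] :=
  cintegral [set y | t < `|x - y|] (fun y => K x y * f y).

Definition variation_norm (q : R) (a : R -> R[i]) : \bar R :=
  ereal_sup
    [set ((\sum_(0 <= j <oo) (normc (a (t j) - a (t j.+1)) `^ q)%:E)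
            `^ q^-1)%E
    | t in [set t : nat -> R | increasing_seq t /\ forall j, 0 < t j]].

Definition variation_op (q : R) (K : R -> R -> R[i]) (f : R -> R[i]) (x : R) :
    \bar R :=
  variation_norm q (fun t => truncated K t f x).

Definition standard_kernel (K : R -> R -> R[i]) : Prop :=
  exists delta C : R, [/\ 0 < delta, 0 < C,
    forall x y, x != y -> normc (K x y) <= C / `|x - y|,
    forall x y z, 2 * `|x - z| < `|x - y| ->
      normc (K x y - K z y)
        <= C * `|x - z| `^ delta / `|x - y| `^ (1 + delta) &
    forall x y z, 2 * `|x - z| < `|x - y| ->
      normc (K y x - K y z)
        <= C * `|x - z| `^ delta / `|x - y| `^ (1 + delta)].

Definition weight (w : R -> R) : Prop :=
  locally_integrable setT w /\ {ae mu, forall x, 0 < w x}.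

(* The uncentred maximal function; [HL_maximal] is the centred one. *)
Definition maximal (f : R -> R) (x : R) : \bar R :=
  ereal_sup
    [set iavg f [set` I] | I in [set I : interval R |
       [/\ x \in I, bounded_set [set` I] & (0 < mu [set` I])%E]]].

Definition A1 (w : R -> R) : Prop :=
  weight w /\
  exists C : R, {ae mu, forall x, (maximal w x <= (C * w x)%:E)%E}.

Definition Ap (p : R) (w : R -> R) : Prop :=
  weight w /\
  exists C : R, forall I : interval R, bounded_set [set` I] ->
    ((\int[mu]_(x in [set` I]) (w x)%:E) *
     (\int[mu]_(x in [set` I]) (w x `^ (- (p - 1)^-1))%:E) `^ (p - 1)
     <= C%:E * mu [set` I] `^ p)%E.

Definition in_Lp (p : R) (w : R -> R) (f : R -> R[i]) : Prop :=
  cmeasurable f /\ (\int[mu]_x (normc (f x) `^ p * w x)%:E < +oo)%E.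

(* [type_pp p T]: the operator [T] is of (strong) type [(p, p)]. *)
Definition type_pp (p : R) (T : (R -> R[i]) -> R -> \bar R) : Prop :=
  exists C : R, forall f, in_Lp p (cst 1) f ->
    (\int[mu]_x (T f x `^ p) <= C%:E * \int[mu]_x (normc (f x) `^ p)%:E)%E.

Definition wmeas (w : R -> R) (E : set R) : \bar R :=
  (\int[mu]_(x in E) (w x)%:E)%E.

End variation.

(* Main.v *)
(* It suffices to treat N bounded functions of compact support, with constants
   independent of N: the vector-valued operator T (the l^rho norm of the
   variations) is lower semicontinuous under truncation of the functions, and
   Fatou's lemma gives the general case. T f is also lower semicontinuous in
   the space variable, so that its level sets are open.

   The variation of the truncations is never compared with a square function.
   For s <= min(q, rho), variations over disjoint cells are bounded by the
   total variation of what lies inside the truncation annuli plus the l^s sum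
   of the masses of the cells cut by their boundaries (each annulus cuts a
   bounded number of cells), uniformly in N. This yields two estimates:
   - a Calderon-Zygmund decomposition at level l along the components of the
     level set of the maximal function: the bad part is controlled off these
     components, so a strong type (p, p) estimate with a weight in A_1 implies
     the weak type (1, 1) estimate with the same weight;
   - a comparison of T f at a point x and at the endpoint of a component of
     {T f > l}: if U >= |f| is a majorant with Mf-type averages bounded by B U
     (Rubio de Francia), the far part of f changes T f by at most const * U(x).
     With the unweighted weak type estimate for the near part this gives a
     good-lambda inequality for T f and U, hence the strong type (p, p)
     estimate for every weight in A_p.
   Starting from the hypothesis (p0, p0) for one function: weak type (1, 1),
   strong type (rho, rho), the latter for N functions by summation, then weak
   type (1, 1) for N functions, and from there all weights. *)

(* The obstacle is the sharp cut-off in the truncations: regularity of the kernel says nothing about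
   the mass lying near the boundary of an annulus. One increment meets only boundedly many cells
   there, and since the annuli of an increasing sequence are disjoint, all the increments that
   charge one cell add up to at most its mass. What is left is an l^s sum of masses, and it has to
   converge.

   In the good-lambda step it would not converge with the maximal function in the role of [U]: a
   function may put the whole mass of every dyadic ring into a single cell, and then each ring
   contributes the same amount. An A_1 majorant cannot concentrate like this, because by reverse
   doubling a cell of width h at distance about 2^j h holds at most a fraction of order eta^j, with
   eta < 1, of the mass of the surrounding ball. This is why the majorant is built by the Rubio de
   Francia algorithm; Muckenhoupt's theorem keeps its L^p(w) norm under control.

   The exponent rho is where vectors come in: there the rho-th power of the l^rho norm is a plain
   sum over the components, so no constant depends on N. *)
Require Import Defs.
From mathcomp Require Import all_boot all_order all_algebra.
From mathcomp Require Import all_classical all_reals all_analysis.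
From mathcomp Require Import measurable_realfun ring lra.

Set Implicit Arguments.
Unset Strict Implicit.
Unset Printing Implicit Defensive.

Import Order.TTheory GRing.Theory Num.Theory.
Import numFieldNormedType.Exports.

Local Open Scope classical_set_scope.
Local Open Scope ring_scope.

(** * Sequence norms *)

Section lpn.
Context {R : realType}.
Implicit Types (p : R) (a b : nat -> R).

Definition lpn p n a : R := (\sum_(k < n) a k `^ p) `^ p^-1.

Lemma lpn_ge0 p n a : 0 <= lpn p n a.
Proof. exact: powR_ge0. Qed.

Lemma sum_powR_ge0 p n a : 0 <= \sum_(k < n) a k `^ p.
Proof. by apply: sumr_ge0 => k _; exact: powR_ge0. Qed.

Lemma powRK p (x : R) : p != 0 -> 0 <= x -> (x `^ p) `^ p^-1 = x.
Proof. by move=> p0 x0; rewrite -powRrM mulfV// powRr1. Qed.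

Lemma powRVK p (x : R) : p != 0 -> 0 <= x -> (x `^ p^-1) `^ p = x.
Proof. by move=> p0 x0; rewrite -powRrM mulVf// powRr1. Qed.

Lemma le_powR p (x y : R) : 0 <= p -> 0 <= x -> x <= y -> x `^ p <= y `^ p.
Proof.
by move=> p0 x0 xy; apply: ge0_ler_powR => //; rewrite nnegrE// (le_trans x0).
Qed.

Lemma lpnK p n a : 0 < p -> lpn p n a `^ p = \sum_(k < n) a k `^ p.
Proof. by move=> p0; rewrite powRVK ?gt_eqF// sum_powR_ge0. Qed.

Lemma lpn_leP p n a (B : R) : 0 < p -> 0 <= B ->
  (lpn p n a <= B) = (\sum_(k < n) a k `^ p <= B `^ p).
Proof.
move=> p0 B0; apply/idP/idP => h.
  by rewrite -lpnK//; apply: le_powR => //; [exact: ltW|exact: lpn_ge0].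
rewrite -(@powRK p B) ?gt_eqF//; apply: le_powR => //.
  by rewrite invr_ge0 ltW.
exact: sum_powR_ge0.
Qed.

Lemma le_lpn p n a b : 0 < p -> (forall k, (k < n)%N -> 0 <= a k <= b k) ->
  lpn p n a <= lpn p n b.
Proof.
move=> p0 ab; rewrite lpn_leP ?lpn_ge0// lpnK//; apply: ler_sum => k _.
by have /andP[a0 akb] := ab _ (ltn_ord k); apply: le_powR => //; exact: ltW.
Qed.

Lemma lpn_Z p n a (c : R) : 0 < p -> 0 <= c -> (forall k, (k < n)%N -> 0 <= a k) ->
  lpn p n (fun k => c * a k) = c * lpn p n a.
Proof.
move=> p0 c0 a0; rewrite /lpn.
rewrite (eq_bigr (fun k : 'I_n => c `^ p * a k `^ p)); last first.
  by move=> k _; rewrite powRM// a0.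
by rewrite -mulr_sumr powRM ?powR_ge0 ?sum_powR_ge0// powRK// gt_eqF.
Qed.

Lemma lpn_eq0 p n a : 0 < p -> (forall k, (k < n)%N -> 0 <= a k) ->
  lpn p n a = 0 -> forall k, (k < n)%N -> a k = 0.
Proof.
move=> p0 a0 /powR_eq0_eq0 h k kn.
have := h; move/eqP; rewrite psumr_eq0 => [/allP|i _]; last exact: powR_ge0.
move/(_ (Ordinal kn)); rewrite mem_index_enum => /(_ isT)/= /eqP.
exact: powR_eq0_eq0.
Qed.

Lemma young_sum p n a b : 1 < p -> (forall k, (k < n)%N -> 0 <= a k) ->
  (forall k, (k < n)%N -> 0 <= b k) ->
  \sum_(k < n) a k `^ p = 1 -> \sum_(k < n) b k `^ p = 1 ->
  \sum_(k < n) a k `^ (p - 1) * b k <= 1.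
Proof.
move=> p1 a0 b0 Sa Sb; have p0 : 0 < p by lra.
have p10 : 0 < p - 1 by lra.
have p'0 : 0 < p / (p - 1) by rewrite divr_gt0.
have pp' : (p / (p - 1))^-1 + p^-1 = 1.
  by rewrite invf_div; field; rewrite gt_eqF.
have pp : (p - 1) * (p / (p - 1)) = p by rewrite mulrC divfK// gt_eqF.
move: (p / (p - 1)) p'0 pp' pp => p' p'0 pp' pp.
apply: (@le_trans _ _ (\sum_(k < n) (a k `^ p * p'^-1 + b k `^ p * p^-1))).
  apply: ler_sum => k _.
  have := conjugate_powR (powR_ge0 (a k) (p - 1)) (b0 _ (ltn_ord k)) p'0 p0 pp'.
  by rewrite -powRrM pp.
by rewrite big_split/= -!mulr_suml Sa Sb !mul1r pp'.
Qed.

Lemma lpn_normalize p n a : 0 < p -> (forall k, (k < n)%N -> 0 <= a k) ->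
  0 < lpn p n a -> \sum_(k < n) (a k / lpn p n a) `^ p = 1.
Proof.
move=> p0 a0 L0.
transitivity (\sum_(k < n) (a k `^ p * (lpn p n a)^-1 `^ p)).
  by apply: eq_bigr => k _; rewrite powRM ?a0// invr_ge0 lpn_ge0.
rewrite -mulr_suml -lpnK// -powRM ?lpn_ge0 ?invr_ge0 ?lpn_ge0//.
by rewrite mulfV ?gt_eqF// powR1.
Qed.

(* Young's inequality, with both sequences normalised, gives the duality between l^p and its conjugate without roots. *)
Lemma lpn_dual p n a b : 1 < p -> (forall k, (k < n)%N -> 0 <= a k) ->
  (forall k, (k < n)%N -> 0 <= b k) -> 0 < lpn p n a ->
  \sum_(k < n) (a k / lpn p n a) `^ (p - 1) * b k <= lpn p n b.
Proof.
move=> p1 a0 b0 L0; have p0 : 0 < p by lra.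
have [M0|M0] := eqVneq (lpn p n b) 0.
  rewrite M0 big1// => k _.
  by rewrite (lpn_eq0 p0 b0 M0 (ltn_ord k)) mulr0.
have {}M0 : 0 < lpn p n b by rewrite lt_neqAle eq_sym M0 lpn_ge0.
have q0 (c : nat -> R) : (forall k, (k < n)%N -> 0 <= c k) ->
    forall k, (k < n)%N -> 0 <= c k / lpn p n c.
  by move=> c0 k kn; rewrite divr_ge0 ?c0 ?lpn_ge0.
have := young_sum p1 (q0 _ a0) (q0 _ b0) (lpn_normalize p0 a0 L0)
  (lpn_normalize p0 b0 M0).
rewrite (eq_bigr (fun k : 'I_n => (a k / lpn p n a) `^ (p - 1) * b k / lpn p n b)).
  by rewrite -mulr_suml ler_pdivrMr ?mul1r.
by move=> k _; rewrite mulrA.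
Qed.

(** The equality case of [lpn_dual]: the functional with coefficients (a / |a|)^(p - 1) norms [a].
    Both Minkowski inequalities below are obtained by testing with it. *)
Lemma lpn_dual_eq p n a : 1 < p -> (forall k, (k < n)%N -> 0 <= a k) ->
  0 < lpn p n a ->
  \sum_(k < n) (a k / lpn p n a) `^ (p - 1) * a k = lpn p n a.
Proof.
move=> p1 a0 L0; set L := lpn p n a.
have p0 : 0 < p by lra.
rewrite (eq_bigr (fun k : 'I_n => a k `^ p * (L^-1) `^ (p - 1))); last first.
  move=> k _; rewrite powRM ?a0 ?invr_ge0 ?ltW//.
  by rewrite mulrAC mulrC [_ * a k]mulrC mulr_powRB1 ?a0// mulrC.
rewrite -mulr_suml -lpnK// -/L -mulr_powRB1 ?lpn_ge0// -mulrA -powRM ?lpn_ge0 ?invr_ge0 ?lpn_ge0//.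
by rewrite mulfV ?gt_eqF// powR1 mulr1.
Qed.

Lemma lpn1 n a : (forall k, (k < n)%N -> 0 <= a k) -> lpn 1 n a = \sum_(k < n) a k.
Proof.
move=> a0; rewrite /lpn invr1 powRr1 ?sum_powR_ge0//.
by apply: eq_bigr => k _; rewrite powRr1// a0.
Qed.

(** The functional that norms a + b is applied to [a] and to [b] separately; p = 1 is plain
    additivity. *)
Lemma lpn_triangle p n a b : 1 <= p -> (forall k, (k < n)%N -> 0 <= a k) ->
  (forall k, (k < n)%N -> 0 <= b k) ->
  lpn p n (fun k => a k + b k) <= lpn p n a + lpn p n b.
Proof.
rewrite le_eqVlt => /predU1P[<- a0 b0|p1 a0 b0].
  by rewrite !lpn1 ?big_split// => k kn; rewrite addr_ge0 ?a0 ?b0.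
pose u k := a k + b k.
have u0 k : (k < n)%N -> 0 <= u k by move=> kn; rewrite addr_ge0 ?a0 ?b0.
have [->|L0] := eqVneq (lpn p n u) 0; first by rewrite addr_ge0 ?lpn_ge0.
have {}L0 : 0 < lpn p n u by rewrite lt_neqAle eq_sym L0 lpn_ge0.
rewrite -(lpn_dual_eq p1 u0 L0).
under eq_bigr do rewrite mulrDr.
rewrite big_split/=; apply: lerD.
  exact: lpn_dual p1 u0 a0 L0.
exact: lpn_dual p1 u0 b0 L0.
Qed.

Lemma sum_powR_le_powR_sum p n a : 1 <= p -> (forall k, (k < n)%N -> 0 <= a k) ->
  \sum_(k < n) a k `^ p <= (\sum_(k < n) a k) `^ p.
Proof.
move=> p1 a0; have S0 : 0 <= \sum_(k < n) a k.
  by apply: sumr_ge0 => k _; exact: a0.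
have p0 : 0 < p by lra.
rewrite -(mulr_powRB1 S0 p0) mulr_suml; apply: ler_sum => k _.
rewrite -(mulr_powRB1 (a0 _ (ltn_ord k)) p0) ler_wpM2l ?a0//.
apply: le_powR; [lra|exact: a0|].
by rewrite (bigD1 k)//= lerDl; apply: sumr_ge0 => i _; exact: a0.
Qed.

Lemma lpn_le_exponent (s q : R) n a : 0 < s -> s <= q ->
  (forall k, (k < n)%N -> 0 <= a k) -> lpn q n a <= lpn s n a.
Proof.
move=> s0 sq a0; have q0 : 0 < q by lra.
rewrite lpn_leP ?lpn_ge0//.
have := @sum_powR_le_powR_sum (q / s) n (fun k => a k `^ s).
rewrite ler_pdivlMr// mul1r sq => /(_ isT (fun k _ => powR_ge0 _ _)).
under eq_bigr do rewrite -powRrM mulrC divfK ?gt_eqF//.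
by rewrite /lpn -powRrM mulrC.
Qed.

Lemma lpn_le_sum p n a : 1 <= p -> (forall k, (k < n)%N -> 0 <= a k) ->
  lpn p n a <= \sum_(k < n) a k.
Proof.
by move=> p1 a0; rewrite -(lpn1 a0); exact: lpn_le_exponent ltr01 p1 a0.
Qed.

Lemma le_lpn_coord p n a k : 0 < p -> (k < n)%N -> 0 <= a k -> a k <= lpn p n a.
Proof.
move=> p0 kn ak; rewrite -(@powRK p (a k)) ?gt_eqF//; apply: le_powR.
- by rewrite invr_ge0 ltW.
- exact: powR_ge0.
- rewrite (bigD1 (Ordinal kn))//= lerDl; apply: sumr_ge0 => i _.
  exact: powR_ge0.
Qed.

End lpn.

Section ereal_lp.
Local Open Scope ereal_scope.
Context {R : realType}.
Implicit Types (p r : R) (A B : nat -> \bar R) (x y : \bar R).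

Lemma le_poweR r x y : (0 <= r)%R -> 0 <= x -> x <= y -> x `^ r <= y `^ r.
Proof.
move=> r0 x0 xy; apply: gt0_ler_poweR => //; rewrite in_itv/= ?x0 leey//.
by rewrite (le_trans x0).
Qed.

Lemma poweRK r x : r != 0%R -> 0 <= x -> (x `^ r) `^ r^-1 = x.
Proof. by move=> r0 x0; rewrite -poweRrM mulfV// poweRe1. Qed.

Lemma poweRVK r x : r != 0%R -> 0 <= x -> (x `^ r^-1) `^ r = x.
Proof. by move=> r0 x0; rewrite -poweRrM mulVf// poweRe1. Qed.

Lemma le_poweR_cancel r x y : (0 < r)%R -> 0 <= x -> 0 <= y ->
  (x `^ r <= y `^ r) = (x <= y).
Proof.
move=> r0 x0 y0; apply/idP/idP => h; last by apply: le_poweR => //; exact: ltW.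
rewrite -(@poweRK r x) ?gt_eqF// -(@poweRK r y) ?gt_eqF//.
by apply: le_poweR; [rewrite invr_ge0 ltW|exact: poweR_ge0|].
Qed.

Lemma lt_poweR_cancel r x y : (0 < r)%R -> 0 <= x -> 0 <= y ->
  (x `^ r < y `^ r) = (x < y).
Proof. by move=> r0 x0 y0; rewrite !ltNge le_poweR_cancel. Qed.

Definition lpe p n A := (\sum_(k < n) A k `^ p) `^ p^-1.

Lemma lpe_ge0 p n A : 0 <= lpe p n A.
Proof. exact: poweR_ge0. Qed.

Lemma sume_poweR_ge0 p n A : 0 <= \sum_(k < n) A k `^ p.
Proof. by apply: sume_ge0 => k _; exact: poweR_ge0. Qed.

Lemma lpe_EFin p n (a : nat -> R) : lpe p n (fun k => (a k)%:E) = (lpn p n a)%:E.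
Proof. by rewrite /lpe /= sumEFin. Qed.

Lemma lpeK p n A : (0 < p)%R -> lpe p n A `^ p = \sum_(k < n) A k `^ p.
Proof. by move=> p0; rewrite poweRVK ?gt_eqF// sume_poweR_ge0. Qed.

Lemma le_lpe p n A B : (0 < p)%R -> (forall k, (k < n)%N -> 0 <= A k) ->
  (forall k, (k < n)%N -> A k <= B k) -> lpe p n A <= lpe p n B.
Proof.
move=> p0 A0 AB; apply: le_poweR.
- by rewrite invr_ge0 ltW.
- exact: sume_poweR_ge0.
- by apply: lee_sum => k _; apply: le_poweR; [exact: ltW|exact: A0|exact: AB].
Qed.

Lemma lpe_y p n A : (0 < p)%R -> (exists k, (k < n)%N /\ A k = +oo) -> lpe p n A = +oo.
Proof.
move=> p0 [k [kn Ak]]; rewrite /lpe (bigD1 (Ordinal kn))//= Ak.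
have S0 : 0 <= \sum_(i < n | i != Ordinal kn) A i `^ p.
  by apply: sume_ge0 => i _; exact: poweR_ge0.
rewrite poweRyr ?gt_eqF// addye ?poweRyr ?invr_eq0 ?gt_eqF//.
exact: lt_le_trans (ltNyr 0) S0.
Qed.

Lemma lpe_triangle p n A B : (1 <= p)%R -> (forall k, (k < n)%N -> 0 <= A k) ->
  (forall k, (k < n)%N -> 0 <= B k) ->
  lpe p n (fun k => A k + B k) <= lpe p n A + lpe p n B.
Proof.
move=> p1 A0 B0; have p0 : (0 < p)%R by lra.
have [[k kA]|nA] := pselect (exists k, (k < n)%N /\ A k = +oo).
  rewrite (@lpe_y p n A)//; last by exists k.
  rewrite addye ?leey// gt_eqF//; exact: lt_le_trans (ltNyr 0) (lpe_ge0 _ _ _).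
have [[k kB]|nB] := pselect (exists k, (k < n)%N /\ B k = +oo).
  rewrite (@lpe_y p n B)//; last by exists k.
  rewrite addey ?leey// gt_eqF//; exact: lt_le_trans (ltNyr 0) (lpe_ge0 _ _ _).
have fin (C : nat -> \bar R) : (forall k, (k < n)%N -> 0 <= C k) -> ~ (exists k, (k < n)%N /\ C k = +oo) ->
    forall k, (k < n)%N -> C k = (fine (C k))%:E.
  move=> C0 nC k kn; apply/esym/fineK; rewrite (ge0_fin_numE (C0 _ kn)) ltey.
  by apply/eqP => Ck; apply: nC; exists k.
have E (C : nat -> \bar R) (c : nat -> R) : (forall k, (k < n)%N -> C k = (c k)%:E) -> lpe p n C = (lpn p n c)%:E.
  by move=> h; rewrite -lpe_EFin /lpe; congr (_ `^ _); apply: eq_bigr => k _; rewrite h.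
rewrite (E A (fine \o A)) 1?(E B (fine \o B))//=; try exact: fin.
rewrite (E _ (fun k => fine (A k) + fine (B k))%R).
  by rewrite -EFinD lee_fin lpn_triangle// => k kn; rewrite fine_ge0 ?A0 ?B0.
by move=> k kn; rewrite EFinD -!fin.
Qed.

End ereal_lp.

Section integral_tools.
Local Open Scope ereal_scope.
Context d (T : measurableType d) {R : realType} (mu : {measure set T -> \bar R}).

(* No measurability is needed: the integral of a nonnegative function is a supremum over the simple functions below it. *)
Lemma int_le (D : set T) (f g : T -> \bar R) : (forall x, D x -> 0 <= g x) ->
  (forall x, D x -> f x <= g x) -> \int[mu]_(x in D) f x <= \int[mu]_(x in D) g x.
Proof.
move=> g0 fg; rewrite integralE.
apply: (@le_trans _ _ (\int[mu]_(x in D) (f ^\+ x))).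
  by apply: geeDl; rewrite oppe_le0; apply: integral_ge0.
rewrite !ge0_integralE//; apply: le_ereal_sup => _ [h hle <-]; exists h => //= x.
apply: le_trans (hle x) _; rewrite /patch; case: ifPn => //; rewrite inE => Dx.
by rewrite unlock ge_max fg// g0.
Qed.

(** Integrability makes the series of the integrals summable, so it splits into its positive and
    negative parts, which recombine into the series of absolute values. *)
Lemma integral_bigcup_le (F : nat -> set T) (g : T -> R) :
  trivIset setT F -> (forall k, measurable (F k)) ->
  mu.-integrable (\bigcup_k F k) (EFin \o g) ->
  (`|\int[mu]_(x in \bigcup_k F k) g x|%R)%:E <=
    \sum_(k <oo) `|(\int[mu]_(x in F k) g x)%R|%:E.
Proof.
move=> tF mF ig.
have E k : (\int[mu]_(x in F k) g x)%:E = \int[mu]_(x in F k) (g x)%:E.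
  rewrite /Rintegral fineK//; apply: integrable_fin_num => //.
  by apply: integrableS ig => //; [exact: bigcup_measurable|exact: bigcup_sup].
rewrite -abse_EFin {1}/Rintegral fineK; last first.
  by apply: integrable_fin_num => //; exact: bigcup_measurable.
rewrite integral_bigcup//.
set a := fun k => (\int[mu]_(x in F k) g x)%R.
under eq_eseriesr do rewrite -E -/(a _).
have sa : summable (fun k : nat => is_true true) (fun k => (a k)%:E).
  have := integrable_summable tF mF ig.
  rewrite (_ : (fun k : nat => is_true true) = [set: nat]); last exact/seteqP.
  by rewrite /summable; congr (_ < +oo); apply: eq_esum => k _; rewrite /a E.
rewrite (@summable_eseries _ _ xpredT sa).
apply: le_trans (lee_abs_sub _ _) _.
rewrite !gee0_abs ?nneseries_ge0//.
rewrite -nneseriesD//; apply: lee_nneseries => k _.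
  by move=> _; rewrite adde_ge0 ?funepos_ge0 ?funeneg_ge0.
have /(congr1 (fun h => h k))/= <- := fune_abse (fun k => (a k)%:E).
exact: lexx.
Qed.

(** Minkowski's integral inequality by duality: the functional norming [u] has coefficients that do
    not depend on x, so it passes under the integral, where [lpn_dual] applies at each point. *)
Lemma lpn_integral p n (u : nat -> R) (g : nat -> T -> R) (D : set T) : (1 <= p)%R ->
  measurable D ->
  (forall k, (k < n)%N -> measurable_fun D (g k)) ->
  (forall k x, (k < n)%N -> D x -> (0 <= g k x)%R) ->
  (forall k, (k < n)%N -> (0 <= u k)%R) ->
  (forall k, (k < n)%N -> (u k)%:E <= \int[mu]_(x in D) (g k x)%:E) ->
  (lpn p n u)%:E <= \int[mu]_(x in D) (lpn p n (g ^~ x))%:E.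
Proof.
move=> + mD mg g0 u0 ug; rewrite le_eqVlt => /predU1P[<-|p1].
  rewrite lpn1//.
  under eq_integral => x xD.
    rewrite lpn1; last by move=> k kn; apply: g0 => //; rewrite inE in xD.
    rewrite -sumEFin; over.
  rewrite (@ge0_integral_sum _ _ _ _ _ mD _ (fun (k : 'I_n) x => (g k x)%:E)).
  - by rewrite -sumEFin; apply: lee_sum => k _; exact: ug.
  - by move=> k; apply/measurable_EFinP; exact: mg.
  - by move=> k x Dx; rewrite lee_fin g0.
have [->|L0] := eqVneq (lpn p n u) 0%R.
  by apply: integral_ge0 => x _; rewrite lee_fin lpn_ge0.
have {}L0 : (0 < lpn p n u)%R by rewrite lt_neqAle eq_sym L0 lpn_ge0.
rewrite -{1}(lpn_dual_eq p1 u0 L0).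
pose c (k : nat) := ((u k / lpn p n u) `^ (p - 1))%R.
apply: (@le_trans _ _ (\int[mu]_(x in D) (\sum_(k < n) (c k)%:E * (g k x)%:E))).
  rewrite (@ge0_integral_sum _ _ _ _ _ mD _ (fun (k : 'I_n) x => (c k)%:E * (g k x)%:E)).
  - rewrite -sumEFin; apply: lee_sum => k _.
    rewrite ge0_integralZl_EFin ?powR_ge0//.
    + by rewrite EFinM lee_wpmul2l ?lee_fin ?powR_ge0// ug.
    + by move=> x Dx; rewrite lee_fin g0.
    + by apply/measurable_EFinP; exact: mg.
  - by move=> k; apply: measurable_funeM; apply/measurable_EFinP; exact: mg.
  - by move=> k x Dx; rewrite mule_ge0 ?lee_fin ?powR_ge0 ?g0.
apply: int_le => x Dx; first by rewrite lee_fin lpn_ge0.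
under eq_bigr do rewrite -EFinM.
rewrite sumEFin lee_fin.
by apply: (lpn_dual p1 u0 _ L0) => k kn; exact: g0.
Qed.

End integral_tools.

(** * Variation norms *)

Section series_tools.
Local Open Scope ereal_scope.
Context {R : realType}.

Lemma nneseries_le (u : nat -> \bar R) (B : \bar R) : (forall k, 0 <= u k) ->
  (forall n, \sum_(k < n) u k <= B) -> \sum_(k <oo) u k <= B.
Proof.
move=> u0 uB; apply: lime_le; first exact: is_cvg_nneseries.
by apply: nearW => n; rewrite big_mkord.
Qed.

Lemma le_nneseries (u : nat -> \bar R) n : (forall k, 0 <= u k) ->
  \sum_(k < n) u k <= \sum_(k <oo) u k.
Proof. by move=> u0; rewrite -(big_mkord xpredT u); exact: nneseries_lim_ge. Qed.

Lemma le_nneseries_term (u : nat -> \bar R) n : (forall k, 0 <= u k) ->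
  u n <= \sum_(k <oo) u k.
Proof.
move=> u0; apply: le_trans (le_nneseries n.+1 u0).
by rewrite big_ord_recr/= leeDr// sume_ge0.
Qed.

End series_tools.

Section disjoint_integrals.
Local Open Scope ereal_scope.
Context d (T : measurableType d) {R : realType} (mu : {measure set T -> \bar R}).

Lemma sum_integral_disjoint (F : nat -> set T) (D : set T) (g : T -> \bar R) n :
  trivIset setT F -> (forall i, measurable (F i)) -> measurable D ->
  (forall i, F i `<=` D) -> measurable_fun D g -> (forall x, D x -> 0 <= g x) ->
  \sum_(i < n) \int[mu]_(x in F i) g x <= \int[mu]_(x in D) g x.
Proof.
move=> tF mF mD FD mg g0.
rewrite -(big_mkord xpredT (fun i => \int[mu]_(x in F i) g x)).
have UD : \big[setU/set0]_(i <- index_iota 0 n) F i `<=` D.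
  by rewrite -bigcup_seq => x [i _ /FD].
rewrite -ge0_integral_bigsetU//.
- apply: ge0_subset_integral => //.
  by apply: bigsetU_measurable.
- exact: iota_uniq.
- exact: sub_trivIset tF.
- apply: measurable_funS mg => //.
- by move=> x /UD; exact: g0.
Qed.

End disjoint_integrals.

Section variation_norm_bounds.
Context {R : realType}.
Variable q : R.
Hypothesis q1 : 1 <= q.
Implicit Types (a b : R -> R[i]) (t : nat -> R).

Let q0 : 0 < q. Proof. exact: lt_le_trans ltr01 q1. Qed.

Definition admissible t := increasing_seq t /\ forall j, 0 < t j.

Definition increment a t (j : nat) : R := normc (a (t j) - a (t j.+1)).

Lemma normc_ge0 (z : R[i]) : 0 <= normc z.
Proof. by case: z => x y /=; exact: sqrtr_ge0. Qed.

Lemma increment_ge0 a t j : 0 <= increment a t j.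
Proof. exact: normc_ge0. Qed.

(** With [le_variation_norm], this reduces every question on the variation to finitely many
    increments, that is to real sums. *)
Lemma variation_norm_le a (B : \bar R) : (0 <= B)%E ->
  (forall t n, admissible t -> ((lpn q n (increment a t))%:E <= B)%E) ->
  (variation_norm q a <= B)%E.
Proof.
move=> B0 h; apply: ge_ereal_sup => _ [t adt <-].
rewrite -(@poweRK _ q B) ?gt_eqF//; apply: le_poweR.
- by rewrite invr_ge0 ltW.
- by apply: nneseries_ge0 => n _ _; rewrite lee_fin powR_ge0.
apply: nneseries_le => [k|n]; first by rewrite lee_fin powR_ge0.
rewrite sumEFin -[X in X%:E](lpnK n (increment a t) q0) -poweR_EFin.
by apply: le_poweR; [exact: ltW|rewrite lee_fin lpn_ge0|exact: h].
Qed.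

Lemma le_variation_norm a t n : admissible t ->
  ((lpn q n (increment a t))%:E <= variation_norm q a)%E.
Proof.
move=> adt; apply: (@le_trans _ _ ((\sum_(0 <= j <oo)
    (normc (a (t j) - a (t j.+1)) `^ q)%:E) `^ q^-1)%E); last first.
  by apply: ereal_sup_ubound; exists t.
rewrite /lpn -poweR_EFin; apply: le_poweR.
- by rewrite invr_ge0 ltW.
- by rewrite lee_fin sum_powR_ge0.
rewrite -sumEFin; apply: (@le_nneseries _ (fun j => (increment a t j `^ q)%:E)).
by move=> k; rewrite lee_fin powR_ge0.
Qed.

Lemma admissible_ex : exists t, admissible t.
Proof.
exists (fun j => j.+1%:R); split => // i j; first by rewrite ler_nat ltnS.
Qed.

Lemma variation_norm_ge0 a : (0 <= variation_norm q a)%E.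
Proof.
have [t adt] := admissible_ex; apply: le_trans (le_variation_norm a 0 adt).
by rewrite lee_fin lpn_ge0.
Qed.

Lemma variation_normD a b :
  (variation_norm q (fun r => (a r + b r)%R) <= variation_norm q a + variation_norm q b)%E.
Proof.
apply: variation_norm_le; first by rewrite adde_ge0 ?variation_norm_ge0.
move=> t n adt.
apply: (@le_trans _ _ (lpn q n (increment a t) + lpn q n (increment b t))%:E).
  rewrite lee_fin; apply: le_trans (lpn_triangle q1 _ _); last first.
  - by move=> k _; exact: increment_ge0.
  - by move=> k _; exact: increment_ge0.
  apply: le_lpn => // k _; rewrite increment_ge0/=.
  rewrite /increment opprD addrACA; exact: le_normcD.
by rewrite EFinD leeD// le_variation_norm.
Qed.

Lemma eq_variation_norm a b : (forall r, 0 < r -> a r = b r) ->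
  variation_norm q a = variation_norm q b.
Proof.
move=> ab; rewrite /variation_norm; congr (ereal_sup _); apply: eq_imagel => t [_ t0].
by congr (_ `^ _)%E; apply: eq_eseriesr => j _; rewrite (ab _ (t0 j)) (ab _ (t0 j.+1)).
Qed.

Local Notation mu := (@lebesgue_measure R).

Definition annulus (om : R -> R) (r r' : R) := [set y | r < om y <= r'].

Lemma measurable_annulus (om : R -> R) (r r' : R) : measurable_fun setT om ->
  measurable (annulus om r r').
Proof.
move=> mom; rewrite (_ : annulus _ _ _ = om @^-1` `]r, r']).
  by rewrite -[X in measurable X]setTI; exact: mom.
by apply/seteqP; split => y /=; rewrite in_itv.
Qed.

Lemma trivIset_annulus (om : R -> R) t : increasing_seq t ->
  trivIset setT (fun i => annulus om (t i) (t i.+1)).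
Proof.
move=> it; apply: ltn_trivIset => i j ij.
rewrite -subset0 => y [] /= /andP[h1 h2] /andP[h3 h4].
have : t j.+1 <= t i by rewrite it.
by move=> h; have := lt_le_trans h3 (le_trans h2 h); rewrite ltxx.
Qed.

(* The variation is bounded by a total variation plus an l^s sum over the cells met by the boundary of the truncation. *)
Lemma variation_norm_cells a (s : R) m (om1 om2 psi phi : R -> R)
    (C : nat -> set R) (P Q : R) (nu : nat -> R) :
  1 <= s -> s <= q ->
  measurable_fun setT om1 -> measurable_fun setT om2 ->
  measurable_fun setT psi -> measurable_fun setT phi ->
  (forall y, 0 <= psi y) -> (forall y, 0 <= phi y) ->
  (forall j, measurable (C j)) ->
  0 <= Q -> (forall j, 0 <= nu j) ->
  (\int[mu]_y (psi y)%:E <= P%:E)%E ->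
  (forall j, (\int[mu]_(y in C j) (phi y)%:E <= (nu j)%:E)%E) ->
  (forall J, \sum_(j < J) nu j `^ s <= Q `^ s) ->
  (forall r r', 0 < r -> r < r' -> exists c : nat -> nat,
    ((normc (a r - a r'))%:E <= \int[mu]_(y in annulus om1 r r') (psi y)%:E +
      \sum_(l < m) (\int[mu]_(y in C (c l) `&` annulus om1 r r') (phi y)%:E +
                    \int[mu]_(y in C (c l) `&` annulus om2 r r') (phi y)%:E))%E) ->
  (variation_norm q a <= (P + 2 * m%:R * Q)%:E)%E.
Proof.
move=> s1 sq mom1 mom2 mpsi mphi psi0 phi0 mC Q0 nu0 psiP phinu nuQ H.
have s0 : 0 < s := lt_le_trans ltr01 s1.
have P0 : 0 <= P.
  by rewrite -lee_fin; apply: le_trans psiP; apply: integral_ge0 => y _; rewrite lee_fin.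
apply: variation_norm_le.
  by rewrite lee_fin addr_ge0 ?mulr_ge0.
move=> t n [it t0]; rewrite lee_fin.
have tS i : t i < t i.+1 by rewrite ltNge it ltnn.
(* [c i l] is the l-th cell that the boundary of the i-th annulus may cut. *)
have [c Hc] := choice (fun i => H _ _ (t0 i) (tS i)).
pose A i := fine (\int[mu]_(y in annulus om1 (t i) (t i.+1)) (psi y)%:E).
pose B (om : R -> R) i j := fine (\int[mu]_(y in C j `&` annulus om (t i) (t i.+1)) (phi y)%:E).
have mE (g : R -> R) D : measurable_fun setT g -> measurable_fun D (EFin \o g).
  by move=> mg; apply/measurable_EFinP; exact: measurable_funTS.
have A0 i : 0 <= A i by apply: fine_ge0; apply: integral_ge0 => y _; rewrite lee_fin.
have B0 (om : R -> R) i j : 0 <= B om i j.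
  by apply: fine_ge0; apply: integral_ge0 => y _; rewrite lee_fin.
have AE i : (A i)%:E = (\int[mu]_(y in annulus om1 (t i) (t i.+1)) (psi y)%:E)%E.
  rewrite fineK// ge0_fin_numE; last by apply: integral_ge0 => y _; rewrite lee_fin.
  apply: (@le_lt_trans _ _ P%:E _ _ _ (ltry P)); apply: (le_trans _ psiP).
  apply: ge0_subset_integral; [exact: measurable_annulus|exact: measurableT|
    exact: mE| |by []] => y _; by rewrite lee_fin.
have BE (om : R -> R) i j : measurable_fun setT om ->
    (B om i j)%:E = (\int[mu]_(y in C j `&` annulus om (t i) (t i.+1)) (phi y)%:E)%E.
  move=> mom; rewrite fineK// ge0_fin_numE; last first.
    by apply: integral_ge0 => y _; rewrite lee_fin.
  apply: (@le_lt_trans _ _ (nu j)%:E _ _ _ (ltry (nu j))); apply: (le_trans _ (phinu j)).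
  apply: ge0_subset_integral; [|exact: mC|exact: mE|by move=> y _; rewrite lee_fin|exact: subIsetl].
  by apply: measurableI; [exact: mC|apply: measurable_annulus; exact: mom].
have AP : \sum_(i < n) A i <= P.
  rewrite -lee_fin -sumEFin; apply: (le_trans _ psiP).
  under eq_bigr do rewrite AE.
  apply: (@sum_integral_disjoint _ _ _ mu (fun i => annulus om1 (t i) (t i.+1)) setT).
  - exact: trivIset_annulus.
  - by move=> i; exact: measurable_annulus.
  - exact: measurableT.
  - by [].
  - exact: mE.
  - by move=> y _; rewrite lee_fin.
have Bnu (om : R -> R) j : measurable_fun setT om -> \sum_(i < n) B om i j <= nu j.
  move=> mom; rewrite -lee_fin -sumEFin; apply: (le_trans _ (phinu j)).
  under eq_bigr do rewrite BE//.
  apply: (@sum_integral_disjoint _ _ _ mu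
    (fun i => C j `&` annulus om (t i) (t i.+1)) (C j)).
  - by apply: trivIset_setIl; exact: trivIset_annulus.
  - by move=> i; apply: measurableI; [exact: mC|apply: measurable_annulus; exact: mom].
  - exact: mC.
  - by move=> i; exact: subIsetl.
  - exact: mE.
  - by move=> y _; rewrite lee_fin.
pose D i := A i + \sum_(l < m) (B om1 i (c i l) + B om2 i (c i l)).
have incD i : increment a t i <= D i.
  have := Hc i; rewrite -AE.
  rewrite (eq_bigr (fun l : 'I_m => (B om1 i (c i l) + B om2 i (c i l))%:E)).
    by rewrite sumEFin -EFinD lee_fin.
  by move=> l _; rewrite EFinD !BE.
(* For fixed l the i-th term is one of the terms of the double sum over all steps i and cells j. In
   that sum each cell contributes at most (sum_i B i j)^s, hence at most [nu j] to the power s,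
   because the annuli are disjoint. *)
have lB : forall (om : R -> R) l, measurable_fun setT om ->
    lpn s n (fun i => B om i (c i l)) <= Q.
  move=> om l mom; rewrite lpn_leP//.
  pose J := (\max_(i < n) (c i l)).+1.
  apply: le_trans (nuQ J).
  apply: (@le_trans _ _ (\sum_(i < n) \sum_(j < J) B om i j `^ s)).
    apply: ler_sum => i _.
    have cJ : (c i l < J)%N by rewrite ltnS (leq_bigmax i).
    rewrite (bigD1 (Ordinal cJ))//= lerDl; apply: sumr_ge0 => j _.
    exact: powR_ge0.
  rewrite exchange_big/=; apply: ler_sum => j _.
  apply: le_trans (@sum_powR_le_powR_sum _ s n (fun i => B om i j) s1 _) _.
    by move=> k _; exact: B0.
  apply: le_powR; [exact: ltW| |exact: Bnu].
  by apply: sumr_ge0 => i _; exact: B0.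
apply: (@le_trans _ _ (lpn s n D)).
  apply: (@le_trans _ _ (lpn s n (increment a t))).
    by apply: lpn_le_exponent => // k _; exact: increment_ge0.
  by apply: le_lpn => // k _; rewrite increment_ge0 incD.
have sumB0 i m' : 0 <= \sum_(l < m') (B om1 i (c i l) + B om2 i (c i l)).
  by apply: sumr_ge0 => l _; rewrite addr_ge0 ?B0.
apply: le_trans (lpn_triangle s1 _ _) _.
- by move=> k _; exact: A0.
- by move=> k _; exact: sumB0.
apply: lerD.
  by apply: le_trans AP; apply: lpn_le_sum => // k _; exact: A0.
suff : forall m', lpn s n (fun i =>
    \sum_(l < m') (B om1 i (c i l) + B om2 i (c i l))) <= 2 * m'%:R * Q by exact.
elim=> [|m' IH].
  rewrite mulr0 mul0r; under [X in lpn _ _ X]eq_fun do rewrite big_ord0.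
  by rewrite lpn_leP// big1 ?powR0 ?gt_eqF// => k _; rewrite powR0// gt_eqF.
under [X in lpn _ _ X]eq_fun do rewrite big_ord_recr/=.
apply: le_trans (lpn_triangle s1 _ _) _.
- by move=> k _; exact: sumB0.
- by move=> k _; rewrite addr_ge0 ?B0.
rewrite (_ : 2 * m'.+1%:R * Q = 2 * m'%:R * Q + (Q + Q)); last first.
  by rewrite -natr1; ring.
apply: lerD => //; apply: le_trans (lpn_triangle s1 _ _) _.
- by move=> k _; exact: B0.
- by move=> k _; exact: B0.
by apply: lerD; exact: lB.
Qed.

End variation_norm_bounds.

(** * Marcinkiewicz interpolation *)

Section geometric_levels.
Context {R : realType}.

Lemma two_powRN_lt1 (s : R) : 0 < s -> 2 `^ (- s) < 1 :> R.
Proof.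
move=> s0; rewrite powRN invf_lt1 ?powR_gt0//.
have : 1 `^ s < 2 `^ s :> R by apply: gt0_ltr_powR => //; rewrite ?nnegrE; lra.
by rewrite powR1.
Qed.

Lemma sum_levels_le (s e : R) n : 0 < s -> 0 < e ->
  \sum_(j < n.+1) (e * 2 ^+ j) `^ s <= (1 - 2 `^ (- s))^-1 * (e * 2 ^+ n) `^ s.
Proof.
move=> s0 e0; set k := (1 - _)^-1.
have h1 := two_powRN_lt1 s0.
have k0 : 0 < k by rewrite invr_gt0 subr_gt0.
(* The constant is the fixed point of k -> k 2^(-s) + 1, which is what one step of the induction
   does to it. *)
have kE : k * 2 `^ (- s) + 1 = k.
  by rewrite /k; field; rewrite subr_eq0 gt_eqF.
have k1 : 1 <= k by rewrite -kE lerDr mulr_ge0 ?powR_ge0 ?ltW.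
elim: n => [|n IH].
  by rewrite big_ord1 expr0 ler_peMl ?powR_ge0.
rewrite big_ord_recr/=; apply: le_trans (lerD IH (lexx _)) _.
rewrite [X in _ + X]( _ : _ = 1 * (e * 2 ^+ n.+1) `^ s); last by rewrite mul1r.
rewrite (_ : (e * 2 ^+ n) `^ s = 2 `^ (- s) * (e * 2 ^+ n.+1) `^ s).
  by rewrite mulrA -mulrDl kE.
have -> : e * 2 ^+ n.+1 = 2 * (e * 2 ^+ n) by rewrite exprS mulrCA.
rewrite [in RHS]powRM ?mulr_ge0 ?exprn_ge0 ?(ltW e0)// powRN mulrA mulVf ?mul1r// gt_eqF// powR_gt0.
Qed.

(** A geometric sum is governed by its last term, and the last level that counts lies below [G]. *)
Lemma sum_levels_lt_le (s e G : R) n : 0 < s -> 0 < e -> 0 <= G ->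
  \sum_(j < n) (e * 2 ^+ j) `^ s * (e * 2 ^+ j < G)%R%:R <=
    (1 - 2 `^ (- s))^-1 * G `^ s.
Proof.
move=> s0 e0 G0.
have h1 := two_powRN_lt1 s0.
elim: n => [|n IH].
  by rewrite big_ord0 mulr_ge0 ?powR_ge0// invr_ge0 subr_ge0 ltW.
have [h|h] := ltP (e * 2 ^+ n) G; last first.
  by rewrite big_ord_recr/= ltNge h mulr0 addr0.
apply: (@le_trans _ _ (\sum_(j < n.+1) (e * 2 ^+ j) `^ s)).
  by apply: ler_sum => j _; rewrite ler_piMr ?powR_ge0// lern1 leq_b1.
apply: le_trans (sum_levels_le _ s0 e0) _.
rewrite ler_wpM2l ?invr_ge0 ?subr_ge0 ?(ltW h1)//.
by apply: le_powR; [exact: ltW|rewrite mulr_ge0 ?exprn_ge0 ?ltW|exact: ltW].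
Qed.

Lemma dyadic_level (e z : R) : 0 < e -> e < z ->
  exists j : nat, e * 2 ^+ j < z /\ z <= e * 2 ^+ j.+1.
Proof.
move=> e0 ez.
pose P j := `[< z <= e * 2 ^+ j.+1 >].
have exP : exists j, P j.
  exists (Num.bound (z / e)); apply/asboolP.
  rewrite -ler_pdivrMl// mulrC; apply: ltW.
  apply: (lt_trans (archi_boundP _)); first by rewrite divr_ge0 ?ltW// (lt_trans e0).
  by rewrite -natrX ltr_nat; apply: (ltn_trans (ltnSn _)); exact: ltn_expl.
exists (ex_minn exP); case: ex_minnP => [[|j] /asboolP zj' jm]; split => //.
  by rewrite expr0 mulr1.
by rewrite ltNge; apply/negP => h; have := jm j; rewrite ltnn => /(_ (asboolT h)).
Qed.

End geometric_levels.

Section marcinkiewicz.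
Local Open Scope ereal_scope.
Context {R : realType}.
Local Notation mu := (@lebesgue_measure R).

Lemma real_between (m h : \bar R) : 0 <= m -> m < h ->
  exists2 l : R, m < l%:E & l%:E < h.
Proof.
case: m => [m| |]// _; case: h => [h| |]//.
  rewrite lte_fin => mh; exists ((m + h) / 2)%R; rewrite lte_fin; lra.
by move=> _; exists (m + 1)%R; rewrite ?ltry// lte_fin ltrDl.
Qed.

Lemma measurable_lt (H : R -> \bar R) (l : \bar R) : measurable_fun setT H ->
  measurable [set x | l < H x].
Proof.
move=> mH; rewrite -[X in measurable X]setTI.
by apply: emeasurable_fun_o_infty.
Qed.

(** The single level within a factor 2 below [h] already suffices. The value +oo has no such level,
    so the bound is proved for the reals l < h and then passed to [h]. *)
Lemma le_sum_levels (r e : R) (h : \bar R) : (0 < r)%R -> (0 < e)%R -> e%:E < h ->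
  h `^ r <= \sum_(j <oo) (if (e * 2 ^+ j)%:E < h then ((2 * (e * 2 ^+ j)) `^ r)%:E else 0).
Proof.
move=> r0 e0 eh; set S := \sum_(j <oo) _.
have t0 j : 0 <= if (e * 2 ^+ j)%:E < h then ((2 * (e * 2 ^+ j)) `^ r)%:E else 0.
  by case: ifP => // _; rewrite lee_fin powR_ge0.
have S0 : 0 <= S by apply: nneseries_ge0.
have key (l : R) : (e < l)%R -> l%:E < h -> (l `^ r)%:E <= S.
  move=> el lh; have [j [jl lj]] := dyadic_level e0 el.
  apply: le_trans (le_nneseries_term j t0).
  rewrite (lt_trans _ lh) ?lte_fin// lee_fin; apply: le_powR; first exact: ltW.
    by rewrite ltW// (lt_trans e0).
  by rewrite mulrCA -exprS.
have h0 : 0 <= h by rewrite (le_trans _ (ltW eh))// lee_fin ltW.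
rewrite -(@poweRVK _ r S) ?gt_eqF//; apply: le_poweR => //; first exact: ltW.
rewrite leNgt; apply/negP => Sh.
set m := maxe (S `^ r^-1) e%:E.
have mh : m < h by rewrite gt_max Sh eh.
have m0 : 0 <= m by rewrite le_max poweR_ge0.
have [l ml lh] := real_between m0 mh.
move: ml; rewrite gt_max => /andP[Sl]; rewrite lte_fin => el.
have l0 : (0 < l)%R := lt_trans e0 el.
have := key l el lh; rewrite leNgt => /negP; apply.
rewrite -[X in X < _](@poweRVK _ r S) ?gt_eqF// -poweR_EFin lt_poweR_cancel//.
  exact: poweR_ge0.
by rewrite lee_fin ltW.
Qed.

Lemma sum_levels_lee (s e : R) (G : \bar R) : (0 < s)%R -> (0 < e)%R -> 0 <= G ->
  \sum_(j <oo) (if (e * 2 ^+ j)%:E < G then ((e * 2 ^+ j) `^ s)%:E else 0) <=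
    ((1 - 2 `^ (- s))^-1)%:E * G `^ s.
Proof.
move=> s0 e0; case: G => [G| |]// G0; last first.
  rewrite poweRyr ?gt_eqF// gt0_muley ?leey// lte_fin invr_gt0 subr_gt0.
  exact: two_powRN_lt1.
apply: nneseries_le => [k|n].
  by case: ifP => // _; rewrite lee_fin powR_ge0.
rewrite (eq_bigr (fun j : 'I_n =>
    ((e * 2 ^+ j) `^ s * (e * 2 ^+ j < G)%R%:R)%:E)); last first.
  by move=> j _; rewrite lte_fin; case: ifP; rewrite ?mulr1 ?mulr0.
by rewrite sumEFin poweR_EFin -EFinM lee_fin sum_levels_lt_le.
Qed.

Variable v : R -> R.
Hypothesis mv : measurable_fun setT v.
Hypothesis v0 : forall x, (0 <= v x)%R.

Let mvE : measurable_fun setT (fun x => (v x)%:E).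
Proof. exact/measurable_EFinP. Qed.

Let v0E x : 0 <= (v x)%:E. Proof. by rewrite lee_fin. Qed.

Lemma integral_if_lt (h g : R -> \bar R) (l : \bar R) :
  \int[mu]_(x in [set x | l < h x]) g x = \int[mu]_x (if l < h x then g x else 0).
Proof.
rewrite integral_mkcond; apply: eq_integral => x _; rewrite patchE.
case: ifPn => [/set_mem/= ->//|/negP xl]; by case: ifPn => // lx; case: xl; exact: mem_set.
Qed.

(* Marcinkiewicz interpolation, summed over the levels [e 2^j] above a threshold [e] that is sent to 0. *)
Lemma marcinkiewicz_truncated (H g : R -> \bar R) (A r e : R) :
  (1 < r)%R -> (0 <= A)%R -> (0 < e)%R ->
  measurable_fun setT H -> measurable_fun setT g ->
  (forall x, 0 <= H x) -> (forall x, 0 <= g x) ->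
  (forall l : R, (0 < l)%R -> \int[mu]_(x in [set x | l%:E < H x]) (v x)%:E <=
     (A / l)%:E * \int[mu]_(x in [set x | (l / 2)%:E < g x]) (g x * (v x)%:E)) ->
  \int[mu]_(x in [set x | e%:E < H x]) (H x `^ r * (v x)%:E) <=
    (2 `^ r * A * (1 - 2 `^ (- (r - 1)))^-1 * 2 `^ (r - 1))%:E *
      \int[mu]_x (g x `^ r * (v x)%:E).
Proof.
move=> r1 A0 e0 mH mg H0 g0 weak.
have r0 : (0 < r)%R by lra.
have r10 : (0 < r - 1)%R by lra.
pose c j : R := (e * 2 ^+ j)%R.
have c0 j : (0 < c j)%R by rewrite /c mulr_gt0// exprn_gt0.
have mlev (h : R -> \bar R) (k : R -> \bar R) (l : \bar R) : measurable_fun setT h ->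
    measurable_fun setT k -> measurable_fun setT (fun x => if l < h x then k x else 0).
  move=> mh mk; apply: measurable_fun_ifT => //.
  by apply: (measurable_fun_bool true); rewrite setTI; exact: measurable_lt.
apply: (@le_trans _ _ (\sum_(j <oo) ((2 * c j) `^ r)%:E *
    \int[mu]_(x in [set x | (c j)%:E < H x]) (v x)%:E)).
  rewrite (eq_eseriesr (g := fun j => \int[mu]_x
      (if (c j)%:E < H x then ((2 * c j) `^ r)%:E * (v x)%:E else 0))); last first.
    move=> j _; rewrite -ge0_integralZl_EFin ?powR_ge0//; last 2 first.
    - exact: measurable_lt.
    - exact: measurable_funTS.
    by rewrite integral_if_lt.
  rewrite -integral_nneseries//; last 2 first.
  - by move=> j; apply: mlev => //; exact: measurable_funeM.
  - by move=> j x _; case: ifP => // _; rewrite mule_ge0// lee_fin powR_ge0.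
  rewrite integral_if_lt; apply: int_le => x _.
    by apply: nneseries_ge0 => j _ _; case: ifP => // _; rewrite mule_ge0// lee_fin powR_ge0.
  case: ifPn => [eH|_]; last first.
    by apply: nneseries_ge0 => j _ _; case: ifP => // _; rewrite mule_ge0// lee_fin powR_ge0.
  apply: le_trans (lee_wpmul2r (v0E x) (le_sum_levels r0 e0 eH)) _.
  rewrite muleC -nneseriesZl; last by move=> j _; case: ifP => // _; rewrite lee_fin powR_ge0.
  apply: lee_nneseries => [j _ _|j _].
    by case: ifP => // _; rewrite ?mule0// mule_ge0// lee_fin powR_ge0.
  by case: ifP => // _; rewrite ?mule0// muleC lexx.
apply: (@le_trans _ _ (\sum_(j <oo) (2 `^ r * A * (c j) `^ (r - 1))%:E *
    \int[mu]_(x in [set x | (c j / 2)%:E < g x]) (g x * (v x)%:E))).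
  apply: lee_nneseries => [j _ _|j _].
    by rewrite mule_ge0 ?lee_fin ?powR_ge0// integral_ge0.
  apply: le_trans (lee_wpmul2l _ (weak _ (c0 j))) _; first by rewrite lee_fin powR_ge0.
  rewrite muleA -EFinM lee_wpmul2r//.
    by apply: integral_ge0 => x _; rewrite mule_ge0.
  rewrite lee_fin powRM ?(ltW (c0 j))// -(mulr_powRB1 (ltW (c0 j)) r0).
  by rewrite le_eqVlt; apply/orP; left; apply/eqP; field; rewrite gt_eqF.
rewrite (eq_eseriesr (g := fun j => \int[mu]_x
    (if (c j / 2)%:E < g x then (2 `^ r * A * c j `^ (r - 1))%:E * (g x * (v x)%:E) else 0)));
  last first.
  move=> j _; rewrite -ge0_integralZl_EFin; last 4 first.
  - exact: measurable_lt.
  - by move=> x _; rewrite mule_ge0.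
  - by apply: measurable_funTS; exact: emeasurable_funM.
  - by rewrite !mulr_ge0 ?powR_ge0.
  by rewrite integral_if_lt.
rewrite -integral_nneseries//; last 2 first.
- move=> j; apply: mlev => //; apply: measurable_funeM.
  exact: emeasurable_funM.
- move=> j x _; case: ifP => // _; rewrite mule_ge0 ?mule_ge0//.
  by rewrite lee_fin !mulr_ge0 ?powR_ge0.
rewrite -ge0_integralZl_EFin; last 4 first.
- by [].
- by move=> x _; rewrite mule_ge0// poweR_ge0.
- by apply: emeasurable_funM => //; exact: measurableT_comp (measurable_poweR _) mg.
- by rewrite !mulr_ge0 ?powR_ge0// invr_ge0 subr_ge0 ltW// two_powRN_lt1.
apply: int_le => x _.
  rewrite mule_ge0 ?mule_ge0 ?poweR_ge0// lee_fin !mulr_ge0 ?powR_ge0//.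
  by rewrite invr_ge0 subr_ge0 ltW// two_powRN_lt1.
(* The levels that count are those below 2 g; they sum to a multiple of (2 g)^(r - 1), whence the
   last factor 2^(r - 1) of the constant. *)
have cE j : ((c j / 2)%:E < g x) = ((c j)%:E < 2%:E * g x).
  case: (g x) (g0 x) => [y| |]// _; last by rewrite gt0_muley ?ltry// lte_fin.
  by rewrite -EFinM !lte_fin ltr_pdivrMr// mulrC.
pose Z := (2 `^ r * A)%:E * (g x * (v x)%:E).
have Z0 : 0 <= Z by rewrite !mule_ge0// lee_fin mulr_ge0 ?powR_ge0.
have gr : g x * (2%:E * g x) `^ (r - 1) = (2 `^ (r - 1))%:E * g x `^ r.
  case: (g x) (g0 x) => [y| |]//; last first.
    by move=> _; rewrite gt0_muley ?lte_fin// !poweRyr ?gt_eqF// !gt0_muley ?lte_fin ?powR_gt0 ?ltry.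
  rewrite lee_fin => y0; rewrite -EFinM !poweR_EFin -!EFinM powRM//; congr EFin.
  by rewrite mulrCA mulr_powRB1.
apply: (@le_trans _ _ (Z * (((1 - 2 `^ (- (r - 1)))^-1)%:E * (2%:E * g x) `^ (r - 1)))).
  apply: nneseries_le => [j|n].
    case: ifP => // _; rewrite mule_ge0 ?mule_ge0//.
    by rewrite lee_fin !mulr_ge0 ?powR_ge0.
  rewrite (eq_bigr (fun j : 'I_n => Z *
      (if (c j)%:E < 2%:E * g x then (c j `^ (r - 1))%:E else 0))); last first.
    move=> j _; rewrite cE; case: ifP => _; last by rewrite mule0.
    by rewrite /Z EFinM muleAC.
  rewrite -ge0_sume_distrr; last by move=> j _; case: ifP => // _; rewrite lee_fin powR_ge0.
  apply: lee_wpmul2l => //; apply: le_trans (sum_levels_lee r10 e0 _); last first.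
    by rewrite mule_ge0.
  apply: (@le_nneseries _ (fun j => if (c j)%:E < 2%:E * g x then (c j `^ (r - 1))%:E else 0)).
  by move=> j; case: ifP => // _; rewrite lee_fin powR_ge0.
rewrite le_eqVlt; apply/orP; left; apply/eqP; rewrite /Z.
transitivity ((2 `^ r * A)%:E * ((1 - 2 `^ (- (r - 1)))^-1)%:E *
    ((g x * (2%:E * g x) `^ (r - 1)) * (v x)%:E)).
  by rewrite muleACA (muleAC (g x)).
by rewrite gr !EFinM !muleA.
Qed.

Lemma marcinkiewicz (H g : R -> \bar R) (A r : R) :
  (1 < r)%R -> (0 <= A)%R ->
  measurable_fun setT H -> measurable_fun setT g ->
  (forall x, 0 <= H x) -> (forall x, 0 <= g x) ->
  (forall l : R, (0 < l)%R -> \int[mu]_(x in [set x | l%:E < H x]) (v x)%:E <=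
     (A / l)%:E * \int[mu]_(x in [set x | (l / 2)%:E < g x]) (g x * (v x)%:E)) ->
  \int[mu]_x (H x `^ r * (v x)%:E) <=
    (2 `^ r * A * (1 - 2 `^ (- (r - 1)))^-1 * 2 `^ (r - 1))%:E *
      \int[mu]_x (g x `^ r * (v x)%:E).
Proof.
move=> r1 A0 mH mg H0 g0 weak.
pose e (n : nat) : R := (n.+1%:R^-1)%R.
have e0 n : (0 < e n)%R by rewrite invr_gt0.
pose S n := [set x | (e n)%:E < H x].
have UE : \bigcup_n S n = [set x | 0 < H x].
  apply/seteqP; split => [x [n _] /=|x /= Hx].
    by apply: lt_trans; rewrite lte_fin.
  have [l l0 lH] := real_between (lexx 0) Hx.
  rewrite lte_fin in l0.
  have [n nl] : exists n, (e n < l)%R.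
    exists (Num.bound l^-1); rewrite /e -[X in (_ < X)%R]invrK ltf_pV2 ?posrE ?invr_gt0//.
    have l'0 : (0 <= l^-1)%R by rewrite invr_ge0 ltW.
    by apply: lt_trans (archi_boundP l'0) _; rewrite ltr_nat.
  by exists n => //=; apply: lt_trans lH; rewrite lte_fin.
have mf : measurable_fun setT (fun x => H x `^ r * (v x)%:E).
  by apply: emeasurable_funM => //; exact: measurableT_comp (measurable_poweR _) mH.
have -> : \int[mu]_x (H x `^ r * (v x)%:E) =
    \int[mu]_(x in \bigcup_n S n) (H x `^ r * (v x)%:E).
  rewrite UE integral_if_lt; apply: eq_integral => x _; case: ifPn => // Hx.
  have -> : H x = 0 by apply/eqP; rewrite eq_le H0 leNgt Hx.
  by rewrite poweR0r ?mul0e// gt_eqF//; lra.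
apply: (cvge_to_le (ge0_nondecreasing_set_cvg_integral _ _ _ _)).
- move=> m n mn; apply/subsetPset => x /=; apply: le_lt_trans.
  by rewrite lee_fin lef_pV2 ?posrE// ler_nat ltnS.
- by move=> n; exact: measurable_lt.
- by move=> n; exact: measurable_funTS.
- by move=> n x _; rewrite mule_ge0// poweR_ge0.
- by apply: nearW => n; exact: marcinkiewicz_truncated.
Qed.
End marcinkiewicz.

(** * Weighted maximal functions *)

Section maximal_operator.
Local Open Scope ereal_scope.
Context {R : realType}.
Local Notation mu := (@lebesgue_measure R).
Implicit Types (v : R -> R) (g h : R -> \bar R) (c r x y l : R).

Lemma ball_R c r y : ball c r y = (`|c - y| < r)%R.
Proof. by []. Qed.

Lemma lebesgue_ball c r : (0 <= r)%R -> mu (ball c r) = (2 * r)%:E.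
Proof. by move=> r0; rewrite lebesgue_measure_ball// mulr_natl. Qed.

(** An enumeration of the balls with rational centre and radius. Codes of no pair give the unit ball
    at 0, and nonpositive radii are replaced by 1. Countability lets a level set of [Mx] be
    exhausted by finite unions of balls, to which Vitali's lemma applies. *)
Definition qcenter (n : nat) : R := ratr (odflt (0, 1)%R (unpickle n : option (rat * rat))).1.
Definition qradius (n : nat) : R :=
  let r := ratr (odflt (0, 1)%R (unpickle n : option (rat * rat))).2 in
  if (0 < r)%R then r else 1%R.
Definition qball n : set R := ball (qcenter n) (qradius n).

Lemma qradius_gt0 n : (0 < qradius n)%R.
Proof. by rewrite /qradius; case: ifP. Qed.

Lemma measurable_qball n : measurable (qball n).
Proof. exact: measurable_ball. Qed.

Lemma ball_sub_qball c r : (0 < r)%R ->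
  exists n, ball c r `<=` qball n /\ (qradius n < 2 * r)%R.
Proof.
move=> r0.
have [p] := @rat_in_itvoo R (c - r / 4) (c + r / 4) ltac:(lra).
rewrite in_itv/= => /andP[p1 p2].
have [s] := @rat_in_itvoo R (5 / 4 * r) (2 * r) ltac:(lra).
rewrite in_itv/= => /andP[s1 s2].
have s0 : (0 < ratr s :> R)%R by lra.
exists (pickle (p, s)); rewrite /qball /qcenter /qradius pickleK/= s0; split => //.
move=> y; rewrite !ball_R => cy.
have : (`|ratr p - c| < r / 4)%R by rewrite ltr_norml; apply/andP; split; lra.
move=> pc; have := ler_normD (ratr p - c)%R (c - y)%R.
rewrite (_ : ratr p - c + (c - y) = ratr p - y)%R; last by ring.
by move=> h; lra.
Qed.

Definition wint v (A : set R) : R := fine (\int[mu]_(x in A) (v x)%:E).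

(** The uncentred maximal function of [g] for the measure v dx, over rational balls; passing from
    any ball to a rational one costs a factor 2 in the radius. *)
Definition Mx v g x := ereal_sup
  [set ((wint v (qball n))^-1)%:E * \int[mu]_(y in qball n) (g y * (v y)%:E)
  | n in [set n | qball n x]].

Lemma Mx_ub v g x n : qball n x ->
  ((wint v (qball n))^-1)%:E * \int[mu]_(y in qball n) (g y * (v y)%:E) <= Mx v g x.
Proof. by move=> nx; apply: ereal_sup_ubound; exists n. Qed.

Lemma Mx_gtP v g x (a : \bar R) : a < Mx v g x <-> exists n, qball n x /\
  a < ((wint v (qball n))^-1)%:E * \int[mu]_(y in qball n) (g y * (v y)%:E).
Proof.
split=> [/ereal_sup_gt[_ [n nx <-] h]|[n [nx h]]]; first by exists n.
exact: lt_le_trans (Mx_ub v g nx).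
Qed.

Lemma qball_ex x : exists n, qball n x.
Proof.
have [n [sub _]] := @ball_sub_qball x 1 ltac:(lra).
by exists n; apply: sub; exact: ballxx.
Qed.

Lemma lsc_Mx v g (a : \bar R) : open [set x | a < Mx v g x].
Proof.
rewrite (_ : [set x | _] = \bigcup_(n in [set n |
    a < ((wint v (qball n))^-1)%:E * \int[mu]_(y in qball n) (g y * (v y)%:E)]) qball n).
  by apply: bigcup_open => n _; exact: ball_open.
apply/seteqP; split => [x /= /Mx_gtP[n [nx h]]|x [n /= h nx]]; first by exists n.
by apply/Mx_gtP; exists n.
Qed.

Lemma measurable_Mx v g : measurable_fun setT (Mx v g).
Proof.
by apply: lower_semicontinuous_measurable; apply/lower_semicontinuousP => a;
  exact: lsc_Mx.
Qed.

(** The dilation factor 3 is the one of Vitali's covering lemma. *)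
Record doubling v (D : R) : Prop := Doubling {
  dbl_meas : measurable_fun setT v;
  dbl_gt0 : forall x, (0 < v x)%R;
  dbl_fin : forall c r, \int[mu]_(x in ball c r) (v x)%:E < +oo;
  dbl_le : forall c r, (0 < r)%R ->
    \int[mu]_(x in ball c (3 * r)) (v x)%:E <= D%:E * \int[mu]_(x in ball c r) (v x)%:E
}.

Lemma ball_int_gt0 v c r : measurable_fun setT v -> (forall x, (0 < v x)%R) -> (0 < r)%R ->
  0 < \int[mu]_(x in ball c r) (v x)%:E.
Proof.
move=> mv v0 r0; rewrite lt_neqAle eq_sym.
apply/andP; split; last by apply: integral_ge0 => x _; rewrite lee_fin ltW.
apply/eqP => I0.
have mB : measurable (ball c r : set R) by exact: measurable_ball.
have mf : measurable_fun (ball c r) (fun x => (v x)%:E).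
  by apply/measurable_EFinP; exact: measurable_funTS.
have /(ae_eq_integral_abs mu mB mf) : \int[mu]_(x in ball c r) `|(v x)%:E| = 0.
  by rewrite -[RHS]I0; apply: eq_integral => x _; rewrite gee0_abs// lee_fin ltW.
move=> [N [mN N0 sub]].
have : mu (ball c r) <= mu N.
  apply: le_measure; rewrite ?inE//.
  apply: subset_trans sub => x Bx /= /(_ Bx) [] vx.
  by have := v0 x; rewrite vx ltxx.
by rewrite N0 lebesgue_ball ?(ltW r0)// lee_fin; lra.
Qed.

Section doubling_weight.
Variables (v : R -> R) (D : R).
Hypothesis dv : doubling v D.

Let mv := dbl_meas dv.
Let v0 := dbl_gt0 dv.
Let v0E x : 0 <= (v x)%:E. Proof. by rewrite lee_fin ltW// v0. Qed.
Let mvE : measurable_fun setT (fun x => (v x)%:E).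
Proof. exact/measurable_EFinP. Qed.

Lemma wintE c r : (wint v (ball c r))%:E = \int[mu]_(x in ball c r) (v x)%:E.
Proof. by rewrite fineK// ge0_fin_numE ?(dbl_fin dv)// integral_ge0. Qed.

Lemma wint_gt0 c r : (0 < r)%R -> (0 < wint v (ball c r))%R.
Proof. by move=> r0; rewrite -lte_fin wintE; exact: ball_int_gt0. Qed.

Lemma doubling_ge0 : (0 <= D)%R.
Proof.
have := dbl_le dv 0 ltr01; rewrite -!wintE -EFinM lee_fin => h.
have h1 := wint_gt0 0 (ltr01 : (0 < 1 :> R)%R).
have h3 : (0 < wint v (ball 0 (3 * 1)))%R by apply: wint_gt0; lra.
by rewrite -(pmulr_lge0 _ h1) (le_trans _ h)// ltW.
Qed.

Lemma integral_cover_le (I : eqType) (E : seq I) (F : I -> set R) (A : set R) :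
  (forall i, measurable (F i)) -> A `<=` cover [set` E] F ->
  \int[mu]_(x in A) (v x)%:E <= \sum_(i <- E) \int[mu]_(x in F i) (v x)%:E.
Proof.
move=> mF AF; under eq_bigr do rewrite integral_mkcond.
rewrite integral_mkcond -ge0_integral_sum//; last 2 first.
- move=> i; have [h _] := measurable_restrictT (fun x => (v x)%:E) (mF i).
  by apply: h; exact: (measurable_funTS mvE).
- by move=> i x _; apply: erestrict_ge0.
have t0 i x : 0 <= ((fun x => (v x)%:E) \_ (F i)) x by apply: erestrict_ge0.
apply: int_le => x _; first exact: sume_ge0.
rewrite patchE; case: ifPn => [/set_mem Ax|_]; last exact: sume_ge0.
have [i iE Fx] := AF _ Ax.
rewrite (big_rem i)//= patchE mem_set// leeDl// sume_ge0//.
Qed.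

(** Each finite union of balls whose average exceeds l is covered by the triples of disjoint ones
    among them. Tripling costs [D], each ball has v-mass at most l^-1 times the integral of g v over
    it, and the finite unions increase to the level set. *)
Lemma maximal_weak_type g l : measurable_fun setT g -> (forall x, 0 <= g x) ->
  (0 < l)%R ->
  \int[mu]_(x in [set x | l%:E < Mx v g x]) (v x)%:E <=
    (D / l)%:E * \int[mu]_x (g x * (v x)%:E).
Proof.
move=> mg g0 l0.
pose J n := `[< l%:E < ((wint v (qball n))^-1)%:E *
   \int[mu]_(y in qball n) (g y * (v y)%:E) >].
pose G N := cover [set` [seq n <- iota 0 N | J n]] qball.
have mG N : measurable (G N) by apply: bigcup_measurable => k _; exact: measurable_qball.
have -> : [set x | l%:E < Mx v g x] = \bigcup_N G N.
  apply/seteqP; split => [x /= /Mx_gtP[n [nx h]]|x [N _ [n /=]]].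
    exists n.+1 => //; exists n => //; rewrite /mkset mem_filter.
    by rewrite mem_iota/= add0n ltnSn andbT; exact/asboolP.
  by rewrite mem_filter => /andP[/asboolP h _] nx; apply/Mx_gtP; exists n.
have gv0 x : 0 <= g x * (v x)%:E by rewrite mule_ge0.
have mgv : measurable_fun setT (fun x => g x * (v x)%:E) by exact: emeasurable_funM.
apply: (cvge_to_le (ge0_nondecreasing_set_cvg_integral _ _ _ _)) => //.
- move=> m n mn; apply/subsetPset => x [k /=].
  rewrite mem_filter mem_iota/= add0n => /andP[Jk km] kx; exists k; last exact: kx.
  by rewrite /mkset mem_filter Jk mem_iota/= add0n (leq_trans km).
- by move=> n; exact: measurable_funTS.
apply: nearW => N.
have ballq n : is_ball (qball n) by exact: is_ball_ball.
have q0 n : qball n !=set0 by exists (qcenter n); apply: ballxx; exact: qradius_gt0.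
have [E [uE subE tE covE]] :=
  vitali_lemma_finite_cover ballq q0 [seq n <- iota 0 N | J n].
apply: (@le_trans _ _ (\sum_(n <- E) \int[mu]_(x in (scale_ball 3 \o qball) n) (v x)%:E)).
  apply: integral_cover_le => // i; rewrite /= /qball scale_ballE//.
  exact: measurable_ball.
apply: (@le_trans _ _ (\sum_(n <- E) (D / l)%:E * \int[mu]_(x in qball n) (g x * (v x)%:E))).
  rewrite big_seq [leRHS]big_seq; apply: lee_sum => n /subE.
  rewrite mem_filter => /andP[/asboolP Jn _] /=; rewrite scale_ballE//.
  apply: le_trans (dbl_le dv _ (qradius_gt0 n)) _.
  rewrite EFinM -muleA lee_wpmul2l ?lee_fin ?doubling_ge0// -wintE.
  have W0 := wint_gt0 (qcenter n) (qradius_gt0 n).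
  rewrite -lee_pdivrMl ?invr_gt0// invrK muleC.
  by rewrite -lee_pdivlMl// ltW.
rewrite -ge0_sume_distrr; last by move=> n _; exact: integral_ge0.
rewrite lee_wpmul2l ?lee_fin ?divr_ge0 ?doubling_ge0 ?(ltW l0)//.
rewrite -ge0_integral_bigsetU//=.
- apply: ge0_subset_integral => //.
  by apply: bigsetU_measurable => n _; exact: measurable_qball.
- by move=> n; exact: measurable_qball.
- exact: measurable_funTS.
Qed.

Lemma Mx_ge0 g x : (forall x, 0 <= g x) -> 0 <= Mx v g x.
Proof.
move=> g0; have [n nx] := qball_ex x; apply: le_trans (Mx_ub v g nx).
rewrite mule_ge0 ?lee_fin ?invr_ge0 ?fine_ge0//.
  exact: integral_ge0.
by apply: integral_ge0 => y _; rewrite mule_ge0.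
Qed.

(** The part of [g] below l / 2 adds at most l / 2 to any average, so the rest alone must exceed l /
    2. This is the form of the weak type that [marcinkiewicz] takes. *)
Lemma maximal_weak_type_truncated g l : measurable_fun setT g -> (forall x, 0 <= g x) ->
  (0 < l)%R ->
  \int[mu]_(x in [set x | l%:E < Mx v g x]) (v x)%:E <=
    (2 * D / l)%:E * \int[mu]_(x in [set x | (l / 2)%:E < g x]) (g x * (v x)%:E).
Proof.
move=> mg g0 l0; have l20 : (0 < l / 2)%R by lra.
pose g1 x := if (l / 2)%:E < g x then g x else 0.
have g10 x : 0 <= g1 x by rewrite /g1; case: ifP.
have mg1 : measurable_fun setT g1.
  apply: measurable_fun_ifT => //.
  by apply: (measurable_fun_bool true); rewrite setTI; exact: measurable_lt.
have sub : [set x | l%:E < Mx v g x] `<=` [set x | (l / 2)%:E < Mx v g1 x].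
  move=> x /= /Mx_gtP[n [nx h]]; apply/Mx_gtP; exists n; split => //.
  have W0 := wint_gt0 (qcenter n) (qradius_gt0 n).
  have : l%:E < (l / 2)%:E + ((wint v (qball n))^-1)%:E *
       \int[mu]_(y in qball n) (g1 y * (v y)%:E).
    apply: lt_le_trans h _.
    rewrite -lee_pdivlMl ?invr_gt0// invrK.
    rewrite ge0_muleDr ?lee_fin ?(ltW l20)//; last first.
      apply: mule_ge0; first by rewrite lee_fin invr_ge0 ltW.
      by apply: integral_ge0 => y _; rewrite mule_ge0.
    have e1 : (wint v (qball n))%:E * ((wint v (qball n))^-1)%:E = 1.
      by rewrite -EFinM mulfV ?gt_eqF.
    rewrite [X in _ + X]muleA e1 mul1e [X in X + _]muleC wintE.
    have mqv : measurable_fun (qball n) (fun x => (v x)%:E) by exact: measurable_funTS.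
    rewrite -ge0_integralZl_EFin ?(ltW l20)//; last exact: measurable_qball.
    rewrite -ge0_integralD; last 5 first.
    - exact: measurable_qball.
    - by move=> y _; rewrite mule_ge0// lee_fin ltW.
    - exact: measurable_funeM.
    - by move=> y _; rewrite mule_ge0.
    - by apply: measurable_funTS; exact: emeasurable_funM.
    apply: int_le => y _.
      by rewrite adde_ge0// mule_ge0// lee_fin ltW.
    rewrite /g1; case: ifPn => [|]; first by rewrite leeDr// mule_ge0// lee_fin ltW.
    by rewrite -leNgt mul0e adde0 => gl; rewrite lee_wpmul2r.
  rewrite {1}(splitr l) EFinD lteD2lE//.
apply: (@le_trans _ _ (\int[mu]_(x in [set x | (l / 2)%:E < Mx v g1 x]) (v x)%:E)).
  apply: ge0_subset_integral => //.
  - by apply: measurable_lt; exact: measurable_Mx.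
  - by apply: measurable_lt; exact: measurable_Mx.
  - exact: measurable_funTS.
apply: le_trans (maximal_weak_type mg1 g10 l20) _.
rewrite integral_if_lt.
have -> : (D / (l / 2) = 2 * D / l)%R by field; rewrite gt_eqF.
by rewrite le_eqVlt; apply/orP; left; apply/eqP; congr (_ * _);
  apply: eq_integral => x _; rewrite /g1; case: ifP => // _; rewrite mul0e.
Qed.

Lemma maximal_strong_type r : (1 < r)%R ->
  exists2 C : R, (0 <= C)%R & forall g, measurable_fun setT g -> (forall x, 0 <= g x) ->
    \int[mu]_x (Mx v g x `^ r * (v x)%:E) <= C%:E * \int[mu]_x (g x `^ r * (v x)%:E).
Proof.
move=> r1; exists (2 `^ r * (2 * D) * (1 - 2 `^ (- (r - 1)))^-1 * 2 `^ (r - 1))%R.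
  rewrite !mulr_ge0 ?powR_ge0 ?doubling_ge0// invr_ge0 subr_ge0 ltW//.
  by apply: two_powRN_lt1; lra.
move=> g mg g0.
have A0 : (0 <= 2 * D)%R by rewrite mulr_ge0 ?doubling_ge0.
have vge x : (0 <= v x)%R by rewrite ltW.
apply: (marcinkiewicz mv vge r1 A0 (measurable_Mx v g) mg _ g0).
  by move=> x; exact: Mx_ge0.
by move=> l l0; exact: maximal_weak_type_truncated.
Qed.

End doubling_weight.
End maximal_operator.

(** * Muckenhoupt weights *)

Section hoelder_nonneg.
Local Open Scope ereal_scope.
Context {R : realType}.
Local Notation mu := (@lebesgue_measure R).

Lemma hoelder_set (A : set R) (f g : R -> R) (p q : R) : measurable A ->
  measurable_fun A f -> measurable_fun A g ->
  (forall x, (0 <= f x)%R) -> (forall x, (0 <= g x)%R) ->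
  (0 < p)%R -> (0 < q)%R -> (p^-1 + q^-1 = 1)%R ->
  \int[mu]_(x in A) (f x * g x)%:E <=
    (\int[mu]_(x in A) (f x `^ p)%:E) `^ p^-1 * (\int[mu]_(x in A) (g x `^ q)%:E) `^ q^-1.
Proof.
move=> mA mf mg f0 g0 p0 q0 pq.
have mr (h : R -> R) : measurable_fun A h -> measurable_fun setT (h \_ A).
  by move=> mh; have [k _] := measurable_restrictT h mA; apply: k.
have H := @hoelder _ _ _ mu _ _ _ _ (mr _ mf) (mr _ mg) p0 q0 pq.
have NE (h : R -> R) (r : R) : (0 < r)%R -> (forall x, (0 <= h x)%R) ->
    'N[mu]_r%:E[EFin \o (h \_ A)] = (\int[mu]_(x in A) (h x `^ r)%:E) `^ r^-1.
  move=> r0 h0; rewrite unlock; rewrite [in RHS]integral_mkcond; apply: (f_equal (fun z => z `^ r^-1)).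
  apply: eq_integral => x _; rewrite /= !patchE; case: ifPn => _ /=.
    by rewrite ger0_norm.
  by rewrite normr0 powR0 ?gt_eqF.
rewrite (NE f)// (NE g)// in H; apply: le_trans H.
rewrite Lnorm1 [leLHS]integral_mkcond; apply: int_le => x _; first exact: abse_ge0.
rewrite /= !patchE; case: ifPn => _ /=.
  by rewrite ger0_norm ?mulr_ge0.
by rewrite mulr0 normr0.
Qed.

End hoelder_nonneg.

Section Ap_weights.
Local Open Scope ereal_scope.
Context {R : realType}.
Local Notation mu := (@lebesgue_measure R).
Implicit Types (w : R -> R) (p c r C : R).

Definition dual_weight p w x : R := (w x `^ (- (p - 1)^-1))%R.

(** The A_p condition in real numbers: both integrals are finite and [w] is positive everywhere.
    [Ap_regular] derives it from [Ap] after a change on a null set. *)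
Record Ap_ball p w C : Prop := ApBall {
  Ap_meas : measurable_fun setT w;
  Ap_gt0 : forall x, (0 < w x)%R;
  Ap_fin : forall c r, \int[mu]_(x in ball c r) (w x)%:E < +oo;
  Ap_dual_fin : forall c r, \int[mu]_(x in ball c r) (dual_weight p w x)%:E < +oo;
  Ap_le : forall c r, (0 < r)%R ->
    (wint w (ball c r) * wint (dual_weight p w) (ball c r) `^ (p - 1) <= C * (2 * r) `^ p)%R
}.

Lemma wint_ge0 w A : (forall x, (0 <= w x)%R) -> (0 <= wint w A)%R.
Proof. by move=> w0; apply: fine_ge0; apply: integral_ge0 => x _; rewrite lee_fin. Qed.

Lemma Ap_dual_real (W S d p C : R) : (0 < p - 1)%R -> (0 <= W)%R -> (0 <= S)%R ->
  (0 <= C)%R -> (0 <= d)%R -> (W * S `^ (p - 1) <= C * d `^ p)%R ->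
  (S * W `^ (p - 1)^-1 <= C `^ (p - 1)^-1 * d `^ (p / (p - 1)))%R.
Proof.
move=> p10 W0 S0 C0 d0 H.
have k0 : (0 <= (p - 1)^-1)%R by rewrite invr_ge0 ltW.
have := le_powR k0 (mulr_ge0 W0 (powR_ge0 S (p - 1))) H.
rewrite (powRM _ W0 (powR_ge0 _ _)) (powRM _ C0 (powR_ge0 _ _)).
by rewrite (powRK (lt0r_neq0 p10) S0) -powRrM mulrC.
Qed.

Lemma Hoelder_real (x W S p : R) : (0 < p)%R -> (0 < p - 1)%R -> (0 <= x)%R ->
  (0 <= W)%R -> (0 <= S)%R -> (x <= W `^ p^-1 * S `^ (p / (p - 1))^-1)%R ->
  (x `^ p <= W * S `^ (p - 1))%R.
Proof.
move=> p0 p10 x0 W0 S0 h; have := le_powR (ltW p0) x0 h.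
rewrite (powRM _ (powR_ge0 _ _) (powR_ge0 _ _)) (powRVK (lt0r_neq0 p0) W0) -powRrM.
by rewrite invf_div divfK// gt_eqF.
Qed.

Definition HLmax (f : R -> \bar R) := Mx (cst 1%R) f.

Lemma HLmaxE (f : R -> \bar R) n :
  ((wint (cst 1%R) (qball n : set R))^-1)%:E * \int[mu]_(y in qball n) (f y * (cst 1%R y)%:E) =
  ((2 * qradius n)^-1)%:E * \int[mu]_(y in qball n) f y.
Proof.
have -> : \int[mu]_(y in qball n) (f y * (cst 1%R y)%:E) = \int[mu]_(y in qball n) f y.
  by apply: eq_integral => y _; rewrite mule1.
rewrite /wint; have -> : \int[mu]_(x in qball n) (cst 1%R x)%:E = 1%:E * mu (qball n).
  by rewrite -integral_cst//; exact: measurable_qball.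
by rewrite mul1e lebesgue_ball// ltW// qradius_gt0.
Qed.

Lemma lerner_real (W S C d p : R) : (0 < p - 1)%R -> (0 < W)%R -> (0 < S)%R ->
  (0 < d)%R -> (W * S `^ (p - 1) <= C * d `^ p)%R ->
  ((S / d) `^ (p - 1) <= C / W * d)%R.
Proof.
move=> p10 W0 S0 d0; rewrite -ler_pdivlMl// => H.
have d'0 : (0 <= d^-1)%R by rewrite invr_ge0 ltW.
rewrite (powRM _ (ltW S0) d'0); apply: le_trans (ler_wpM2r (powR_ge0 _ _) H) _.
have dp : (d `^ p * d^-1 `^ (p - 1) = d)%R.
  rewrite -(mulr_powRB1 (ltW d0) (_ : 0 < p)%R); last by lra.
  by rewrite -mulrA -powRM ?(ltW d0)// mulfV ?gt_eqF// powR1 mulr1.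
rewrite -!mulrA dp le_eqVlt; apply/orP; left; apply/eqP; ring.
Qed.

Section fixed_weight.
Variables (p : R) (w : R -> R) (C : R).
Hypotheses (p1 : (1 < p)%R) (Aw : Ap_ball p w C).

Local Notation sg := (dual_weight p w).
Local Notation p' := (p / (p - 1))%R.

Let w0 := Ap_gt0 Aw.
Let mw := Ap_meas Aw.
Let p0 : (0 < p)%R. Proof. exact: lt_trans ltr01 p1. Qed.
Let p10 : (0 < p - 1)%R. Proof. by rewrite subr_gt0. Qed.
Let p'1 : (1 < p')%R. Proof. by rewrite ltr_pdivlMr// mul1r gtrBl. Qed.
Let p'0 : (0 < p')%R. Proof. exact: lt_trans ltr01 p'1. Qed.

Lemma dual_exponent : (p' - 1 = (p - 1)^-1)%R.
Proof. by field; rewrite gt_eqF. Qed.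

Lemma dual_weight_gt0 x : (0 < sg x)%R.
Proof. by rewrite powR_gt0. Qed.

Lemma measurable_dual_weight : measurable_fun setT sg.
Proof. exact: measurableT_comp (measurable_powR _) mw. Qed.

Lemma dual_weightK x : dual_weight p' sg x = w x.
Proof.
rewrite /dual_weight dual_exponent -powRrM invrK mulrNN mulVf ?gt_eqF//.
by rewrite powRr1// ltW.
Qed.

Lemma wE c r : (wint w (ball c r))%:E = \int[mu]_(x in ball c r) (w x)%:E.
Proof.
by rewrite fineK// ge0_fin_numE ?(Ap_fin Aw)// integral_ge0// => x _; rewrite lee_fin ltW.
Qed.

Lemma sgE c r : (wint sg (ball c r))%:E = \int[mu]_(x in ball c r) (sg x)%:E.
Proof.
rewrite fineK// ge0_fin_numE ?(Ap_dual_fin Aw)// integral_ge0// => x _.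
by rewrite lee_fin ltW// dual_weight_gt0.
Qed.

Lemma wint_w_gt0 c r : (0 < r)%R -> (0 < wint w (ball c r))%R.
Proof. by move=> r0; rewrite -lte_fin wE; exact: ball_int_gt0. Qed.

Lemma wint_sg_gt0 c r : (0 < r)%R -> (0 < wint sg (ball c r))%R.
Proof.
move=> r0; rewrite -lte_fin sgE; apply: ball_int_gt0 => //.
  exact: measurable_dual_weight.
by move=> x; exact: dual_weight_gt0.
Qed.

Lemma Ap_const_gt0 : (0 < C)%R.
Proof.
have h := Ap_le Aw 0 ltr01.
have : (0 < wint w (ball 0 1) * wint sg (ball 0 1) `^ (p - 1))%R.
  by rewrite mulr_gt0 ?powR_gt0 ?wint_w_gt0 ?wint_sg_gt0.
by move=> /lt_le_trans /(_ h); rewrite pmulr_lgt0// powR_gt0//; lra.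
Qed.

(** Raising the A_p inequality to the power (p - 1)^-1 exchanges [w] with its dual weight and p with
    its conjugate exponent. *)
Lemma Ap_ball_dual : Ap_ball p' sg (C `^ (p - 1)^-1).
Proof.
split.
- exact: measurable_dual_weight.
- exact: dual_weight_gt0.
- exact: Ap_dual_fin Aw.
- move=> c r; under eq_integral do rewrite dual_weightK.
  exact: Ap_fin Aw c r.
- move=> c r r0.
  rewrite (_ : wint (dual_weight p' sg) (ball c r) = wint w (ball c r)); last first.
    by rewrite /wint; congr fine; apply: eq_integral => x _; rewrite dual_weightK.
  rewrite dual_exponent; apply: Ap_dual_real => //.
  - exact: ltW (wint_w_gt0 c r0).
  - exact: ltW (wint_sg_gt0 c r0).
  - exact: ltW Ap_const_gt0.
  - by rewrite mulr_ge0 ?ltW.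
  - exact: Ap_le Aw c r r0.
Qed.

(** Hoelder's inequality for w^(1/p) w^(-1/p) bounds |A| by w(A)^(1/p) times a power of the dual
    mass of the ball, which the A_p condition turns into w(B)^-1. With a smaller ball for A it gives
    doubling; with half of a ball it drives the good-lambda inequality. *)
Lemma Ap_subset (A : set R) c r : measurable A -> A `<=` ball c r -> (0 < r)%R ->
  (fine (mu A) `^ p * wint w (ball c r) <= C * (2 * r) `^ p * wint w A)%R.
Proof.
move=> mA AB r0.
have mB : measurable (ball c r : set R) by exact: measurable_ball.
have mwE (D : set R) : measurable_fun D (fun x => (w x)%:E).
  by apply/measurable_EFinP; exact: measurable_funTS.
have msE (D : set R) : measurable_fun D (fun x => (sg x)%:E).
  by apply/measurable_EFinP; apply: measurable_funTS; exact: measurable_dual_weight.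
have wAE : (wint w A)%:E = \int[mu]_(x in A) (w x)%:E.
  rewrite fineK// ge0_fin_numE; last by apply: integral_ge0 => x _; rewrite lee_fin ltW.
  apply: le_lt_trans (Ap_fin Aw c r); apply: ge0_subset_integral => //.
    exact: mwE.
  by move=> x _; rewrite lee_fin ltW.
have muAfin : mu A \is a fin_num.
  rewrite ge0_fin_numE//; apply: (@le_lt_trans _ _ (mu (ball c r))).
    by apply: le_measure; rewrite ?inE.
  by rewrite lebesgue_ball ?ltW// ltry.
have key : mu A <= (\int[mu]_(x in A) (w x)%:E) `^ p^-1 * (\int[mu]_(x in A) (sg x)%:E) `^ p'^-1.
  have pq : (p^-1 + p'^-1 = 1)%R by rewrite invf_div; field; rewrite gt_eqF.
  have := @hoelder_set _ A (fun x => w x `^ p^-1)%R (fun x => w x `^ (- p^-1))%R p p' mA.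
  have m1 s : measurable_fun A (fun x => w x `^ s)%R.
    by apply: measurable_funTS; exact: measurableT_comp (measurable_powR _) mw.
  move=> /(_ (m1 _) (m1 _) (fun=> powR_ge0 _ _) (fun=> powR_ge0 _ _) p0 p'0 pq).
  have -> : \int[mu]_(x in A) (w x `^ p^-1 * w x `^ (- p^-1))%:E = mu A.
    rewrite -[RHS]mul1e -integral_cst//; apply: eq_integral => x _.
    by rewrite powRN mulfV// gt_eqF// powR_gt0.
  have E1 x : ((w x `^ p^-1) `^ p = w x)%R by exact: powRVK (lt0r_neq0 p0) (ltW (w0 x)).
  have E2 x : ((w x `^ (- p^-1)) `^ p' = sg x)%R.
    rewrite -powRrM /dual_weight; congr (_ `^ _)%R.
    by rewrite mulNr; congr (- _)%R; field; rewrite !gt_eqF.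
  move=> H; apply: le_trans H _.
  apply: lee_pmul; [exact: poweR_ge0|exact: poweR_ge0| |]; apply: le_poweR.
  - by rewrite invr_ge0 ltW.
  - by apply: integral_ge0 => x _; rewrite lee_fin powR_ge0.
  - by apply: int_le => x _; [rewrite lee_fin ltW|rewrite E1 lexx].
  - by rewrite invr_ge0 ltW.
  - by apply: integral_ge0 => x _; rewrite lee_fin powR_ge0.
  - by apply: int_le => x _; [rewrite lee_fin powR_ge0|rewrite E2 lexx].
have h0 : (fine (mu A) <= wint w A `^ p^-1 * wint sg (ball c r) `^ p'^-1)%R.
  rewrite -lee_fin fineK//; apply: le_trans key _.
  rewrite EFinM; apply: lee_pmul; rewrite ?poweR_ge0//.
    by rewrite -wAE poweR_EFin lexx.
  rewrite -poweR_EFin sgE; apply: le_poweR.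
  - by rewrite invr_ge0 ltW.
  - by apply: integral_ge0 => x _; rewrite lee_fin ltW// dual_weight_gt0.
  - apply: ge0_subset_integral => //; first exact: msE.
    by move=> x _; rewrite lee_fin ltW// dual_weight_gt0.
have wA0 : (0 <= wint w A)%R by apply: wint_ge0 => x; exact: ltW.
have sB0 : (0 <= wint sg (ball c r))%R by rewrite ltW// wint_sg_gt0.
have muA0 : (0 <= fine (mu A))%R by apply: fine_ge0; exact: measure_ge0.
have h := Hoelder_real p0 p10 muA0 wA0 sB0 h0.
apply: le_trans (ler_wpM2r (ltW (wint_w_gt0 c r0)) h) _.
rewrite -[leLHS]mulrA [leRHS]mulrC; apply: ler_wpM2l => //.
by rewrite mulrC; exact: Ap_le Aw c r r0.
Qed.

Lemma Ap_doubling : doubling w (C * 3 `^ p).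
Proof.
split => //; first exact: Ap_fin Aw.
move=> c r r0; have r30 : (0 < 3 * r)%R by lra.
rewrite -!wE -EFinM lee_fin.
have sub : ball c r `<=` ball c (3 * r)%R by apply: le_ball; lra.
have mB : measurable (ball c r : set R) by exact: measurable_ball.
have := Ap_subset mB sub r30.
rewrite lebesgue_ball ?(ltW r0)//= (_ : 2 * (3 * r) = 3 * (2 * r))%R; last by ring.
rewrite (powRM _ (_ : 0 <= 3)%R (_ : 0 <= 2 * r)%R)//; last by rewrite mulr_ge0 ?ltW.
have h : (0 < (2 * r) `^ p)%R by rewrite powR_gt0// mulr_gt0.
move=> H; rewrite -(ler_pM2l h); apply: le_trans H _.
by rewrite le_eqVlt; apply/orP; left; apply/eqP; ring.
Qed.

Definition lerner_g (f : R -> \bar R) y := f y * ((sg y)^-1)%:E.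
Definition lerner_G (f : R -> \bar R) y := Mx sg (lerner_g f) y `^ (p - 1) * ((w y)^-1)%:E.

(* Lerner's pointwise bound: with [s] the dual weight, [M f <= (C M_w(M_s(f / s)^(p - 1) / w))^(1 / (p - 1))], so the estimate for [M] follows from the two estimates for the weighted maximal operators, which hold for every doubling weight. *)
Lemma lerner_pointwise (f : R -> \bar R) x : measurable_fun setT f -> (forall x, 0 <= f x) ->
  HLmax f x `^ p * (w x)%:E <= (C `^ p')%:E * (Mx w (lerner_G f) x `^ p' * (w x)%:E).
Proof.
move=> mf f0; set g := lerner_g f; set G := lerner_G f.
have sg0 y : (0 <= (sg y)^-1)%R by rewrite invr_ge0 ltW// dual_weight_gt0.
have w'0 y : (0 <= (w y)^-1)%R by rewrite invr_ge0 ltW.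
have g0 y : 0 <= g y by rewrite /g /lerner_g mule_ge0// lee_fin.
have G0 y : 0 <= G y by rewrite /G /lerner_G mule_ge0 ?poweR_ge0 ?lee_fin.
have C0 := Ap_const_gt0.
have MG0 : 0 <= Mx w G x by apply: (Mx_ge0 Ap_doubling).
(* Let a be the average of [g] over the ball for the dual weight. It is at most [Mx sg g] at every
   point of the ball, so a^(p - 1) times the length is at most the integral of G w; the A_p
   condition converts the ratio of dual mass to length into length over w-mass. *)
have key n : qball n x ->
    (((2 * qradius n)^-1)%:E * \int[mu]_(y in qball n) f y) `^ (p - 1) <= C%:E * Mx w G x.
  move=> nx; set r := qradius n; have r0 : (0 < r)%R := qradius_gt0 n.
  pose W := wint w (qball n); pose S := wint sg (qball n).
  have W0 : (0 < W)%R by exact: wint_w_gt0.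
  have S0 : (0 < S)%R by exact: wint_sg_gt0.
  pose I := \int[mu]_(y in qball n) f y.
  have I0 : 0 <= I by exact: integral_ge0.
  pose a := (S^-1)%:E * I.
  have a0 : 0 <= a by rewrite mule_ge0// lee_fin invr_ge0 ltW.
  have aM y : qball n y -> a <= Mx sg g y.
    move=> ny; apply: le_trans (Mx_ub sg g ny); rewrite /a /I.
    apply: lee_wpmul2l; first by rewrite lee_fin invr_ge0 ltW.
    rewrite le_eqVlt; apply/orP; left; apply/eqP; apply: eq_integral => z _.
    by rewrite /g /lerner_g -muleA -EFinM mulVf ?mule1// gt_eqF// dual_weight_gt0.
  have aI : a `^ (p - 1) * (2 * r)%:E <= \int[mu]_(y in qball n) (G y * (w y)%:E).
    rewrite -(lebesgue_ball (qcenter n) (ltW r0)) -(integral_cst mu (measurable_qball n)).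
    apply: int_le => y ny; first by rewrite mule_ge0// lee_fin ltW.
    rewrite /G /lerner_G -muleA -EFinM mulVf ?mule1; last by rewrite gt_eqF.
    by apply: le_poweR; [exact: ltW|exact: a0|exact: aM].
  have GM : (W^-1)%:E * \int[mu]_(y in qball n) (G y * (w y)%:E) <= Mx w G x.
    exact: Mx_ub.
  have Apn : (W * S `^ (p - 1) <= C * (2 * r) `^ p)%R by exact: Ap_le Aw _ _ r0.
  have d0 : (0 < 2 * r)%R by rewrite mulr_gt0.
  have IE : ((2 * r)^-1)%:E * I = (S / (2 * r))%:E * a.
    rewrite /a muleA -EFinM; congr (_%:E * _).
    by field; rewrite !gt_eqF.
  rewrite -/I IE poweRM ?lee_fin ?divr_ge0 ?(ltW S0) ?(ltW d0)// poweR_EFin.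
  apply: (@le_trans _ _ ((C * W^-1)%:E * (a `^ (p - 1) * (2 * r)%:E))).
    rewrite [X in _ <= _ * X]muleC muleA -EFinM lee_wpmul2r ?poweR_ge0// lee_fin.
    exact: lerner_real p10 W0 S0 d0 Apn.
  apply: le_trans (lee_wpmul2l _ aI) _; first by rewrite lee_fin mulr_ge0 ?invr_ge0 ?ltW.
  by rewrite EFinM -muleA lee_wpmul2l// lee_fin ltW.
have HL0 : 0 <= HLmax f x.
  have [n nx] := qball_ex x; apply: le_trans (Mx_ub _ f nx).
  rewrite HLmaxE mule_ge0 ?integral_ge0// lee_fin invr_ge0 mulr_ge0// ltW//.
  exact: qradius_gt0.
have k0 : (0 < (p - 1)^-1)%R by rewrite invr_gt0.
have HLle : HLmax f x <= (C%:E * Mx w G x) `^ (p - 1)^-1.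
  apply: ge_ereal_sup => _ [n nx <-]; rewrite HLmaxE.
  rewrite -[leLHS](@poweRK _ (p - 1)) ?gt_eqF//; last first.
    rewrite mule_ge0 ?integral_ge0// lee_fin invr_ge0 mulr_ge0// ltW//.
    exact: qradius_gt0.
  by apply: le_poweR; [exact: ltW|exact: poweR_ge0|exact: key].
rewrite muleA lee_wpmul2r ?lee_fin ?(ltW (w0 x))//.
rewrite -poweR_EFin -poweRM ?lee_fin ?(ltW C0)//.
apply: le_trans (le_poweR (ltW p0) HL0 HLle) _.
by rewrite -poweRrM [((p - 1)^-1 * p)%R]mulrC lexx.
Qed.

End fixed_weight.
End Ap_weights.

Section geometric_series.
Context {R : realType}.

Lemma powR_inv (a r : R) : 0 <= a -> (a^-1) `^ r = a `^ (- r).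
Proof. by move=> a0; rewrite -(powR_inv1 a0) -powRrM mulN1r. Qed.

Lemma sum_geometric_le (c : R) n : 0 <= c -> c < 1 ->
  \sum_(j < n) c ^+ j <= (1 - c)^-1.
Proof.
move=> c0 c1; have h : 0 < 1 - c by rewrite subr_gt0.
rewrite -[leRHS]mul1r ler_pdivlMr//.
have -> : (\sum_(j < n) c ^+ j) * (1 - c) = 1 - c ^+ n.
  elim: n => [|n IH]; first by rewrite big_ord0 expr0; ring.
  by rewrite big_ord_recr/= mulrDl IH exprS; ring.
by rewrite gerBl exprn_ge0.
Qed.

Lemma sum_half_le n : \sum_(j < n) 2^-1 ^+ j <= 2 :> R.
Proof.
have e : (1 - 2^-1)^-1 = 2 :> R by field.
by rewrite -[leRHS]e; apply: sum_geometric_le; lra.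
Qed.

Local Open Scope ereal_scope.

(** Each a i is at most the l^p norm of the sequence, and the weights 2^-i sum to at most 2. This
    crude form replaces Minkowski's inequality for the series in [A1_majorant]. *)
Lemma dyadic_sum_poweR_le (a : nat -> \bar R) (p : R) : (0 < p)%R -> (forall i, 0 <= a i) ->
  (\sum_(i <oo) (2^-1 ^+ i)%:E * a i) `^ p <= (2 `^ p)%:E * \sum_(i <oo) a i `^ p.
Proof.
move=> p0 a0; set S := \sum_(i <oo) a i `^ p.
have S0 : 0 <= S by apply: nneseries_ge0 => i _ _; exact: poweR_ge0.
have aS i : a i <= S `^ p^-1.
  rewrite -[leLHS](@poweRK _ p) ?gt_eqF//; apply: le_poweR.
  - by rewrite invr_ge0 ltW.
  - exact: poweR_ge0.
  - by apply: (le_nneseries_term (u := fun i => a i `^ p)) => k; exact: poweR_ge0.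
have le2 : \sum_(i <oo) (2^-1 ^+ i)%:E * a i <= 2%:E * S `^ p^-1.
  apply: nneseries_le => [k|n]; first by rewrite mule_ge0// lee_fin exprn_ge0.
  apply: (@le_trans _ _ (\sum_(i < n) (2^-1 ^+ i)%:E * S `^ p^-1)).
    by apply: lee_sum => i _; rewrite lee_wpmul2l// lee_fin exprn_ge0.
  rewrite -ge0_sume_distrl; last by move=> i _; rewrite lee_fin exprn_ge0.
  rewrite lee_wpmul2r ?poweR_ge0// sumEFin lee_fin.
  exact: sum_half_le.
apply: le_trans (le_poweR (ltW p0) _ le2) _.
  by apply: nneseries_ge0 => i _ _; rewrite mule_ge0// lee_fin exprn_ge0.
by rewrite poweRM ?lee_fin ?poweR_ge0// poweRVK ?gt_eqF// poweR_EFin lexx.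
Qed.

End geometric_series.

(** * Muckenhoupt's theorem and the Rubio de Francia algorithm *)

Section muckenhoupt.
Local Open Scope ereal_scope.
Context {R : realType}.
Local Notation mu := (@lebesgue_measure R).
Variables (p : R) (w : R -> R) (C : R).
Hypotheses (p1 : (1 < p)%R) (Aw : Ap_ball p w C).

Local Notation sg := (dual_weight p w).
Local Notation p' := (p / (p - 1))%R.

Let w0 := Ap_gt0 Aw.
Let mw := Ap_meas Aw.
Let p0 : (0 < p)%R. Proof. exact: lt_trans ltr01 p1. Qed.
Let p10 : (0 < p - 1)%R. Proof. by rewrite subr_gt0. Qed.
Let p'1 : (1 < p')%R. Proof. by rewrite ltr_pdivlMr// mul1r gtrBl. Qed.
Let mwE : measurable_fun setT (fun x => (w x)%:E). Proof. exact/measurable_EFinP. Qed.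

Let sg_poweR x : (sg x `^ (- p) * sg x = w x)%R.
Proof.
have s0 := dual_weight_gt0 Aw x.
have -> : (sg x `^ (- p) * sg x = sg x `^ (- p + 1))%R.
  by rewrite powRD ?powRr1 ?(ltW s0)//; apply/implyP => _; rewrite gt_eqF.
rewrite /dual_weight -powRrM (_ : - (p - 1)^-1 * (- p + 1) = 1)%R ?powRr1 ?(ltW (w0 x))//.
by field; rewrite gt_eqF.
Qed.

Let w_poweR x : (w x `^ (- p') * w x = sg x)%R.
Proof.
have -> : (w x `^ (- p') * w x = w x `^ (- p' + 1))%R.
  by rewrite powRD ?powRr1 ?(ltW (w0 x))//; apply/implyP => _; rewrite gt_eqF.
rewrite /dual_weight; congr (_ `^ _)%R.
by field; rewrite gt_eqF.
Qed.

Lemma muckenhoupt : exists2 A : R, (1 <= A)%R &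
  forall f : R -> \bar R, measurable_fun setT f -> (forall x, 0 <= f x) ->
    \int[mu]_x (HLmax f x `^ p * (w x)%:E) <= A%:E * \int[mu]_x (f x `^ p * (w x)%:E).
Proof.
have dw := Ap_doubling p1 Aw.
have ds := Ap_doubling p'1 (Ap_ball_dual p1 Aw).
have [C1 C10 H1] := maximal_strong_type dw p'1.
have [C2 C20 H2] := maximal_strong_type ds p1.
(* The added 1 makes the constant positive, since [A1_majorant] takes a negative power of it. *)
exists (1 + C `^ p' * (C1 * C2))%R; first by rewrite lerDl !mulr_ge0 ?powR_ge0.
move=> f mf f0.
have ms : measurable_fun setT sg := measurable_dual_weight Aw.
have minv (h : R -> R) : measurable_fun setT h -> (forall x, (0 < h x)%R) ->
    measurable_fun setT (fun x => ((h x)^-1)%:E).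
  move=> mh h0; apply/measurable_EFinP.
  rewrite (_ : (fun x => _) = (fun x => h x `^ (-1))%R); last first.
    by apply/funext => x; rewrite powR_inv1// ltW.
  exact: measurableT_comp (measurable_powR _) mh.
have mpow (h : R -> \bar R) (r : R) : measurable_fun setT h -> measurable_fun setT (fun x => h x `^ r).
  by move=> mh; exact: measurableT_comp (measurable_poweR _) mh.
have mg : measurable_fun setT (lerner_g p w f).
  apply: emeasurable_funM => //; apply: minv => //; exact: dual_weight_gt0 Aw.
have mG : measurable_fun setT (lerner_G p w f).
  apply: emeasurable_funM; last exact: minv.
  by apply: mpow; exact: measurable_Mx.
have sg0 x : (0 <= (sg x)^-1)%R by rewrite invr_ge0 ltW// (dual_weight_gt0 Aw).
have w'0 x : (0 <= (w x)^-1)%R by rewrite invr_ge0 ltW.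
have g0 x : 0 <= lerner_g p w f x by rewrite /lerner_g mule_ge0// lee_fin.
have M0 x : 0 <= Mx sg (lerner_g p w f) x := Mx_ge0 ds _ g0.
have G0 x : 0 <= lerner_G p w f x by rewrite /lerner_G mule_ge0 ?poweR_ge0 ?lee_fin.
have wE0 x : 0 <= (w x)%:E by rewrite lee_fin ltW.
apply: (@le_trans _ _ ((C `^ p' * (C1 * C2))%:E * \int[mu]_x (f x `^ p * (w x)%:E))); last first.
  rewrite lee_wpmul2r//; last by rewrite lee_fin lerDr.
  by apply: integral_ge0 => x _; rewrite mule_ge0 ?poweR_ge0.
apply: (@le_trans _ _ ((C `^ p')%:E *
    \int[mu]_x (Mx w (lerner_G p w f) x `^ p' * (w x)%:E))).
  rewrite -ge0_integralZl_EFin ?powR_ge0//; last 2 first.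
  - by move=> x _; rewrite mule_ge0 ?poweR_ge0.
  - by apply: emeasurable_funM => //; apply: mpow; exact: measurable_Mx.
  apply: int_le => x _; last exact: lerner_pointwise.
  by rewrite !mule_ge0 ?poweR_ge0 ?lee_fin ?powR_ge0// ltW.
rewrite EFinM -muleA lee_wpmul2l ?lee_fin ?powR_ge0//.
apply: le_trans (H1 _ mG G0) _; rewrite EFinM -muleA lee_wpmul2l ?lee_fin//.
have GE x : lerner_G p w f x `^ p' * (w x)%:E = Mx sg (lerner_g p w f) x `^ p * (sg x)%:E.
  rewrite /lerner_G poweRM ?poweR_ge0 ?lee_fin// -muleA -poweRrM.
  rewrite (_ : (p - 1) * p' = p)%R; last by rewrite mulrC divfK// gt_eqF.
  congr (_ * _); rewrite poweR_EFin -EFinM -w_poweR; congr EFin; congr (_ * _)%R.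
  by rewrite powR_inv// ltW.
have gE x : lerner_g p w f x `^ p * (sg x)%:E = f x `^ p * (w x)%:E.
  rewrite /lerner_g poweRM ?lee_fin// -muleA; congr (_ * _).
  rewrite poweR_EFin -EFinM -sg_poweR; congr EFin; congr (_ * _)%R.
  by rewrite powR_inv// ltW// (dual_weight_gt0 Aw).
apply: (@le_trans _ _ (\int[mu]_x (Mx sg (lerner_g p w f) x `^ p * (sg x)%:E))).
  apply: int_le => x _; last by rewrite GE lexx.
  by rewrite mule_ge0 ?poweR_ge0// lee_fin ltW// (dual_weight_gt0 Aw).
apply: le_trans (H2 _ mg g0) _; rewrite lee_wpmul2l ?lee_fin//.
apply: int_le => x _; last by rewrite gE lexx.
by rewrite mule_ge0 ?poweR_ge0.
Qed.

Lemma HLmax_ge0 (f : R -> \bar R) x : (forall x, 0 <= f x) -> 0 <= HLmax f x.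
Proof.
move=> f0; have [n nx] := qball_ex x; apply: le_trans (Mx_ub _ f nx).
rewrite HLmaxE mule_ge0 ?integral_ge0// lee_fin invr_ge0 mulr_ge0// ltW//.
exact: qradius_gt0.
Qed.

(* The Rubio de Francia algorithm: [U] is a sum of rescaled iterates of the maximal operator applied to [f]. *)
Lemma A1_majorant : exists B D : R, [/\ (0 < B)%R, (0 <= D)%R &
  forall f : R -> \bar R, measurable_fun setT f -> (forall x, 0 <= f x) ->
  exists U : R -> \bar R, [/\ measurable_fun setT U,
    forall x, f x <= U x,
    forall c r x : R, (0 < r)%R -> ball c r x -> \int[mu]_(y in ball c r) U y <= (B * r)%:E * U x &
    \int[mu]_x (U x `^ p * (w x)%:E) <= D%:E * \int[mu]_x (f x `^ p * (w x)%:E)]].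
Proof.
have [A A1 HA] := muckenhoupt.
have A0 : (0 < A)%R := lt_le_trans ltr01 A1.
have A20 : (0 < 2 * A)%R by rewrite mulr_gt0.
(* As th^p = 1 / (2 A), the integral of (th^i M^i f)^p w is at most 2^-i times that of f^p w. The
   further factor 1 / 2 in [c] supplies the weights of [dyadic_sum_poweR_le]. *)
pose th : R := ((2 * A) `^ (- p^-1))%R.
have th0 : (0 < th)%R by rewrite powR_gt0.
have thp : (th `^ p = (2 * A)^-1)%R.
  by rewrite /th -powRrM mulNr mulVf ?gt_eqF// powR_inv1// ltW.
pose c := (th / 2)%R.
have c0 : (0 < c)%R by rewrite /c divr_gt0.
(* The maximal function of [U] is at most U / c, because it shifts the series by one term, and a
   ball of radius r lies in a rational ball of length below 4 r. In the second constant 2^p comes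
   from [dyadic_sum_poweR_le] and 2 from the sum of the 2^-i. *)
exists (4 / c)%R, (2 `^ p * 2)%R; split.
- by rewrite divr_gt0.
- by rewrite mulr_ge0 ?powR_ge0.
move=> f mf f0; pose Mi i := iter i HLmax f.
have mMi i : measurable_fun setT (Mi i).
  by elim: i => [|i _] //=; exact: measurable_Mx.
have Mi0 i x : 0 <= Mi i x.
  by elim: i x => [|i IH] x //=; exact: HLmax_ge0.
have MiA i : \int[mu]_x (Mi i x `^ p * (w x)%:E) <=
    (A ^+ i)%:E * \int[mu]_x (f x `^ p * (w x)%:E).
  elim: i => [|i IH]; first by rewrite expr0 mul1e lexx.
  apply: le_trans (HA _ (mMi i) (Mi0 i)) _.
  by rewrite exprS EFinM -muleA lee_wpmul2l// lee_fin ltW.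
pose U x := \sum_(i <oo) (c ^+ i)%:E * Mi i x.
have t0 i x : 0 <= (c ^+ i)%:E * Mi i x by rewrite mule_ge0// lee_fin exprn_ge0 ?ltW.
have mt i : measurable_fun setT (fun x => (c ^+ i)%:E * Mi i x) by exact: measurable_funeM.
have U0 x : 0 <= U x by apply: nneseries_ge0 => i _ _; exact: t0.
have mU : measurable_fun setT U.
  by apply: ge0_emeasurable_sum => // i x _ _; exact: t0.
have wE0 x : 0 <= (w x)%:E by rewrite lee_fin ltW.
have mpow (h : R -> \bar R) (r : R) : measurable_fun setT h -> measurable_fun setT (fun x => h x `^ r).
  by move=> mh; exact: measurableT_comp (measurable_poweR _) mh.
exists U; split => //.
- move=> x; apply: le_trans (le_nneseries_term 0 (t0 ^~ x)).
  by rewrite expr0 mul1e.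
- move=> a r x r0 ax; have [n [sub nr]] := ball_sub_qball a r0.
  have MU : HLmax U x <= (c^-1)%:E * U x.
    apply: ge_ereal_sup => _ [k kx <-]; rewrite HLmaxE.
    have k0 : (0 <= (2 * qradius k)^-1 :> R)%R.
      by rewrite invr_ge0 mulr_ge0// ltW// qradius_gt0.
    rewrite integral_nneseries; last 3 first.
    - exact: measurable_qball.
    - by move=> i; exact: (measurable_funTS (mt i)).
    - by move=> i y _; exact: t0.
    rewrite -nneseriesZl; last by move=> i _; apply: integral_ge0 => y _; exact: t0.
    apply: (@le_trans _ _ (\sum_(i <oo) (c^-1)%:E * ((c ^+ i.+1)%:E * Mi i.+1 x))).
      apply: lee_nneseries => [i _ _|i _].
        by rewrite mule_ge0 ?lee_fin// integral_ge0// => y _; exact: t0.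
      rewrite ge0_integralZl_EFin; last 4 first.
      - exact: measurable_qball.
      - by move=> y _; exact: Mi0.
      - exact: (measurable_funTS (mMi i)).
      - by rewrite exprn_ge0 ?ltW.
      rewrite [X in _ <= X]muleA -EFinM exprS mulrA mulVf ?gt_eqF// mul1r muleCA.
      rewrite lee_wpmul2l ?lee_fin ?exprn_ge0 ?(ltW c0)//.
      by rewrite -HLmaxE; exact: Mx_ub.
    rewrite nneseriesZl; last by move=> i _; exact: t0.
    rewrite lee_wpmul2l ?lee_fin ?invr_ge0 ?(ltW c0)//.
    apply: nneseries_le => [i|m]; first exact: t0.
    rewrite -(big_mkord xpredT (fun i => (c ^+ i.+1)%:E * Mi i.+1 x)).
    apply: le_trans (le_nneseries m.+1 (t0 ^~ x)).
    by rewrite -[leRHS](big_mkord xpredT (fun i => (c ^+ i)%:E * Mi i x)) big_nat_recl//= leeDr.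
  have rn0 : (0 < 2 * qradius n :> R)%R by rewrite mulr_gt0 ?qradius_gt0.
  apply: (@le_trans _ _ (\int[mu]_(y in qball n) U y)).
    apply: ge0_subset_integral => //.
    - exact: measurable_ball.
    - exact: measurable_qball.
    - exact: (measurable_funTS mU).
  have := Mx_ub (cst 1%R) U (sub _ ax); rewrite HLmaxE => /le_trans/(_ MU).
  rewrite lee_pdivrMl// => /le_trans; apply.
  rewrite muleA -EFinM lee_wpmul2r// lee_fin.
  by rewrite [leRHS]mulrAC ler_wpM2r ?invr_ge0 ?(ltW c0)//; lra.
- have th1 i : ((th ^+ i)%:E * 0 = 0 :> \bar R) by rewrite mule0.
  apply: (@le_trans _ _ (\int[mu]_x ((2 `^ p)%:E *
      \sum_(i <oo) (((th ^+ i)%:E * Mi i x) `^ p * (w x)%:E)))).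
    apply: int_le => x _.
      rewrite mule_ge0 ?lee_fin ?powR_ge0// nneseries_ge0// => i _ _.
      by rewrite mule_ge0 ?poweR_ge0.
    have thM0 i : 0 <= (th ^+ i)%:E * Mi i x by rewrite mule_ge0// lee_fin exprn_ge0 ?ltW.
    have := dyadic_sum_poweR_le p0 thM0.
    rewrite (_ : \sum_(i <oo) (2^-1 ^+ i)%:E * ((th ^+ i)%:E * Mi i x) = U x); last first.
      apply: eq_eseriesr => i _; rewrite muleA -EFinM -exprMn.
      by rewrite /c (mulrC th).
    move=> H; apply: le_trans (lee_wpmul2r (wE0 x) H) _.
    rewrite -muleA lee_wpmul2l ?lee_fin ?powR_ge0//.
    rewrite muleC -nneseriesZl; last by move=> i _; exact: poweR_ge0.
    by apply: lee_nneseries => [i _ _|i _]; rewrite ?mule_ge0 ?poweR_ge0// muleC lexx.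
  have mth i : measurable_fun setT (fun x => ((th ^+ i)%:E * Mi i x) `^ p * (w x)%:E).
    by apply: emeasurable_funM => //; apply: mpow; exact: measurable_funeM.
  have th0' i x : 0 <= ((th ^+ i)%:E * Mi i x) `^ p * (w x)%:E.
    by rewrite mule_ge0 ?poweR_ge0.
  rewrite ge0_integralZl_EFin; last 4 first.
  - exact: measurableT.
  - by move=> x _; apply: nneseries_ge0 => i _ _; exact: th0'.
  - by apply: ge0_emeasurable_sum => [i x _ _|i _]; [exact: th0'|exact: mth].
  - exact: powR_ge0.
  rewrite EFinM -muleA lee_wpmul2l ?lee_fin ?powR_ge0//.
  rewrite integral_nneseries//.
  set F := \int[mu]_x (f x `^ p * (w x)%:E).
  have F0 : 0 <= F by apply: integral_ge0 => x _; rewrite mule_ge0 ?poweR_ge0.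
  apply: (@le_trans _ _ (\sum_(i <oo) (2^-1 ^+ i)%:E * F)).
    apply: lee_nneseries => [i _ _|i _]; first exact: integral_ge0.
    apply: (@le_trans _ _ (\int[mu]_x (((2 * A)^-1 ^+ i)%:E * (Mi i x `^ p * (w x)%:E)))).
      apply: int_le => x _.
        by rewrite mule_ge0 ?mule_ge0 ?poweR_ge0// lee_fin exprn_ge0// invr_ge0 ltW.
      rewrite poweRM ?lee_fin ?exprn_ge0 ?(ltW th0)// -muleA lee_wpmul2r//.
        by rewrite mule_ge0 ?poweR_ge0.
      rewrite poweR_EFin lee_fin -powR_mulrn ?(ltW th0)// -powRrM mulrC powRrM thp powR_mulrn//.
      by rewrite invr_ge0 ltW.
    rewrite ge0_integralZl_EFin; last 4 first.
    - exact: measurableT.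
    - by move=> x _; rewrite mule_ge0 ?poweR_ge0.
    - by apply: emeasurable_funM => //; exact: mpow.
    - by rewrite exprn_ge0// invr_ge0 ltW.
    apply: le_trans (lee_wpmul2l _ (MiA i)) _.
      by rewrite lee_fin exprn_ge0// invr_ge0 ltW.
    rewrite muleA -EFinM lee_wpmul2r// lee_fin -exprMn invfM -mulrA mulVf ?gt_eqF//.
    by rewrite mulr1.
  apply: nneseries_le => [i|n]; first by rewrite mule_ge0// lee_fin exprn_ge0.
  rewrite -ge0_sume_distrl; last by move=> i _; rewrite lee_fin exprn_ge0.
  rewrite lee_wpmul2r// sumEFin lee_fin.
  exact: sum_half_le.
Qed.

End muckenhoupt.

Lemma mulr_rescale (R : realType) (h N b c : R) : 0 < N ->
  h * (b * c) = b / N * (c * (N * h)).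
Proof. by move=> N0; field; rewrite gt_eqF. Qed.

Section nneseries_mul.
Local Open Scope ereal_scope.
Context {R : realType}.

(** The factor x may be +oo: a nonzero term then makes the right side infinite, and otherwise both
    sides vanish. *)
Lemma nneseries_mulr_le (u : nat -> \bar R) (x : \bar R) : (forall j, 0 <= u j) -> 0 <= x ->
  (\sum_(j <oo) u j) * x <= \sum_(j <oo) u j * x.
Proof.
move=> u0; case: x => [x| |]// x0.
  rewrite muleC -nneseriesZl; last by move=> i _.
  by apply: lee_nneseries => [j _ _|j _]; rewrite ?mule_ge0// muleC lexx.
have [[j uj]|H] := pselect (exists j, u j != 0).
  have ujy : u j * +oo = +oo by rewrite gt0_muley// lt_neqAle eq_sym uj u0.
  rewrite (@nneseries_pinfty _ (fun j => u j * +oo) xpredT j) ?leey//.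
  by move=> n _; rewrite mule_ge0.
have uz j : u j = 0 by apply/eqP; apply: contrapT => uj; apply: H; exists j; exact/negP.
have -> : \sum_(j <oo) u j = 0.
  by apply: eseries0 => i _ _; exact: uz.
by rewrite mul0e; apply: nneseries_ge0 => i _ _; rewrite uz mul0e.
Qed.

End nneseries_mul.

(** * Dyadic kernels, and sums over cells for functions in A_1 *)

Section dyadic_kernel.
Local Open Scope ereal_scope.
Context {R : realType}.
Local Notation mu := (@lebesgue_measure R).

(* A dyadic majorant of the kernels [(h / |y - a|)^(1 + e)], with [eta = 2^(- e)]. *)
Definition dyadic_kernel (eta a h y : R) : \bar R :=
  \sum_(j <oo) (if (`|y - a| < 2 ^+ j.+1 * h)%R then ((eta / 2) ^+ j)%:E else 0).

Lemma dyadic_kernel_term_ge0 (eta a h y : R) j : (0 <= eta)%R ->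
  0 <= (if (`|y - a| < 2 ^+ j.+1 * h)%R then ((eta / 2) ^+ j)%:E else 0 : \bar R).
Proof. by move=> e0; case: ifP => // _; rewrite lee_fin exprn_ge0// divr_ge0. Qed.

Lemma dyadic_kernel_ge (eta a h y : R) j : (0 <= eta)%R ->
  (`|y - a| < 2 ^+ j.+1 * h)%R -> ((eta / 2) ^+ j)%:E <= dyadic_kernel eta a h y.
Proof.
move=> e0 yj; have := le_nneseries_term j (fun k => dyadic_kernel_term_ge0 a h y k e0).
by rewrite yj.
Qed.

Lemma dyadic_kernel_ge0 (eta a h y : R) : (0 <= eta)%R -> 0 <= dyadic_kernel eta a h y.
Proof. by move=> e0; apply: nneseries_ge0 => j _ _; exact: dyadic_kernel_term_ge0. Qed.

Lemma measurable_dyadic_kernel (eta a h : R) : (0 <= eta)%R ->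
  measurable_fun setT (dyadic_kernel eta a h).
Proof.
move=> e0; apply: ge0_emeasurable_sum => [j y _ _|j _]; first exact: dyadic_kernel_term_ge0.
apply: measurable_fun_ifT => //; apply: measurable_fun_ltr => //.
by apply: measurableT_comp => //; exact: measurable_funB.
Qed.

(** The j-th ball contributes at most (eta / 2)^j 2^(j + 1) h m = 2 h eta^j m, and these terms form
    a geometric series. *)
Lemma integral_dyadic_kernel_le (eta a h : R) (g : R -> \bar R) (m : \bar R) :
  (0 <= eta)%R -> (eta < 1)%R -> (0 < h)%R -> 0 <= m ->
  measurable_fun setT g -> (forall y, 0 <= g y) ->
  (forall d, (h <= d)%R -> \int[mu]_(y in ball a d) g y <= d%:E * m) ->
  \int[mu]_y (dyadic_kernel eta a h y * g y) <= (2 * h * (1 - eta)^-1)%:E * m.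
Proof.
move=> e0 e1 h0 m0 mg g0 gm.
pose t (j : nat) (y : R) : \bar R :=
  if (`|y - a| < 2 ^+ j.+1 * h)%R then ((eta / 2) ^+ j)%:E * g y else 0.
have t0 j y : 0 <= t j y.
  by rewrite /t; case: ifP => // _; rewrite mule_ge0// lee_fin exprn_ge0// divr_ge0.
have mt j : measurable_fun setT (t j).
  apply: measurable_fun_ifT => //; last exact: measurable_funeM.
  apply: measurable_fun_ltr => //.
  by apply: measurableT_comp => //; exact: measurable_funB.
apply: (@le_trans _ _ (\int[mu]_y \sum_(j <oo) t j y)).
  apply: int_le => y _; first by apply: nneseries_ge0 => j _ _; exact: t0.
  apply: le_trans (nneseries_mulr_le _ (g0 y)) _.
    by move=> j; exact: dyadic_kernel_term_ge0.
  apply: lee_nneseries => [j _ _|j _].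
    by rewrite mule_ge0//; exact: dyadic_kernel_term_ge0.
  by rewrite /t; case: ifP => _; rewrite ?mul0e lexx.
rewrite integral_nneseries//.
apply: (@le_trans _ _ (\sum_(j <oo) (2 * h * eta ^+ j)%:E * m)).
  apply: lee_nneseries => [j _ _|j _]; first by apply: integral_ge0 => y _; exact: t0.
  have hj : (h <= 2 ^+ j.+1 * h)%R by rewrite ler_peMl ?(ltW h0)// exprn_ege1//; lra.
  have -> : \int[mu]_y t j y =
      ((eta / 2) ^+ j)%:E * \int[mu]_(y in ball a (2 ^+ j.+1 * h)%R) g y.
    rewrite -ge0_integralZl_EFin; last 4 first.
    - exact: measurable_ball.
    - by move=> y _; exact: g0.
    - exact: (measurable_funTS mg).
    - by rewrite exprn_ge0// divr_ge0.
    rewrite [RHS]integral_mkcond; apply: eq_integral => y _; rewrite patchE /t distrC.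
    case: ifPn => [h1|/negP h1]; first by rewrite mem_set.
    by rewrite memNset.
  apply: le_trans (lee_wpmul2l _ (gm _ hj)) _; first by rewrite lee_fin exprn_ge0// divr_ge0.
  rewrite muleA -EFinM lee_wpmul2r// lee_fin exprMn exprS.
  rewrite le_eqVlt; apply/orP; left; apply/eqP.
  rewrite exprVn; field; by rewrite expf_neq0.
have mn0 j : 0 <= (2 * h * eta ^+ j)%:E :> \bar R.
  by rewrite lee_fin !mulr_ge0 ?exprn_ge0 ?(ltW h0).
apply: nneseries_le => [j|n]; first by rewrite mule_ge0.
rewrite -ge0_sume_distrl//; apply: lee_wpmul2r => //.
rewrite sumEFin lee_fin -mulr_sumr ler_wpM2l ?mulr_ge0 ?(ltW h0)//.
exact: sum_geometric_le.
Qed.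

(** One term of the kernel suffices, that of the scale j with 2^j h / 2 < |y - a| <= 2^j h. Starting
    the scales at h / 2 admits |y - a| = h and costs the factor 2^(1 + e). *)
Lemma power_le_dyadic_kernel (e a h y : R) : (0 < e)%R -> (0 < h)%R -> (h <= `|y - a|)%R ->
  ((h / `|y - a|) `^ (1 + e))%:E <=
    (2 `^ (1 + e))%:E * dyadic_kernel (2 `^ (- e)) a h y.
Proof.
move=> e0 h0 hy; set z := `|y - a|%R in hy *.
have z0 : (0 < z)%R := lt_le_trans h0 hy.
have h20 : (0 < h / 2)%R by rewrite divr_gt0.
have h2z : (h / 2 < z)%R by lra.
have [j [jz zj]] := dyadic_level h20 h2z.
have e1 : (h / 2 * 2 ^+ j.+1 = 2 ^+ j * h)%R by rewrite exprS; field.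
rewrite e1 in zj.
have zj' : (z < 2 ^+ j.+1 * h)%R.
  apply: le_lt_trans zj _; rewrite exprS -mulrA ltr_pMl ?mulr_gt0 ?exprn_gt0//; lra.
have p2 : (0 <= 2 `^ (- e) :> R)%R by exact: powR_ge0.
apply: (@le_trans _ _ ((2 `^ (1 + e))%:E * ((2 `^ (- e) / 2) ^+ j)%:E)); last first.
  by rewrite lee_wpmul2l ?lee_fin ?powR_ge0//; exact: dyadic_kernel_ge.
have -> : ((2 `^ (- e) / 2) ^+ j = (2 ^- j) `^ (1 + e) :> R)%R.
  have -> : (2 `^ (- e) / 2 = (2^-1) `^ (1 + e) :> R)%R.
    by rewrite powR_inv// -powR_inv1// -powRD ?pnatr_eq0 ?implybT//; congr (_ `^ _)%R; ring.
  by rewrite -powR_mulrn ?powR_ge0// powRAC powR_mulrn ?invr_ge0// exprVn.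
rewrite -EFinM -powRM ?invr_ge0 ?exprn_ge0// lee_fin; apply: le_powR.
- lra.
- by rewrite divr_ge0 ?ltW.
- rewrite ler_pdivrMr// -mulrA -ler_pdivrMl//.
  by rewrite mulrC [leRHS]mulrC ler_pdivlMr ?exprn_gt0// ltW.
Qed.

End dyadic_kernel.

(* The constant must not depend on the majorant [U], only on its [A_1] constant [B]. *)
Definition cell_const {R : realType} (B s : R) : R :=
  8 * B + 2 * B / (1 - (1 + B^-1)^-1 `^ (s - 1)).

Section A1_functions.
Local Open Scope ereal_scope.
Context {R : realType}.
Local Notation mu := (@lebesgue_measure R).
Variables (U : R -> \bar R) (B : R).
Hypotheses (B0 : (0 < B)%R) (mU : measurable_fun setT U) (U0 : forall x, 0 <= U x).
Hypothesis HU : forall c r x : R, (0 < r)%R -> ball c r x ->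
  \int[mu]_(y in ball c r) U y <= (B * r)%:E * U x.

Let mUS D : measurable_fun D U. Proof. exact: (measurable_funTS mU). Qed.
Let phi (c d : R) := \int[mu]_(y in ball c d) U y.
Let phi0 (c d : R) : 0 <= phi c d. Proof. by apply: integral_ge0. Qed.

Let le_phi (c d : R) (A : set R) : measurable A -> ball c d `<=` A ->
  phi c d <= \int[mu]_(y in A) U y.
Proof.
move=> mA sub; apply: ge0_subset_integral; [exact: measurable_ball|exact: mA|
  exact: mUS|by move=> y _; exact: U0|exact: sub].
Qed.

(** By [HU], at every point of the ring between the two balls [U] is at least the mass of the inner
    ball divided by 2 d B. The ring has measure 2 d, so it carries at least B^-1 times the mass of
    the inner ball. *)
Lemma reverse_doubling (c d : R) : (0 < d)%R -> (1 + B^-1)%:E * phi c d <= phi c (2 * d).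
Proof.
move=> d0; have d20 : (0 < 2 * d)%R by rewrite mulr_gt0.
have sub : ball c d `<=` ball c (2 * d)%R by apply: le_ball; lra.
have mb e : measurable (ball c e : set R) by exact: measurable_ball.
have mD : measurable (ball c (2 * d)%R `\` ball c d) by exact: measurableD.
rewrite {2}/phi -(setDUK sub) ge0_integral_setU; last 5 first.
- exact: mb.
- exact: mD.
- exact: mUS.
- by move=> x _; exact: U0.
- by rewrite disj_set2E setDIK.
rewrite EFinD ge0_muleDl ?lee_fin ?invr_ge0 ?(ltW B0)// mul1e leeD2l//.
have muD : mu (ball c (2 * d)%R `\` ball c d) = (2 * d)%:E.
  have fin : mu (ball c (2 * d)%R) < +oo by rewrite lebesgue_ball ?(ltW d20)// ltry.
  transitivity (mu (ball c (2 * d)%R) - mu (ball c d)).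
    have := @measureD _ _ _ mu _ _ (mb (2 * d)%R) (mb d) fin.
    by rewrite (setIidr sub).
  by rewrite !lebesgue_ball ?(ltW d0) ?(ltW d20)// -EFinB; congr EFin; ring.
apply: (@le_trans _ _ (((2 * d)^-1 * B^-1)%:E * phi c d * mu (ball c (2 * d)%R `\` ball c d))).
  rewrite muD [leRHS]muleAC -EFinM lee_wpmul2r// lee_fin.
  by rewrite le_eqVlt; apply/orP; left; apply/eqP; field; rewrite !gt_eqF.
rewrite -(integral_cst mu mD).
apply: int_le => y [yB _] //=.
rewrite -invfM lee_pdivrMl ?mulr_gt0//.
apply: le_trans (le_phi (mb _) sub) _; apply: le_trans (HU d20 yB) _.
by rewrite mulrC lexx.
Qed.

Let eta := ((1 + B^-1)^-1)%R.

Lemma eta_gt0 : (0 < eta)%R.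
Proof. by rewrite invr_gt0 addr_gt0 ?invr_gt0. Qed.

Lemma eta_lt1 : (eta < 1)%R.
Proof. by rewrite invf_lt1 ?addr_gt0 ?invr_gt0// ltrDl invr_gt0. Qed.

Lemma reverse_doubling_iter (c d : R) j : (0 < d)%R ->
  phi c d <= (eta ^+ j)%:E * phi c (2 ^+ j * d).
Proof.
move=> d0; elim: j => [|j IH]; first by rewrite !expr0 mul1e mul1r lexx.
apply: le_trans IH _; rewrite exprSr EFinM -muleA lee_wpmul2l//.
  by rewrite lee_fin exprn_ge0// ltW// eta_gt0.
rewrite lee_pdivlMl ?addr_gt0 ?invr_gt0// exprS -mulrA.
by apply: reverse_doubling; rewrite mulr_gt0// exprn_gt0.
Qed.

Definition cell (a h : R) (n : nat) : set R :=
  [set y | (n%:R * h <= `|y - a| < n.+1%:R * h)%R].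

Lemma measurable_cell (a h : R) n : measurable (cell a h n).
Proof.
rewrite (_ : cell a h n = (fun y => `|y - a|)%R @^-1` `[(n%:R * h)%R, (n.+1%:R * h)%R[).
  rewrite -[X in measurable X]setTI.
  have mn : measurable_fun setT (fun y : R => `|y - a|%R).
    by apply: measurableT_comp => //; exact: measurable_funB.
  by apply: mn => //.
by apply/seteqP; split => y /=; rewrite in_itv.
Qed.

Lemma trivIset_cell (a h : R) : (0 < h)%R -> trivIset setT (cell a h).
Proof.
move=> h0; apply: ltn_trivIset => i j ij.
rewrite -subset0 => y [] /= /andP[h1 h2] /andP[h3 h4].
have : (j.+1%:R * h <= i%:R * h)%R by rewrite ler_wpM2r ?(ltW h0)// ler_nat.
lra.
Qed.

(** The cell lies in two balls of radius h about the midpoints of its intervals. With 2^j <= n, each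
    can be doubled j times inside the ball of radius 4 n h about [a], which contains [x]; every
    doubling gains a factor eta. *)
Lemma integral_cell_le (a h x : R) n : (0 < h)%R -> (`|x - a| < h)%R -> (0 < n)%N ->
  \int[mu]_(y in cell a h n) U y <=
    (8 * B * n%:R * h * eta ^+ trunc_log 2 n)%:E * U x.
Proof.
move=> h0 xa n0; set j := trunc_log 2 n.
have jn : (2 ^ j <= n)%N by exact: trunc_logP.
have jnR : (2 ^+ j <= n%:R :> R)%R by rewrite -natrX ler_nat.
have n1 : (1 <= n%:R :> R)%R by rewrite ler1n.
have nh0 : (0 < 4 * n%:R * h)%R by rewrite !mulr_gt0// ltr0n.
have side c : (`|c - a| = (n%:R + 2^-1) * h)%R ->
    phi c h <= (4 * B * n%:R * h * eta ^+ j)%:E * U x.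
  move=> ca; apply: le_trans (reverse_doubling_iter c j h0) _.
  rewrite (_ : (4 * B * n%:R * h * eta ^+ j = eta ^+ j * (B * (4 * n%:R * h)))%R); last by ring.
  rewrite EFinM -muleA lee_wpmul2l ?lee_fin ?exprn_ge0 ?(ltW eta_gt0)//.
  have xB : ball a (4 * n%:R * h)%R x.
    rewrite ball_R distrC; apply: (lt_le_trans xa).
    by rewrite ler_peMl ?(ltW h0)//; lra.
  apply: le_trans (HU nh0 xB); apply: le_phi; first exact: measurable_ball.
  move=> y; rewrite !ball_R => cy.
  have := ler_distD c a y; rewrite (distrC a c) ca => H; apply: (le_lt_trans H).
  have e : (2 ^+ j * h <= n%:R * h)%R by rewrite ler_wpM2r// ltW.
  have : (h <= n%:R * h)%R by rewrite ler_peMl// ltW.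
  by rewrite mulrDl => h1; nra.
pose c1 := (a + (n%:R + 2^-1) * h)%R; pose c2 := (a - (n%:R + 2^-1) * h)%R.
have d0 : (0 <= (n%:R + 2^-1) * h)%R by rewrite mulr_ge0 ?(ltW h0)// addr_ge0 ?invr_ge0.
have s1 : phi c1 h <= (4 * B * n%:R * h * eta ^+ j)%:E * U x.
  by apply: side; rewrite /c1 addrC addKr ger0_norm.
have s2 : phi c2 h <= (4 * B * n%:R * h * eta ^+ j)%:E * U x.
  by apply: side; rewrite /c2 addrC addKr normrN ger0_norm.
have sub : cell a h n `<=` ball c1 h `|` ball c2 h.
  move=> y /= /andP[]; rewrite -natr1 !ball_R /c1 /c2.
  have [ya|ya] := leP 0%R (y - a)%R.
    by rewrite ger0_norm// => h1 h2; left; rewrite ltr_norml; apply/andP; split; nra.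
  by rewrite ltr0_norm// => h1 h2; right; rewrite ltr_norml; apply/andP; split; nra.
apply: (@le_trans _ _ (phi c1 h + phi c2 h)).
  rewrite /phi integral_mkcond [X in _ <= X + _]integral_mkcond [X in _ <= _ + X]integral_mkcond.
  have mp c : measurable_fun setT (U \_ (ball c h)).
    have [k _] := measurable_restrictT U (measurable_ball c h : measurable (ball c h : set R)).
    by apply: k.
  have p0 c y : 0 <= (U \_ (ball c h)) y by apply: erestrict_ge0.
  rewrite -ge0_integralD; last 5 first.
  - exact: measurableT.
  - by move=> y _; exact: p0.
  - exact: mp.
  - by move=> y _; exact: p0.
  - exact: mp.
  apply: int_le => y _; first by rewrite adde_ge0.
  rewrite patchE; case: ifPn => [/set_mem cy|_]; last by rewrite adde_ge0.
  case: (sub _ cy) => yb; rewrite !patchE (mem_set yb).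
    by rewrite leeDl//; case: ifP.
  by rewrite leeDr//; case: ifP.
apply: le_trans (leeD s1 s2) _.
have c0 : (0 <= 4 * B * n%:R * h * eta ^+ j)%R.
  by rewrite !mulr_ge0 ?exprn_ge0 ?(ltW eta_gt0) ?(ltW B0) ?(ltW h0).
rewrite -ge0_muleDl ?lee_fin// -EFinD lee_wpmul2r// lee_fin.
by rewrite le_eqVlt; apply/orP; left; apply/eqP; ring.
Qed.

(* The gain [eta ^+ j] at distance [2 ^+ j * h], coming from the reverse doubling of [U], makes the l^s sum over the cells converge. *)
Lemma cell_sum_le (s : R) : (1 < s)%R -> (0 < cell_const B s)%R /\
  forall (F : R -> R) (a h x u : R) (nu : nat -> R) J, (0 < h)%R -> (`|x - a| < h)%R ->
    U x <= u%:E -> measurable_fun setT F -> (forall y, (0 <= F y)%R) ->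
    (forall y, (F y)%:E <= U y) ->
    (forall n, (0 <= nu n)%R) ->
    (forall n, (0 < n)%N -> (nu n * (n%:R * h))%:E <= \int[mu]_(y in cell a h n) (F y)%:E) ->
    nu 0%N = 0%R ->
    (\sum_(n < J) nu n `^ s <= (cell_const B s * u) `^ s)%R.
Proof.
move=> s1; have s10 : (0 < s - 1)%R by lra.
have e0 := eta_gt0; have e1 := eta_lt1.
pose et := (eta `^ (s - 1))%R.
have et0 : (0 <= et)%R by exact: powR_ge0.
have et1 : (et < 1)%R.
  have : (eta `^ (s - 1) < 1 `^ (s - 1))%R by apply: gt0_ltr_powR; rewrite ?nnegrE ?ltW.
  by rewrite powR1.
pose K := (2 * B / (1 - et))%R.
have K0 : (0 < K)%R by rewrite divr_gt0 ?mulr_gt0// subr_gt0.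
have -> : cell_const B s = (8 * B + K)%R by [].
split; first by rewrite addr_gt0// mulr_gt0.
move=> F a h x u nu J h0 xa Uxu mF F0 FU nu0 nuE nuz.
have u0 : (0 <= u)%R by rewrite -lee_fin (le_trans _ Uxu).
have mFE D : measurable_fun D (fun y => (F y)%:E).
  by apply/measurable_EFinP; exact: measurable_funTS.
have FE0 y : 0 <= (F y)%:E by rewrite lee_fin.
pose l n := trunc_log 2 n.
have nuB n : (nu n <= 8 * B * u * eta ^+ l n)%R.
  case: n => [|n]; first by rewrite nuz !mulr_ge0 ?exprn_ge0 ?(ltW e0) ?(ltW B0) ?(ltW h0).
  have nh : (0 < n.+1%:R * h)%R by rewrite mulr_gt0.
  rewrite -(ler_pM2r nh) -lee_fin; apply: le_trans (nuE n.+1 isT) _.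
  apply: (@le_trans _ _ (\int[mu]_(y in cell a h n.+1) U y)); first exact: int_le.
  apply: le_trans (integral_cell_le h0 xa (ltn0Sn n)) _.
  have c0 : (0 <= 8 * B * n.+1%:R * h * eta ^+ l n.+1)%R.
    by rewrite !mulr_ge0 ?exprn_ge0 ?(ltW e0) ?(ltW B0) ?(ltW h0).
  apply: le_trans (lee_wpmul2l _ Uxu) _; first by rewrite lee_fin.
  by rewrite -EFinM lee_fin le_eqVlt; apply/orP; left; apply/eqP; ring.
(* In nu^s = nu^(s - 1) nu the first factor takes the pointwise bound [nuB]. The sum that remains is
   linear in [F] with a geometric gain, hence an integral against a dyadic kernel. *)
have nuS n : (nu n `^ s <= (8 * B * u) `^ (s - 1) * (et ^+ l n * nu n))%R.
  rewrite -(mulr_powRB1 (nu0 n) (lt_trans ltr01 s1)) mulrC mulrA ler_wpM2r//.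
  have -> : (et ^+ l n = (eta ^+ l n) `^ (s - 1))%R.
    by rewrite /et -powR_mulrn ?powR_ge0// powRAC powR_mulrn// ltW.
  rewrite -powRM ?exprn_ge0 ?mulr_ge0 ?(ltW e0) ?(ltW B0)//.
  by apply: le_powR => //; exact: ltW.
have key : (\sum_(n < J) et ^+ l n * nu n <= K * u)%R.
  apply: (@le_trans _ _ (\sum_(n < J.+1) et ^+ l n * nu n)%R).
    by rewrite big_ord_recr/= lerDl mulr_ge0// exprn_ge0.
  rewrite big_ord_recl nuz mulr0 add0r -(ler_pM2l h0) -lee_fin mulr_sumr -sumEFin.
  apply: (@le_trans _ _ (\int[mu]_y (dyadic_kernel et a h y * (F y)%:E))).
    apply: (@le_trans _ _ (\sum_(n < J) \int[mu]_(y in cell a h n.+1)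
        (dyadic_kernel et a h y * (F y)%:E))).
      apply: lee_sum => n _; rewrite lift0.
      have n1 : (0 < n.+1%:R :> R)%R by [].
      rewrite (_ : (h * (et ^+ l n.+1 * nu n.+1) =
        (et ^+ l n.+1 / n.+1%:R) * (nu n.+1 * (n.+1%:R * h)))%R); last first.
        exact: mulr_rescale.
      have c0 : (0 <= et ^+ l n.+1 / n.+1%:R)%R by rewrite divr_ge0 ?exprn_ge0.
      rewrite EFinM; apply: le_trans (lee_wpmul2l _ (nuE n.+1 isT)) _; first by rewrite lee_fin.
      rewrite -ge0_integralZl_EFin; last 4 first.
      - exact: measurable_cell.
      - by move=> y _; exact: FE0.
      - exact: mFE.
      - exact: c0.
      apply: int_le => y; first by rewrite mule_ge0// dyadic_kernel_ge0.
      move=> /andP[y1 y2]; rewrite lee_wpmul2r//.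
      apply: le_trans (dyadic_kernel_ge (j := l n.+1) et0 _); last first.
        apply: (lt_le_trans y2); rewrite ler_wpM2r ?(ltW h0)// -natrX ler_nat.
        exact: trunc_log_ltn.
      rewrite lee_fin exprMn exprVn ler_wpM2l ?exprn_ge0//.
      rewrite lef_pV2 ?posrE ?exprn_gt0// -natrX ler_nat.
      exact: trunc_logP.
    apply: (@sum_integral_disjoint _ _ _ mu (fun n => cell a h n.+1) setT).
    - apply: ltn_trivIset => i j ij; have /trivIsetP H := trivIset_cell (a := a) h0.
      by apply: H => //; rewrite eqSS neq_ltn ij ?orbT.
    - by move=> i; exact: measurable_cell.
    - exact: measurableT.
    - by [].
    - by apply: emeasurable_funM; [exact: measurable_dyadic_kernel|exact: mFE].
    - by move=> y _; rewrite mule_ge0// dyadic_kernel_ge0.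
  apply: (@le_trans _ _ ((2 * h * (1 - et)^-1)%:E * (B * u)%:E)).
    apply: (integral_dyadic_kernel_le et0 et1 h0 _ (mFE setT) FE0).
    - by rewrite lee_fin mulr_ge0 ?(ltW B0).
    - move=> d hd; apply: (@le_trans _ _ (\int[mu]_(y in ball a d) U y)); first exact: int_le.
      have dx : ball a d x by rewrite ball_R distrC (lt_le_trans xa).
      have d0 : (0 < d)%R := lt_le_trans h0 hd.
      apply: le_trans (HU d0 dx) _.
      apply: le_trans (lee_wpmul2l _ Uxu) _; first by rewrite lee_fin mulr_ge0 ?(ltW B0) ?(ltW d0).
      by rewrite -!EFinM lee_fin mulrAC mulrC lexx.
  by rewrite -EFinM lee_fin le_eqVlt; apply/orP; left; apply/eqP; rewrite /K; ring.
apply: (@le_trans _ _ ((8 * B * u) `^ (s - 1) * (K * u))%R).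
  apply: (@le_trans _ _ (\sum_(n < J) (8 * B * u) `^ (s - 1) * (et ^+ l n * nu n))%R).
    by apply: ler_sum => n _; exact: nuS.
  by rewrite -mulr_sumr ler_wpM2l ?powR_ge0.
have K0' := ltW K0; have B8 : (0 <= 8 * B)%R by apply: mulr_ge0 => //; exact: ltW.
move: K0' key => {K0}; move: K => {}K K0 key.
have Du0 : (0 <= (8 * B + K) * u)%R by apply: mulr_ge0 => //; exact: addr_ge0.
rewrite -(mulr_powRB1 Du0 (lt_trans ltr01 s1)) mulrC; apply: ler_pM.
- exact: mulr_ge0.
- exact: powR_ge0.
- by rewrite ler_wpM2r// lerDr.
- apply: le_powR; [exact: ltW|exact: mulr_ge0|].
  by rewrite ler_wpM2r// lerDl.
Qed.

End A1_functions.

(** * Truncated kernels *)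

Section complex_tools.
Context {R : realType}.
Local Notation mu := (@lebesgue_measure R).
Local Notation Re := complex.Re.
Local Notation Im := complex.Im.
Implicit Types (z : R[i]) (F : R -> R[i]).

Lemma normcE z : normc z = Num.sqrt (Re z ^+ 2 + Im z ^+ 2).
Proof. by case: z. Qed.

Lemma Re_le_normc z : `|Re z| <= normc z.
Proof. by rewrite normcE -sqrtr_sqr ler_wsqrtr// lerDl sqr_ge0. Qed.

Lemma Im_le_normc z : `|Im z| <= normc z.
Proof. by rewrite normcE -sqrtr_sqr ler_wsqrtr// lerDr sqr_ge0. Qed.

Lemma normc_le_ReIm z : normc z <= `|Re z| + `|Im z|.
Proof.
rewrite normcE -[leRHS]ger0_norm ?addr_ge0// -sqrtr_sqr ler_wsqrtr//.
rewrite sqrrD !real_normK ?num_real// addrAC lerDl mulrn_wge0// mulr_ge0//.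
Qed.

Lemma normc_sub_le z1 z2 : `|normc z1 - normc z2| <= normc (z1 - z2).
Proof.
have h (a b : R[i]) : normc a - normc b <= normc (a - b).
  by rewrite lerBlDr -{1}(subrK b a); exact: le_normcD.
by rewrite ler_norml h andbT lerNl opprB -[leRHS]normcN opprB h.
Qed.

Lemma Re_mul z1 z2 : Re (z1 * z2) = Re z1 * Re z2 - Im z1 * Im z2.
Proof. by case: z1; case: z2. Qed.

Lemma Im_mul z1 z2 : Im (z1 * z2) = Re z1 * Im z2 + Im z1 * Re z2.
Proof. by case: z1; case: z2. Qed.

Lemma Re_add z1 z2 : Re (z1 + z2) = Re z1 + Re z2.
Proof. by case: z1; case: z2. Qed.

Lemma Im_add z1 z2 : Im (z1 + z2) = Im z1 + Im z2.
Proof. by case: z1; case: z2. Qed.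

Definition cmeas_on (D : set R) F :=
  measurable_fun D (fun x => Re (F x)) /\ measurable_fun D (fun x => Im (F x)).

Lemma cmeas_onS (A D : set R) F : measurable D -> A `<=` D -> cmeas_on D F -> cmeas_on A F.
Proof. by move=> mD AD [h1 h2]; split; apply: measurable_funS; eauto. Qed.

Lemma cmeas_onM D F G : cmeas_on D F -> cmeas_on D G -> cmeas_on D (fun y => F y * G y).
Proof.
move=> [f1 f2] [g1 g2]; split.
- rewrite (_ : (fun x => _) = (fun x => Re (F x) * Re (G x) - Im (F x) * Im (G x))).
    by apply: measurable_funB; exact: measurable_funM.
  by apply/funext => x; rewrite Re_mul.
- rewrite (_ : (fun x => _) = (fun x => Re (F x) * Im (G x) + Im (F x) * Re (G x))).
    by apply: measurable_funD; exact: measurable_funM.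
  by apply/funext => x; rewrite Im_mul.
Qed.

Lemma measurable_normc D F : cmeas_on D F -> measurable_fun D (fun x => normc (F x)).
Proof.
move=> [f1 f2]; rewrite (_ : (fun x => _) =
    (fun x => (Re (F x) ^+ 2 + Im (F x) ^+ 2) `^ 2^-1)).
  apply: measurableT_comp (measurable_powR _) _.
  by apply: measurable_funD; exact: measurable_funX.
by apply/funext => x; rewrite normcE powR12_sqrt// addr_ge0 ?sqr_ge0.
Qed.

(** The factor 2 comes from bounding the real and imaginary parts separately. *)
Lemma cintegral_le D F : measurable D -> cmeas_on D F ->
  ((normc (cintegral D F))%:E <= 2%:E * \int[mu]_(y in D) (normc (F y))%:E)%E.
Proof.
move=> mD [f1 f2].
have mn : measurable_fun D (fun x => (normc (F x))%:E).
  by apply/measurable_EFinP; exact: measurable_normc.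
have b (g : R -> R) : measurable_fun D g -> (forall x, `|g x| <= normc (F x)) ->
    ((`|\int[mu]_(x in D) g x|)%:E <= \int[mu]_(y in D) (normc (F y))%:E)%E.
  move=> mg gF; apply: (@le_trans _ _ `|\int[mu]_(x in D) (g x)%:E|%E).
    by rewrite /Rintegral; case: (\int[mu]_(x in D) (g x)%:E)%E => [r| |] /=; rewrite ?normr0 ?lexx ?leey.
  have mgE : measurable_fun D (EFin \o g) by exact/measurable_EFinP.
  apply: le_trans (le_abse_integral mu mD mgE) _.
  by apply: int_le => x _; rewrite ?lee_fin ?normc_ge0.
apply: (@le_trans _ _ (`|Re (cintegral D F)| + `|Im (cintegral D F)|)%:E).
  by rewrite lee_fin; exact: normc_le_ReIm.
rewrite (_ : 2%:E = 1%:E + 1%:E)%E// ge0_muleDl ?lee_fin//.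
rewrite !mul1e EFinD; apply: leeD; apply: b => //.
  by move=> x; exact: Re_le_normc.
by move=> x; exact: Im_le_normc.
Qed.

End complex_tools.

Section hoelder_continuity.
Context {R : realType}.

Lemma hoelder_continuous (g : R -> R) (y A e r : R) : 0 < e -> 0 < r -> 0 <= A ->
  (forall z, `|y - z| < r -> `|g y - g z| <= A * `|y - z| `^ e) ->
  {for y, continuous g}.
Proof.
move=> e0 r0 A0 H; apply/cvgrPdist_le => /= eps eps0.
pose d := (eps / (A + 1)) `^ e^-1.
have A1 : 0 < A + 1 by rewrite ltr_wpDl.
have d0 : 0 < d by rewrite powR_gt0// divr_gt0.
have m0 : 0 < Num.min r d by rewrite lt_min r0.
apply: filterS (nbhsx_ballx y (Num.min r d) m0) => z.
rewrite /ball/= lt_min => /andP[zr zd].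
apply: le_trans (H _ zr) _.
apply: (@le_trans _ _ (A * (eps / (A + 1)))).
  have E : d `^ e = eps / (A + 1).
    by apply: powRVK; [rewrite gt_eqF|rewrite divr_ge0 ?ltW].
  apply: ler_wpM2l => //; rewrite -E; apply: le_powR => //; exact: ltW.
by rewrite mulrA ler_pdivrMr//; nra.
Qed.

End hoelder_continuity.

Lemma sum_shift_le (R : realType) (u v : nat -> R) m n : (forall j, 0 <= v j) ->
  (forall j, (j < m)%N -> u j = 0) -> (forall j, u (m + j)%N = v j) ->
  \sum_(k < n) u k <= \sum_(k < n) v k.
Proof.
move=> v0 um uv.
have mono a b : \sum_(k < a) v k <= \sum_(k < a + b) v k.
  elim: b => [|b IH]; first by rewrite addn0 lexx.
  by rewrite addnS big_ord_recr/=; apply: le_trans IH _; rewrite lerDl.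
apply: (@le_trans _ _ (\sum_(k < n - m) v k)).
  elim: n => [|n IH]; first by rewrite !big_ord0.
  rewrite big_ord_recr/=; have [nm|mn] := ltnP n m.
    rewrite (um _ nm) addr0; apply: (le_trans IH).
    by rewrite (eqP (ltnW nm)) big_ord0; apply: sumr_ge0 => k _; exact: v0.
  by rewrite subSn// big_ord_recr/= -uv subnKC// lerD2r.
have [nm|mn] := leqP m n; last by rewrite (eqP (ltnW mn)) big_ord0; apply: sumr_ge0.
by have := mono (n - m)%N m; rewrite subnK.
Qed.

Section kernel.
Context {R : realType}.
Local Notation mu := (@lebesgue_measure R).
Local Notation Re := complex.Re.
Local Notation Im := complex.Im.
Variables (q delta C : R) (K : R -> R -> R[i]).
Hypotheses (q1 : 1 <= q) (delta0 : 0 < delta) (C0 : 0 < C).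
Hypothesis Ksize : forall x y, x != y -> normc (K x y) <= C / `|x - y|.
Hypothesis Ky : forall x y z, 2 * `|x - z| < `|x - y| ->
  normc (K y x - K y z) <= C * `|x - z| `^ delta / `|x - y| `^ (1 + delta).

Definition outside (x t : R) : set R := [set y | t < `|x - y|].

Lemma mem_outside x t y : (y \in outside x t) = (t < `|x - y|).
Proof. by apply/idP/idP => [/set_mem|h]; [|exact: mem_set]. Qed.

Lemma measurable_dist (x : R) : measurable_fun setT (fun y : R => `|x - y|).
Proof. by apply: measurableT_comp => //; exact: measurable_funB. Qed.

Lemma measurable_invdist (x : R) D : measurable_fun D (fun y : R => `|x - y|^-1).
Proof.
rewrite (_ : (fun y => _) = (fun y => `|x - y| `^ (-1))).
  by apply: measurable_funTS; apply: measurableT_comp (measurable_powR _) (measurable_dist x).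
by apply/funext => y; rewrite powR_inv1.
Qed.

Lemma measurable_outside x t : measurable (outside x t).
Proof.
rewrite (_ : outside x t = (fun y => `|x - y|) @^-1` `]t, +oo[).
  by rewrite -[X in measurable X]setTI; apply: measurable_dist.
by apply/seteqP; split => y /=; rewrite in_itv/= ?andbT.
Qed.

(** Regularity in the second variable makes [K x] Hoelder continuous near every y different from
    [x], and continuity on an open set gives measurability. *)
Lemma kernel_cmeas x t : 0 <= t -> cmeas_on (outside x t) (K x).
Proof.
move=> t0.
have oD : open [set y : R | y != x].
  by rewrite (_ : [set y | _] = ~` [set x]) ?openC//; apply/seteqP; split => y /= /eqP.
have mD := open_measurable oD.
have sub : outside x t `<=` [set y | y != x].
  by move=> y /= h; apply/eqP => yx; move: h; rewrite /outside/= yx subrr normr0 ltNge t0.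
apply: (cmeas_onS mD sub).
have hc (g : R[i] -> R) : (forall a b, `|g a - g b| <= normc (a - b)) ->
    measurable_fun [set y | y != x] (g \o K x).
  move=> gl; apply: open_continuous_measurable_fun => // y; rewrite inE/= => yx.
  have d0 : 0 < `|y - x| by rewrite normr_gt0 subr_eq0.
  apply: (@hoelder_continuous _ _ y (C / `|y - x| `^ (1 + delta)) delta (`|y - x| / 2)).
  - exact: delta0.
  - by rewrite divr_gt0.
  - by rewrite divr_ge0 ?powR_ge0 ?(ltW C0).
  - move=> z yz; apply: le_trans (gl _ _) _; rewrite mulrAC.
    by apply: Ky; rewrite mulrC -ltr_pdivlMr.
split; apply: hc => a b.
- by apply: le_trans (Re_le_normc _); case: a; case: b.
- by apply: le_trans (Im_le_normc _); case: a; case: b.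
Qed.

(* The class of functions on which every truncated operator is given by an absolutely convergent integral. *)
Definition admissible_fun (f : R -> R[i]) := cmeasurable f /\
  forall x t, 0 < t -> (\int[mu]_(y in outside x t) (normc (f y) / `|x - y|)%:E < +oo)%E.

Lemma cmeasurable_on (D : set R) f : cmeasurable f -> cmeas_on D f.
Proof. by move=> [f1 f2]; split; exact: measurable_funTS. Qed.

Lemma kernel_mul_cmeas x t f : 0 <= t -> cmeasurable f ->
  cmeas_on (outside x t) (fun y => K x y * f y).
Proof.
by move=> t0 mf; apply: cmeas_onM; [exact: kernel_cmeas|exact: cmeasurable_on].
Qed.

Lemma kernel_mul_le x y f : x != y -> normc (K x y * f y) <= C * (normc (f y) / `|x - y|).
Proof.
move=> xy; rewrite Normc.normcM mulrA mulrAC ler_wpM2r ?normc_ge0//.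
exact: Ksize.
Qed.

Lemma outside_neq x t y : 0 <= t -> outside x t y -> x != y.
Proof. by move=> t0 h; apply/eqP => xy; move: h; rewrite /outside/= xy subrr normr0 ltNge t0. Qed.

Lemma kernel_integrable x t f : 0 < t -> admissible_fun f ->
  mu.-integrable (outside x t) (fun y => (Re (K x y * f y))%:E) /\
  mu.-integrable (outside x t) (fun y => (Im (K x y * f y))%:E).
Proof.
move=> t0 [mf If]; have [m1 m2] := kernel_mul_cmeas x (ltW t0) mf.
have mD := measurable_outside x t.
have If' : mu.-integrable (outside x t) (fun y => (C * (normc (f y) / `|x - y|))%:E).
  apply/integrableP; split; first (apply/measurable_EFinP; apply: measurable_funM => //;
    apply: measurable_funM; last exact: measurable_invdist;
    by apply: measurable_normc; exact: cmeasurable_on).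
  under eq_integral => y _.
    rewrite gee0_abs; last by rewrite lee_fin mulr_ge0 ?divr_ge0 ?normc_ge0 ?(ltW C0).
    rewrite EFinM; over.
  rewrite ge0_integralZl_EFin ?(ltW C0)//.
  - by rewrite lte_mul_pinfty ?lee_fin ?(ltW C0)// If.
  - by move=> y _; rewrite lee_fin divr_ge0 ?normc_ge0.
  - apply/measurable_EFinP; apply: measurable_funM; last exact: measurable_invdist.
    by apply: measurable_normc; exact: cmeasurable_on.
have dom (g : R[i] -> R) : (forall z, `|g z| <= normc z) ->
    measurable_fun (outside x t) (fun y => g (K x y * f y)) ->
    mu.-integrable (outside x t) (fun y => (g (K x y * f y))%:E).
  move=> gl mg; apply: le_integrable If' => //; first exact/measurable_EFinP.
  move=> y oy; rewrite !abse_EFin lee_fin; apply: le_trans (gl _) _.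
  apply: le_trans (kernel_mul_le _ (outside_neq (ltW t0) oy)) _.
  exact: ler_norm.
by split; apply: dom => //; [exact: Re_le_normc|exact: Im_le_normc].
Qed.

Local Notation ann x := (annulus (fun y => `|x - y|)).

Lemma annulus_outside x t t' : ann x t t' `<=` outside x t.
Proof. by move=> y /andP[]. Qed.

Lemma outside_split x t t' : t < t' -> outside x t = ann x t t' `|` outside x t'.
Proof.
move=> tt; apply/seteqP; split => y; rewrite /outside /annulus/=.
  by move=> ty; have [h|h] := leP `|x - y| t'; [left; rewrite ty|right].
by case=> [/andP[]//|]; exact: lt_trans.
Qed.

Lemma truncated_sub x t t' f : 0 < t -> t < t' -> admissible_fun f ->
  truncated K t f x - truncated K t' f x = cintegral (ann x t t') (fun y => K x y * f y).
Proof.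
move=> t0 tt af; have [i1 i2] := kernel_integrable x t0 af.
have dj : [disjoint ann x t t' & outside x t'].
  rewrite disj_set2E; apply/eqP; rewrite -subset0 => y []; rewrite /annulus/outside/=.
  by move=> /andP[_ h1] h2; have := lt_le_trans h2 h1; rewrite ltxx.
have mA : measurable (ann x t t') by apply: measurable_annulus; exact: measurable_dist.
have mO := measurable_outside x t'.
rewrite /truncated -/(outside x t) -/(outside x t') /cintegral (outside_split x tt) in i1 i2 *.
rewrite !Rintegral_setU//.
by apply/eqP; rewrite eq_complex /= !addrK !eqxx.
Qed.

Lemma truncatedD x t f g : 0 < t -> admissible_fun f -> admissible_fun g ->
  truncated K t (fun y => f y + g y) x = truncated K t f x + truncated K t g x.
Proof.
move=> t0 af ag; have [f1 f2] := kernel_integrable x t0 af.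
have [g1 g2] := kernel_integrable x t0 ag; have mO := measurable_outside x t.
rewrite /truncated -/(outside x t) /cintegral.
under eq_Rintegral do rewrite mulrDr Re_add.
under [in X in Complex _ X]eq_Rintegral do rewrite mulrDr Im_add.
by rewrite !RintegralD.
Qed.

Lemma variation_opD x f g : admissible_fun f -> admissible_fun g ->
  (variation_op q K (fun y => f y + g y)%R x <= variation_op q K f x + variation_op q K g x)%E.
Proof.
move=> af ag; rewrite /variation_op.
rewrite (@eq_variation_norm _ q _ (fun r => truncated K r f x + truncated K r g x)%R).
  exact: variation_normD.
by move=> r r0; exact: truncatedD.
Qed.

(* Restriction to the complement of a ball centred at [a] only cuts the truncation parameters below its radius. *)
Lemma variation_op_outside (a h : R) (f : R -> R[i]) : 0 < h ->
  (variation_op q K (fun y => if h < `|a - y| then f y else 0)%R a <= variation_op q K f a)%E.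
Proof.
move=> h0; pose g (y : R) : R[i] := if h < `|a - y| then f y else 0.
rewrite -/g /variation_op.
have pE (p : R[i] -> R) t : p 0 = 0 -> (fun y => p (K a y * g y)) \_ (outside a t) =
    (fun y => p (K a y * f y)) \_ (outside a (Num.max t h)).
  move=> p00; apply/funext => y; rewrite !patchE !mem_outside gt_max /g.
  case: (h < `|a - y|); rewrite /= ?andbT ?andbF//.
  by rewrite mulr0 p00; case: ifP.
have tE t : truncated K t g a = truncated K (Num.max t h) f a.
  rewrite /truncated /cintegral -/(outside a t) -/(outside a (Num.max t h)).
  rewrite !(Rintegral_mkcond mu (outside a t)) !(Rintegral_mkcond mu (outside a (Num.max t h))).
  by have /= -> := pE (fun z => Re z) t erefl; have /= -> := pE (fun z => Im z) t erefl.
apply: (variation_norm_le q1); first exact: (variation_norm_ge0 q1).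
move=> t n [it t0].
have [[m hm]|hn] := pselect (exists m, h < t m); last first.
  have tmax j : Num.max (t j) h = h.
    by apply/max_idPr; rewrite leNgt; apply/negP => H; apply: hn; exists j.
  apply: le_trans (variation_norm_ge0 q1 _); rewrite lee_fin lpn_leP ?(lt_le_trans ltr01 q1)//.
  rewrite big1 ?powR_ge0// => k _.
  by rewrite /increment !tE !tmax subrr Normc.normc0 powR0// gt_eqF// (lt_le_trans ltr01 q1).
have exm : exists m, h < t m by exists m.
case: (ex_minnP exm) => [[|m'] hm' min].
  have tmax j : Num.max (t j) h = t j.
    by apply/max_idPl; apply: ltW; apply: (lt_le_trans hm'); rewrite it.
  apply: le_trans (le_variation_norm q1 _ n (conj it t0)); rewrite lee_fin.
  apply: le_lpn; first exact: lt_le_trans ltr01 q1.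
  by move=> k _; rewrite increment_ge0/= /increment !tE !tmax.
have th j : (j <= m')%N -> Num.max (t j) h = h.
  move=> jm; apply/max_idPr; rewrite leNgt; apply/negP => /min; rewrite ltnNge => /negP.
  by apply.
have ht j : Num.max (t (m'.+1 + j)%N) h = t (m'.+1 + j)%N.
  by apply/max_idPl; apply: ltW; apply: (lt_le_trans hm'); rewrite it leq_addr.
(* The parameters up to index m' all become h after the maximum with h, so their mutual increments
   vanish. They are merged into the one parameter h, which is followed by the parameters above h. *)
pose s j := if j is i.+1 then t (m'.+1 + i)%N else h.
have ads : admissible s.
  have sS i : s i < s i.+1.
    case: i => [|i] /=; first by rewrite addn0.
    by rewrite ltNge it -ltnNge addnS.
  split; last by case => [|j] /=.
  have smono := homo_ltn lt_trans sS.
  move=> i j; have [ij|ji|->] := ltngtP i j; last by rewrite lexx.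
    by rewrite (ltW (smono _ _ ij)).
  by apply/negbTE; rewrite -ltNge; exact: smono.
apply: le_trans (le_variation_norm q1 _ n ads); rewrite lee_fin.
have q0 : 0 < q := lt_le_trans ltr01 q1.
rewrite (lpn_leP _ _ q0 (lpn_ge0 _ _ _)) (lpnK _ _ q0).
apply: (@sum_shift_le _ (fun k => increment (fun t => truncated K t g a) t k `^ q)
  (fun k => increment (fun t => truncated K t f a) s k `^ q) m').
- by move=> j; exact: powR_ge0.
- move=> j jm; rewrite /increment !tE !th ?(ltnW jm)//.
  by rewrite subrr Normc.normc0 powR0// gt_eqF.
- move=> j; congr (_ `^ _); rewrite /increment !tE; case: j => [|j].
    by rewrite addn0 th//= -[in Num.max _ _](addn0 m'.+1) ht.
  by rewrite addnS -addSn ht -addnS ht.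
Qed.

End kernel.

(** * Vector-valued variations *)

Section vector_variation.
Context {R : realType}.
Local Notation mu := (@lebesgue_measure R).
Variables (q rho : R).
Hypotheses (q1 : 1 <= q) (rho1 : 1 < rho).

Let rho0 : 0 < rho. Proof. exact: lt_trans ltr01 rho1. Qed.

Lemma measurable_lpn d (T : measurableType d) (p : R) n (D : set T) (g : nat -> T -> R) :
  (forall k, (k < n)%N -> measurable_fun D (g k)) ->
  measurable_fun D (fun x => lpn p n (g ^~ x)).
Proof.
move=> mg; rewrite /lpn; apply: measurableT_comp (measurable_powR _) _.
apply: measurable_sum => k; apply: measurableT_comp (measurable_powR _) _.
exact: mg.
Qed.

(** [variation_norm_cells] is applied to each component with its own masses, and the l^rho norm over
    the components is moved inside by Minkowski's inequality: under the integrals, and, as s <= rho,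
    under the l^s sum over the cells. The resulting bound is therefore free of n. *)
Lemma variation_vector_cells n (a : nat -> R -> R[i]) (s : R) m (om1 om2 : R -> R)
    (psi phi : nat -> R -> R) (Cl : nat -> set R) (P Q : R) (nu : nat -> R) :
  1 <= s -> s <= q -> s <= rho ->
  measurable_fun setT om1 -> measurable_fun setT om2 ->
  (forall k, measurable_fun setT (psi k)) -> (forall k, measurable_fun setT (phi k)) ->
  (forall k y, 0 <= psi k y) -> (forall k y, 0 <= phi k y) ->
  (forall j, measurable (Cl j)) ->
  0 <= Q -> (forall j, 0 <= nu j) ->
  (\int[mu]_y (lpn rho n (psi ^~ y))%:E <= P%:E)%E ->
  (forall j, (\int[mu]_(y in Cl j) (lpn rho n (phi ^~ y))%:E <= (nu j)%:E)%E) ->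
  (forall J, \sum_(j < J) nu j `^ s <= Q `^ s) ->
  (forall k (r r' : R), (k < n)%N -> 0 < r -> r < r' -> exists c : nat -> nat,
    ((normc (a k r - a k r'))%:E <= \int[mu]_(y in annulus om1 r r') (psi k y)%:E +
      \sum_(l < m) (\int[mu]_(y in Cl (c l) `&` annulus om1 r r') (phi k y)%:E +
                    \int[mu]_(y in Cl (c l) `&` annulus om2 r r') (phi k y)%:E))%E) ->
  (lpe rho n (fun k => variation_norm q (a k)) <= (P + 2 * m%:R * Q)%:E)%E.
Proof.
move=> s1 sq sr mom1 mom2 mpsi mphi psi0 phi0 mC Q0 nu0 psiP phinu nuQ H.
have s0 : 0 < s := lt_le_trans ltr01 s1.
have mE (g : R -> R) (D : set R) : measurable_fun setT g ->
    measurable_fun D (fun y => (g y)%:E).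
  by move=> mg; apply/measurable_EFinP; exact: measurable_funTS.
have I0 (g : R -> R) (D : set R) : (forall y, 0 <= g y) ->
    (0 <= \int[mu]_(y in D) (g y)%:E)%E.
  by move=> g0; apply: integral_ge0 => y _; rewrite lee_fin.
pose Pk k := fine (\int[mu]_y (psi k y)%:E).
pose nk k j := fine (\int[mu]_(y in Cl j) (phi k y)%:E).
have PkE k : (k < n)%N -> (Pk k)%:E = (\int[mu]_y (psi k y)%:E)%E.
  move=> kn; rewrite fineK// ge0_fin_numE ?I0//.
  apply: (@le_lt_trans _ _ P%:E _ _ _ (ltry P)); apply: le_trans psiP.
  apply: int_le => y _; first by rewrite lee_fin lpn_ge0.
  by rewrite lee_fin; apply: (@le_lpn_coord _ rho n (psi ^~ y)).
have nkE k j : (k < n)%N -> (nk k j)%:E = (\int[mu]_(y in Cl j) (phi k y)%:E)%E.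
  move=> kn; rewrite fineK// ge0_fin_numE ?I0//.
  apply: (@le_lt_trans _ _ (nu j)%:E _ _ _ (ltry (nu j))); apply: le_trans (phinu j).
  apply: int_le => y _; first by rewrite lee_fin lpn_ge0.
  by rewrite lee_fin; apply: (@le_lpn_coord _ rho n (phi ^~ y)).
have Pk0 k : 0 <= Pk k by rewrite /Pk fine_ge0 ?I0.
have nk0 k j : 0 <= nk k j by rewrite /nk fine_ge0 ?I0.
have lnk j : lpn rho n (nk ^~ j) <= nu j.
  rewrite -lee_fin; apply: le_trans (phinu j).
  apply: (@lpn_integral _ _ R mu rho n (nk ^~ j) phi (Cl j) (ltW rho1) (mC j)).
  - by move=> k _; apply: measurable_funTS; exact: mphi.
  - by move=> k y _ _; exact: phi0.
  - by move=> k _; exact: nk0.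
  - by move=> k kn; rewrite nkE.
have nks k J : (k < n)%N -> \sum_(j < J) nk k j `^ s <= Q `^ s.
  move=> kn; apply: le_trans (nuQ J); apply: ler_sum => j _.
  apply: le_powR; [exact: ltW|exact: nk0|]; apply: le_trans (lnk j).
  exact: (@le_lpn_coord _ rho n (nk ^~ j)).
pose Sk k := fine (\sum_(j <oo) (nk k j `^ s)%:E)%E.
have Sk00 k : (0 <= \sum_(j <oo) (nk k j `^ s)%:E)%E.
  by apply: nneseries_ge0 => j _ _; rewrite lee_fin powR_ge0.
have Sk0 k : 0 <= Sk k by rewrite /Sk fine_ge0.
have SkE k : (k < n)%N -> (Sk k)%:E = (\sum_(j <oo) (nk k j `^ s)%:E)%E.
  move=> kn; rewrite fineK// ge0_fin_numE//.
  apply: (@le_lt_trans _ _ (Q `^ s)%:E _ _ _ (ltry _)).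
  apply: nneseries_le => [j|J]; first by rewrite lee_fin powR_ge0.
  by rewrite sumEFin lee_fin nks.
pose Qk k := Sk k `^ s^-1.
have Qk0 k : 0 <= Qk k by exact: powR_ge0.
have QkE k : Qk k `^ s = Sk k by rewrite powRVK ?gt_eqF.
have lQ : lpn rho n Qk <= Q.
  (* Minkowski's inequality with exponent rho / s for the counting measure on the cells. *)
  have rs1 : 1 <= rho / s by rewrite ler_pdivlMr// mul1r.
  have -> : lpn rho n Qk = lpn (rho / s) n Sk `^ s^-1.
    rewrite /lpn -powRrM.
    have -> : (rho / s)^-1 * s^-1 = rho^-1.
      by rewrite invf_div mulrAC mulfV ?gt_eqF// mul1r.
    by congr (_ `^ _); apply: eq_bigr => k _; rewrite /Qk -powRrM mulrC.
  apply: (@le_trans _ _ ((Q `^ s) `^ s^-1)); last by rewrite (powRK (lt0r_neq0 s0) Q0) lexx.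
  apply: le_powR.
  - by rewrite invr_ge0 ltW.
  - exact: lpn_ge0.
  rewrite -lee_fin.
  apply: (@le_trans _ _ (\int[counting]_(j in setT) (lpn (rho / s) n (fun k => nk k j `^ s))%:E)%E).
    apply: (@lpn_integral _ _ _ counting (rho / s) n Sk (fun k j => nk k j `^ s)) => //.
    - by move=> k j _ _; exact: powR_ge0.
    - move=> k kn; rewrite ge0_integral_count; last by move=> j; rewrite lee_fin powR_ge0.
      by rewrite SkE.
  rewrite ge0_integral_count; last by move=> j; rewrite lee_fin lpn_ge0.
  apply: nneseries_le => [j|J]; first by rewrite lee_fin lpn_ge0.
  rewrite sumEFin lee_fin; apply: le_trans (nuQ J); apply: ler_sum => j _.
  have -> : lpn (rho / s) n (fun k => nk k j `^ s) = lpn rho n (nk ^~ j) `^ s.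
    rewrite /lpn -!powRrM.
    have -> : (rho / s)^-1 = rho^-1 * s by rewrite invf_div mulrC.
    by congr (_ `^ _); apply: eq_bigr => k _; rewrite -powRrM mulrCA mulfV ?gt_eqF// mulr1.
  by apply: le_powR; [exact: ltW|exact: lpn_ge0|exact: lnk].
have lP : lpn rho n Pk <= P.
  rewrite -lee_fin; apply: le_trans psiP.
  apply: (@lpn_integral _ _ R mu rho n Pk psi setT (ltW rho1) measurableT).
  - by move=> k _; exact: mpsi.
  - by move=> k y _ _; exact: psi0.
  - by move=> k _; exact: Pk0.
  by move=> k kn; rewrite PkE.
have VP k : (k < n)%N -> (variation_norm q (a k) <= (Pk k + 2 * m%:R * Qk k)%:E)%E.
  move=> kn; apply: (variation_norm_cells q1 s1 sq mom1 mom2 (mpsi k) (mphi k) (psi0 k)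
    (phi0 k) mC (Qk0 k) (nk0 k)) => //.
  - by rewrite PkE.
  - by move=> j; rewrite nkE.
  - move=> J; rewrite QkE -lee_fin SkE// -sumEFin.
    by apply: (@le_nneseries _ (fun j => (nk k j `^ s)%:E)) => j; rewrite lee_fin powR_ge0.
  - by move=> r r' r0 rr; exact: H.
apply: (@le_trans _ _ (lpe rho n (fun k => (Pk k + 2 * m%:R * Qk k)%:E))).
  by apply: le_lpe => // k kn; exact: variation_norm_ge0.
have m0 : 0 <= 2 * m%:R :> R by rewrite mulr_ge0.
rewrite lpe_EFin lee_fin; apply: le_trans (lpn_triangle (ltW rho1) _ _) _.
- by move=> k _; exact: Pk0.
- by move=> k _; exact: mulr_ge0.
by rewrite lpn_Z//; apply: lerD => //; rewrite ler_wpM2l.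
Qed.

Lemma lpn_lipschitz p n (a b : nat -> R) : 1 <= p ->
  (forall k, 0 <= a k) -> (forall k, 0 <= b k) ->
  lpn p n a <= lpn p n b + \sum_(k < n) `|a k - b k|.
Proof.
move=> p1 a0 b0; have p0 : 0 < p := lt_le_trans ltr01 p1.
apply: (@le_trans _ _ (lpn p n (fun k => b k + `|a k - b k|))).
  apply: le_lpn => // k _; rewrite a0/= -lerBlDl; exact: ler_norm.
apply: le_trans (lpn_triangle p1 _ _) _ => //.
by rewrite lerD2l; apply: lpn_le_sum.
Qed.

End vector_variation.

Section nice_functions.
Context {R : realType}.
Local Notation mu := (@lebesgue_measure R).

Definition nice (f : R -> R[i]) := cmeasurable f /\
  exists M r : R, [/\ 0 < M, 0 < r, (forall y, normc (f y) <= M) &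
    forall y, r < `|y| -> f y = 0].

Lemma cmeasurable_normc (f : R -> R[i]) : cmeasurable f ->
  measurable_fun setT (fun y => normc (f y)).
Proof. by move=> mf; apply: measurable_normc; exact: cmeasurable_on. Qed.

Lemma nice_integrable (f : R -> R[i]) : nice f -> (\int[mu]_y (normc (f y))%:E < +oo)%E.
Proof.
move=> [mf [M [r [M0 r0 fM fr]]]].
apply: (@le_lt_trans _ _ (\int[mu]_(y in `[(- r)%R, r]) M%:E)%E).
  rewrite [leRHS]integral_mkcond; apply: int_le => y _.
    by rewrite patchE; case: ifP => // _; rewrite lee_fin ltW.
  rewrite patchE; case: ifPn => [_|]; first by rewrite lee_fin.
  rewrite notin_setE /= in_itv/= -ler_norml => /negP; rewrite -ltNge => /fr ->.
  by rewrite Normc.normc0.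
apply: (@le_lt_trans _ _ (M%:E * mu `[(- r)%R, r])%E).
  by rewrite -(integral_cst mu (measurable_itv `[(- r)%R, r])) lexx.
rewrite lebesgue_measure_itv/=.
by case: ifP => _; rewrite ?mule0// -EFinB -EFinM ltry.
Qed.

Lemma nice_admissible (f : R -> R[i]) : nice f -> admissible_fun f.
Proof.
move=> nf; have [mf _] := nf; split=> // x t t0.
apply: (@le_lt_trans _ _ (\int[mu]_y ((t^-1)%:E * (normc (f y))%:E))%E).
  rewrite integral_mkcond; apply: int_le => y _.
    by rewrite mule_ge0// lee_fin ?normc_ge0// invr_ge0 ltW.
  rewrite patchE; case: ifPn => [|_]; last first.
    by rewrite mule_ge0// lee_fin ?normc_ge0// invr_ge0 ltW.
  rewrite inE /outside/= => txy; rewrite -EFinM lee_fin mulrC.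
  apply: ler_wpM2r; first exact: normc_ge0.
  rewrite lef_pV2 ?posrE//; first exact: ltW.
  exact: lt_trans txy.
rewrite ge0_integralZl_EFin//; last 3 first.
- by move=> y _; rewrite lee_fin normc_ge0.
- by apply/measurable_EFinP; exact: cmeasurable_normc.
- by rewrite invr_ge0 ltW.
by rewrite lte_mul_pinfty// ?lee_fin ?invr_ge0 ?ltW//; exact: nice_integrable.
Qed.

Lemma cmeasurableD (f g : R -> R[i]) : cmeasurable f -> cmeasurable g ->
  cmeasurable (fun y => f y + g y).
Proof.
move=> [f1 f2] [g1 g2]; split.
  under [X in measurable_fun _ X]eq_fun do rewrite Re_add; exact: measurable_funD.
under [X in measurable_fun _ X]eq_fun do rewrite Im_add; exact: measurable_funD.
Qed.

Lemma niceD (f g : R -> R[i]) : nice f -> nice g -> nice (fun y => f y + g y).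
Proof.
move=> [mf [M [r [M0 r0 fM fr]]]] [mg [M' [r' [M'0 r'0 gM gr]]]].
split; first exact: cmeasurableD.
exists (M + M'), (Num.max r r'); split.
- exact: addr_gt0.
- by rewrite lt_max r0.
- by move=> y; apply: (le_trans (le_normcD _ _)); exact: lerD.
- by move=> y; rewrite gt_max => /andP[/fr -> /gr ->]; rewrite addr0.
Qed.

Lemma cmeasurable_if (P : R -> bool) (f : R -> R[i]) : measurable [set y | P y] ->
  cmeasurable f -> cmeasurable (fun y => if P y then f y else 0).
Proof.
move=> mP [f1 f2].
have mb : measurable_fun setT P.
  by apply: (measurable_fun_bool true); rewrite setTI.
split.
  have -> : (fun y => complex.Re (if P y then f y else 0)) =
      (fun y => if P y then complex.Re (f y) else 0).
    by apply/funext => y; case: (P y).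
  exact: measurable_fun_ifT.
have -> : (fun y => complex.Im (if P y then f y else 0)) =
    (fun y => if P y then complex.Im (f y) else 0).
  by apply/funext => y; case: (P y).
exact: measurable_fun_ifT.
Qed.

Lemma nice_if (P : R -> bool) (f : R -> R[i]) : measurable [set y | P y] ->
  nice f -> nice (fun y => if P y then f y else 0).
Proof.
move=> mP [mf [M [r [M0 r0 fM fr]]]]; split; first exact: cmeasurable_if.
exists M, r; split => // y; last by move=> /fr ->; case: (P y).
by case: (P y) => //; rewrite Normc.normc0 ltW.
Qed.

End nice_functions.

Section vector_operator.
Context {R : realType}.
Local Notation mu := (@lebesgue_measure R).
Variables (q rho delta C : R) (K : R -> R -> R[i]).
Hypotheses (q1 : 1 <= q) (rho1 : 1 < rho) (delta0 : 0 < delta) (C0 : 0 < C).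
Hypothesis Ksize : forall x y, x != y -> normc (K x y) <= C / `|x - y|.
Hypothesis Ky : forall x y z, 2 * `|x - z| < `|x - y| ->
  normc (K y x - K y z) <= C * `|x - z| `^ delta / `|x - y| `^ (1 + delta).

Let rho0 : 0 < rho. Proof. exact: lt_trans ltr01 rho1. Qed.

Definition vec_norm N (f : nat -> R -> R[i]) (y : R) : R :=
  lpn rho N (fun k => normc (f k y)).

Definition vec_op N (f : nat -> R -> R[i]) (x : R) : \bar R :=
  lpe rho N (fun k => variation_op q K (f k) x).

Lemma vec_norm_ge0 N f y : 0 <= vec_norm N f y.
Proof. exact: lpn_ge0. Qed.

Lemma normc_le_vec_norm N f k y : (k < N)%N -> normc (f k y) <= vec_norm N f y.
Proof.
move=> kN; apply: (@le_lpn_coord _ rho N (fun k => normc (f k y)) k rho0 kN).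
exact: normc_ge0.
Qed.

Lemma measurable_vec_norm N f : (forall k, cmeasurable (f k)) ->
  measurable_fun setT (vec_norm N f).
Proof.
by move=> mf; apply: measurable_lpn => k _; exact: cmeasurable_normc.
Qed.

Lemma vec_normD N f g y :
  vec_norm N (fun k y => f k y + g k y) y <= vec_norm N f y + vec_norm N g y.
Proof.
apply: le_trans (lpn_triangle (ltW rho1) _ _); last 2 first.
- by move=> k _; exact: normc_ge0.
- by move=> k _; exact: normc_ge0.
by apply: le_lpn => // k _; rewrite normc_ge0/= le_normcD.
Qed.

Lemma vec_normB N f g y :
  vec_norm N (fun k y => f k y - g k y) y <= vec_norm N f y + vec_norm N g y.
Proof.
apply: le_trans (vec_normD N f (fun k y => - g k y) y) _.
rewrite lerD2l; apply: le_lpn => // k _; rewrite normc_ge0/=.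
by rewrite normcN lexx.
Qed.

Lemma vec_norm_integrable N f : (forall k, nice (f k)) ->
  (\int[mu]_y (vec_norm N f y)%:E < +oo)%E.
Proof.
move=> nf.
apply: (@le_lt_trans _ _ (\int[mu]_y (\sum_(k < N) (normc (f k y))%:E))%E).
  apply: int_le => y _; first by apply: sume_ge0 => k _; rewrite lee_fin normc_ge0.
  by rewrite sumEFin lee_fin; apply: lpn_le_sum => [|k _]; [exact: ltW|exact: normc_ge0].
rewrite ge0_integral_sum//; last 2 first.
- by move=> k; apply/measurable_EFinP; apply: cmeasurable_normc; have [] := nf k.
- by move=> k y _; rewrite lee_fin normc_ge0.
by apply: lte_sum_pinfty => k _; exact: nice_integrable.
Qed.

Lemma vec_norm_bounded N f : (forall k, nice (f k)) ->
  exists M r : R, [/\ 0 < M, 0 < r, (forall y, vec_norm N f y <= M) &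
    forall y, r < `|y| -> vec_norm N f y = 0].
Proof.
move=> nf.
have [M [r [M0 r0 fM fr]]] : exists M r : R, [/\ 0 < M, 0 < r,
   (forall y, \sum_(k < N) normc (f k y) <= M) &
   forall y, r < `|y| -> \sum_(k < N) normc (f k y) = 0].
  elim: N => [|N [M [r [M0 r0 fM fr]]]].
    by exists 1, 1; split => // y; rewrite big_ord0.
  have [_ [M' [r' [M'0 r'0 gM gr]]]] := nf N.
  exists (M + M'), (Num.max r r'); split.
  - exact: addr_gt0.
  - by rewrite lt_max r0.
  - by move=> y; rewrite big_ord_recr/=; apply: lerD.
  - move=> y; rewrite gt_max big_ord_recr/= => /andP[/fr -> /gr ->].
    by rewrite Normc.normc0 addr0.
have le y : vec_norm N f y <= \sum_(k < N) normc (f k y).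
  by apply: lpn_le_sum => [|k _]; [exact: ltW|exact: normc_ge0].
exists M, r; split => // y; first exact: le_trans (fM y).
move=> /fr fy; apply: le_anti; rewrite vec_norm_ge0 andbT -fy; exact: le.
Qed.

Lemma vec_opD N f g x : (forall k, nice (f k)) -> (forall k, nice (g k)) ->
  (vec_op N (fun k y => (f k y + g k y)%R) x <= vec_op N f x + vec_op N g x)%E.
Proof.
move=> nf ng; apply: le_trans (lpe_triangle (ltW rho1) _ _); last 2 first.
- by move=> k _; exact: (variation_norm_ge0 q1).
- by move=> k _; exact: (variation_norm_ge0 q1).
apply: le_lpe => // k _; first exact: (variation_norm_ge0 q1).
by apply: (variation_opD q1 delta0 C0 Ksize Ky); exact: nice_admissible.
Qed.

Lemma vec_op_outside N f a h : 0 < h ->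
  (vec_op N (fun k y => if h < `|a - y| then f k y else 0)%R a <= vec_op N f a)%E.
Proof.
move=> h0; apply: le_lpe; first exact: rho0.
  by move=> k _; exact: (variation_norm_ge0 q1).
by move=> k _; exact: (variation_op_outside K q1).
Qed.

(** The kernel is at most C / d on the support, so the total variation alone is bounded: this is
    [variation_vector_cells] with m = 0 and no cells. *)
Lemma vec_op_far N f (x d : R) : (forall k, nice (f k)) -> 0 < d ->
  (forall k y, (k < N)%N -> `|x - y| <= d -> f k y = 0) ->
  (vec_op N f x <= (2 * C / d)%:E * \int[mu]_y (vec_norm N f y)%:E)%E.
Proof.
move=> nf d0 fd.
pose A := fine (\int[mu]_y (vec_norm N f y)%:E).
have AE : (\int[mu]_y (vec_norm N f y)%:E = A%:E)%E.
  rewrite fineK// ge0_fin_numE ?vec_norm_integrable//.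
  by apply: integral_ge0 => y _; rewrite lee_fin vec_norm_ge0.
have c0 : 0 <= 2 * C / d by rewrite divr_ge0 ?mulr_ge0 ?ltW.
have mn k : measurable_fun setT (fun y => normc (f k y)).
  by apply: cmeasurable_normc; have [] := nf k.
rewrite AE -EFinM.
have -> : 2 * C / d * A = 2 * C / d * A + 2 * 0%:R * 0 by rewrite mulr0 addr0.
have ms : measurable_fun setT (fun y : R => `|x - y|) by exact: measurable_dist.
apply: (@variation_vector_cells R q rho q1 rho1 N (fun k r => truncated K r (f k) x) 1 0
  (fun y => `|x - y|) (fun y => `|x - y|) (fun k y => 2 * C / d * normc (f k y))
  (fun _ _ => 0) (fun=> set0) (2 * C / d * A) 0 (fun=> 0)) => //.
- exact: ltW.
- by move=> k; apply: measurable_funM.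
- by move=> k y; rewrite mulr_ge0 ?normc_ge0.
- rewrite EFinM -AE -ge0_integralZl_EFin//; last 2 first.
  + by move=> y _; rewrite lee_fin vec_norm_ge0.
  + by apply/measurable_EFinP; apply: measurable_vec_norm => k; have [] := nf k.
  apply: int_le => y _; first by rewrite -EFinM lee_fin mulr_ge0// vec_norm_ge0.
  rewrite -EFinM lee_fin lpn_Z// => k _; exact: normc_ge0.
- by move=> j; rewrite integral_set0.
- by move=> J; rewrite big1 ?powR0 ?oner_eq0// => j _; rewrite powR0 ?oner_eq0.
- move=> k r r' kN r0 rr; exists (fun=> 0%N); rewrite big_ord0 adde0.
  have af := nice_admissible (nf k).
  rewrite (@truncated_sub R delta C K delta0 C0 Ksize Ky x r r' (f k) r0 rr af).
  have mA : measurable (annulus (fun y => `|x - y|) r r') by exact: measurable_annulus.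
  have mK : cmeas_on (annulus (fun y => `|x - y|) r r') (fun y => K x y * f k y).
    exact: (cmeas_onS (measurable_outside x r) (@annulus_outside R x r r')
      (@kernel_mul_cmeas R delta C K delta0 C0 Ky x r (f k) (ltW r0) af.1)).
  apply: (le_trans (cintegral_le mA mK)).
  rewrite -ge0_integralZl_EFin//; last 2 first.
  + by move=> y _; rewrite lee_fin normc_ge0.
  + by apply/measurable_EFinP; exact: measurable_normc.
  apply: int_le => y Ay; rewrite -?EFinM lee_fin.
    by rewrite mulr_ge0 ?normc_ge0.
  have [yd|dy] := leP `|x - y| d.
    by rewrite fd// mulr0 Normc.normc0 !mulr0.
  have xy : x != y by rewrite -subr_eq0 -normr_gt0 (lt_trans d0).
  apply: (le_trans (ler_wpM2l _ (kernel_mul_le Ksize _ xy))) => //.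
  rewrite [leRHS]mulrAC -!mulrA; apply: ler_wpM2l => //; apply: ler_wpM2l; first exact: ltW.
  rewrite ler_wpM2l ?normc_ge0// lef_pV2 ?posrE//; first exact: ltW.
  exact: lt_trans dy.
Qed.

End vector_operator.

(** * Lower semicontinuity *)

Section semicontinuity.
Context {R : realType}.

Lemma lt_adde_split (x y : \bar R) (l : R) : (0 <= x)%E -> (0 <= y)%E ->
  (l%:E < x + y)%E ->
  exists l1 l2 : R, [/\ (l1%:E < x)%E, (l2%:E < y)%E & l1 + l2 = l].
Proof.
case: x => [x| |]; case: y => [y| |] //=.
- move=> _ _; rewrite -EFinD lte_fin => lxy.
  exists (x - (x + y - l) / 2), (y - (x + y - l) / 2); rewrite !lte_fin.
  by split; lra.
- by move=> _ _ _; exists (x - 1), (l - x + 1); rewrite lte_fin ltry; split => //; lra.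
- by move=> _ _ _; exists (l - y + 1), (y - 1); rewrite lte_fin ltry; split => //; lra.
- by move=> _ _ _; exists l, 0; rewrite !ltry addr0.
Qed.

(* [A] is at most the lower limit of [B] along the filter [F]. *)
Definition lsc_along {I : Type} (F : set_system I) (A : \bar R) (B : I -> \bar R) :=
  forall l : R, (l%:E < A)%E -> \forall i \near F, (l%:E < B i)%E.

Lemma lsc_along_add {I : Type} (F : set_system I) {FF : Filter F} a b (A B : I -> \bar R) :
  (0 <= a)%E -> (0 <= b)%E -> lsc_along F a A -> lsc_along F b B ->
  lsc_along F (a + b)%E (fun i => A i + B i)%E.
Proof.
move=> a0 b0 lA lB l /(lt_adde_split a0 b0) [l1 [l2 [h1 h2 <-]]].
apply: (@filterS2 I F FF _ _ _ _ (lA l1 h1) (lB l2 h2)) => i Ai Bi.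
by rewrite EFinD; exact: lteD.
Qed.

Lemma lsc_along_sum {I : Type} (F : set_system I) {FF : Filter F} n (a : nat -> \bar R)
    (A : nat -> I -> \bar R) : (forall k, 0 <= a k)%E ->
  (forall k, lsc_along F (a k) (A k)) ->
  lsc_along F (\sum_(k < n) a k)%E (fun i => \sum_(k < n) A k i)%E.
Proof.
move=> a0 lA; elim: n => [|n IH].
  move=> l; rewrite big_ord0 => l0; apply: filterE => i.
  by rewrite big_ord0.
move=> l; rewrite big_ord_recr/= => h.
have s0 : (0 <= \sum_(k < n) a k)%E by apply: sume_ge0 => k _; exact: a0.
have := @lsc_along_add I F FF _ _ _ _ s0 (a0 n) IH (lA n) l h.
by apply: filterS => i; rewrite big_ord_recr.
Qed.

Lemma lsc_along_poweR {I : Type} (F : set_system I) {FF : Filter F} (r : R) a (A : I -> \bar R) :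
  0 < r -> (0 <= a)%E -> (forall i, 0 <= A i)%E ->
  lsc_along F a A -> lsc_along F (a `^ r)%E (fun i => A i `^ r)%E.
Proof.
move=> r0 a0 A0 lA l; have [l0|l0] := ltP l 0.
  move=> _; apply: filterE => i.
  by apply: (@lt_le_trans _ _ 0%E); [rewrite lte_fin|exact: poweR_ge0].
have -> : l%:E = ((l `^ r^-1)%:E `^ r)%E.
  by rewrite poweR_EFin powRVK ?gt_eqF.
have m0 : (0 <= (l `^ r^-1)%:E)%E by rewrite lee_fin powR_ge0.
rewrite lt_poweR_cancel// => /lA; apply: filterS => i.
by rewrite lt_poweR_cancel.
Qed.

Lemma lt_of_half_gap (l a b S u : R) : l < a -> u <= (a - l) / 2 -> S <= u -> a <= b + S -> l < b.
Proof. by lra. Qed.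

(** The variation is a supremum of l^q norms of finitely many increments, and each of these is a
    Lipschitz function of finitely many values. *)
Lemma lsc_along_variation {I : Type} (F : set_system I) {FF : Filter F} (q : R)
    (a : R -> R[i]) (b : I -> R -> R[i]) : 1 <= q ->
  (forall t e : R, 0 < t -> 0 < e -> \forall i \near F, normc (a t - b i t) <= e) ->
  lsc_along F (variation_norm q a) (fun i => variation_norm q (b i)).
Proof.
move=> q1 ab l; have [l0|l0] := ltP l 0.
  move=> _; apply: filterE => i; apply: (@lt_le_trans _ _ 0%E); first by rewrite lte_fin.
  exact: (variation_norm_ge0 q1).
move=> lV; have [t [n [adm h]]] : exists t n, admissible t /\ l < lpn q n (increment a t).
  apply: contrapT => H; move: lV; apply/negP; rewrite -leNgt.
  apply: (variation_norm_le q1); first by rewrite lee_fin.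
  move=> t n adm; rewrite lee_fin leNgt; apply/negP => lt; apply: H.
  by exists t, n.
(* Each of the n increments moves by at most 2 e, so at least half of the gap above l survives. *)
pose e := (lpn q n (increment a t) - l) / (4 * n.+1%:R).
have n0 : 0 < n.+1%:R :> R by rewrite ltr0n.
have e0 : 0 < e by rewrite divr_gt0 ?subr_gt0 ?mulr_gt0.
have near_t : \forall i \near F, forall j : 'I_n.+1, normc (a (t j) - b i (t j)) <= e.
  apply: (@filter_forall _ (ordinal n.+1) (fun (j : 'I_n.+1) i =>
      normc (a (t j) - b i (t j)) <= e) F) => j.
  exact: (ab (t j) e (adm.2 j) e0).
apply: filterS near_t => i Hi.
apply: (@lt_le_trans _ _ (lpn q n (increment (b i) t))%:E); last first.
  exact: (le_variation_norm q1).
rewrite lte_fin.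
have il (j : nat) : (j < n)%N -> `|increment a t j - increment (b i) t j| <= 2 * e.
  move=> jn; apply: (le_trans (normc_sub_le _ _)).
  have -> : a (t j) - a (t j.+1) - (b i (t j) - b i (t j.+1)) =
      (a (t j) - b i (t j)) - (a (t j.+1) - b i (t j.+1)) by ring.
  apply: (le_trans (le_normcD _ _)); rewrite normcN.
  have := Hi (Ordinal (leqW jn)); have := Hi (Ordinal (jn : (j.+1 < n.+1)%N)) => /=; lra.
have lip := @lpn_lipschitz R q n (increment a t) (increment (b i) t) q1
  (increment_ge0 _ _) (increment_ge0 _ _).
have S1 : \sum_(j < n) `|increment a t j - increment (b i) t j| <= n%:R * (2 * e).
  apply: (@le_trans _ _ (\sum_(j < n) 2 * e)); first by apply: ler_sum => j _; exact: il.
  by rewrite sumr_const card_ord -[leLHS]mulr_natl.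
have S2 : n%:R * (2 * e) <= (lpn q n (increment a t) - l) / 2.
  have -> : (lpn q n (increment a t) - l) / 2 = n.+1%:R * (2 * e).
    by rewrite /e; field; rewrite gt_eqF.
  by apply: ler_wpM2r; [rewrite mulr_ge0// ltW|rewrite ler_nat].
exact: (lt_of_half_gap h S2 S1 lip).
Qed.

Lemma lsc_along_lpe {I : Type} (F : set_system I) {FF : Filter F} (q rho : R) N
    (a : nat -> R -> R[i]) (b : I -> nat -> R -> R[i]) : 1 <= q -> 0 < rho ->
  (forall k (t e : R), 0 < t -> 0 < e -> \forall i \near F, normc (a k t - b i k t) <= e) ->
  lsc_along F (lpe rho N (fun k => variation_norm q (a k)))
    (fun i => lpe rho N (fun k => variation_norm q (b i k))).
Proof.
move=> q1 rho0 ab; apply: lsc_along_poweR.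
- by rewrite invr_gt0.
- by apply: sume_ge0 => k _; exact: poweR_ge0.
- by move=> i; apply: sume_ge0 => k _; exact: poweR_ge0.
apply: (@lsc_along_sum _ F _ N (fun k => variation_norm q (a k) `^ rho)%E
  (fun k i => variation_norm q (b i k) `^ rho)%E) => k; first exact: poweR_ge0.
apply: lsc_along_poweR => //.
- exact: (variation_norm_ge0 q1).
- by move=> i; exact: (variation_norm_ge0 q1).
by apply: lsc_along_variation => // t e; exact: ab.
Qed.

End semicontinuity.

Section vec_op_semicontinuity.
Context {R : realType}.
Local Notation mu := (@lebesgue_measure R).
Variables (q rho delta C : R) (K : R -> R -> R[i]).
Hypotheses (q1 : 1 <= q) (rho1 : 1 < rho) (delta0 : 0 < delta) (C0 : 0 < C).
Hypothesis Ksize : forall x y, x != y -> normc (K x y) <= C / `|x - y|.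
Hypothesis Kx : forall x y z, 2 * `|x - z| < `|x - y| ->
  normc (K x y - K z y) <= C * `|x - z| `^ delta / `|x - y| `^ (1 + delta).
Hypothesis Ky : forall x y z, 2 * `|x - z| < `|x - y| ->
  normc (K y x - K y z) <= C * `|x - z| `^ delta / `|x - y| `^ (1 + delta).

Let rho0 : 0 < rho. Proof. exact: lt_trans ltr01 rho1. Qed.

Definition truncated_kernel (t : R) (f : R -> R[i]) (x y : R) : R[i] :=
  if t < `|x - y| then K x y * f y else 0.

Lemma truncated_mkcond t f x :
  truncated K t f x = cintegral setT (truncated_kernel t f x).
Proof.
have pE (p : R[i] -> R) : p 0 = 0 -> (fun y => p (K x y * f y)) \_ (outside x t) =
    (fun y => p (truncated_kernel t f x y)).
  move=> p00; apply/funext => y; rewrite patchE mem_outside /truncated_kernel.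
  by case: ifP.
rewrite /truncated /cintegral -/(outside x t).
rewrite !(Rintegral_mkcond mu (outside x t)).
by have /= -> := pE (fun z => complex.Re z) erefl; have /= -> := pE (fun z => complex.Im z) erefl.
Qed.

Lemma truncated_kernel_integrable (t : R) f x : 0 < t -> nice f ->
  mu.-integrable setT (fun y => (complex.Re (truncated_kernel t f x y))%:E) /\
  mu.-integrable setT (fun y => (complex.Im (truncated_kernel t f x y))%:E).
Proof.
move=> t0 nf.
have [i1 i2] := @kernel_integrable R delta C K delta0 C0 Ksize Ky x t f t0 (nice_admissible nf).
have pE (p : R[i] -> R) : p 0 = 0 -> (fun y => (p (K x y * f y))%:E) \_ (outside x t) =
    (fun y => (p (truncated_kernel t f x y))%:E).
  move=> p00; apply/funext => y; rewrite patchE mem_outside /truncated_kernel.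
  by case: ifP => // _; rewrite p00.
split.
  rewrite -(pE (fun z => complex.Re z) erefl).
  exact: (proj1 (@integrable_mkcond _ _ _ mu (outside x t) (fun y => (complex.Re (K x y * f y))%:E) (measurable_outside x t)) i1).
rewrite -(pE (fun z => complex.Im z) erefl).
exact: (proj1 (@integrable_mkcond _ _ _ mu (outside x t) (fun y => (complex.Im (K x y * f y))%:E) (measurable_outside x t)) i2).
Qed.

Lemma truncated_diff_le (t : R) f x z : 0 < t -> nice f ->
  ((normc (truncated K t f x - truncated K t f z))%:E <=
   2 * \int[mu]_y (normc (truncated_kernel t f x y - truncated_kernel t f z y))%:E)%E.
Proof.
move=> t0 nf.
have [rx ix] := truncated_kernel_integrable x t0 nf.
have [rz iz] := truncated_kernel_integrable z t0 nf.
rewrite !truncated_mkcond.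
have -> : cintegral setT (truncated_kernel t f x) - cintegral setT (truncated_kernel t f z) =
    cintegral setT (fun y => truncated_kernel t f x y - truncated_kernel t f z y).
  have reB (a b : R[i]) : complex.Re (a - b) = complex.Re a - complex.Re b by case: a; case: b.
  have imB (a b : R[i]) : complex.Im (a - b) = complex.Im a - complex.Im b by case: a; case: b.
  apply/eqP; rewrite eq_complex reB imB /cintegral/=; apply/andP; split.
    under [X in _ == X]eq_Rintegral do rewrite reB.
    by rewrite RintegralB.
  under [X in _ == X]eq_Rintegral do rewrite imB.
  by rewrite RintegralB.
apply: cintegral_le => //.
have mE (g : R -> R) : mu.-integrable setT (fun y => (g y)%:E) -> measurable_fun setT g.
  by move=> /measurable_int /measurable_EFinP.
split.
  have -> : (fun y => complex.Re (truncated_kernel t f x y - truncated_kernel t f z y)) =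
     (fun y => complex.Re (truncated_kernel t f x y)) \- (fun y => complex.Re (truncated_kernel t f z y)).
    by apply/funext => y /=; case: (truncated_kernel t f x y); case: (truncated_kernel t f z y).
  by apply: measurable_funB; exact: mE.
have -> : (fun y => complex.Im (truncated_kernel t f x y - truncated_kernel t f z y)) =
   (fun y => complex.Im (truncated_kernel t f x y)) \- (fun y => complex.Im (truncated_kernel t f z y)).
  by apply/funext => y /=; case: (truncated_kernel t f x y); case: (truncated_kernel t f z y).
by apply: measurable_funB; exact: mE.
Qed.

(** Where both points see y, regularity in the first variable applies. Where just one of them does,
    y lies in a shell of half-width |x - z| about the sphere of radius t, and the size bound is
    used. *)
Lemma truncated_kernel_diff (t M : R) f x z y : 0 < t -> 0 < M -> normc (f y) <= M ->
  4 * `|x - z| < t ->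
  normc (truncated_kernel t f x y - truncated_kernel t f z y) <=
    C * `|x - z| `^ delta / t `^ (1 + delta) * normc (f y) +
    C * M / t * (nat_of_bool (t - `|x - z| <= `|x - y| <= t + `|x - z|))%:R.
Proof.
move=> t0 M0 fM xzt.
have A0 : 0 <= C * `|x - z| `^ delta / t `^ (1 + delta) * normc (f y).
  by rewrite mulr_ge0 ?normc_ge0// divr_ge0 ?powR_ge0// mulr_ge0 ?powR_ge0// ltW.
have B0 : 0 <= C * M / t by rewrite divr_ge0 ?mulr_ge0 ?ltW.
have d0 := normr_ge0 (x - z).
have kb u : t < `|u - y| -> normc (K u y * f y) <= C * M / t.
  move=> tu; have uy : u != y by rewrite -subr_eq0 -normr_gt0 (lt_trans t0).
  rewrite Normc.normcM -mulrA [M / t]mulrC mulrA; apply: ler_pM => //; try exact: normc_ge0.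
  apply: (le_trans (Ksize uy)); apply: ler_wpM2l; first exact: ltW.
  by rewrite lef_pV2 ?posrE ?ltW// (lt_trans t0).
rewrite /truncated_kernel.
case: ifPn => [tx|]; case: ifPn => [tz|].
- apply: ler_wpDr; first by rewrite mulr_ge0// ler0n.
  rewrite -mulrBl Normc.normcM; apply: ler_wpM2r; first exact: normc_ge0.
  have xz2 : 2 * `|x - z| < `|x - y| by lra.
  apply: (le_trans (Kx xz2)); apply: ler_wpM2l; first by rewrite mulr_ge0 ?powR_ge0// ltW.
  have p1 : 0 < 1 + delta by apply: addr_gt0.
  rewrite lef_pV2 ?posrE ?powR_gt0//; last exact: lt_trans tx.
  by apply: le_powR; exact: ltW.
- rewrite -leNgt subr0 => tz; apply: ler_wpDl => //.
  have -> : t - `|x - z| <= `|x - y| <= t + `|x - z|.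
    have := ler_distD z x y => h; apply/andP; split; lra.
  by rewrite mulr1; exact: kb.
- rewrite -leNgt sub0r normcN => tx; apply: ler_wpDl => //.
  have -> : t - `|x - z| <= `|x - y| <= t + `|x - z|.
    have := ler_distD x z y; rewrite (distrC z x) => h; apply/andP; split; lra.
  by rewrite mulr1; exact: kb.
- by move=> _ _; rewrite subrr Normc.normc0 addr_ge0// mulr_ge0// ler0n.
Qed.

Lemma measure_shell_le (t d x : R) : 0 <= d ->
  (\int[mu]_y ((nat_of_bool (t - d <= `|x - y| <= t + d))%:R)%:E <= (4 * d)%:E)%E.
Proof.
move=> d0.
pose A := [set` `[x - t - d, x - t + d]] : set R.
pose B := [set` `[x + t - d, x + t + d]] : set R.
have mI (a b : R) : a <= b -> (mu [set` `[a, b]] <= (b - a)%:E)%E.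
  by move=> ab; rewrite lebesgue_measure_itv/= lte_fin; case: ifP => // _; rewrite lee_fin subr_ge0.
apply: (@le_trans _ _ (\int[mu]_y (\1_(A `|` B) y)%:E)%E).
  apply: int_le => y _; first by rewrite lee_fin.
  rewrite lee_fin indicE; case: (boolP (t - d <= `|x - y| <= t + d)) => h; last by rewrite ler0n.
  have yAB : (A `|` B) y; last by rewrite (mem_set yAB).
  move: h => /andP[h1 h2]; have [xy|yx] := leP 0 (x - y).
    rewrite ger0_norm// in h1 h2; left; rewrite /A /= in_itv/=; apply/andP; split; lra.
  rewrite ltr0_norm// in h1 h2; right; rewrite /B /= in_itv/=; apply/andP; split; lra.
have mA : measurable A by exact: measurable_itv.
have mB : measurable B by exact: measurable_itv.
rewrite integral_indic ?setIT//; last exact: measurableU.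
apply: (@le_trans _ _ (mu A + mu B)%E); first exact: measureU2.
apply: (@le_trans _ _ ((2 * d)%:E + (2 * d)%:E)%E).
  apply: leeD; [apply: (le_trans (mI _ _ _))|apply: (le_trans (mI _ _ _))]; rewrite ?lee_fin; lra.
by rewrite -EFinD lee_fin; lra.
Qed.

Lemma truncated_continuous (t e : R) f x : 0 < t -> 0 < e -> nice f ->
  \forall z \near x, normc (truncated K t f x - truncated K t f z) <= e.
Proof.
move=> t0 e0 nf; have [mf [M [r [M0 r0 fM fr]]]] := nf.
pose A := fine (\int[mu]_y (normc (f y))%:E).
have A0 : 0 <= A by apply: fine_ge0; apply: integral_ge0 => y _; rewrite lee_fin normc_ge0.
have AE : (\int[mu]_y (normc (f y))%:E = A%:E)%E.
  rewrite fineK// ge0_fin_numE ?nice_integrable//.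
  by apply: integral_ge0 => y _; rewrite lee_fin normc_ge0.
pose c1 := C / t `^ (1 + delta); pose c2 := C * M / t.
have c10 : 0 < c1 by rewrite divr_gt0 ?powR_gt0.
have c20 : 0 < c2 by rewrite divr_gt0 ?mulr_gt0.
(* [d1] brings the regularity term below e / 4 and [d2] does the same for the shell, which has
   measure at most 4 |x - z|; the factor 2 of [truncated_diff_le] then gives e. *)
pose d1 := (e / (4 * (c1 * A + 1))) `^ delta^-1.
pose d2 := e / (16 * c2).
have cA0 : 0 <= c1 * A := mulr_ge0 (ltW c10) A0.
have k0 : 0 < 4 * (c1 * A + 1) by lra.
have d10 : 0 < d1 by apply: powR_gt0; exact: divr_gt0.
have d20 : 0 < d2 by apply: divr_gt0 => //; exact: mulr_gt0.
apply/nbhs_ballP; exists (Num.min (t / 4) (Num.min d1 d2)) => /=.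
  by rewrite !lt_min d10 d20 divr_gt0.
move=> z; rewrite /ball/= !lt_min => /and3P[zt z1 z2].
have zt4 : 4 * `|x - z| < t by rewrite mulrC -ltr_pdivlMr.
have c1d : 0 <= c1 * `|x - z| `^ delta := mulr_ge0 (ltW c10) (powR_ge0 _ _).
have n1 y : (0 <= (c1 * `|x - z| `^ delta)%:E * (normc (f y))%:E)%E.
  by rewrite mule_ge0// lee_fin ?normc_ge0.
have n2 y : (0 <= c2%:E * ((nat_of_bool (t - `|x - z| <= `|x - y| <= t + `|x - z|))%:R)%:E)%E.
  by rewrite mule_ge0// lee_fin ?ler0n ?ltW.
rewrite -lee_fin; apply: (le_trans (truncated_diff_le x z t0 nf)).
apply: (@le_trans _ _ (2%:E * \int[mu]_y ((c1 * `|x - z| `^ delta)%:E * (normc (f y))%:E +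
   c2%:E * ((nat_of_bool (t - `|x - z| <= `|x - y| <= t + `|x - z|))%:R)%:E))%E).
  apply: lee_wpmul2l => //; apply: int_le => y _.
    by apply: adde_ge0; [exact: n1|exact: n2].
  rewrite -!EFinM -EFinD lee_fin; apply: (le_trans (truncated_kernel_diff t0 M0 (fM y) zt4)).
  by rewrite /c1 [C / _ * _]mulrAC.
have mind : measurable_fun setT (fun y : R => ((nat_of_bool (t - `|x - z| <= `|x - y| <= t + `|x - z|))%:R : R)).
  have -> : (fun y : R => ((nat_of_bool (t - `|x - z| <= `|x - y| <= t + `|x - z|))%:R : R)) =
     \1_((fun y => `|x - y|) @^-1` [set` `[t - `|x - z|, t + `|x - z|]]).
    apply/funext => y; rewrite indicE; congr ((nat_of_bool _)%:R).
    by apply/idP/idP; rewrite inE /= in_itv.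
  apply: measurable_indic; rewrite -[X in measurable X]setTI.
  by apply: (measurable_dist x) => //; exact: measurable_itv.
rewrite ge0_integralD; last 5 first.
- exact: measurableT.
- by move=> y _; exact: n1.
- by apply: measurable_funeM; apply/measurable_EFinP; exact: cmeasurable_normc.
- by move=> y _; exact: n2.
- by apply: measurable_funeM; apply/measurable_EFinP.
rewrite ge0_integralZl_EFin//; last 2 first.
- by move=> y _; rewrite lee_fin normc_ge0.
- by apply/measurable_EFinP; exact: cmeasurable_normc.
rewrite ge0_integralZl_EFin; last 4 first.
- exact: measurableT.
- by move=> y _; rewrite lee_fin ler0n.
- by apply/measurable_EFinP.
- exact: ltW.
rewrite AE.
apply: (@le_trans _ _ (2%:E * ((c1 * `|x - z| `^ delta)%:E * A%:E + c2%:E * (4 * `|x - z|)%:E))%E).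
  apply: lee_wpmul2l => //; apply: leeD => //; apply: lee_wpmul2l; first by rewrite lee_fin ltW.
  exact: measure_shell_le.
have -> : (2%:E * ((c1 * `|x - z| `^ delta)%:E * A%:E + c2%:E * (4 * `|x - z|)%:E))%E =
    (2 * (c1 * `|x - z| `^ delta * A + c2 * (4 * `|x - z|)))%:E by [].
rewrite lee_fin.
have h1 : `|x - z| `^ delta <= e / (4 * (c1 * A + 1)).
  apply: (@le_trans _ _ (d1 `^ delta)); first by apply: le_powR => //; exact: ltW.
  by rewrite /d1 powRVK ?gt_eqF// divr_ge0 ?ltW.
have h2 : c2 * `|x - z| <= e / 16.
  have c216 : 0 < 16 * c2 by exact: mulr_gt0.
  move: z2; rewrite /d2 (ltr_pdivlMr _ _ c216) => /ltW; move: (c2) => u z2; lra.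
have h3 : c1 * `|x - z| `^ delta * A <= e / 4.
  apply: (@le_trans _ _ (c1 * A * (e / (4 * (c1 * A + 1))))).
    by rewrite mulrAC; apply: ler_wpM2l => //; rewrite mulr_ge0// ltW.
  rewrite mulrA ler_pdivrMr//.
  have : 0 <= c1 * A by rewrite mulr_ge0// ltW.
  move: (c1 * A) => u u0; nra.
lra.
Qed.

Lemma lsc_vec_op N f : (forall k, nice (f k)) -> lower_semicontinuous (vec_op q rho K N f).
Proof.
move=> nf x l lx; have := @lsc_along_lpe R R (nbhs x) _ q rho N
  (fun k t => truncated K t (f k) x) (fun z k t => truncated K t (f k) z) q1 rho0.
move=> /(_ (nbhs_filter x) (fun k t e t0 e0 => truncated_continuous x t0 e0 (nf k)) l lx) H.
by exists [set z | (l%:E < vec_op q rho K N f z)%E].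
Qed.

Lemma open_vec_op N f (l : R) : (forall k, nice (f k)) ->
  open [set x | (l%:E < vec_op q rho K N f x)%E].
Proof. by move=> nf; exact: (proj1 (lower_semicontinuousP _) (@lsc_vec_op N f nf) l). Qed.

Lemma measurable_vec_op N f : (forall k, nice (f k)) ->
  measurable_fun setT (vec_op q rho K N f).
Proof. by move=> nf; apply: lower_semicontinuous_measurable; exact: lsc_vec_op. Qed.

End vec_op_semicontinuity.

(** * A_1 weights *)

Section almost_everywhere_and_balls.
Context {R : realType}.
Local Notation mu := (@lebesgue_measure R).

Lemma ae_mono (P Q : R -> Prop) : (forall x, P x -> Q x) ->
  (\forall x \ae mu, P x) -> \forall x \ae mu, Q x.
Proof.
by move=> PQ [N [mN N0 PN]]; exists N; split => // x /= nQ; apply: PN => /= /PQ.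
Qed.

Lemma ae_and (P Q : R -> Prop) : (\forall x \ae mu, P x) -> (\forall x \ae mu, Q x) ->
  \forall x \ae mu, P x /\ Q x.
Proof.
move=> hP hQ; apply: (negligibleS _ (negligibleU hP hQ)) => x /= /not_andP[]; by [left|right].
Qed.

Lemma ball_nonpos (c r : R) : r <= 0 -> ball c r = set0.
Proof.
move=> r0; apply/seteqP; split => y //=; rewrite ball_R/=.
by rewrite ltNge (le_trans r0 (normr_ge0 _)).
Qed.

End almost_everywhere_and_balls.

(** * Components of open sets as families of balls *)

Section components.
Context {R : realType}.

(** Void members of the enumeration become balls of radius 0. An endpoint in [U] would lie in some
    component; this component is open, so it would meet the given one and coincide with it, although
    a ball does not contain its endpoints. *)
Lemma open_components (U : set R) (M : R) : open U -> (forall y, U y -> `|y| <= M) ->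
  exists c r : nat -> R, [/\ forall j, 0 <= r j,
    trivIset setT (fun j => ball (c j) (r j)),
    U = \bigcup_j ball (c j) (r j) &
    forall j, 0 < r j -> ~ U (c j - r j) /\ ~ U (c j + r j)].
Proof.
move=> oU UM; pose I := open_disjoint_itv oU.
have IU j : I j `<=` U by rewrite (@open_disjoint_itv_bigcup R U oU) => y Iy; exists j.
have edge j e : U e -> (forall d : R, 0 < d -> exists2 z, I j z & `|e - z| < d) -> I j e.
  rewrite {1}(@open_disjoint_itv_bigcup R U oU) => -[k _ Ike] H.
  have [d /= d0 dI] : exists2 d : R, 0 < d & ball e d `<=` I k.
    have := @open_disjoint_itv_open R U oU k; rewrite openE => /(_ e Ike) /nbhs_ballP[d d0 dI].
    by exists d.
  have [z Ijz ez] := H d d0.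
  by rewrite (@open_disjoint_itv_trivIset R U oU j k Logic.I Logic.I)//; exists z; split => //; exact: dI.
have H j : exists cr : R * R, [/\ 0 <= cr.2, I j = ball cr.1 cr.2 &
    0 < cr.2 -> ~ U (cr.1 - cr.2) /\ ~ U (cr.1 + cr.2)].
  have [I0|/set0P[y0 Iy0]] := eqVneq (I j) set0.
    by exists (0, 0); split; rewrite /= ?ltxx// I0 ball_nonpos.
  have lb : has_lbound (I j).
    by exists (- M) => y /IU /UM; rewrite ler_norml => /andP[].
  have ub : has_ubound (I j).
    by exists M => y /IU /UM; rewrite ler_norml => /andP[].
  have IE : I j = [set y | inf (I j) < y < sup (I j)].
    rewrite -(interval_bounded_interior _ lb ub); last exact: (@open_disjoint_itv_is_interval R U oU j).
    by have := @open_disjoint_itv_open R U oU j; rewrite interior_id => h; exact: (esym h).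
  move: IE; move: (inf (I j)) (sup (I j)) => a b IE.
  have ab : a < b by move: Iy0; rewrite IE/= => /andP[]; exact: lt_trans.
  exists ((a + b) / 2, (b - a) / 2); split => /=; first lra.
    rewrite IE; apply/seteqP; split => y /=; rewrite ball_R/= ltr_norml; last lra.
    by move=> /andP[h1 h2]; apply/andP; split; lra.
  move=> _; have -> : (a + b) / 2 - (b - a) / 2 = a by lra.
  have -> : (a + b) / 2 + (b - a) / 2 = b by lra.
  have nI e : ~ (a < e < b) -> ~ I j e by rewrite {1}IE.
  split => Ue.
    apply: (nI a); first by rewrite ltxx.
    apply: edge => // d d0; exists (a + Num.min (d / 2) ((b - a) / 2)).
      by rewrite IE/=; have [h|h] := leP (d / 2) ((b - a) / 2); apply/andP; split; lra.
    by have [h|h] := leP (d / 2) ((b - a) / 2); rewrite ltr_norml; apply/andP; split; lra.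
  apply: (nI b); first by rewrite ltxx andbF.
  apply: edge => // d d0; exists (b - Num.min (d / 2) ((b - a) / 2)).
    by rewrite IE/=; have [h|h] := leP (d / 2) ((b - a) / 2); apply/andP; split; lra.
  by have [h|h] := leP (d / 2) ((b - a) / 2); rewrite ltr_norml; apply/andP; split; lra.
have [cr Hcr] := choice H.
exists (fun j => (cr j).1), (fun j => (cr j).2).
have E : (fun j => ball (cr j).1 (cr j).2) = I.
  by apply/funext => j; have [_ ->] := Hcr j.
split.
- by move=> j; have [] := Hcr j.
- rewrite E; exact: (@open_disjoint_itv_trivIset R U oU).
- by rewrite E; exact: (@open_disjoint_itv_bigcup R U oU).
- by move=> j; have [_ _] := Hcr j.
Qed.

(** The value 0 off the cells is a default: where this index is used to pick a coefficient, the
    function multiplied by it vanishes off the cells, or a test for membership comes first. *)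
Definition cell_index (B : nat -> set R) (y : R) : nat := xget 0%N [set j | B j y].

Lemma cell_indexE B j y : trivIset setT B -> B j y -> cell_index B y = j.
Proof.
move=> tB By; rewrite /cell_index; case: xgetP => [i _ Bi|/(_ j)]; last by move=> /(_ By).
by apply: tB => //; exists y.
Qed.

Lemma measurable_cell_fun (B : nat -> set R) (g : nat -> R) : trivIset setT B ->
  (forall j, measurable (B j)) -> measurable_fun setT (fun y => g (cell_index B y)).
Proof.
move=> tB mB.
have mi j : measurable [set y | cell_index B y = j].
  have -> : [set y | cell_index B y = j] =
      B j `|` (if j == 0%N then ~` \bigcup_i B i else set0).
    apply/seteqP; split => y /=.
      move=> <-; rewrite {1 2}/cell_index; case: xgetP => [i _ Bi|H]; first by left.
      by right; rewrite eqxx => -[i _] /H.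
    case=> [|]; first exact: cell_indexE.
    case: eqP => // -> H; rewrite /cell_index; case: xgetP => // i _ Bi.
    by exfalso; apply: H; exists i.
  apply: measurableU => //; case: ifP => // _; apply: measurableC.
  exact: bigcup_measurable.
move=> _ Y mY; rewrite setTI.
have -> : (fun y => g (cell_index B y)) @^-1` Y =
    \bigcup_j (if g j \in Y then [set y | cell_index B y = j] else set0).
  apply/seteqP; split => y /=.
    by move=> Yg; exists (cell_index B y) => //; rewrite mem_set.
  by move=> [j _]; case: ifPn => //; rewrite inE => Yj /= ->.
by apply: bigcup_measurable => j _; case: ifP.
Qed.

End components.

Section complex_integral.
Context {R : realType}.
Local Notation mu := (@lebesgue_measure R).

Definition cintegrable (D : set R) (F : R -> R[i]) :=
  mu.-integrable D (fun y => (complex.Re (F y))%:E) /\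
  mu.-integrable D (fun y => (complex.Im (F y))%:E).

Lemma cintegrable_cmeas D F : cintegrable D F -> cmeas_on D F.
Proof. by move=> [h1 h2]; split; apply/measurable_EFinP; [exact: measurable_int h1|exact: measurable_int h2]. Qed.

Lemma cintegrableS D A F : measurable D -> measurable A -> A `<=` D ->
  cintegrable D F -> cintegrable A F.
Proof.
move=> mD mA AD [h1 h2].
split; first exact: (@integrableS _ _ _ mu D A (fun y => (complex.Re (F y))%:E) mD mA AD h1).
exact: (@integrableS _ _ _ mu D A (fun y => (complex.Im (F y))%:E) mD mA AD h2).
Qed.

Lemma nice_cintegrable (f : R -> R[i]) : nice f -> cintegrable setT f.
Proof.
move=> nf; have [mf _] := nf; have [m1 m2] := mf.
split; apply/integrableP; split.
- by apply/measurable_EFinP.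
- apply: le_lt_trans (nice_integrable nf); apply: int_le => y _.
    by rewrite lee_fin normc_ge0.
  by rewrite abse_EFin lee_fin; exact: Re_le_normc.
- by apply/measurable_EFinP.
- apply: le_lt_trans (nice_integrable nf); apply: int_le => y _.
    by rewrite lee_fin normc_ge0.
  by rewrite abse_EFin lee_fin; exact: Im_le_normc.
Qed.

Lemma cintegralB D F G : measurable D -> cintegrable D F -> cintegrable D G ->
  cintegral D (fun y => F y - G y) = cintegral D F - cintegral D G.
Proof.
move=> mD [f1 f2] [g1 g2].
have reB (a b : R[i]) : complex.Re (a - b) = complex.Re a - complex.Re b by case: a; case: b.
have imB (a b : R[i]) : complex.Im (a - b) = complex.Im a - complex.Im b by case: a; case: b.
apply/eqP; rewrite eq_complex reB imB /cintegral/=; apply/andP; split.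
  under [X in X == _]eq_Rintegral do rewrite reB.
  by rewrite RintegralB.
under [X in X == _]eq_Rintegral do rewrite imB.
by rewrite RintegralB.
Qed.

Lemma cintegrableZ D z F : measurable D -> cintegrable D F -> cintegrable D (fun y => z * F y).
Proof.
move=> mD [f1 f2]; split.
  under eq_fun do rewrite Re_mul EFinB !EFinM.
  by apply: integrableB => //; exact: integrableZl.
under eq_fun do rewrite Im_mul EFinD !EFinM.
by apply: integrableD => //; exact: integrableZl.
Qed.

Lemma cintegralZ D z F : measurable D -> cintegrable D F ->
  cintegral D (fun y => z * F y) = z * cintegral D F.
Proof.
move=> mD [f1 f2].
have iZ (a : R) (h : R -> R) : mu.-integrable D (fun y => (h y)%:E) ->
    mu.-integrable D (EFin \o (fun y => a * h y)).
  move=> ih; rewrite [X in integrable _ _ X](_ : _ = (fun y => a%:E * (h y)%:E)%E)//.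
  exact: integrableZl.
apply/eqP; rewrite eq_complex Re_mul Im_mul /cintegral/=; apply/andP; split.
  under [X in X == _]eq_Rintegral do rewrite Re_mul.
  by rewrite RintegralB ?RintegralZl//; exact: iZ.
under [X in X == _]eq_Rintegral do rewrite Im_mul.
by rewrite RintegralD ?RintegralZl//; exact: iZ.
Qed.

End complex_integral.

Section A1_weights.
Context {R : realType}.
Local Notation mu := (@lebesgue_measure R).

(** The A_1 condition over balls for an everywhere positive weight; a single null set serves all
    balls. *)
Record A1_ball (v : R -> R) (A : R) : Prop := A1Ball {
  A1_meas : measurable_fun setT v;
  A1_gt0 : forall x, 0 < v x;
  A1_fin : forall c r, (\int[mu]_(x in ball c r) (v x)%:E < +oo)%E;
  A1_const : 0 < A;
  A1_le : (\forall x \ae mu, forall c r, 0 < r -> ball c r x ->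
    (\int[mu]_(y in ball c r) (v y)%:E <= (A * (2 * r) * v x)%:E)%E) }.

Variables (v : R -> R) (A : R).
Hypothesis Av : A1_ball v A.

Let mv : measurable_fun setT v := A1_meas Av.
Let v0 x : 0 < v x := A1_gt0 Av x.
Let A0 : 0 < A := A1_const Av.
Let mvE D : measurable D -> measurable_fun D (fun x => (v x)%:E).
Proof. by move=> mD; apply/measurable_EFinP; exact: measurable_funTS. Qed.

Lemma A1_average (c r k : R) (X : \bar R) : 0 < r -> 0 <= k -> (0 <= X)%E ->
  {ae mu, forall y, ball c r y -> (X <= (k * r * v y)%:E)%E} ->
  (X <= (k / 2)%:E * \int[mu]_(y in ball c r) (v y)%:E)%E.
Proof.
move=> r0 k0 X0 H.
have mB : measurable (ball c r) by exact: measurable_ball.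
have kr : 0 <= k * r by rewrite mulr_ge0// ltW.
have H' : \forall y \ae mu, ball c r y -> (X <= (k * r)%:E * (v y)%:E)%E.
  by apply: (ae_mono _ H) => y Hy By; rewrite -EFinM; exact: Hy.
have : (\int[mu]_(y in ball c r) X <= \int[mu]_(y in ball c r) ((k * r)%:E * (v y)%:E))%E.
  apply: ae_ge0_le_integral => //.
  - by move=> y _; rewrite -EFinM lee_fin mulr_ge0// ltW.
  - by apply: measurable_funeM; exact: mvE.
rewrite ge0_integralZl_EFin//; last 2 first.
- by move=> y _; rewrite lee_fin ltW.
- exact: mvE.
have -> : (\int[mu]_(y in ball c r) X = X * (2 * r)%:E)%E.
  by rewrite -(lebesgue_ball c (ltW r0)) -(integral_cst mu mB).
move=> H2.
have r2 : 0 <= (2 * r)^-1 by rewrite invr_ge0 mulr_ge0// ltW.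
have r2n : 2 * r != 0 by rewrite mulf_neq0 ?gt_eqF.
have -> : X = ((2 * r)^-1%:E * (X * (2 * r)%:E))%E.
  by rewrite muleCA -EFinM mulVf ?mule1.
apply: (le_trans (lee_wpmul2l _ H2)); first by rewrite lee_fin.
rewrite muleA -EFinM.
have -> : (2 * r)^-1 * (k * r) = k / 2 by field; rewrite gt_eqF.
by [].
Qed.

Lemma A1_density (c r : R) : 0 < r ->
  {ae mu, forall y, ball c r y -> wint v (ball c r) / (A * (2 * r)) <= v y}.
Proof.
move=> r0; apply: (ae_mono _ (A1_le Av)) => y Hy By.
have := Hy c r r0 By; rewrite ler_pdivrMr ?mulr_gt0// mulrC -lee_fin.
rewrite /wint fineK// ge0_fin_numE ?(A1_fin Av)//.
by apply: integral_ge0 => z _; rewrite lee_fin ltW.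
Qed.

(** By [A1_density], v is almost everywhere on a ball at least A^-1 times its average, which bounds
    the dual weight from above. The constant stays [A] for every p. *)
Lemma A1_Ap_ball (p : R) : 1 < p -> Ap_ball p v A.
Proof.
move=> p1; have p10 : 0 < p - 1 by rewrite subr_gt0.
have wE c r : (wint v (ball c r))%:E = (\int[mu]_(y in ball c r) (v y)%:E)%E.
  rewrite /wint fineK// ge0_fin_numE ?(A1_fin Av)//.
  by apply: integral_ge0 => z _; rewrite lee_fin ltW.
have wgt c r : 0 < r -> 0 < wint v (ball c r).
  by move=> r0; rewrite -lte_fin wE; exact: ball_int_gt0.
have md : measurable_fun setT (dual_weight p v).
  by apply: measurableT_comp (measurable_powR _) _.
have dual_le c r : 0 < r -> (\int[mu]_(y in ball c r) (dual_weight p v y)%:E <=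
    ((wint v (ball c r) / (A * (2 * r))) `^ (- (p - 1)^-1) * (2 * r))%:E)%E.
  move=> r0; have mB : measurable (ball c r) by exact: measurable_ball.
  have m0 : 0 < wint v (ball c r) / (A * (2 * r)) by rewrite divr_gt0 ?wgt ?mulr_gt0.
  rewrite EFinM -(lebesgue_ball c (ltW r0)) -(integral_cst mu mB).
  apply: ae_ge0_le_integral => //.
  - by move=> y _; rewrite lee_fin powR_ge0.
  - by apply/measurable_EFinP; exact: measurable_funTS.
  - by move=> y _; rewrite lee_fin powR_ge0.
  - apply: (ae_mono _ (A1_density c r0)) => y Hy By; rewrite lee_fin /dual_weight !powRN.
    by rewrite lef_pV2 ?posrE ?powR_gt0//; apply: le_powR; rewrite ?Hy ?invr_ge0 ?ltW.
split.
- exact: mv.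
- exact: v0.
- exact: (A1_fin Av).
- move=> c r; have [r0|r0] := ltP 0 r; last by rewrite ball_nonpos// integral_set0.
  exact: (le_lt_trans (dual_le c r r0) (ltry _)).
- move=> c r r0.
  have m0 : 0 < wint v (ball c r) / (A * (2 * r)) by rewrite divr_gt0 ?wgt ?mulr_gt0.
  have r20 : 0 < 2 * r by rewrite mulr_gt0.
  apply: (@le_trans _ _ (wint v (ball c r) *
     ((wint v (ball c r) / (A * (2 * r))) `^ (- (p - 1)^-1) * (2 * r)) `^ (p - 1))).
    apply: ler_wpM2l; first exact/ltW/wgt.
    apply: le_powR; first exact: ltW.
      by apply: fine_ge0; apply: integral_ge0 => y _; rewrite lee_fin powR_ge0.
    rewrite -lee_fin; apply: le_trans (dual_le c r r0).
    rewrite /wint fineK// ge0_fin_numE; first exact: (le_lt_trans (dual_le c r r0) (ltry _)).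
    by apply: integral_ge0 => y _; rewrite lee_fin powR_ge0.
  rewrite powRM; [|exact: powR_ge0|exact: ltW].
  rewrite -powRrM mulNr mulVf ?gt_eqF// powRN powRr1; last exact: ltW.
  have -> : p = 1 + (p - 1) by ring.
  rewrite [(2 * r) `^ (1 + _)]powRD; last by rewrite (gt_eqF r20) implybT.
  rewrite powRr1; last exact: ltW.
  have -> : 1 + (p - 1) - 1 = p - 1 by ring.
  have wn := wgt c r r0; move: (wint v (ball c r)) ((2 * r) `^ (p - 1)) wn => m t m1.
  have -> : m * ((m / (A * (2 * r)))^-1 * t) = A * (2 * r * t).
    by field; rewrite !gt_eqF.
  exact: lexx.
Qed.

(** For almost every y in the ball, A_1 bounds the v-mass of all larger concentric balls by their
    length times v(y), so the dyadic kernel gives a multiple of r v(y); [A1_average] turns this into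
    the mass of the ball. *)
Lemma A1_tail (e : R) : 0 < e -> exists2 D, 0 < D & forall c r : R, 0 < r ->
  (\int[mu]_(x in [set x | (r <= `|x - c|)%R]) ((r / `|x - c|) `^ (1 + e) * v x)%:E <=
   D%:E * \int[mu]_(x in ball c r) (v x)%:E)%E.
Proof.
move=> e0; pose eta : R := 2 `^ (- e).
have eta0 : 0 <= eta by exact: powR_ge0.
have eta1 : eta < 1 by exact: two_powRN_lt1.
have e1 : 0 < 1 - eta by rewrite subr_gt0.
pose k := 2 `^ (1 + e) * (2 / (1 - eta)) * (2 * A).
have k0 : 0 < k by rewrite !mulr_gt0 ?powR_gt0 ?invr_gt0.
exists (k / 2); first exact: divr_gt0.
move=> c r r0; apply: A1_average => //; first exact: ltW.
  by apply: integral_ge0 => x _; rewrite lee_fin mulr_ge0 ?powR_ge0 ?ltW.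
apply: (ae_mono _ (A1_le Av)) => y Hy By.
have mW : measurable_fun setT (dyadic_kernel eta c r) by exact: measurable_dyadic_kernel.
have n1 x : (0 <= (2 `^ (1 + e))%:E * (dyadic_kernel eta c r x * (v x)%:E))%E.
  apply: mule_ge0; first by rewrite lee_fin powR_ge0.
  by apply: mule_ge0; [exact: dyadic_kernel_ge0|rewrite lee_fin ltW].
apply: (@le_trans _ _ (\int[mu]_x ((2 `^ (1 + e))%:E * (dyadic_kernel eta c r x * (v x)%:E)))%E).
  rewrite integral_mkcond; apply: int_le => x _.
    exact: n1.
  rewrite patchE; case: ifPn => [|_]; last exact: n1.
  rewrite inE/= => rx; rewrite EFinM muleA; apply: lee_wpmul2r; first by rewrite lee_fin ltW.
  exact: power_le_dyadic_kernel.
rewrite ge0_integralZl_EFin//; last 2 first.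
- by move=> x _; apply: mule_ge0; [exact: dyadic_kernel_ge0|rewrite lee_fin ltW].
- by apply: emeasurable_funM => //; exact: mvE.
have Avy : (0 <= (2 * A * v y)%:E)%E by rewrite lee_fin !mulr_ge0 ?ltW.
have HH : (\int[mu]_x (dyadic_kernel eta c r x * (v x)%:E) <=
    (2 * r / (1 - eta))%:E * (2 * A * v y)%:E)%E.
  apply: integral_dyadic_kernel_le => //; first exact: mvE.
    by move=> x; rewrite lee_fin ltW.
  move=> d rd; have d0 : 0 < d by exact: lt_le_trans rd.
  have Bd : ball c d y by move: By; rewrite !ball_R/= => h; exact: lt_le_trans h rd.
  apply: (le_trans (Hy c d d0 Bd)); rewrite -EFinM lee_fin.
  by rewrite le_eqVlt; apply/orP; left; apply/eqP; ring.
apply: (le_trans (lee_wpmul2l _ HH)); first by rewrite lee_fin powR_ge0.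
rewrite -!EFinM lee_fin /k.
by rewrite le_eqVlt; apply/orP; left; apply/eqP; ring.
Qed.

(** For an A_1 weight a Lebesgue average is at most A times the average for v dx, so [HLmax] is
    dominated by A times [Mx v]. *)
Lemma A1_weak_type : exists2 D, 0 < D & forall (g : R -> \bar R) (l : R),
  measurable_fun setT g -> (forall x, 0 <= g x)%E -> 0 < l ->
  (\int[mu]_(x in [set x | l%:E < HLmax g x]) (v x)%:E <=
   (D / l)%:E * \int[mu]_x (g x * (v x)%:E))%E.
Proof.
have dv := @Ap_doubling R 2 v A (ltr1n R 2) (A1_Ap_ball (ltr1n R 2)).
exists (A * 3 `^ 2 * A); first by rewrite !mulr_gt0 ?powR_gt0.
move=> g l mg g0 l0.
have lA : 0 < l / A by exact: divr_gt0.
apply: (@le_trans _ _ (\int[mu]_(x in [set x | (l / A)%:E < Mx v g x]) (v x)%:E)%E).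
  apply: ge0_subset_integral.
  - exact: (measurable_lt _ (measurable_Mx _ _)).
  - exact: (measurable_lt _ (measurable_Mx _ _)).
  - by apply: mvE; exact: (measurable_lt _ (measurable_Mx _ _)).
  - by move=> x _; rewrite lee_fin ltW.
  move=> x /= /Mx_gtP[n [Bx]]; rewrite HLmaxE => h.
  apply/Mx_gtP; exists n; split => //.
  have r0 : 0 < qradius n :> R by exact: qradius_gt0.
  have mB : measurable (qball n : set R) by rewrite /qball; exact: measurable_ball.
  have w0 : 0 < wint v (qball n) by exact: (wint_gt0 dv _ r0).
  have d0 : 0 < wint v (qball n) / (A * (2 * qradius n)) by rewrite divr_gt0 ?mulr_gt0.
  have H : ((wint v (qball n) / (A * (2 * qradius n)))%:E * \int[mu]_(y in qball n) g y <=
      \int[mu]_(y in qball n) (g y * (v y)%:E))%E.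
    rewrite -ge0_integralZl_EFin//; last 2 first.
    - exact: measurable_funTS.
    - exact: ltW.
    apply: ae_ge0_le_integral => //.
    - by move=> y _; rewrite mule_ge0// lee_fin ltW.
    - by apply: measurable_funeM; exact: measurable_funTS.
    - by move=> y _; rewrite mule_ge0// lee_fin ltW.
    - by apply: emeasurable_funM; [exact: measurable_funTS|exact: mvE].
    - apply: (ae_mono _ (A1_density (qcenter n) r0)) => y Hy By.
      by rewrite muleC; apply: lee_wpmul2l => //; rewrite lee_fin; exact: Hy.
  apply: (@lt_le_trans _ _ ((wint v (qball n))^-1%:E *
     ((wint v (qball n) / (A * (2 * qradius n)))%:E * \int[mu]_(y in qball n) g y))%E); last first.
    by apply: lee_wpmul2l => //; rewrite lee_fin invr_ge0 ltW.
  rewrite muleA -EFinM.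
  have -> : (wint v (qball n))^-1 * (wint v (qball n) / (A * (2 * qradius n))) =
      A^-1 * (2 * qradius n)^-1.
    by field; rewrite !gt_eqF.
  have -> : ((A^-1 / (2 * qradius n))%:E * \int[mu]_(y in qball n) g y)%E =
      (A^-1%:E * ((2 * qradius n)^-1%:E * \int[mu]_(y in qball n) g y))%E.
    by rewrite EFinM muleA.
  have -> : (l / A)%:E = (A^-1%:E * l%:E)%E by rewrite mulrC EFinM.
  by rewrite lte_pmul2l// lte_fin invr_gt0.
apply: (le_trans (maximal_weak_type dv mg g0 lA)).
by rewrite invf_div mulrA.
Qed.

End A1_weights.

(** * Calderon-Zygmund decomposition *)

Section bad_part.
Context {R : realType}.
Local Notation mu := (@lebesgue_measure R).

(** The annulus consists of two intervals with the four listed endpoints. The ball does not contain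
    [x], so it lies on one side of it and is inside or outside as a whole unless it contains an
    endpoint. *)
Lemma ball_annulus_cases (x c r t t' : R) : r <= `|x - c| -> 0 < t -> t < t' ->
  [\/ ball c r `&` annulus (fun y => `|x - y|) t t' = set0,
      ball c r `<=` annulus (fun y => `|x - y|) t t' |
      exists2 l : nat, (l < 4)%N & ball c r (nth 0 [:: x - t; x + t; x - t'; x + t'] l)].
Proof.
move=> rx t0 tt.
have bE z : ball c r z = (c - r < z < c + r) :> Prop.
  by rewrite ball_R/= ltr_norml; congr is_true; apply/idP/idP => /andP[h1 h2]; apply/andP; split; lra.
have [H|H] := pselect (exists2 l : nat, (l < 4)%N &
    ball c r (nth 0 [:: x - t; x + t; x - t'; x + t'] l)); first exact: Or33.
have [E|/set0P[y [By Ay]]] := eqVneq (ball c r `&` annulus (fun y => `|x - y|) t t') set0.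
  exact: Or31.
apply: Or32 => y' By'.
have h0 : ~ (c - r < x - t < c + r) by move=> h; apply: H; exists 0%N => //=; rewrite bE.
have h1 : ~ (c - r < x + t < c + r) by move=> h; apply: H; exists 1%N => //=; rewrite bE.
have h2 : ~ (c - r < x - t' < c + r) by move=> h; apply: H; exists 2%N => //=; rewrite bE.
have h3 : ~ (c - r < x + t' < c + r) by move=> h; apply: H; exists 3%N => //=; rewrite bE.
move: By By' Ay; rewrite !bE /annulus/= => /andP[b1 b2] /andP[b3 b4].
have [xc|xc] := leP 0 (x - c).
  move: rx; rewrite ger0_norm// => rx.
  have -> : `|x - y| = x - y by rewrite ger0_norm//; lra.
  have -> : `|x - y'| = x - y' by rewrite ger0_norm//; lra.
  move=> /andP[a1 a2]; apply/andP; split.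
    rewrite ltNge; apply/negP => h; apply: h0; apply/andP; split; lra.
  rewrite leNgt; apply/negP => h; apply: h2; apply/andP; split; lra.
move: rx; rewrite ltr0_norm// => rx.
have -> : `|x - y| = y - x by rewrite ler0_norm ?opprB//; lra.
have -> : `|x - y'| = y' - x by rewrite ler0_norm ?opprB//; lra.
move=> /andP[a1 a2]; apply/andP; split.
  rewrite ltNge; apply/negP => h; apply: h1; apply/andP; split; lra.
rewrite leNgt; apply/negP => h; apply: h3; apply/andP; split; lra.
Qed.

Lemma powR_le1 (u a b : R) : 0 <= u -> u <= 1 -> 0 < a -> a <= b -> u `^ b <= u `^ a.
Proof.
move=> u0 u1 a0 ab; have [->|un] := eqVneq u 0.
  by rewrite !powR0 ?gt_eqF// (lt_le_trans a0).
have u01 : 0 < u <= 1 by rewrite lt_def un u0.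
exact: (ger_powR u01 ab).
Qed.

Variables (q rho delta C : R) (K : R -> R -> R[i]).
Hypotheses (q1 : 1 <= q) (rho1 : 1 < rho) (delta0 : 0 < delta) (C0 : 0 < C).
Hypothesis Ksize : forall x y, x != y -> normc (K x y) <= C / `|x - y|.
Hypothesis Ky : forall x y z, 2 * `|x - z| < `|x - y| ->
  normc (K y x - K y z) <= C * `|x - z| `^ delta / `|x - y| `^ (1 + delta).

Let rho0 : 0 < rho. Proof. exact: lt_trans ltr01 rho1. Qed.

Variables (c r : nat -> R) (b : nat -> R -> R[i]) (N : nat) (L x : R).
Local Notation B := (fun j => ball (c j) (r j)).
Hypotheses (r0 : forall j, 0 <= r j) (tB : trivIset setT B).
Hypothesis nb : forall k, nice (b k).
Hypothesis b0 : forall k y, ~ (\bigcup_j B j) y -> b k y = 0.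
Hypothesis bc : forall k j, cintegral (B j) (b k) = 0.
Hypothesis L0 : 0 <= L.
Hypothesis bL : forall j,
  (\int[mu]_(y in ball (c j) (r j)) (vec_norm rho N b y)%:E <= (L * r j)%:E)%E.
Hypothesis xB : forall j, 0 < r j -> 4 * r j <= `|x - c j|.

Let mB j : measurable (ball (c j) (r j)). Proof. exact: measurable_ball. Qed.

Let B_pos j y : ball (c j) (r j) y ->
  [/\ 0 < r j, 4 * r j <= `|x - c j|, `|c j - y| < r j & `|x - c j| / 2 < `|x - y|].
Proof.
rewrite ball_R/= => h; have rj : 0 < r j := le_lt_trans (normr_ge0 _) h.
have h4 := xB rj; split=> //.
by have := ler_distD y x (c j); rewrite (distrC y) => ?; lra.
Qed.

Let sub_outside j : 0 < r j -> ball (c j) (r j) `<=` outside x (`|x - c j| / 2).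
Proof. by move=> rj y /B_pos[]. Qed.

Let half_pos j : 0 < r j -> 0 < `|x - c j| / 2.
Proof. by move=> rj; have := xB rj; lra. Qed.

Let kernel_cint k j A : 0 < r j -> measurable A -> A `<=` ball (c j) (r j) ->
  cintegrable A (fun y => K x y * b k y).
Proof.
move=> rj mA AB; have h0 := half_pos rj.
apply: (cintegrableS (measurable_outside x (`|x - c j| / 2)) mA).
  by move=> y /AB; exact: sub_outside.
exact: (@kernel_integrable R delta C K delta0 C0 Ksize Ky x _ (b k) h0 (nice_admissible (nb k))).
Qed.

Let mnb k : measurable_fun setT (fun y => normc (b k y)).
Proof. by apply: cmeasurable_normc; have [] := nb k. Qed.

Let int_coef_le (D : set R) (F : R -> R) (u : R) k : measurable D -> 0 <= u ->
  (forall y, D y -> F y <= u * normc (b k y)) ->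
  (2%:E * \int[mu]_(y in D) (F y)%:E <= \int[mu]_(y in D) (2 * u * normc (b k y))%:E)%E.
Proof.
move=> mD u0 H.
apply: (@le_trans _ _ (2%:E * \int[mu]_(y in D) (u * normc (b k y))%:E)%E).
  apply: lee_wpmul2l => //; apply: int_le => y Dy.
    by rewrite lee_fin mulr_ge0// normc_ge0.
  by rewrite lee_fin; exact: H.
rewrite -ge0_integralZl_EFin//; last 2 first.
- by move=> y _; rewrite lee_fin mulr_ge0// normc_ge0.
- by apply/measurable_EFinP; apply: measurable_funM => //; exact: (measurable_funTS (mnb k)).
apply: int_le => y Dy; first by rewrite lee_fin !mulr_ge0// normc_ge0.
by rewrite -EFinM lee_fin mulrA.
Qed.

Let size_bound k j A : measurable A -> A `<=` ball (c j) (r j) -> 0 < r j ->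
  ((normc (cintegral A (fun y => (K x y * b k y)%R)))%:E <=
   \int[mu]_(y in A) (2 * (2 * C / `|x - c j|) * normc (b k y))%:E)%E.
Proof.
move=> mA AB rj.
apply: (le_trans (cintegral_le mA (cintegrable_cmeas (kernel_cint k rj mA AB)))).
have h0 := half_pos rj; have xc0 : 0 < `|x - c j| by lra.
apply: int_coef_le => //; first by rewrite divr_ge0// mulr_ge0// ltW.
move=> y /AB /B_pos[_ _ _ h].
have xy : x != y by rewrite -subr_eq0 -normr_gt0 (lt_trans h0).
apply: (le_trans (kernel_mul_le Ksize _ xy)).
rewrite [leRHS]mulrAC [2 * C]mulrC -!mulrA; apply: ler_wpM2l; first exact: ltW.
rewrite mulrCA; apply: ler_wpM2l; first exact: normc_ge0.
by rewrite -[leRHS]invf_div lef_pV2 ?posrE//; [exact: ltW|exact: lt_trans h].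
Qed.

(** As [b k] has integral 0 on the ball, K x y may be replaced by K x y - K x (c j), to which
    regularity in the second variable applies. *)
Let cancel_bound k j : 0 < r j ->
  ((normc (cintegral (ball (c j) (r j)) (fun y => (K x y * b k y)%R)))%:E <=
   \int[mu]_(y in ball (c j) (r j))
     (2 * (C * r j `^ delta / `|x - c j| `^ (1 + delta)) * normc (b k y))%:E)%E.
Proof.
move=> rj; have mA := mB j.
have xc0 : 0 < `|x - c j| by have := xB rj; lra.
have ib : cintegrable (ball (c j) (r j)) (b k).
  exact: (cintegrableS measurableT (mB j) (@subsetT _ _) (nice_cintegrable (nb k))).
have iK := kernel_cint k rj mA (@subset_refl _ _).
have iZ := cintegrableZ (K x (c j)) (mB j) ib.
have -> : cintegral (ball (c j) (r j)) (fun y => K x y * b k y) =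
    cintegral (ball (c j) (r j)) (fun y => K x y * b k y - K x (c j) * b k y).
  by rewrite cintegralB// cintegralZ// bc mulr0 subr0.
have ms : cmeas_on (ball (c j) (r j)) (fun y => K x y * b k y - K x (c j) * b k y).
  have [m1 m2] := cintegrable_cmeas iK; have [m3 m4] := cintegrable_cmeas iZ.
  have reB (z1 z2 : R[i]) : complex.Re (z1 - z2) = complex.Re z1 - complex.Re z2 by case: z1; case: z2.
  have imB (z1 z2 : R[i]) : complex.Im (z1 - z2) = complex.Im z1 - complex.Im z2 by case: z1; case: z2.
  split.
    by under [X in measurable_fun _ X]eq_fun do rewrite reB; exact: measurable_funB.
  by under [X in measurable_fun _ X]eq_fun do rewrite imB; exact: measurable_funB.
apply: (le_trans (cintegral_le mA ms)).
apply: int_coef_le => //; first by rewrite divr_ge0 ?powR_ge0// mulr_ge0 ?powR_ge0// ltW.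
move=> y /B_pos[_ r4 cy _].
rewrite -mulrBl Normc.normcM; apply: ler_wpM2r; first exact: normc_ge0.
rewrite -[K x y - _]opprB normcN.
have h : 2 * `|c j - y| < `|c j - x| by rewrite (distrC _ x); lra.
apply: (le_trans (Ky h)); rewrite (distrC _ x).
apply: ler_wpM2r; first by rewrite invr_ge0 powR_ge0.
apply: ler_wpM2l; first exact: ltW.
by apply: le_powR => //; exact: ltW.
Qed.

Let idx := cell_index B.
(** Coefficients with which the mass of a ball is charged: [ka] by cancellation when the ball lies
    in the annulus, [kb] by size when it is cut. They are twice those of [cancel_bound] and
    [size_bound], for the factor 2 in [increment_cells]. *)
Let ka j := 4 * (C * r j `^ delta / `|x - c j| `^ (1 + delta)).
Let kb j := 8 * C / `|x - c j|.
Let psi k y := ka (idx y) * normc (b k y).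
Let phi k y := kb (idx y) * normc (b k y).

Let ka0 j : 0 <= ka j.
Proof. by rewrite mulr_ge0// divr_ge0 ?powR_ge0// mulr_ge0 ?powR_ge0// ltW. Qed.
Let kb0 j : 0 <= kb j.
Proof. by rewrite divr_ge0// mulr_ge0// ltW. Qed.
Let psi0 k y : 0 <= psi k y. Proof. by rewrite mulr_ge0 ?normc_ge0. Qed.
Let phi0 k y : 0 <= phi k y. Proof. by rewrite mulr_ge0 ?normc_ge0. Qed.
Let mpsi k : measurable_fun setT (psi k).
Proof. by apply: measurable_funM => //; exact: measurable_cell_fun. Qed.
Let mphi k : measurable_fun setT (phi k).
Proof. by apply: measurable_funM => //; exact: measurable_cell_fun. Qed.
Let idxE j y : ball (c j) (r j) y -> idx y = j.
Proof. exact: (@cell_indexE R B j y tB). Qed.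

Let An (t t' : R) := annulus (fun y : R => `|x - y|) t t'.
Let mAn t t' : measurable (An t t').
Proof. by apply: measurable_annulus; exact: measurable_dist. Qed.
Let pt t t' l := nth 0 [:: x - t; x + t; x - t'; x + t'] l.

(** The three cases of [ball_annulus_cases]. A cut ball contains one of the four points [pt t t' l],
    so its index is the index of that point. *)
Let cell_increment k j (t t' : R) : 0 < t -> t < t' ->
  ((2 * normc (cintegral (ball (c j) (r j) `&` An t t')
      (fun y => (K x y * b k y)%R)))%:E <=
   \int[mu]_(y in ball (c j) (r j) `&` An t t') (psi k y)%:E +
   \sum_(l < 4) (if j == idx (pt t t' l) then
     \int[mu]_(y in ball (c j) (r j) `&` An t t') (phi k y)%:E else 0))%E.
Proof.
move=> t0 tt; pose A := An t t'; have mA : measurable A := mAn t t'; rewrite -/A.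
have mBA : measurable (ball (c j) (r j) `&` A) by exact: measurableI.
have p1 : (0 <= \int[mu]_(y in ball (c j) (r j) `&` A) (psi k y)%:E)%E.
  by apply: integral_ge0 => y _; rewrite lee_fin.
have p2 : (0 <= \int[mu]_(y in ball (c j) (r j) `&` A) (phi k y)%:E)%E.
  by apply: integral_ge0 => y _; rewrite lee_fin.
have p3 l : (0 <= if j == idx (pt t t' l) then
     \int[mu]_(y in ball (c j) (r j) `&` A) (phi k y)%:E else 0)%E by case: ifP.
have emp : ball (c j) (r j) `&` A = set0 -> (2 * normc (cintegral (ball (c j) (r j) `&` A)
      (fun y => K x y * b k y)))%:E = 0%E.
  move=> ->; rewrite /cintegral !Rintegral_set0.
  by rewrite (_ : Complex 0 0 = 0 :> R[i])// Normc.normc0 mulr0.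
have [rj|rj] := ltP 0 (r j); last first.
  rewrite emp; last by rewrite ball_nonpos// set0I.
  by apply: adde_ge0 => //; apply: sume_ge0 => l _; exact: p3.
have xr : r j <= `|x - c j| by have := xB rj; lra.
case: (ball_annulus_cases xr t0 tt) => [E|E|[l l4 Bl]].
- rewrite emp//.
  by apply: adde_ge0 => //; apply: sume_ge0 => l _; exact: p3.
- have -> : ball (c j) (r j) `&` A = ball (c j) (r j) by apply/setIidPl.
  apply: (@le_trans _ _ (\int[mu]_(y in ball (c j) (r j)) (psi k y)%:E)%E); last first.
    apply: leeDl; apply: sume_ge0 => l _; case: ifP => // _.
    by apply: integral_ge0 => y _; rewrite lee_fin.
  rewrite EFinM; apply: (@le_trans _ _ (2%:E * \int[mu]_(y in ball (c j) (r j))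
     (2 * (C * r j `^ delta / `|x - c j| `^ (1 + delta)) * normc (b k y))%:E)%E).
    by apply: lee_wpmul2l; [rewrite lee_fin|exact: (cancel_bound k rj)].
  have u0 : 0 <= 2 * (C * r j `^ delta / `|x - c j| `^ (1 + delta)).
    by apply: mulr_ge0 => //; rewrite divr_ge0 ?powR_ge0// mulr_ge0 ?powR_ge0// ltW.
  apply: (le_trans (@int_coef_le _ _ _ k (mB j) u0 (fun y _ => lexx _))).
  apply: int_le => y By; rewrite lee_fin; first exact: psi0.
  apply: ler_wpM2r; first exact: normc_ge0.
  by rewrite (idxE By) /ka mulrA -natrM.
- have lj : j = idx (pt t t' l) by rewrite (idxE Bl).
  rewrite (bigD1 (Ordinal l4))//= -lj eqxx.
  apply: (@le_trans _ _ (\int[mu]_(y in ball (c j) (r j) `&` A) (phi k y)%:E)%E); last first.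
    rewrite addeCA; apply: leeDl; apply: adde_ge0 => //.
    by apply: sume_ge0 => i _; exact: p3.
  rewrite EFinM; apply: (@le_trans _ _ (2%:E * \int[mu]_(y in ball (c j) (r j) `&` A)
     (2 * (2 * C / `|x - c j|) * normc (b k y))%:E)%E).
    by apply: lee_wpmul2l; [rewrite lee_fin|exact: (size_bound k mBA (@subIsetl _ _ _) rj)].
  have u0 : 0 <= 2 * (2 * C / `|x - c j|).
    by apply: mulr_ge0 => //; rewrite divr_ge0// mulr_ge0// ltW.
  apply: (le_trans (@int_coef_le _ _ _ k mBA u0 (fun y _ => lexx _))).
  apply: int_le => y [By _]; rewrite lee_fin; first exact: phi0.
  apply: ler_wpM2r; first exact: normc_ge0.
  by rewrite (idxE By) /kb !mulrA -!natrM.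
Qed.

(** [b k] vanishes off the balls, so the integral over the annulus is a series over the balls;
    treating real and imaginary parts separately produces the factor 2. *)
Let increment_cells k (t t' : R) : 0 < t -> t < t' ->
  ((normc (truncated K t (b k) x - truncated K t' (b k) x))%:E <=
   \sum_(j <oo) (2 * normc (cintegral (ball (c j) (r j) `&` An t t')
      (fun y => (K x y * b k y)%R)))%:E)%E.
Proof.
move=> t0 tt; have ab := nice_admissible (nb k).
rewrite (@truncated_sub R delta C K delta0 C0 Ksize Ky x t t' (b k) t0 tt ab).
pose A := An t t'; have mA : measurable A := mAn t t'; rewrite -/A.
change (annulus (fun y : R => `|x - y|) t t') with A.
pose F j := ball (c j) (r j) `&` A.
have mF j : measurable (F j) by exact: measurableI.
have tF : trivIset setT F.
  by move=> i j _ _ [y [[Bi _] [Bj _]]]; exact: (tB Logic.I Logic.I (ex_intro _ y (conj Bi Bj))).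
pose e j := normc (cintegral (F j) (fun y => K x y * b k y)).
have FA : \bigcup_j F j `<=` A by move=> y [j _ []].
have iK : cintegrable (\bigcup_j F j) (fun y => K x y * b k y).
  apply: (@cintegrableS R (outside x t)).
  - exact: measurable_outside.
  - exact: bigcup_measurable.
  - by move=> y /FA; exact: annulus_outside.
  - exact: (@kernel_integrable R delta C K delta0 C0 Ksize Ky x t (b k) t0 ab).
have pE (p : R[i] -> R) : p 0 = 0 -> (fun y => p (K x y * b k y)) \_ A =
    (fun y => p (K x y * b k y)) \_ (\bigcup_j F j).
  move=> p00; apply/funext => y; rewrite !patchE.
  case: ifPn => hA; case: ifPn => hF //.
    rewrite b0 ?mulr0// => -[j _ By]; move: hF; rewrite notin_setE; apply.
    by exists j => //; split => //; move: hA; rewrite inE.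
  by move: hF; rewrite inE => /FA; move: hA; rewrite notin_setE.
have -> : cintegral A (fun y => K x y * b k y) = cintegral (\bigcup_j F j) (fun y => K x y * b k y).
  rewrite /cintegral; congr Complex.
    by rewrite Rintegral_mkcond [RHS]Rintegral_mkcond (pE (fun z => complex.Re z)).
  by rewrite Rintegral_mkcond [RHS]Rintegral_mkcond (pE (fun z => complex.Im z)).
have e0 j : (0 <= (e j)%:E)%E by rewrite lee_fin normc_ge0.
have S2 : (\sum_(j <oo) (2 * e j)%:E = \sum_(j <oo) (e j)%:E + \sum_(j <oo) (e j)%:E)%E.
  rewrite -nneseriesD//; apply: eq_eseriesr => j _.
  by rewrite -EFinD; congr (_%:E); ring.
apply: (@le_trans _ _ (\sum_(j <oo) (2 * e j)%:E)%E); last exact: lexx.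
rewrite S2.
apply: (@le_trans _ _ (`|\int[mu]_(y in \bigcup_j F j) complex.Re (K x y * b k y)|%:E +
   `|\int[mu]_(y in \bigcup_j F j) complex.Im (K x y * b k y)|%:E)%E).
  by rewrite -EFinD lee_fin; exact: (normc_le_ReIm (cintegral _ _)).
apply: leeD.
  apply: (le_trans (@integral_bigcup_le _ _ R mu F (fun y => complex.Re (K x y * b k y)) tF mF iK.1)).
  apply: lee_nneseries => [j _|j _]; first by rewrite lee_fin.
  by rewrite lee_fin; exact: (Re_le_normc (cintegral (F j) (fun y => K x y * b k y))).
apply: (le_trans (@integral_bigcup_le _ _ R mu F (fun y => complex.Im (K x y * b k y)) tF mF iK.2)).
apply: lee_nneseries => [j _|j _]; first by rewrite lee_fin.
by rewrite lee_fin; exact: (Im_le_normc (cintegral (F j) (fun y => K x y * b k y))).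
Qed.

(* For a truncation annulus around [x], the balls inside it contribute by cancellation and sum to the total variation; at most four balls meet its boundary, and they are summed in l^s. *)
Lemma vec_op_bad_le (S : R) :
  (forall J, \sum_(j < J) (r j / `|x - c j|) `^ (Num.min (Num.min q rho) (1 + delta)) <= S) ->
  (vec_op q rho K N b x <=
   (4 * C * L * S + 64 * C * L * S `^ (Num.min q rho)^-1)%:E)%E.
Proof.
move=> HS; set s := Num.min q rho in HS *; set sg := Num.min s _ in HS.
have s1 : 1 <= s by rewrite le_min q1 ltW.
have s0 : 0 < s := lt_le_trans ltr01 s1.
have sg0 : 0 < sg by rewrite lt_min s0 addr_gt0.
have S0 : 0 <= S by apply: le_trans (HS 0%N); rewrite big_ord0.
pose u j := r j / `|x - c j|.
(* As u j <= 1, the one sum [S] with the smaller exponent bounds both the sum with exponent 1 +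
   delta, for the balls inside an annulus, and the sum with exponent s, for the cut ones. *)
have u0 j : 0 <= u j by rewrite divr_ge0.
have u1 j : u j <= 1.
  have [rj|rj] := ltP 0 (r j); last by rewrite /u (le_anti (_ : r j <= 0 <= r j)) ?mul0r ?ler01// rj r0.
  have := xB rj => h; rewrite ler_pdivrMr ?mul1r; lra.
have ms : measurable_fun setT (fun y : R => `|x - y|) by exact: measurable_dist.
have CL : 0 <= C * L by rewrite mulr_ge0// ltW.
have vn0 y : 0 <= vec_norm rho N b y by exact: lpn_ge0.
have mvn : measurable_fun setT (vec_norm rho N b).
  by apply: measurable_vec_norm => k; have [] := nb k.
pose P := 4 * C * L * S; pose Q := 8 * C * L * S `^ s^-1.
have cell_int (g : nat -> R) j : 0 <= g j ->
    (\int[mu]_(y in ball (c j) (r j)) (g (idx y) * vec_norm rho N b y)%:E <= (g j * (L * r j))%:E)%E.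
  move=> gj; apply: (@le_trans _ _ ((g j)%:E * \int[mu]_(y in ball (c j) (r j)) (vec_norm rho N b y)%:E)%E).
    rewrite -ge0_integralZl_EFin; last 4 first.
    - exact: mB.
    - by move=> y _; rewrite lee_fin.
    - by apply/measurable_EFinP; exact: (measurable_funTS mvn).
    - exact: gj.
    apply: int_le => y By; first by rewrite -EFinM lee_fin mulr_ge0.
    by rewrite -EFinM lee_fin (idxE By).
  by rewrite EFinM; apply: lee_wpmul2l.
have -> : 4 * C * L * S + 64 * C * L * S `^ s^-1 = P + 2 * 4%:R * Q by rewrite /P /Q; ring.
have sq : s <= q by rewrite ge_min lexx.
have sr : s <= rho by rewrite ge_min lexx orbT.
have Q0 : 0 <= Q.
  by rewrite /Q -mulrA -mulrA; apply: mulr_ge0 => //; rewrite mulrA mulr_ge0// powR_ge0.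
have nu0 j : 0 <= 8 * C * L * u j.
  by rewrite -mulrA -mulrA; apply: mulr_ge0 => //; rewrite mulrA mulr_ge0.
apply: (@variation_vector_cells R q rho q1 rho1 N (fun k t => truncated K t (b k) x) s 4
  (fun y => `|x - y|) (fun y => `|x - y|) psi phi (fun j => ball (c j) (r j)) P Q
  (fun j => 8 * C * L * u j) s1 sq sr ms ms mpsi mphi psi0 phi0 mB Q0 nu0).
- apply: (@le_trans _ _ (\int[mu]_(y in \bigcup_j ball (c j) (r j)) (ka (idx y) * vec_norm rho N b y)%:E)%E).
    rewrite [leRHS]integral_mkcond; apply: int_le => y _.
      by rewrite patchE; case: ifP => // _; rewrite lee_fin mulr_ge0.
    have E : lpn rho N (psi ^~ y) = ka (idx y) * vec_norm rho N b y.
      by rewrite /psi lpn_Z// => k _; exact: normc_ge0.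
    rewrite E patchE; case: ifPn => // h.
    have v0 : vec_norm rho N b y = 0.
      rewrite /vec_norm /lpn big1 ?powR0 ?gt_eqF ?invr_gt0// => k _.
      rewrite b0; last by move: h; rewrite notin_setE.
      by rewrite Normc.normc0 powR0 ?gt_eqF.
    by rewrite v0 mulr0.
  rewrite ge0_integral_bigcup//; last 2 first.
  + apply/measurable_EFinP; apply: measurable_funTS; apply: measurable_funM => //.
    exact: measurable_cell_fun.
  + by move=> y _; rewrite lee_fin mulr_ge0.
  apply: nneseries_le => [j|J].
    by apply: integral_ge0 => y _; rewrite lee_fin mulr_ge0.
  apply: (@le_trans _ _ (\sum_(j < J) (4 * C * L * u j `^ (1 + delta))%:E)%E).
    apply: lee_sum => j _; apply: (le_trans (cell_int ka j (ka0 j))); rewrite lee_fin /ka.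
    have [rj|rj] := ltP 0 (r j); last first.
      rewrite (le_anti (_ : r j <= 0 <= r j)) ?rj ?r0// !mulr0.
      by rewrite -mulrA -mulrA; apply: mulr_ge0 => //; rewrite mulrA mulr_ge0// powR_ge0.
    have xc : 0 < `|x - c j| by have := xB rj; lra.
    have -> : u j `^ (1 + delta) = r j * r j `^ delta / `|x - c j| `^ (1 + delta).
      rewrite /u powRM; [|exact: r0|by rewrite invr_ge0].
      rewrite powRD; last by rewrite (gt_eqF rj) implybT.
      by rewrite powR_inv// powRN (powRr1 (ltW rj)).
    by rewrite le_eqVlt; apply/orP; left; apply/eqP; ring.
  rewrite sumEFin lee_fin -mulr_sumr /P; apply: ler_wpM2l.
    by rewrite -mulrA mulr_ge0.
  apply: le_trans (HS J); apply: ler_sum => j _; apply: powR_le1 => //.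
  by rewrite ge_min lexx orbT.
- move=> j; apply: (@le_trans _ _ (kb j * (L * r j))%:E); last first.
    rewrite lee_fin /kb /u le_eqVlt; apply/orP; left; apply/eqP; ring.
  apply: le_trans (cell_int kb j (kb0 j)); apply: int_le => y By; rewrite lee_fin.
    exact: mulr_ge0.
  by rewrite /phi lpn_Z// => k _; exact: normc_ge0.
- move=> J; rewrite /Q powRM ?powR_ge0//; last by rewrite -mulrA mulr_ge0.
  rewrite powRVK ?gt_eqF//.
  apply: (@le_trans _ _ (\sum_(j < J) (8 * C * L) `^ s * u j `^ s)).
    apply: ler_sum => j _; rewrite powRM//; by rewrite -mulrA mulr_ge0.
  rewrite -mulr_sumr; apply: ler_wpM2l; first exact: powR_ge0.
  apply: le_trans (HS J); apply: ler_sum => j _; apply: powR_le1 => //.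
  by rewrite ge_min lexx.
- move=> k t t' kN t0 tt; exists (fun l => idx (pt t t' l)).
  apply: (le_trans (increment_cells k t0 tt)).
  pose A := An t t'; have mA : measurable A := mAn t t'.
  have ph0 j : (0 <= \int[mu]_(y in ball (c j) (r j) `&` A) (phi k y)%:E)%E.
    by apply: integral_ge0 => y _; rewrite lee_fin.
  apply: nneseries_le => [j|J]; first by rewrite lee_fin mulr_ge0// normc_ge0.
  apply: (@le_trans _ _ (\sum_(j < J) (\int[mu]_(y in ball (c j) (r j) `&` A) (psi k y)%:E +
     \sum_(l < 4) (if (j : nat) == idx (pt t t' l) then
       \int[mu]_(y in ball (c j) (r j) `&` A) (phi k y)%:E else 0)))%E).
    by apply: lee_sum => j _; exact: cell_increment.
  rewrite big_split/=; apply: leeD.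
    apply: (@sum_integral_disjoint _ _ R mu (fun j => ball (c j) (r j) `&` A) A
      (fun y => (psi k y)%:E) J).
    - by move=> i j _ _ [y [[Bi _] [Bj _]]]; exact: (tB Logic.I Logic.I (ex_intro _ y (conj Bi Bj))).
    - by move=> j; exact: (measurableI _ _ (mB j) mA).
    - exact: mA.
    - by move=> j; exact: subIsetr.
    - by apply/measurable_EFinP; exact: (measurable_funTS (mpsi k)).
    - by move=> y _; rewrite lee_fin.
  rewrite exchange_big/=; apply: lee_sum => l _.
  apply: (@le_trans _ _ (\int[mu]_(y in ball (c (idx (pt t t' l))) (r (idx (pt t t' l))) `&` A) (phi k y)%:E)%E); last first.
    by apply: leeDl; exact: ph0.
  set i := idx _.
  have [iJ|Ji] := ltnP i J.
    rewrite (bigD1 (Ordinal iJ))//= eqxx big1 ?adde0// => j /eqP ji.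
    by case: eqP => // ji'; exfalso; apply: ji; exact: val_inj.
  rewrite big1; first exact: ph0.
  by move=> j _; case: eqP => // ji; move: Ji; rewrite -ji leqNgt ltn_ord.
Qed.

End bad_part.

Section calderon_zygmund.
Context {R : realType}.
Local Notation mu := (@lebesgue_measure R).

Lemma normc_real (a : R) : normc (Complex a 0) = `|a|.
Proof. by rewrite normcE/= expr0n addr0 sqrtr_sqr. Qed.

(** Chebyshev's inequality at level 1 for the sum of the h j. *)
Lemma integral_le_nneseries (v : R -> R) (E : set R) (h : nat -> R -> \bar R) :
  measurable_fun setT v -> (forall x, 0 <= v x) -> (forall j, measurable_fun setT (h j)) ->
  (forall j x, 0 <= h j x)%E -> (forall x, E x -> 1 <= \sum_(j <oo) h j x)%E ->
  (\int[mu]_(x in E) (v x)%:E <= \sum_(j <oo) \int[mu]_x (h j x * (v x)%:E))%E.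
Proof.
move=> mv v0 mh h0 hE.
have hv0 j x : (0 <= h j x * (v x)%:E)%E by rewrite mule_ge0// lee_fin.
rewrite -integral_nneseries//; last first.
  by move=> j; apply: emeasurable_funM; [exact: mh|apply/measurable_EFinP].
rewrite [leLHS]integral_mkcond.
apply: (@int_le _ _ R mu setT) => x _; first exact: nneseries_ge0.
rewrite patchE; case: ifPn => [|_]; last exact: nneseries_ge0.
rewrite inE => /hE H.
apply: (@le_trans _ _ ((\sum_(j <oo) h j x) * (v x)%:E)%E).
  by rewrite -[leLHS]mul1e; apply: lee_wpmul2r => //; rewrite lee_fin.
by apply: nneseries_mulr_le => //; rewrite lee_fin.
Qed.

Section vector_norm_maximal.
Variables (F : R -> R) (M0 r0 I l : R).
Hypotheses (mF : measurable_fun setT F) (F0 : forall y, 0 <= F y).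
Hypotheses (FM : forall y, F y <= M0) (Fr : forall y, r0 < `|y| -> F y = 0).
Hypothesis IE : (\int[mu]_y (F y)%:E = I%:E)%E.
Hypothesis l0 : 0 < l.
Local Notation HF := (HLmax (fun y => (F y)%:E)).

(** A ball with average above l meets the support of [F] and is shorter than I / l. *)
Lemma HLmax_support x : (l%:E < HF x)%E -> `|x| <= r0 + I / l.
Proof.
move=> /Mx_gtP[n [Bx]]; rewrite HLmaxE => h.
have rn : 0 < qradius n :> R by exact: qradius_gt0.
have [y By yr] : exists2 y, qball n y & `|y| <= r0.
  apply: contrapT => H; move: h; apply/negP; rewrite -leNgt.
  rewrite integral0_eq ?mule0 ?lee_fin ?ltW// => y By; congr (_%:E); apply: Fr.
  by rewrite ltNge; apply/negP => yr; apply: H; exists y.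
have le : l * (2 * qradius n) < I.
  rewrite -lte_fin -IE.
  have : (l%:E < (2 * qradius n)^-1%:E * \int[mu]_y (F y)%:E)%E.
    apply: (lt_le_trans h); apply: lee_wpmul2l; first by rewrite lee_fin invr_ge0 mulr_ge0// ltW.
    apply: ge0_subset_integral => //.
    - by rewrite /qball; exact: measurable_ball.
    - exact/measurable_EFinP.
    - by move=> z _; rewrite lee_fin.
  rewrite IE -EFinM !lte_fin mulrC ltr_pdivlMr// mulr_gt0//.
have le2 : 2 * qradius n < I / l by rewrite ltr_pdivlMr// mulrC.
move: Bx By; rewrite /qball !ball_R/= => Bx By.
have := ler_normD (x - qcenter n) (qcenter n); rewrite subrK (distrC x) => h1.
have := ler_normD (qcenter n - y) y; rewrite subrK => h2; lra.
Qed.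

(** The endpoint c - r and the ball lie together in a rational ball of radius below 4 r, whose
    average is at most l. *)
Lemma HLmax_component_average (c r : R) : 0 < r -> ~ (l%:E < HF (c - r))%E ->
  (\int[mu]_(y in ball c r) (F y)%:E <= (8 * l * r)%:E)%E.
Proof.
move=> r0' H; have r2 : 0 < 2 * r by rewrite mulr_gt0.
have [n [sub rn]] := ball_sub_qball c r2.
have qn : 0 < qradius n :> R by exact: qradius_gt0.
have Be : qball n (c - r) by apply: sub; rewrite ball_R/= opprB addrC subrK gtr0_norm//; lra.
have h : ((2 * qradius n)^-1%:E * \int[mu]_(y in qball n) (F y)%:E <= l%:E)%E.
  rewrite -HLmaxE; apply: (le_trans (Mx_ub (cst 1) (fun y => (F y)%:E) Be)).
  by rewrite leNgt; exact/negP.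
have h2 : (\int[mu]_(y in qball n) (F y)%:E <= (l * (2 * qradius n))%:E)%E.
  move: h; rewrite lee_pdivrMl; last by rewrite mulr_gt0.
  by rewrite [l * _]mulrC EFinM.
apply: (@le_trans _ _ (\int[mu]_(y in qball n) (F y)%:E)%E).
  apply: ge0_subset_integral => //.
  - exact: measurable_ball.
  - by rewrite /qball; exact: measurable_ball.
  - by apply/measurable_EFinP; exact: measurable_funTS.
  - by move=> z _; rewrite lee_fin.
  - move=> y By; apply: sub; move: By; rewrite !ball_R/= => h3; lra.
apply: (le_trans h2); rewrite lee_fin.
have -> : 8 * l * r = l * (2 * (2 * (2 * r))) by ring.
by apply: ler_wpM2l; [exact: ltW|lra].
Qed.

(** Lebesgue's differentiation theorem. The averages over centred balls are at most 2 l, since each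
    such ball lies in a rational one of less than twice the radius. *)
Lemma le_of_HLmax : \forall x \ae mu, ~ (l%:E < HF x)%E -> F x <= 2 * l.
Proof.
have LF : locally_integrable setT F.
  split => //; first exact: openT.
  move=> A _ _; apply: (@le_lt_trans _ _ (\int[mu]_y (F y)%:E)%E); last by rewrite IE ltry.
  rewrite integral_mkcond; apply: int_le => y _; first by rewrite lee_fin.
  by rewrite patchE; case: ifP; rewrite ?lee_fin// ger0_norm.
apply: (ae_mono _ (lebesgue_differentiation LF)) => x Lx Hx.
rewrite leNgt; apply/negP => lt.
have : (((F x - 2 * l)%:E : \bar R) <= 0)%E.
  apply: (@cvge_ge _ _ _ _ _ 0%E _ _ Lx).
  near=> r.
  have r0' : 0 < r by near: r; exact: nbhs_right_gt.
  have mB : measurable (ball x r) by exact: measurable_ball.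
  have [n [sub rn]] := ball_sub_qball x r0'.
  have qn : 0 < qradius n :> R by exact: qradius_gt0.
  have Be : qball n x by apply: sub; exact: ballxx.
  have h : ((2 * qradius n)^-1%:E * \int[mu]_(y in qball n) (F y)%:E <= l%:E)%E.
    rewrite -HLmaxE; apply: (le_trans (Mx_ub (cst 1) (fun y => (F y)%:E) Be)).
    by rewrite leNgt; exact/negP.
  have h2 : (\int[mu]_(y in qball n) (F y)%:E <= (l * (2 * qradius n))%:E)%E.
    move: h; rewrite lee_pdivrMl; last by rewrite mulr_gt0.
    by rewrite [l * _]mulrC EFinM.
  have h3 : (\int[mu]_(y in ball x r) (F y)%:E <= (2 * l * (2 * r))%:E)%E.
    apply: (@le_trans _ _ (\int[mu]_(y in qball n) (F y)%:E)%E).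
      apply: ge0_subset_integral => //.
      - by rewrite /qball; exact: measurable_ball.
      - by apply/measurable_EFinP; exact: measurable_funTS.
      - by move=> z _; rewrite lee_fin.
    apply: (le_trans h2); rewrite lee_fin.
    have -> : 2 * l * (2 * r) = l * (2 * (2 * r)) by ring.
    by apply: ler_wpM2l; [exact: ltW|lra].
  have mc : measurable_fun (ball x r) (fun y => `|F y - F x|).
    by apply: measurable_funTS; apply: measurableT_comp => //; apply: measurable_funB.
  have h4 : ((F x * (2 * r))%:E <= \int[mu]_(y in ball x r) (`|F y - F x|)%:E +
      \int[mu]_(y in ball x r) (F y)%:E)%E.
    rewrite -ge0_integralD; last 5 first.
    - exact: mB.
    - by move=> y _; rewrite lee_fin.
    - exact/measurable_EFinP.
    - by move=> y _; rewrite lee_fin.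
    - by apply/measurable_EFinP; exact: measurable_funTS.
    rewrite EFinM -(lebesgue_ball x (ltW r0')) -(integral_cst mu mB).
    apply: int_le => y _; first by rewrite -EFinD lee_fin addr_ge0.
    by rewrite -EFinD lee_fin /=; have := ler_norm (F x - F y); rewrite distrC => ?; lra.
  rewrite /davg /iavg lebesgue_ball; last exact: ltW.
  have r2 : 0 < 2 * r by rewrite mulr_gt0.
  have -> : ((2 * r)%:E^-1 = (2 * r)^-1%:E :> \bar R)%E by rewrite inver gt_eqF.
  have -> : (F x - 2 * l)%:E = ((2 * r)^-1%:E * ((F x - 2 * l) * (2 * r))%:E)%E.
    rewrite -EFinM; congr (_%:E); field; by rewrite gt_eqF.
  apply: lee_wpmul2l; first by rewrite lee_fin invr_ge0 ltW.
  have -> : ((F x - 2 * l) * (2 * r))%:E = ((F x * (2 * r))%:E - (2 * l * (2 * r))%:E)%E.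
    by rewrite -EFinB mulrBl.
  rewrite leeBlDr//; apply: (le_trans h4); apply: leeD => //.
by rewrite lee_fin; lra.
Unshelve. all: by end_near.
Qed.

End vector_norm_maximal.

Variables (rho : R) (rho1 : 1 < rho) (f : nat -> R -> R[i]) (N : nat) (l : R).
Hypotheses (nf : forall k, nice (f k)) (l0 : 0 < l).
Local Notation F := (vec_norm rho N f).
Local Notation Om := [set x | (l%:E < HLmax (fun y => (F y)%:E) x)%E].

(* The balls are the components of the level set of the maximal function of the vector norm, so that the endpoint of each ball lies outside it. The bad part [b] is the oscillation on these balls. *)
Lemma calderon_zygmund_decomposition :
  exists (c r : nat -> R) (g b : nat -> R -> R[i]),
    [/\ forall j, 0 <= r j, trivIset setT (fun j => ball (c j) (r j)) &
        Om = \bigcup_j ball (c j) (r j)] /\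
    [/\ forall k, nice (g k), forall k, nice (b k),
        forall k y, f k y = g k y + b k y,
        forall k y, ~ (\bigcup_j ball (c j) (r j)) y -> b k y = 0 &
        forall k j, cintegral (ball (c j) (r j)) (b k) = 0] /\
    [/\ forall j, (\int[mu]_(y in ball (c j) (r j)) (vec_norm rho N b y)%:E <=
          (24 * l * r j)%:E)%E,
        \forall y \ae mu, vec_norm rho N g y <= 8 * l,
        forall y, ~ Om y -> vec_norm rho N g y = F y &
        forall y, Om y -> vec_norm rho N g y <= 8 * l].
Proof.
have [M0 [r0 [M00 r00 FM Fr]]] := vec_norm_bounded rho1 N nf.
pose I := fine (\int[mu]_y (F y)%:E).
have IE : (\int[mu]_y (F y)%:E = I%:E)%E.
  rewrite fineK// ge0_fin_numE ?(vec_norm_integrable rho1 N nf)//.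
  by apply: integral_ge0 => y _; rewrite lee_fin vec_norm_ge0.
have F0 y : 0 <= F y by exact: vec_norm_ge0.
have mF : measurable_fun setT F by apply: measurable_vec_norm => k; have [] := nf k.
have oOm : open Om by exact: lsc_Mx.
have [c [r [rj0 tB OmE Hend]]] := open_components oOm (HLmax_support mF F0 Fr IE l0).
pose B j := ball (c j) (r j).
have mB j : measurable (B j) by exact: measurable_ball.
have FB j : (\int[mu]_(y in B j) (F y)%:E <= (8 * l * r j)%:E)%E.
  have [rj|rj] := ltP 0 (r j).
    by apply: (HLmax_component_average mF F0 l0 rj); have [] := Hend j rj.
  by rewrite /B ball_nonpos// integral_set0 lee_fin !mulr_ge0// ltW.
have icf k j : cintegrable (B j) (f k).
  exact: (cintegrableS measurableT (mB j) (@subsetT _ _) (nice_cintegrable (nf k))).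
pose av k j : R[i] := Complex (2 * r j)^-1 0 * cintegral (B j) (f k).
pose idx := cell_index B.
have idxE j y : B j y -> idx y = j by exact: (@cell_indexE R B j y tB).
have mOm : measurable Om by exact: open_measurable.
have bOm : measurable_fun setT (fun y => `[< Om y >]).
  apply: (measurable_fun_bool true); rewrite setTI.
  by rewrite [X in measurable X](_ : _ = Om)//; apply/seteqP; split => y /= /asboolP.
pose g k y := if `[< Om y >] then av k (idx y) else f k y.
pose b k y := f k y - g k y.
have avE k j : 0 < r j -> ((normc (av k j))%:E <= \int[mu]_(y in B j) ((r j)^-1 * normc (f k y))%:E)%E.
  move=> rj; have rV : 0 <= (r j)^-1 by rewrite invr_ge0.
  rewrite /av Normc.normcM normc_real ger0_norm; last by rewrite invr_ge0 mulr_ge0.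
  rewrite EFinM.
  apply: (@le_trans _ _ ((2 * r j)^-1%:E * (2%:E * \int[mu]_(y in B j) (normc (f k y))%:E))%E).
    apply: lee_wpmul2l; first by rewrite lee_fin invr_ge0 mulr_ge0.
    by apply: cintegral_le => //; exact: (cintegrable_cmeas (icf k j)).
  rewrite muleA -EFinM; have -> : (2 * r j)^-1 * 2 = (r j)^-1 by field; rewrite gt_eqF.
  rewrite -ge0_integralZl_EFin; last 4 first.
  - exact: mB.
  - by move=> y _; rewrite lee_fin normc_ge0.
  - apply/measurable_EFinP; apply: measurable_funTS; apply: cmeasurable_normc; by have [] := nf k.
  - exact: rV.
  by apply: int_le => y _; rewrite -?EFinM lee_fin// mulr_ge0 ?normc_ge0.
(* Minkowski's inequality compares the norm of the vector of averages with the integral of the norm;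
   the 2 of [cintegral_le] cancels against the length 2 r j. *)
have avF j : 0 < r j -> lpn rho N (fun k => normc (av k j)) <= 8 * l.
  move=> rj; have rV : 0 <= (r j)^-1 by rewrite invr_ge0.
  rewrite -lee_fin.
  apply: (@le_trans _ _ (\int[mu]_(y in B j) (lpn rho N (fun k => (r j)^-1 * normc (f k y)))%:E)%E).
    apply: (@lpn_integral _ _ R mu rho N (fun k => normc (av k j))
      (fun k y => (r j)^-1 * normc (f k y)) (B j) (ltW rho1) (mB j)).
    - move=> k _; apply: measurable_funM => //; apply: measurable_funTS.
      by apply: cmeasurable_normc; have [] := nf k.
    - by move=> k y _ _; rewrite mulr_ge0 ?normc_ge0.
    - by move=> k _; exact: normc_ge0.
    - by move=> k _; exact: avE.
  apply: (@le_trans _ _ (\int[mu]_(y in B j) ((r j)^-1%:E * (F y)%:E))%E).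
    apply: int_le => y _; first by rewrite mule_ge0// lee_fin.
    rewrite lpn_Z//; first exact: lt_trans ltr01 rho1.
    by move=> k _; exact: normc_ge0.
  rewrite ge0_integralZl_EFin; last 4 first.
  - exact: mB.
  - by move=> y _; rewrite lee_fin.
  - by apply/measurable_EFinP; exact: (measurable_funTS mF).
  - exact: rV.
  apply: (le_trans (lee_wpmul2l _ (FB j))); first by rewrite lee_fin.
  rewrite -EFinM lee_fin le_eqVlt; apply/orP; left; apply/eqP; field; rewrite gt_eqF//.
have OmB y : Om y -> exists2 j, B j y & 0 < r j.
  rewrite OmE => -[j _ By]; exists j => //.
  by rewrite ltNge; apply/negP => rj; move: By; rewrite /B ball_nonpos.
have gOm k y j : B j y -> g k y = av k j.
  move=> By; rewrite /g; case: asboolP => [_|H]; first by rewrite (idxE j).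
  by exfalso; apply: H; rewrite OmE; exists j.
have gC k y : ~ Om y -> g k y = f k y by move=> H; rewrite /g; case: asboolP.
have ng k : nice (g k).
  have [mf [M [r1 [M1 r10 fM fr]]]] := nf k.
  have mcell (h : nat -> R) : measurable_fun setT (fun y => h (idx y)) by exact: measurable_cell_fun.
  split.
    split.
      have -> : (fun y => complex.Re (g k y)) =
          (fun y => if `[< Om y >] then complex.Re (av k (idx y)) else complex.Re (f k y)).
        by apply/funext => y; rewrite /g; case: ifP.
      apply: measurable_fun_ifT => //; first exact: (mcell (fun j => complex.Re (av k j))).
      exact: mf.1.
    have -> : (fun y => complex.Im (g k y)) =
        (fun y => if `[< Om y >] then complex.Im (av k (idx y)) else complex.Im (f k y)).
      by apply/funext => y; rewrite /g; case: ifP.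
    apply: measurable_fun_ifT => //; first exact: (mcell (fun j => complex.Im (av k j))).
    exact: mf.2.
  exists (2 * M), (Num.max r1 (r0 + I / l)); split.
  - by rewrite mulr_gt0.
  - by rewrite lt_max r10.
  - move=> y; have [Oy|Oy] := pselect (Om y); last by rewrite gC//; have := fM y; lra.
    have [j By rj] := OmB y Oy; rewrite (gOm k y j By) -lee_fin.
    apply: (le_trans (avE k j rj)).
    apply: (@le_trans _ _ (\int[mu]_(y in B j) (cst ((r j)^-1 * M)%:E y))%E).
      apply: int_le => z _; first by rewrite lee_fin mulr_ge0 ?invr_ge0// ltW.
      by rewrite lee_fin; apply: ler_wpM2l; rewrite ?invr_ge0.
    apply: (@le_trans _ _ (((r j)^-1 * M)%:E * mu (ball (c j) (r j)))%E).
      by rewrite -(integral_cst mu (mB j)) lexx.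
    rewrite (lebesgue_ball (c j) (rj0 j)) -EFinM lee_fin.
    by rewrite le_eqVlt; apply/orP; left; apply/eqP; field; rewrite gt_eqF.
  - move=> y; rewrite gt_max => /andP[h1 h2]; rewrite gC ?fr// => Oy.
    by have := HLmax_support mF F0 Fr IE l0 Oy; rewrite leNgt h2.
have nb k : nice (b k).
  have [mg [M [r1 [M1 r10 gM gr]]]] := ng k.
  have nN : nice (fun y => - g k y).
    split.
      have reN (z : R[i]) : complex.Re (- z) = - complex.Re z by case: z.
      have imN (z : R[i]) : complex.Im (- z) = - complex.Im z by case: z.
      split.
        under [X in measurable_fun _ X]eq_fun do rewrite reN.
        by apply: measurableT_comp => //; exact: mg.1.
      under [X in measurable_fun _ X]eq_fun do rewrite imN.
      by apply: measurableT_comp => //; exact: mg.2.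
    exists M, r1; split => // y; first by rewrite normcN.
    by move=> /gr ->; rewrite oppr0.
  exact: (niceD (nf k) nN).
have vg y : Om y -> vec_norm rho N g y <= 8 * l.
  move=> Oy; have [j By rj] := OmB y Oy; apply: le_trans (avF j rj).
  apply: le_lpn; first exact: lt_trans ltr01 rho1.
  by move=> k _; rewrite normc_ge0/= (gOm k y j By).
have vgC y : ~ Om y -> vec_norm rho N g y = F y.
  by move=> Oy; rewrite /vec_norm; congr lpn; apply/funext => k; rewrite gC.
exists c, r, g, b; split; [|split] => //.
- split => //.
  + by move=> k y; rewrite /b addrC subrK.
  + by move=> k y; rewrite -OmE => Oy; rewrite /b gC// subrr.
  + move=> k j; have [rj|rj] := ltP 0 (r j); last first.
      rewrite ball_nonpos// /cintegral !Rintegral_set0; reflexivity.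
    have ig : cintegrable (B j) (g k).
      exact: (cintegrableS measurableT (mB j) (@subsetT _ _) (nice_cintegrable (ng k))).
    rewrite [LHS](cintegralB (mB j) (icf k j) ig).
    suff -> : cintegral (B j) (g k) = cintegral (B j) (f k) by rewrite subrr.
    have cE (p : R[i] -> R) : \int[mu]_(y in B j) p (g k y) = p (av k j) * (2 * r j).
      rewrite (@eq_Rintegral _ _ _ mu (B j) (fun=> p (av k j))); last first.
        by move=> y; rewrite inE => By; rewrite (gOm k y j By).
      have mBE : fine (mu (B j)) = 2 * r j by rewrite /B (lebesgue_ball (c j) (rj0 j)).
      rewrite -mBE; exact: (@Rintegral_cst _ _ R mu (B j) (mB j) (p (av k j))).
    have r2 : 2 * r j != 0 by rewrite gt_eqF// mulr_gt0.
    apply/eqP; rewrite eq_complex {1 3}/cintegral /= (cE (fun z => complex.Re z)) (cE (fun z => complex.Im z)).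
    rewrite /av Re_mul Im_mul /= !mul0r subr0 addr0.
    by rewrite ![(2 * r j)^-1 * _]mulrC !divfK//; apply/andP.
- split => //.
  + move=> j; apply: (@le_trans _ _ (\int[mu]_(y in B j) ((F y)%:E + (8 * l)%:E))%E).
      apply: int_le => y By; first by rewrite adde_ge0// lee_fin// mulr_ge0// ltW.
      rewrite -EFinD lee_fin; apply: (le_trans (vec_normB rho1 N f g y)).
      by rewrite lerD2l; apply: vg; rewrite OmE; exists j.
    have l80 : 0 <= 8 * l by rewrite mulr_ge0// ltW.
    rewrite ge0_integralD; last 5 first.
    * exact: mB.
    * by move=> y _; rewrite lee_fin.
    * by apply/measurable_EFinP; exact: (measurable_funTS mF).
    * by move=> y _; rewrite lee_fin.
    * exact: measurable_cst.
    (* The first summand bounds the mass of f, the second that of g, which is at most 8 l on an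
       interval of length 2 r j. *)
    have -> : 24 * l * r j = 8 * l * r j + 8 * l * (2 * r j) by ring.
    rewrite EFinD; apply: leeD; first exact: FB.
    by rewrite [leRHS]EFinM -(lebesgue_ball (c j) (rj0 j)) -(integral_cst mu (mB j)).
  + apply: (ae_mono _ (le_of_HLmax mF F0 IE l0)) => y Hy.
    have [Oy|Oy] := pselect (Om y); first exact: vg.
    rewrite vgC//; apply: (le_trans (Hy Oy)); apply: ler_wpM2r; first exact: ltW.
    by rewrite ler_nat.
Qed.

End calderon_zygmund.

(** * Weak type (1, 1) from strong type (p, p) *)

Section weak_type.
Context {R : realType}.
Local Notation mu := (@lebesgue_measure R).
Variables (q rho delta C : R) (K : R -> R -> R[i]).
Hypotheses (q1 : 1 < q) (rho1 : 1 < rho) (delta0 : 0 < delta) (C0 : 0 < C).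
Hypothesis Ksize : forall x y, x != y -> normc (K x y) <= C / `|x - y|.
Hypothesis Kx : forall x y z, 2 * `|x - z| < `|x - y| ->
  normc (K x y - K z y) <= C * `|x - z| `^ delta / `|x - y| `^ (1 + delta).
Hypothesis Ky : forall x y z, 2 * `|x - z| < `|x - y| ->
  normc (K y x - K y z) <= C * `|x - z| `^ delta / `|x - y| `^ (1 + delta).
Variables (v : R -> R) (A : R).
Hypothesis Av : A1_ball v A.

Let q1' : 1 <= q. Proof. exact: ltW. Qed.
Let mv : measurable_fun setT v := A1_meas Av.
Let v0 x : 0 < v x := A1_gt0 Av x.
Let mvE (D : set R) : measurable_fun D (fun x => (v x)%:E).
Proof. by apply/measurable_EFinP; exact: (measurable_funTS mv). Qed.
Let s := Num.min q rho.
Let s1 : 1 < s. Proof. by rewrite lt_min q1. Qed.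

Definition strong_type (p : R) (w : R -> R) (N : nat) (D : R) :=
  forall f : nat -> R -> R[i], (forall k, nice (f k)) ->
  (\int[mu]_x (vec_op q rho K N f x `^ p * (w x)%:E) <=
   D%:E * \int[mu]_x (vec_norm rho N f x `^ p * w x)%:E)%E.

Definition weak_type (w : R -> R) (N : nat) (D : R) :=
  forall (f : nat -> R -> R[i]) (l : R), (forall k, nice (f k)) -> 0 < l ->
  (\int[mu]_(x in [set x | l%:E < vec_op q rho K N f x]) (w x)%:E <=
   (D / l)%:E * \int[mu]_x (vec_norm rho N f x * w x)%:E)%E.

Lemma threshold_aux (a b l th t : R) : 0 <= a -> 0 <= l -> th <= t -> (a + b) * t <= 1 ->
  a * l * th + b * l * t <= l.
Proof.
move=> a0 l0' tht h.
have h1 : a * l * th <= a * l * t by apply: ler_wpM2l => //; exact: mulr_ge0.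
have h2 : (a + b) * t * l <= 1 * l by apply: ler_wpM2r.
lra.
Qed.

Lemma bad_part_threshold : exists2 th : R, 0 < th &
  forall l, 0 <= l -> 4 * C * (24 * l) * th + 64 * C * (24 * l) * th `^ s^-1 <= l.
Proof.
have s0 : 0 < s := lt_trans ltr01 s1.
have a0 : 0 < 4 * C * 24 by rewrite !mulr_gt0.
have b0 : 0 < 64 * C * 24 by rewrite !mulr_gt0.
have := a0; have := b0; move: (4 * C * 24) (64 * C * 24) (mulrA (4 * C) 24) (mulrA (64 * C) 24).
move=> a b aE bE b0' a0'.
have k0 : 0 < a + b by exact: addr_gt0.
have [t t0 [t1 tC]] : exists2 t : R, 0 < t & t <= 1 /\ (a + b) * t <= 1.
  exists (Num.min 1 (a + b)^-1); first by rewrite lt_min ltr01 invr_gt0.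
  split; first by rewrite ge_min lexx.
  by rewrite mulrC -ler_pdivlMr// div1r ge_min lexx orbT.
exists (t `^ s); first exact: powR_gt0.
move=> l l0; rewrite powRK ?gt_eqF//; last exact: ltW.
have h : t `^ s <= t.
  rewrite -[leRHS](powRr1 (ltW t0)); exact: (powR_le1 (ltW t0) t1 ltr01 (ltW s1)).
rewrite aE bE; exact: (threshold_aux (ltW a0') l0 h tC).
Qed.

Lemma A1_dilate : exists2 D, 0 < D & forall c r : R, 0 <= r ->
  (\int[mu]_(x in ball c (4 * r)) (v x)%:E <= D%:E * \int[mu]_(x in ball c r) (v x)%:E)%E.
Proof.
have dv := @Ap_doubling R 2 v A (ltr1n R 2) (A1_Ap_ball Av (ltr1n R 2)).
set D := A * _ in dv.
have D0 : 0 < D by rewrite mulr_gt0 ?powR_gt0// (A1_const Av).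
exists (D * D); first exact: mulr_gt0.
move=> c r; rewrite le_eqVlt => /predU1P[<-|r0].
  by rewrite mulr0 ball_nonpos// integral_set0 mule0.
have r3 : 0 < 3 * r by rewrite mulr_gt0.
apply: (@le_trans _ _ (\int[mu]_(x in ball c (3 * (3 * r))) (v x)%:E)%E).
  apply: ge0_subset_integral.
  - exact: measurable_ball.
  - exact: measurable_ball.
  - exact: mvE.
  - by move=> x _; rewrite lee_fin ltW.
  - by move=> x; rewrite !ball_R/= => h; lra.
apply: (le_trans (dbl_le dv c r3)); rewrite [(D * D)%:E]EFinM -muleA; apply: lee_wpmul2l.
  by rewrite lee_fin ltW.
exact: (dbl_le dv c r0).
Qed.

Lemma ge0_integral_setU_le (X Y : set R) (h : R -> \bar R) : measurable X -> measurable Y ->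
  measurable_fun setT h -> (forall x, 0 <= h x)%E ->
  (\int[mu]_(x in X `|` Y) h x <= \int[mu]_(x in X) h x + \int[mu]_(x in Y) h x)%E.
Proof.
move=> mX mY mh h0.
have r0 (Z : set R) x : (0 <= (h \_ Z) x)%E by rewrite patchE; case: ifP.
have mr (Z : set R) : measurable Z -> measurable_fun setT (h \_ Z).
  by move=> mZ; have [k _] := measurable_restrictT h mZ; apply: k; exact: (measurable_funTS mh).
rewrite integral_mkcond [X in (_ <= X + _)%E]integral_mkcond [X in (_ <= _ + X)%E]integral_mkcond.
rewrite -ge0_integralD; last 5 first.
- exact: measurableT.
- by move=> x _; exact: r0.
- exact: mr.
- by move=> x _; exact: r0.
- exact: mr.
apply: int_le => x _; first exact: adde_ge0.
rewrite !patchE in_setU; case: (x \in X) => /=; first by rewrite leeDl//; case: ifP.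
by rewrite add0e.
Qed.

(** At level 2 l, half goes to the good part, treated by Chebyshev's inequality and |g|^p <= (8
    l)^(p - 1) |g|. Off the dilated balls, T b > l forces the sum of the (r j / |x - c j|)^(1 + e)
    above [th] by [vec_op_bad_le]; Chebyshev and [A1_tail] bound the weight of this set by that of
    the level set of the maximal function. *)
Lemma weak_type_of_strong_type (p D : R) : 1 < p -> 0 <= D ->
  exists2 D', 0 <= D' & forall N, strong_type p v N D -> weak_type v N D'.
Proof.
move=> p1 D0.
have p0 : 0 < p := lt_trans ltr01 p1.
have [th th0 thP] := bad_part_threshold.
have [D1 D10 weakM] := A1_weak_type Av.
have [D2 D20 dil] := A1_dilate.
(* 1 + e is the exponent of the sum in [vec_op_bad_le]; it exceeds 1 because s > 1, so the tails are
   integrable. *)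
pose e := Num.min s (1 + delta) - 1.
have e0 : 0 < e by rewrite subr_gt0 lt_min s1 ltrDl.
have eE : Num.min s (1 + delta) = 1 + e by rewrite /e [RHS]addrC subrK.
have [D3 D30 tail] := A1_tail Av e0.
pose G := D * 8 `^ (p - 1) * (1 + 8 * D1) + (D2 + th^-1 * D3) * D1.
have G0 : 0 <= G.
  have : 0 <= D * 8 `^ (p - 1) * (1 + 8 * D1).
    by rewrite !mulr_ge0 ?powR_ge0// addr_ge0// mulr_ge0// ltW.
  have : 0 <= (D2 + th^-1 * D3) * D1.
    by rewrite mulr_ge0 ?ltW// addr_gt0// mulr_gt0 ?invr_gt0.
  rewrite /G; lra.
exists (2 * G); first by rewrite mulr_ge0.
move=> N strong f l2 nf l20.
have [l l0 lE] : exists2 l : R, 0 < l & l2 = 2 * l by exists (l2 / 2); lra.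
have [c [r [g [b [[rj0 tB OmE] [[ng nb fgb b0 bc] [bL gl gOmC gOm]]]]]]] :=
  @calderon_zygmund_decomposition R rho rho1 f N l nf l0.
pose F := vec_norm rho N f; pose IF := (\int[mu]_x (F x * v x)%:E)%E.
pose Om := [set x | (l%:E < HLmax (fun y => (F y)%:E) x)%E].
have F0 y : 0 <= F y by exact: vec_norm_ge0.
have mF : measurable_fun setT F by apply: measurable_vec_norm => k; have [] := nf k.
have mFE : measurable_fun setT (fun y => (F y)%:E) by exact/measurable_EFinP.
have mOm : measurable Om by exact: (measurable_lt _ (measurable_Mx _ _)).
have vOm : (\int[mu]_(x in Om) (v x)%:E <= (D1 / l)%:E * IF)%E.
  apply: (le_trans (weakM (fun y => (F y)%:E) l mFE _ l0)); first by move=> x; rewrite lee_fin.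
  by apply: lee_wpmul2l => //; rewrite lee_fin divr_ge0// ltW.
have IF0 : (0 <= IF)%E by apply: integral_ge0 => x _; rewrite lee_fin mulr_ge0// ltW.
have mB j : measurable (ball (c j) (r j)) by exact: measurable_ball.
pose T := vec_op q rho K N.
have mT h : (forall k, nice (h k)) -> measurable_fun setT (T h).
  by move=> nh; exact: (measurable_vec_op q1' rho1 delta0 C0 Ksize Kx Ky N nh).
have T0 h x : (0 <= T h x)%E by exact: lpe_ge0.
pose E1 := [set x | (l%:E < T g x)%E]; pose E2 := [set x | (l%:E < T b x)%E].
pose E3 := \bigcup_j ball (c j) (4 * r j).
have mE1 : measurable E1 by exact: measurable_lt (mT _ ng).
have mE2 : measurable E2 by exact: measurable_lt (mT _ nb).
have mE3 : measurable E3 by apply: bigcup_measurable => j _; exact: measurable_ball.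
have sub : [set x | (l2%:E < T f x)%E] `<=` E1 `|` (E2 `|` E3).
  move=> x /= lt; apply: contrapT => H.
  have h1 : (T g x <= l%:E)%E by rewrite leNgt; apply/negP => ?; apply: H; left.
  have h2 : (T b x <= l%:E)%E by rewrite leNgt; apply/negP => ?; apply: H; right; left.
  have fE : f = (fun k y => g k y + b k y).
    by apply/funext => k; apply/funext => y; exact: fgb.
  have le : (T f x <= l2%:E)%E.
    rewrite fE; apply: (le_trans (vec_opD q1' rho1 delta0 C0 Ksize Ky N x ng nb)).
    have -> : l2%:E = (l%:E + l%:E)%E by rewrite -EFinD lE; congr (_%:E); ring.
    exact: (leeD h1 h2).
  by move: lt; rewrite ltNge le.
pose Gn := vec_norm rho N g.
have Gn0 y : 0 <= Gn y by exact: vec_norm_ge0.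
have mGn : measurable_fun setT Gn by apply: measurable_vec_norm => k; have [] := ng k.
have Fv0 x : 0 <= F x * v x := mulr_ge0 (F0 x) (ltW (v0 x)).
have Gv0 x : 0 <= Gn x * v x := mulr_ge0 (Gn0 x) (ltW (v0 x)).
(* Off [Om] the norms of g and f agree; on [Om] the norm of g is at most 8 l, and the weight of [Om]
   is at most D1 / l times the integral of f. *)
have IG : (\int[mu]_x (Gn x * v x)%:E <= (1 + 8 * D1)%:E * IF)%E.
  apply: (@le_trans _ _ (\int[mu]_x ((F x * v x)%:E + (8 * l)%:E * ((\1_Om x)%:E * (v x)%:E)))%E).
    apply: int_le => x _.
      apply: adde_ge0; first by rewrite lee_fin; exact: Fv0.
      by rewrite !mule_ge0// lee_fin ?mulr_ge0 ?ltW.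
    have [Ox|Ox] := pselect (Om x).
      rewrite indicE mem_set// mul1e -EFinM -EFinD lee_fin.
      have := gOm x Ox => h; have := ler_wpM2r (ltW (v0 x)) h => h2.
      by apply: (le_trans h2); rewrite lerDr; exact: Fv0.
    by rewrite indicE memNset// mul0e mule0 adde0 lee_fin /Gn gOmC.
  rewrite ge0_integralD; last 5 first.
  - exact: measurableT.
  - by move=> x _; rewrite lee_fin; exact: Fv0.
  - by apply/measurable_EFinP; exact: (measurable_funM mF mv).
  - by move=> x _; rewrite ?mule_ge0// lee_fin ?mulr_ge0// ltW.
  - apply: measurable_funeM; apply: emeasurable_funM; last exact: mvE.
    by apply/measurable_EFinP; exact: measurable_indic.
  rewrite ge0_integralZl_EFin; last 4 first.
  - exact: measurableT.
  - by move=> x _; rewrite mule_ge0// lee_fin// ltW.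
  - apply: emeasurable_funM; last exact: mvE.
    by apply/measurable_EFinP; exact: measurable_indic.
  - by rewrite mulr_ge0// ltW.
  have -> : (1 + 8 * D1)%:E = (1%:E + (8 * l)%:E * (D1 / l)%:E)%E.
    by rewrite -EFinM -EFinD; congr (_%:E); field; rewrite gt_eqF.
  rewrite ge0_muleDl; last 2 first.
  - by rewrite lee_fin.
  - by rewrite -EFinM lee_fin !mulr_ge0 ?invr_ge0// ltW.
  rewrite mul1e; apply: leeD; first exact: lexx.
  rewrite -muleA; apply: lee_wpmul2l; first by rewrite lee_fin mulr_ge0// ltW.
  apply: le_trans vOm; rewrite [leRHS]integral_mkcond; apply: (@int_le _ _ R mu setT) => x _.
    by rewrite patchE; case: ifP => // _; rewrite lee_fin ltW.
  rewrite patchE indicE; case: ifP => _; by rewrite ?mul1e ?mul0e.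
have B1 : (\int[mu]_(x in E1) (v x)%:E <= (D * 8 `^ (p - 1) * (1 + 8 * D1) / l)%:E * IF)%E.
  have lp0 : 0 < l `^ p by exact: powR_gt0.
  apply: (@le_trans _ _ ((l `^ p)^-1%:E * \int[mu]_x (T g x `^ p * (v x)%:E))%E).
    rewrite -ge0_integralZl_EFin; last 4 first.
    - exact: measurableT.
    - by move=> x _; rewrite mule_ge0 ?poweR_ge0// lee_fin ltW.
    - apply: emeasurable_funM; last exact: mvE.
      by apply: measurableT_comp (measurable_poweR _) (mT _ ng).
    - by rewrite invr_ge0 ltW.
    rewrite [leLHS]integral_mkcond; apply: (@int_le _ _ R mu setT) => x _.
      by rewrite !mule_ge0 ?poweR_ge0// lee_fin ?invr_ge0 ltW.
    rewrite patchE; case: ifPn => [|_]; last first.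
      by rewrite !mule_ge0 ?poweR_ge0// lee_fin ?invr_ge0 ltW.
    rewrite inE /E1/= => lT.
    rewrite muleA -[leLHS]mul1e; apply: lee_wpmul2r; first by rewrite lee_fin ltW.
    have -> : (1%:E = (l `^ p)^-1%:E * (l%:E `^ p))%E.
      by rewrite poweR_EFin -EFinM mulVf ?gt_eqF.
    apply: lee_wpmul2l; first by rewrite lee_fin invr_ge0 ltW.
    by apply: le_poweR; [exact: ltW|rewrite lee_fin ltW|exact: ltW].
  have := strong g ng => h.
  apply: (le_trans (lee_wpmul2l _ h)); first by rewrite lee_fin invr_ge0 ltW.
  have l8 : 0 < 8 * l by rewrite mulr_gt0.
  have H : (\int[mu]_x (Gn x `^ p * v x)%:E <= ((8 * l) `^ (p - 1))%:E * \int[mu]_x (Gn x * v x)%:E)%E.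
    rewrite -ge0_integralZl_EFin; last 4 first.
    - exact: measurableT.
    - by move=> x _; rewrite lee_fin; exact: Gv0.
    - by apply/measurable_EFinP; exact: (measurable_funM mGn mv).
    - exact: powR_ge0.
    apply: ae_ge0_le_integral.
    - exact: measurableT.
    - by move=> x _; rewrite lee_fin mulr_ge0 ?powR_ge0// ltW.
    - apply/measurable_EFinP.
      exact: (measurable_funM (measurableT_comp (measurable_powR p) mGn) mv).
    - by move=> x _; rewrite -EFinM lee_fin; exact: (mulr_ge0 (powR_ge0 _ _) (Gv0 x)).
    - by apply: measurable_funeM; apply/measurable_EFinP; apply: measurable_funM.
    - apply: (ae_mono _ gl) => x Hx _; rewrite -EFinM lee_fin mulrA.
      apply: ler_wpM2r; first exact: ltW.
      have [->|gn] := eqVneq (Gn x) 0; first by rewrite powR0 ?gt_eqF// mulr0.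
      have gp : 0 < Gn x by rewrite lt_def gn Gn0.
      have -> : Gn x `^ p = Gn x `^ (p - 1) * Gn x.
        rewrite -{3}[Gn x](powRr1 (ltW gp)) -powRD ?subrK//.
        by rewrite (gt_eqF gp) implybT.
      apply: ler_wpM2r; first exact: ltW.
      by apply: le_powR; [rewrite subr_ge0 ltW|exact: Gn0|exact: Hx].
  apply: (@le_trans _ _ ((l `^ p)^-1%:E * (D%:E * (((8 * l) `^ (p - 1))%:E * ((1 + 8 * D1)%:E * IF))))%E).
    apply: lee_wpmul2l; first by rewrite lee_fin invr_ge0 ltW.
    apply: lee_wpmul2l; first by rewrite lee_fin.
    apply: (le_trans H); apply: lee_wpmul2l; first by rewrite lee_fin powR_ge0.
    exact: IG.
  rewrite !muleA -!EFinM.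
  have -> : (l `^ p)^-1 * D * (8 * l) `^ (p - 1) * (1 + 8 * D1) = D * 8 `^ (p - 1) * (1 + 8 * D1) / l.
    have -> : l `^ p = l * l `^ (p - 1).
      rewrite -{2}[l](powRr1 (ltW l0)) -powRD; last by rewrite (gt_eqF l0) implybT.
      by rewrite addrC subrK.
    rewrite powRM ?ltW//.
    have lq : 0 < l `^ (p - 1) by exact: powR_gt0.
    by move: (l `^ (p - 1)) (8 `^ (p - 1)) lq => z1 z2 z10; field; rewrite !gt_eqF.
  exact: lexx.
have nseq (j : nat) : 0 <= r j := rj0 j.
(* The first summand alone is 1 on the dilated ball; off all dilated balls the second ones must sum
   to at least 1 wherever T b > l. *)
pose h (j : nat) (x : R) : \bar R := ((if (`|c j - x| < 4 * r j)%R then 1 else 0) +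
  (if (r j <= `|x - c j|)%R then (th^-1 * (r j / `|x - c j|) `^ (1 + e))%:E else 0))%E.
have h10 j (x : R) : (0 <= (if (`|c j - x| < 4 * r j)%R then 1 else 0 : \bar R))%E by case: ifP.
have h20 j (x : R) : (0 <= (if (r j <= `|x - c j|)%R then (th^-1 * (r j / `|x - c j|) `^ (1 + e))%:E else 0 : \bar R))%E.
  by case: ifP => // _; rewrite lee_fin mulr_ge0 ?powR_ge0// invr_ge0 ltW.
have h0 j (x : R) : (0 <= h j x)%E by apply: adde_ge0.
have md1 (a : R) : measurable_fun setT (fun x : R => `|a - x|) by exact: measurable_dist.
have md2 (a : R) : measurable_fun setT (fun x : R => `|x - a|).
  by under eq_fun do rewrite distrC; exact: measurable_dist.
have mi (a : R) : measurable_fun setT (fun x : R => `|x - a|^-1).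
  by under eq_fun do rewrite distrC; exact: measurable_invdist.
have mh1 j : measurable_fun setT (fun x : R => (if (`|c j - x| < 4 * r j)%R then 1 else 0 : \bar R)%E).
  by apply: measurable_fun_ifT => //; apply: measurable_fun_ltr.
have mh2 j : measurable_fun setT (fun x : R => (if (r j <= `|x - c j|)%R then (th^-1 * (r j / `|x - c j|) `^ (1 + e))%:E else 0 : \bar R)%E).
  apply: measurable_fun_ifT => //; first by apply: measurable_fun_ler.
  apply/measurable_EFinP; apply: measurable_funM => //.
  by apply: measurableT_comp (measurable_powR _) _; apply: measurable_funM.
have mh j : measurable_fun setT (h j) by exact: emeasurable_funD.
have thV : 0 <= th^-1 by rewrite invr_ge0 ltW.
have thD : 0 <= th^-1 * D3 := mulr_ge0 thV (ltW D30).
have DD : 0 <= D2 + th^-1 * D3 := addr_ge0 (ltW D20) thD.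
have vx0 x : (0 <= (v x)%:E)%E by rewrite lee_fin ltW.
have hI0 j : (0 <= \int[mu]_x (h j x * (v x)%:E))%E.
  by apply: integral_ge0 => x _; exact: mule_ge0.
have mp j : measurable_fun setT (fun x : R => (r j / `|x - c j|) `^ (1 + e)).
  apply: (measurableT_comp (measurable_powR _)).
  exact: (measurable_funM (measurable_cst _) (mi (c j))).
have B2 : (\int[mu]_(x in E2 `|` E3) (v x)%:E <= ((D2 + th^-1 * D3) * (D1 / l))%:E * IF)%E.
  have H : forall x, (E2 `|` E3) x -> (1 <= \sum_(j <oo) h j x)%E.
    move=> x Ex; have [[j _ Bj]|nE3] := pselect (E3 x).
      apply: le_trans (@le_nneseries_term _ (h ^~ x) j (h0^~ x)).
      by move: Bj; rewrite ball_R/= /h => ->; rewrite leeDl.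
    case: Ex => // Ex.
    have far j : 4 * r j <= `|x - c j|.
      rewrite leNgt; apply/negP => lt; apply: nE3; exists j => //.
      by rewrite ball_R/= distrC.
    apply: contrapT => /negP; rewrite -ltNge => small.
    move: Ex; rewrite /E2/=; apply/negP; rewrite -leNgt.
    have HS J : \sum_(j < J) (r j / `|x - c j|) `^ (Num.min (Num.min q rho) (1 + delta)) <= th.
      rewrite -/s eE -[leRHS]mulr1 -ler_pdivrMl// mulr_sumr -lee_fin -sumEFin.
      apply: le_trans (ltW small); apply: le_trans (le_nneseries J (h0^~ x)).
      apply: lee_sum => j _; rewrite /h.
      have -> : r j <= `|x - c j| by have := far j; have := nseq j; lra.
      by rewrite leeDr.
    have L0 : 0 <= 24 * l by rewrite mulr_ge0// ltW.
    apply: (le_trans (@vec_op_bad_le R q rho delta C K q1' rho1 delta0 C0 Ksize Ky c r b N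
      (24 * l) x rj0 tB nb b0 bc L0 bL (fun j _ => far j) th HS)).
    rewrite lee_fin; apply: thP; exact: ltW.
  apply: (le_trans (integral_le_nneseries mv (fun x => ltW (v0 x)) mh h0 H)).
  apply: (@le_trans _ _ (\sum_(j <oo) ((D2 + th^-1 * D3)%:E * \int[mu]_(x in ball (c j) (r j)) (v x)%:E))%E).
    apply: lee_nneseries => [j *|j *]; first exact: hI0.
    have -> : (\int[mu]_x (h j x * (v x)%:E) =
       \int[mu]_x ((if (`|c j - x| < 4 * r j)%R then 1 else 0) * (v x)%:E +
         (if (r j <= `|x - c j|)%R then (th^-1 * (r j / `|x - c j|) `^ (1 + e))%:E else 0) * (v x)%:E))%E.
      by apply: eq_integral => x _; rewrite /h ge0_muleDl.
    rewrite ge0_integralD; last 5 first.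
    - exact: measurableT.
    - by move=> x _; apply: mule_ge0.
    - by apply: emeasurable_funM; [exact: (mh1 j)|exact: mvE].
    - by move=> x _; apply: mule_ge0.
    - by apply: emeasurable_funM; [exact: (mh2 j)|exact: mvE].
    have Iv0 : (0 <= \int[mu]_(x in ball (c j) (r j)) (v x)%:E)%E by exact: integral_ge0.
    rewrite EFinD ge0_muleDl; last 2 first.
    - by rewrite lee_fin ltW.
    - by rewrite lee_fin.
    apply: leeD.
      apply: le_trans (dil (c j) (r j) (rj0 j)).
      rewrite [leRHS]integral_mkcond; apply: (@int_le _ _ R mu setT) => x _.
        by rewrite patchE; case: ifP.
      rewrite patchE; case: ifPn => lt; last by rewrite mul0e; case: ifP.
      by rewrite mul1e mem_set// ball_R.
    have [rj|rj] := ltP 0 (r j); last first.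
      have -> : r j = 0 by apply: le_anti; rewrite rj rj0.
      rewrite (eq_integral (cst 0%E)) ?integral_cst// ?mul0e.
        by rewrite mule_ge0// ?integral_ge0// lee_fin.
      move=> x _; rewrite mul0r powR0 ?mulr0; last by rewrite gt_eqF// addr_gt0.
      by case: ifP; rewrite mul0e.
    rewrite EFinM -muleA; apply: (@le_trans _ _ (th^-1%:E * \int[mu]_(x in [set x | (r j <= `|x - c j|)%R])
        ((r j / `|x - c j|) `^ (1 + e) * v x)%:E)%E); last first.
      by apply: lee_wpmul2l; [rewrite lee_fin invr_ge0 ltW|exact: tail].
    have mD : measurable [set x | (r j <= `|x - c j|)%R].
      rewrite [X in measurable X](_ : _ = (fun x => `|x - c j|) @^-1` [set` `[r j, +oo[]).
        by rewrite -[X in measurable X]setTI; apply: md2 => //; exact: measurable_itv.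
      by apply/seteqP; split => x /=; rewrite in_itv/= andbT.
    rewrite -ge0_integralZl_EFin; last 4 first.
    - exact: mD.
    - by move=> x _; rewrite lee_fin mulr_ge0 ?powR_ge0// ltW.
    - by apply/measurable_EFinP; exact: (measurable_funTS (measurable_funM (mp j) mv)).
    - by rewrite invr_ge0 ltW.
    have k0 x : (0 <= th^-1%:E * ((r j / `|x - c j|) `^ (1 + e) * v x)%:E)%E.
      by rewrite mule_ge0// lee_fin ?invr_ge0 ?mulr_ge0 ?powR_ge0// ltW.
    rewrite [leRHS]integral_mkcond; apply: (@int_le _ _ R mu setT) => x _.
      by rewrite patchE; case: ifP.
    rewrite patchE; case: ifPn => lt; last by rewrite mul0e; case: ifP.
    by rewrite mem_set//= -!EFinM mulrA.
  rewrite nneseriesZl; last by move=> j _; exact: integral_ge0.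
  rewrite EFinM -muleA; apply: lee_wpmul2l.
    by rewrite lee_fin.
  apply: le_trans vOm; rewrite /Om OmE ge0_integral_bigcup//; exact: mvE.
apply: (@le_trans _ _ (\int[mu]_(x in E1 `|` (E2 `|` E3)) (v x)%:E)%E).
  rewrite [leLHS]integral_mkcond [leRHS]integral_mkcond; apply: (@int_le _ _ R mu setT) => x _.
    by rewrite patchE; case: ifP => // _; rewrite lee_fin ltW.
  rewrite !patchE; case: ifPn => [|_]; last by case: ifP => // _; rewrite lee_fin ltW.
  by rewrite inE => /sub ?; rewrite mem_set.
apply: (@le_trans _ _ (\int[mu]_(x in E1) (v x)%:E + \int[mu]_(x in E2 `|` E3) (v x)%:E)%E).
  by apply: ge0_integral_setU_le => //; exact: measurableU.
apply: (le_trans (leeD B1 B2)); rewrite -ge0_muleDl; last 2 first.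
- rewrite lee_fin divr_ge0 ?(ltW l0)// !mulr_ge0 ?powR_ge0// addr_ge0// mulr_ge0// ltW//.
- by rewrite lee_fin mulr_ge0// divr_ge0// ltW.
apply: lee_wpmul2r => //; rewrite -EFinD lee_fin lE.
rewrite le_eqVlt; apply/orP; left; apply/eqP; rewrite /G; field; rewrite !gt_eqF//.
Qed.

End weak_type.

(** * Good-lambda inequality *)

Section smooth_part.
Context {R : realType}.
Local Notation mu := (@lebesgue_measure R).

Lemma cintegral_mkcond (A : set R) (G : R -> R[i]) :
  cintegral A G = cintegral setT (fun y => if y \in A then G y else 0).
Proof.
have pE (p : R[i] -> R) : p 0 = 0 -> (fun y => p (G y)) \_ A =
    (fun y => p (if y \in A then G y else 0)).
  by move=> p0; apply/funext => y; rewrite patchE; case: ifP.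
rewrite /cintegral; congr Complex.
  by rewrite Rintegral_mkcond (pE (fun z => complex.Re z)).
by rewrite Rintegral_mkcond (pE (fun z => complex.Im z)).
Qed.

Lemma cintegrable_mkcond (A : set R) (G : R -> R[i]) : measurable A ->
  cintegrable setT G -> cintegrable setT (fun y => if y \in A then G y else 0).
Proof.
move=> mA iG; have [i1 i2] := cintegrableS measurableT mA (@subsetT _ A) iG.
have pE (p : R[i] -> R) : p 0 = 0 -> (fun y => (p (G y))%:E) \_ A =
    (fun y => (p (if y \in A then G y else 0))%:E).
  by move=> p0; apply/funext => y; rewrite patchE; case: ifP => // _; rewrite p0.
split.
  rewrite -(pE (fun z => complex.Re z))//.
  exact: (proj1 (@integrable_mkcond _ _ _ mu A (fun y => (complex.Re (G y))%:E) mA) i1).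
rewrite -(pE (fun z => complex.Im z))//.
exact: (proj1 (@integrable_mkcond _ _ _ mu A (fun y => (complex.Im (G y))%:E) mA) i2).
Qed.

Lemma cintegrableB (D : set R) F G : measurable D -> cintegrable D F -> cintegrable D G ->
  cintegrable D (fun y => F y - G y).
Proof.
move=> mD [f1 f2] [g1 g2].
have reB (a b : R[i]) : complex.Re (a - b) = complex.Re a - complex.Re b by case: a; case: b.
have imB (a b : R[i]) : complex.Im (a - b) = complex.Im a - complex.Im b by case: a; case: b.
split.
  by under eq_fun do rewrite reB EFinB; exact: integrableB.
by under eq_fun do rewrite imB EFinB; exact: integrableB.
Qed.

Lemma cintegral_set_diff (A B : set R) (G : R -> R[i]) : measurable A -> measurable B ->
  cintegrable setT G ->
  ((normc (cintegral A G - cintegral B G))%:E <=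
   2%:E * \int[mu]_y (if (y \in A) (+) (y \in B) then normc (G y) else 0)%:E)%E.
Proof.
move=> mA mB iG.
have iA := cintegrable_mkcond mA iG; have iB := cintegrable_mkcond mB iG.
rewrite (cintegral_mkcond A) (cintegral_mkcond B) -(cintegralB measurableT iA iB).
apply: (le_trans (cintegral_le measurableT (cintegrable_cmeas (cintegrableB measurableT iA iB)))).
apply: lee_wpmul2l; first by rewrite lee_fin.
apply: int_le => y _; first by rewrite lee_fin; case: ifP => // _; exact: normc_ge0.
have h1 (z : R[i]) : normc (z - z) <= 0 by rewrite subrr Normc.normc0.
have h2 (z : R[i]) : normc (z - 0) <= normc z by rewrite subr0.
have h3 (z : R[i]) : normc (0 - z) <= normc z by rewrite sub0r normcN.
rewrite lee_fin; case: (y \in A); case: (y \in B).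
- exact: h1.
- exact: h2.
- exact: h3.
- exact: h1.
Qed.

Lemma floor_multiple (h z : R) : 0 < h -> 0 <= z -> exists n : nat, n%:R * h <= z < n.+1%:R * h.
Proof.
move=> h0 z0; exists (Num.truncn (z / h)).
have zh : 0 <= z / h by rewrite divr_ge0// ltW.
by have := truncn_itv zh; rewrite ler_pdivlMr// ltr_pdivrMr.
Qed.

Lemma neighbour_multiple (h z t : R) (n m : nat) : 0 < h -> `|z - t| < h ->
  n%:R * h <= z < n.+1%:R * h -> m%:R * h <= t < m.+1%:R * h ->
  [\/ n = m.-1, n = m | n = m.+1].
Proof.
move=> h0; rewrite ltr_norml => /andP[a1 a2] /andP[b1 b2] /andP[c1 c2].
have e k : k.+1%:R * h = k%:R * h + h by rewrite -natr1 mulrDl mul1r.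
rewrite e in b2; rewrite e in c2.
have l1 : (n < m.+2)%N by rewrite -(ltr_nat R) -(ltr_pM2r h0) !e; lra.
have l2 : (m < n.+2)%N by rewrite -(ltr_nat R) -(ltr_pM2r h0) !e; lra.
move: l1; rewrite ltnS leq_eqVlt => /predU1P[->|]; first exact: Or33.
rewrite ltnS leq_eqVlt => /predU1P[->|nm]; first exact: Or32.
apply: Or31; case: m l2 nm {c1 c2} => // m; rewrite !ltnS => l2 nm /=.
by apply/eqP; rewrite eqn_leq nm l2.
Qed.

Variables (q rho delta C : R) (K : R -> R -> R[i]).
Hypotheses (q1 : 1 < q) (rho1 : 1 < rho) (delta0 : 0 < delta) (C0 : 0 < C).
Hypothesis Ksize : forall x y, x != y -> normc (K x y) <= C / `|x - y|.
Hypothesis Kx : forall x y z, 2 * `|x - z| < `|x - y| ->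
  normc (K x y - K z y) <= C * `|x - z| `^ delta / `|x - y| `^ (1 + delta).
Hypothesis Ky : forall x y z, 2 * `|x - z| < `|x - y| ->
  normc (K y x - K y z) <= C * `|x - z| `^ delta / `|x - y| `^ (1 + delta).

Let q1' : 1 <= q. Proof. exact: ltW. Qed.
Let rho0 : 0 < rho. Proof. exact: lt_trans ltr01 rho1. Qed.
Let s := Num.min q rho.
Let s1 : 1 < s. Proof. by rewrite lt_min q1. Qed.

(** The first term comes from regularity, integrated against the dyadic kernel. In the second, 24 C
    = 2 * 6 * (2 C): six cells, two annuli, and the coefficient of [phi]. *)
Definition smooth_const (B : R) : R :=
  2 * C * (3 / 2) `^ (1 + delta) * 2 `^ (1 + delta) * (2 / (1 - 2 `^ (- delta))) * B
  + 24 * C * cell_const B s.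

Variables (U : R -> \bar R) (B : R).
Hypotheses (B0 : 0 < B) (mU : measurable_fun setT U) (U0 : forall x, (0 <= U x)%E).
Hypothesis HU : forall c r x : R, 0 < r -> ball c r x ->
  (\int[mu]_(y in ball c r) U y <= (B * r)%:E * U x)%E.
Variables (N : nat) (f : nat -> R -> R[i]) (a h x u : R).
Hypotheses (nf : forall k, nice (f k)) (h0 : 0 < h) (xa : `|x - a| < h).
Hypotheses (Uxu : (U x <= u%:E)%E) (FU : forall y, ((vec_norm rho N f y)%:E <= U y)%E).

Let f2 k y : R[i] := if 3 * h < `|a - y| then f k y else 0.
Let F2 := vec_norm rho N f2.
Let A1 (t t' : R) := annulus (fun y : R => `|x - y|) t t'.
Let A2 (t t' : R) := annulus (fun y : R => `|a - y|) t t'.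
Let c1 := 2 * C * (3 / 2) `^ (1 + delta) / h.
Let psi k y := c1 * (h / `|y - a|) `^ (1 + delta) * normc (f2 k y).
Let phi k y := 2 * C / `|a - y| * normc (f2 k y).

Let nf2 k : nice (f2 k).
Proof.
apply: nice_if; last exact: nf.
exact: measurable_outside.
Qed.
Let mA1 t t' : measurable (A1 t t').
Proof. by apply: measurable_annulus; exact: measurable_dist. Qed.
Let mA2 t t' : measurable (A2 t t').
Proof. by apply: measurable_annulus; exact: measurable_dist. Qed.
Let mn2 k : measurable_fun setT (fun y => normc (f2 k y)).
Proof. by apply: cmeasurable_normc; have [] := nf2 k. Qed.
Let c10 : 0 <= c1.
Proof. by rewrite divr_ge0 ?(ltW h0)// mulr_ge0 ?powR_ge0// mulr_ge0// ltW. Qed.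
Let psi0 k y : 0 <= psi k y.
Proof. by rewrite mulr_ge0 ?normc_ge0// mulr_ge0 ?powR_ge0. Qed.
Let phi0 k y : 0 <= phi k y.
Proof. by rewrite mulr_ge0 ?normc_ge0// divr_ge0// mulr_ge0// ltW. Qed.
Let mpow : measurable_fun setT (fun y : R => (h / `|y - a|) `^ (1 + delta)).
Proof.
apply: (measurableT_comp (measurable_powR _)).
apply: (measurable_funM (measurable_cst _)).
by under eq_fun do rewrite distrC; exact: measurable_invdist.
Qed.
Let mpsi k : measurable_fun setT (psi k).
Proof. exact: (measurable_funM (measurable_funM (measurable_cst _) mpow) (mn2 k)). Qed.
Let mphi k : measurable_fun setT (phi k).
Proof.
apply: (measurable_funM _ (mn2 k)); apply: (measurable_funM (measurable_cst _)).
exact: measurable_invdist.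
Qed.

Let iKa k : cintegrable setT (fun y => K a y * f2 k y).
Proof.
have h3 : 0 < 3 * h by rewrite mulr_gt0.
have [i1 i2] := @truncated_kernel_integrable R delta C K delta0 C0 Ksize Ky (3 * h) (f k) a h3 (nf k).
have E : truncated_kernel K (3 * h) (f k) a = (fun y => K a y * f2 k y).
  by apply/funext => y; rewrite /truncated_kernel /f2; case: ifP => // _; rewrite mulr0.
by rewrite E in i1 i2; split.
Qed.

(** On the support of [f2] one has |a - y| > 3 h, hence |x - y| > 2 h > 2 |x - a|, so regularity in
    the first variable applies; also |x - y| >= (2 / 3) |y - a|, whence the power of 3 / 2 in
    [c1]. *)
Let kernel_diff k y : 2 * normc (K x y * f2 k y - K a y * f2 k y) <= psi k y.
Proof.
rewrite /psi /f2; case: ifPn => hy; last by rewrite !mulr0 subrr Normc.normc0 !mulr0.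
rewrite -mulrBl Normc.normcM mulrA; apply: ler_wpM2r; first exact: normc_ge0.
have ya : 0 < `|y - a| by rewrite distrC; apply: lt_trans hy; rewrite mulr_gt0.
have xy : 2 / 3 * `|y - a| <= `|x - y|.
  have tri : `|a - y| <= `|x - a| + `|x - y| by rewrite (distrC x a); exact: ler_distD.
  have hy3 : 3 * h < `|a - y| := hy; have xa' : `|x - a| < h := xa.
  by rewrite (distrC y a); lra.
have xy0 : 0 < `|x - y| by apply: lt_le_trans xy; rewrite mulr_gt0.
have h2 : 2 * `|x - a| < `|x - y|.
  have tri : `|a - y| <= `|x - a| + `|x - y| by rewrite (distrC x a); exact: ler_distD.
  have hy3 : 3 * h < `|a - y| := hy; have xa' : `|x - a| < h := xa.
  by lra.
have d1 : 0 <= 1 + delta by rewrite addr_ge0// ltW.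
apply: (@le_trans _ _ (2 * (C * h `^ delta / `|x - y| `^ (1 + delta)))).
  apply: ler_wpM2l => //; apply: (le_trans (Kx h2)).
  apply: ler_wpM2r; first by rewrite invr_ge0 powR_ge0.
  apply: ler_wpM2l; first exact: ltW.
  by apply: le_powR => //; exact: ltW.
have -> : C * h `^ delta / `|x - y| `^ (1 + delta) = C / h * (h / `|x - y|) `^ (1 + delta).
  rewrite powRM ?invr_ge0// ?ltW// powR_inv// powRN.
  rewrite [h `^ (1 + delta)]powRD; last by rewrite (gt_eqF h0) implybT.
  rewrite (powRr1 (ltW h0)).
  have := powR_gt0 (1 + delta) xy0; move: (`|x - y| `^ (1 + delta)) (h `^ delta) => z1 z2 z10.
  by field; rewrite !gt_eqF.
have -> : c1 * (h / `|y - a|) `^ (1 + delta) = 2 * (C / h * (3 / 2 * (h / `|y - a|)) `^ (1 + delta)).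
  rewrite [(3 / 2 * _) `^ _]powRM//; last by rewrite divr_ge0// ltW.
  by rewrite /c1; field; rewrite gt_eqF.
apply: ler_wpM2l => //; apply: ler_wpM2l; first by rewrite divr_ge0// ltW.
apply: le_powR => //; first by rewrite divr_ge0// ltW.
rewrite mulrCA; apply: ler_wpM2l; first exact: ltW.
by rewrite -[3 / 2]invf_div -invfM lef_pV2 ?posrE//; rewrite mulr_gt0.
Qed.

(** The cells at distance t and t' from [a], with their neighbours. The predecessor of 0 is 0, which
    merely repeats a cell. *)
Let pt (n0 n1 : nat) l := nth 0%N [:: n0.-1; n0; n0.+1; n1.-1; n1; n1.+1] l.

(** |a - y| and |x - y| differ by less than h, so a point lying in only one of the two annuli has |a
    - y| within h of t or of t'. *)
Let strip t t' n0 n1 y : 0 < t -> t < t' ->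
  n0%:R * h <= t < n0.+1%:R * h -> n1%:R * h <= t' < n1.+1%:R * h ->
  (y \in A1 t t') (+) (y \in A2 t t') ->
  exists2 l : 'I_6, cell a h (pt n0 n1 l) y & A1 t t' y \/ A2 t t' y.
Proof.
move=> t0 tt H0 H1 yA.
have d1 : `| `|a - y| - `|x - y| | < h.
  apply: le_lt_trans xa; rewrite (distrC x a); apply: le_trans (ler_dist_dist _ _) _.
  by rewrite opprB addrA subrK.
have [n Hn] := floor_multiple h0 (normr_ge0 (a - y)).
have near_t : `| `|a - y| - t| < h \/ `| `|a - y| - t'| < h.
  have [b1|b1] := ltP `| `|a - y| - t| h; first by left.
  have [b2|b2] := ltP `| `|a - y| - t'| h; first by right.
  exfalso; move: d1 b1 b2 yA; rewrite ltr_norml => /andP[e1 e2] b1 b2.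
  have E : (y \in A1 t t') = (y \in A2 t t').
    apply/idP/idP; rewrite !inE /A1 /A2 /annulus/= => /andP[g1 g2]; apply/andP; split.
    - move: b1; rewrite real_ler_normr ?num_real// => /orP[]; lra.
    - move: b2; rewrite real_ler_normr ?num_real// => /orP[]; lra.
    - move: b1; rewrite real_ler_normr ?num_real// => /orP[]; lra.
    - move: b2; rewrite real_ler_normr ?num_real// => /orP[]; lra.
  by rewrite E addbb.
have yA' : A1 t t' y \/ A2 t t' y.
  move: yA; case: (boolP (y \in A1 t t')) => [|_ /=]; rewrite inE; first by left.
  by right.
have cn : cell a h n y by rewrite /cell/= distrC.
have find l : (l < 6)%N -> n = pt n0 n1 l -> exists2 l : 'I_6, cell a h (pt n0 n1 l) y & A1 t t' y \/ A2 t t' y.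
  by move=> l6 nE; exists (Ordinal l6) => //=; rewrite -nE.
case: near_t => nt.
  have [E|E|E] := neighbour_multiple h0 nt Hn H0.
  - exact: (find 0%N).
  - exact: (find 1%N).
  - exact: (find 2%N).
have [E|E|E] := neighbour_multiple h0 nt Hn H1.
- exact: (find 3%N).
- exact: (find 4%N).
- exact: (find 5%N).
Qed.

Let size_phi k y : 2 * normc (K a y * f2 k y) <= phi k y.
Proof.
rewrite /phi /f2; case: ifPn => hy; last by rewrite !mulr0 Normc.normc0 !mulr0.
have ay : a != y by rewrite -subr_eq0 -normr_gt0 (lt_trans _ hy)// mulr_gt0.
apply: (le_trans (ler_wpM2l _ (kernel_mul_le Ksize _ ay))) => //.
by rewrite le_eqVlt; apply/orP; left; apply/eqP; ring.
Qed.

(** The two differences are split by an intermediate integral of K a over the annulus about [x]: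
    first the kernel changes on a fixed annulus, which gives [psi], then the annulus changes with
    the kernel fixed, which gives [phi] on the symmetric difference located by [strip]. *)
Let increment_smooth k (t t' : R) : 0 < t -> t < t' -> exists c : nat -> nat,
  ((normc ((truncated K t (f2 k) x - truncated K t (f2 k) a) -
     (truncated K t' (f2 k) x - truncated K t' (f2 k) a)))%:E <=
   \int[mu]_(y in A1 t t') (psi k y)%:E +
   \sum_(l < 6) (\int[mu]_(y in cell a h (c l) `&` A1 t t') (phi k y)%:E +
                 \int[mu]_(y in cell a h (c l) `&` A2 t t') (phi k y)%:E))%E.
Proof.
move=> t0 tt; have af := nice_admissible (nf2 k).
have t'0 : 0 < t' := lt_trans t0 tt.
have [n0 H0] := floor_multiple h0 (ltW t0); have [n1 H1] := floor_multiple h0 (ltW t'0).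
exists (pt n0 n1).
have -> : (truncated K t (f2 k) x - truncated K t (f2 k) a) -
     (truncated K t' (f2 k) x - truncated K t' (f2 k) a) =
   (truncated K t (f2 k) x - truncated K t' (f2 k) x) -
   (truncated K t (f2 k) a - truncated K t' (f2 k) a) by ring.
rewrite (@truncated_sub R delta C K delta0 C0 Ksize Ky x t t' (f2 k) t0 tt af).
rewrite (@truncated_sub R delta C K delta0 C0 Ksize Ky a t t' (f2 k) t0 tt af).
have -> : cintegral (annulus (fun y : R => `|x - y|) t t') (fun y => K x y * f2 k y) -
    cintegral (annulus (fun y : R => `|a - y|) t t') (fun y => K a y * f2 k y) =
  (cintegral (A1 t t') (fun y => K x y * f2 k y) - cintegral (A1 t t') (fun y => K a y * f2 k y)) +
  (cintegral (A1 t t') (fun y => K a y * f2 k y) - cintegral (A2 t t') (fun y => K a y * f2 k y)) by rewrite addrA subrK.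
apply: (@le_trans _ _ ((normc (cintegral (A1 t t') (fun y => K x y * f2 k y) -
     cintegral (A1 t t') (fun y => K a y * f2 k y)))%:E +
  (normc (cintegral (A1 t t') (fun y => K a y * f2 k y) -
     cintegral (A2 t t') (fun y => K a y * f2 k y)))%:E)%E).
  by rewrite -EFinD lee_fin le_normcD.
apply: leeD.
  have ix : cintegrable (A1 t t') (fun y => K x y * f2 k y).
    apply: (cintegrableS (measurable_outside x t) (mA1 t t') (@annulus_outside R x t t')).
    exact: (@kernel_integrable R delta C K delta0 C0 Ksize Ky x t (f2 k) t0 af).
  have ia := cintegrableS measurableT (mA1 t t') (@subsetT _ _) (iKa k).
  rewrite -(cintegralB (mA1 t t') ix ia).
  have iB := cintegrableB (mA1 t t') ix ia.
  apply: (le_trans (cintegral_le (mA1 t t') (cintegrable_cmeas iB))).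
  rewrite -ge0_integralZl_EFin; last 4 first.
  - exact: mA1.
  - by move=> y _; rewrite lee_fin normc_ge0.
  - by apply/measurable_EFinP; apply: measurable_normc; exact: cintegrable_cmeas iB.
  - by [].
  apply: int_le => y _; first by rewrite lee_fin.
  by rewrite -EFinM lee_fin; exact: kernel_diff.
apply: (le_trans (cintegral_set_diff (mA1 t t') (mA2 t t') (iKa k))).
have mres (D : set R) : measurable D -> measurable_fun setT ((fun y => (phi k y)%:E) \_ D).
  move=> mD; have [m _] := measurable_restrictT (fun y => (phi k y)%:E) mD; apply: m.
  by apply/measurable_EFinP; exact: (measurable_funTS (mphi k)).
have res0 (D : set R) y : (0 <= ((fun y => (phi k y)%:E) \_ D) y)%E.
  by rewrite patchE; case: ifP => // _; rewrite lee_fin.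
pose D1 l := cell a h (pt n0 n1 l) `&` A1 t t'.
pose D2 l := cell a h (pt n0 n1 l) `&` A2 t t'.
have mD1 l : measurable (D1 l) by apply: measurableI => //; exact: measurable_cell.
have mD2 l : measurable (D2 l) by apply: measurableI => //; exact: measurable_cell.
apply: (@le_trans _ _ (\int[mu]_y (\sum_(l < 6) (((fun y => (phi k y)%:E) \_ (D1 l)) y +
    ((fun y => (phi k y)%:E) \_ (D2 l)) y)))%E); last first.
  rewrite ge0_integral_sum; last 3 first.
  - exact: measurableT.
  - by move=> l; apply: emeasurable_funD; exact: mres.
  - by move=> l y _; apply: adde_ge0.
  apply: lee_sum => l _; rewrite ge0_integralD; last 5 first.
  - exact: measurableT.
  - by move=> y _; exact: res0.
  - exact: mres.
  - by move=> y _; exact: res0.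
  - exact: mres.
  by rewrite -!integral_mkcond lexx.
have mG : measurable_fun setT (fun y => normc (K a y * f2 k y)).
  by apply: measurable_normc; exact: cintegrable_cmeas (iKa k).
have mind : measurable_fun setT (fun y => (if (y \in A1 t t') (+) (y \in A2 t t') then normc (K a y * f2 k y) else 0)%:E).
  apply/measurable_EFinP; apply: measurable_fun_ifT => //.
  apply: (measurable_fun_bool true); rewrite setTI.
  rewrite [X in measurable X](_ : _ = (A1 t t' `\` A2 t t') `|` (A2 t t' `\` A1 t t')).
    by apply: measurableU; exact: measurableD.
  apply/seteqP; split => y /=.
    case: (boolP (y \in A1 t t')); case: (boolP (y \in A2 t t')); rewrite ?inE ?notin_setE//=; by [left|right].
  by case=> -[]; rewrite -(@in_setE _ (A1 t t')) -(@in_setE _ (A2 t t')); case: (y \in A1 t t'); case: (y \in A2 t t').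
rewrite -ge0_integralZl_EFin; last 4 first.
- exact: measurableT.
- by move=> y _; rewrite lee_fin; case: ifP => // _; exact: normc_ge0.
- exact: mind.
- by [].
apply: int_le => y _; first by apply: sume_ge0 => l _; apply: adde_ge0.
rewrite -EFinM; case: ifPn => yA; last by rewrite mulr0; apply: sume_ge0 => l _; apply: adde_ge0.
have [l cl yA'] := strip t0 tt H0 H1 yA.
apply: (@le_trans _ _ (phi k y)%:E); first by rewrite lee_fin; exact: size_phi.
rewrite (bigD1 l)//=.
have rest : (0 <= \sum_(i < 6 | i != l) (((fun y => (phi k y)%:E) \_ (D1 i)) y +
    ((fun y => (phi k y)%:E) \_ (D2 i)) y))%E.
  by apply: sume_ge0 => i _; apply: adde_ge0.
apply: (le_trans _ (leeDl _ rest)).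
have r1 := res0 (D1 l) y; have r2 := res0 (D2 l) y.
case: yA' => yA'.
  apply: (le_trans _ (leeDl _ r2)).
  by rewrite patchE mem_set//; split.
apply: (le_trans _ (leeDr _ r1)).
by rewrite patchE mem_set//; split.
Qed.

Let F2_le y : F2 y <= vec_norm rho N f y.
Proof.
by apply: le_lpn => // k _; rewrite normc_ge0 /f2 /=; case: ifP => // _; rewrite Normc.normc0 normc_ge0.
Qed.

Let F2_eq0 y : `|a - y| <= 3 * h -> F2 y = 0.
Proof.
move=> ay; rewrite /F2 /vec_norm /lpn big1 ?powR0 ?gt_eqF ?invr_gt0// => k _.
have -> : f2 k y = 0 by rewrite /f2 ltNge ay.
by rewrite Normc.normc0 powR0 ?gt_eqF.
Qed.

(* Comparison with the endpoint [a], where the operator is controlled: the difference of the truncations is split into the smoothness of the kernel and the mass of [f] near the boundary of the annuli, summed over cells of length [h]. *)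
Lemma vec_op_smooth_le :
  (vec_op q rho K N f2 x <= vec_op q rho K N f a + (smooth_const B * u)%:E)%E.
Proof.
have u0 : 0 <= u by rewrite -lee_fin (le_trans (U0 x) Uxu).
have [D0 cellP] := cell_sum_le B0 mU U0 HU s1.
have F20 y : 0 <= F2 y by exact: vec_norm_ge0.
have mF2 : measurable_fun setT F2 by apply: measurable_vec_norm => k; have [] := nf2 k.
have F2U y : ((F2 y)%:E <= U y)%E by apply: le_trans (FU y); rewrite lee_fin.
pose M n := fine (\int[mu]_(y in cell a h n) (F2 y)%:E).
have ME n : (M n)%:E = (\int[mu]_(y in cell a h n) (F2 y)%:E)%E.
  rewrite /M fineK// ge0_fin_numE; last by apply: integral_ge0 => y _; rewrite lee_fin.
  apply: (@le_lt_trans _ _ (\int[mu]_y (F2 y)%:E)%E); last exact: (vec_norm_integrable rho1 N nf2).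
  rewrite [leLHS]integral_mkcond; apply: (@int_le _ _ R mu setT) => y _; first by rewrite lee_fin.
  by rewrite patchE; case: ifP => _; rewrite ?lexx// lee_fin; exact: F20.
have M0 n : 0 <= M n.
  by rewrite /M fine_ge0// integral_ge0// => y _; rewrite lee_fin.
(* Cell 0 carries no mass of [f2], and its coefficient is set to 0 as [cell_sum_le] requires. *)
pose nu' (n : nat) := if n is 0%N then 0 else M n / (n%:R * h).
have nu'0 n : 0 <= nu' n.
  case: n => [|n]; first exact: lexx.
  by apply: divr_ge0; [exact: M0|apply: mulr_ge0 => //; exact: ltW].
have nu'S J : \sum_(n < J) nu' n `^ s <= (cell_const B s * u) `^ s.
  apply: (cellP F2 a h x u nu' J h0 xa Uxu mF2 F20 F2U nu'0 _ erefl).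
  case=> // n _; rewrite -ME lee_fin /nu' divfK//.
  by rewrite mulf_neq0 ?gt_eqF.
pose Q := 2 * C * (cell_const B s * u).
pose P := 2 * C * (3 / 2) `^ (1 + delta) * 2 `^ (1 + delta) * (2 / (1 - 2 `^ (- delta))) * B * u.
have Du0 : 0 <= cell_const B s * u by rewrite mulr_ge0// ltW.
have CC0 : 0 <= 2 * C by rewrite mulr_ge0// ltW.
have Q0 : 0 <= Q by exact: mulr_ge0.
have key : (lpe rho N (fun k => variation_norm q (fun t : R => (truncated K t (f2 k) x - truncated K t (f2 k) a)%R))
    <= (P + 2 * 6%:R * Q)%:E)%E.
  have sq : s <= q by rewrite ge_min lexx.
  have sr : s <= rho by rewrite ge_min lexx orbT.
  have nu0 n : 0 <= 2 * C * nu' n by rewrite mulr_ge0.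
  have mc n : measurable (cell a h n) by exact: measurable_cell.
  apply: (@variation_vector_cells R q rho q1' rho1 N
    (fun k t => truncated K t (f2 k) x - truncated K t (f2 k) a) s 6
    (fun y => `|x - y|) (fun y => `|a - y|) psi phi (cell a h) P Q (fun n => 2 * C * nu' n)
    (ltW s1) sq sr (measurable_dist x) (measurable_dist a) mpsi mphi psi0 phi0 mc Q0 nu0).
  - pose eta : R := 2 `^ (- delta).
    have eta0 : 0 <= eta by exact: powR_ge0.
    have eta1 : eta < 1 by exact: two_powRN_lt1.
    have k0 : 0 <= c1 * 2 `^ (1 + delta) by rewrite mulr_ge0 ?powR_ge0.
    apply: (@le_trans _ _ (\int[mu]_y ((c1 * 2 `^ (1 + delta))%:E * (dyadic_kernel eta a h y * U y)))%E).
      have WU y : (0 <= dyadic_kernel eta a h y * U y)%E by rewrite mule_ge0// dyadic_kernel_ge0.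
      apply: int_le => y _; first by rewrite mule_ge0// lee_fin.
      have -> : lpn rho N (psi ^~ y) = c1 * (h / `|y - a|) `^ (1 + delta) * F2 y.
        rewrite /psi lpn_Z//; first by rewrite mulr_ge0 ?powR_ge0.
        by move=> k _; exact: normc_ge0.
      have [ya|ya] := leP `|a - y| (3 * h).
        by rewrite F2_eq0// mulr0 mule_ge0// lee_fin.
      have h0' : 0 < h := h0.
      have hy : h <= `|y - a| by rewrite distrC; lra.
      have e1 : (c1 * (h / `|y - a|) `^ (1 + delta) * F2 y)%:E =
          (c1%:E * (((h / `|y - a|) `^ (1 + delta))%:E * (F2 y)%:E))%E by rewrite -!EFinM mulrA.
      have e2 : ((c1 * 2 `^ (1 + delta))%:E * (dyadic_kernel eta a h y * U y) =
          c1%:E * ((2 `^ (1 + delta))%:E * dyadic_kernel eta a h y * U y))%E.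
        have -> : (c1 * 2 `^ (1 + delta))%:E = (c1%:E * (2 `^ (1 + delta))%:E)%E by [].
        by rewrite !muleA.
      rewrite e1 e2; apply: lee_wpmul2l; first by rewrite lee_fin.
      apply: lee_pmul; [by rewrite lee_fin powR_ge0|by rewrite lee_fin| |exact: F2U].
      exact: (power_le_dyadic_kernel delta0 h0 hy).
    rewrite ge0_integralZl_EFin; last 4 first.
    + exact: measurableT.
    + by move=> y _; rewrite mule_ge0// dyadic_kernel_ge0.
    + by apply: emeasurable_funM => //; exact: measurable_dyadic_kernel.
    + exact: k0.
    have BU0 : (0 <= B%:E * U x)%E by rewrite mule_ge0// lee_fin ltW.
    have HH : (\int[mu]_y (dyadic_kernel eta a h y * U y) <= (2 * h / (1 - eta))%:E * (B%:E * U x))%E.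
      apply: integral_dyadic_kernel_le => //.
      move=> d hd; have d0 : 0 < d := lt_le_trans h0 hd.
      have Bx : ball a d x by rewrite ball_R/= distrC; exact: lt_le_trans hd.
      by apply: (le_trans (HU d0 Bx)); rewrite muleA -EFinM mulrC.
    apply: (le_trans (lee_wpmul2l _ HH)); first by rewrite lee_fin.
    have e1 : 0 < 1 - eta by rewrite subr_gt0.
    have he0 : 0 <= 2 * h / (1 - eta) by rewrite divr_ge0 ?mulr_ge0// ltW.
    apply: (@le_trans _ _ ((c1 * 2 `^ (1 + delta))%:E * ((2 * h / (1 - eta))%:E * (B%:E * u%:E)))%E).
      apply: lee_wpmul2l; first by rewrite lee_fin.
      apply: lee_wpmul2l; first by rewrite lee_fin.
      by apply: lee_wpmul2l => //; rewrite lee_fin ltW.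
    rewrite -!EFinM lee_fin /P /c1 -/eta.
    by rewrite le_eqVlt; apply/orP; left; apply/eqP; field; rewrite !gt_eqF.
  - move=> n.
    have E y : lpn rho N (phi ^~ y) = 2 * C / `|a - y| * F2 y.
      rewrite /phi lpn_Z//; first by rewrite divr_ge0.
      by move=> k _; exact: normc_ge0.
    case: n => [|n].
      rewrite /nu' mulr0; apply: (@le_trans _ _ (\int[mu]_(y in cell a h 0) 0)%E); last by rewrite integral0.
      apply: int_le => y // /andP[_ hy]; rewrite E F2_eq0 ?mulr0//.
      have h0' : 0 < h := h0.
      by move: hy; rewrite mul1r distrC; lra.
    have nh : 0 < n.+1%:R * h by rewrite mulr_gt0.
    apply: (@le_trans _ _ (\int[mu]_(y in cell a h n.+1) ((2 * C / (n.+1%:R * h))%:E * (F2 y)%:E))%E).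
      apply: int_le => y; first by rewrite mule_ge0// lee_fin// divr_ge0// ltW.
      move=> /andP[hy _]; rewrite -EFinM lee_fin E; apply: ler_wpM2r => //.
      apply: ler_wpM2l => //; rewrite lef_pV2 ?posrE//; first by rewrite distrC.
      by rewrite distrC; exact: lt_le_trans hy.
    rewrite ge0_integralZl_EFin; last 4 first.
    + exact: mc.
    + by move=> y _; rewrite lee_fin.
    + by apply/measurable_EFinP; exact: (measurable_funTS mF2).
    + by rewrite divr_ge0// ltW.
    rewrite -ME -EFinM lee_fin /nu' le_eqVlt; apply/orP; left; apply/eqP.
    by rewrite mulrAC mulrA.
  - move=> J; rewrite /Q powRM//.
    apply: (@le_trans _ _ (\sum_(j < J) (2 * C) `^ s * nu' j `^ s)).
      by apply: ler_sum => j _; rewrite powRM.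
    by rewrite -mulr_sumr; apply: ler_wpM2l; [exact: powR_ge0|exact: nu'S].
  - by move=> k t t' kN t0 tt; exact: increment_smooth.
apply: (@le_trans _ _ (lpe rho N (fun k => variation_norm q (fun t : R => (truncated K t (f2 k) x - truncated K t (f2 k) a)%R)) +
   vec_op q rho K N f2 a)%E).
  apply: le_trans (lpe_triangle (ltW rho1) _ _); last 2 first.
  - by move=> k _; exact: (variation_norm_ge0 q1').
  - by move=> k _; exact: (variation_norm_ge0 q1').
  apply: le_lpe; first exact: rho0.
    by move=> k _; exact: (variation_norm_ge0 q1').
  move=> k _ /=.
  have -> : variation_op q K (f2 k) x = variation_norm q (fun t : R =>
      (truncated K t (f2 k) x - truncated K t (f2 k) a) + truncated K t (f2 k) a).
    by apply: (eq_variation_norm q) => t _; rewrite subrK.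
  exact: (variation_normD q1').
have H1 : (vec_op q rho K N f2 a <= vec_op q rho K N f a)%E.
  by apply: (vec_op_outside K q1' rho1 N f a); rewrite mulr_gt0.
have H2 : P + 2 * 6%:R * Q = smooth_const B * u.
  by rewrite /smooth_const /P /Q; ring.
apply: (le_trans (leeD key H1)); by rewrite H2 addeC lexx.
Qed.

End smooth_part.

Section good_lambda.
Context {R : realType}.
Local Notation mu := (@lebesgue_measure R).

Lemma integral_disjoint_le (X Y Z : set R) (h : R -> \bar R) : measurable X -> measurable Y ->
  measurable_fun setT h -> (forall x, 0 <= h x)%E -> X `<=` Z -> Y `<=` Z ->
  (forall x, X x -> ~ Y x) ->
  (\int[mu]_(x in X) h x + \int[mu]_(x in Y) h x <= \int[mu]_(x in Z) h x)%E.
Proof.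
move=> mX mY mh h0 XZ YZ XY.
have r0 (W : set R) x : (0 <= (h \_ W) x)%E by rewrite patchE; case: ifP.
have mr (W : set R) : measurable W -> measurable_fun setT (h \_ W).
  by move=> mW; have [k _] := measurable_restrictT h mW; apply: k; exact: (measurable_funTS mh).
rewrite [X in (X + _ <= _)%E]integral_mkcond [X in (_ + X <= _)%E]integral_mkcond [leRHS]integral_mkcond.
rewrite -ge0_integralD; last 5 first.
- exact: measurableT.
- by move=> x _; exact: r0.
- exact: mr.
- by move=> x _; exact: r0.
- exact: mr.
apply: int_le => x _; first exact: r0.
rewrite !patchE; case: (boolP (x \in X)) => [|_]; rewrite ?inE.
  move=> Xx; rewrite memNset; last exact: XY.
  by rewrite adde0 mem_set//; exact: XZ.
case: (boolP (x \in Y)) => [|_]; rewrite ?inE add0e; last by case: ifP.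
by move=> Yx; rewrite mem_set//; exact: YZ.
Qed.

Lemma le_half_absorb (Y A : \bar R) : (0 <= Y)%E -> (Y < +oo)%E ->
  (Y <= A + (2^-1)%:E * Y)%E -> (Y <= 2%:E * A)%E.
Proof.
case: Y => [y| |]//= y0 _; case: A => [a| |].
- by rewrite -!EFinM -EFinD !lee_fin => h; lra.
- by move=> _; rewrite gt0_muley ?leey// lte_fin.
- by rewrite -EFinM.
Qed.

Lemma expr_small (t e : R) : 0 <= t -> t < 1 -> 0 < e -> exists m : nat, t ^+ m <= e.
Proof.
move=> t0 t1 e0; have [->|tn] := eqVneq t 0; first by exists 1%N; rewrite expr1 ltW.
have tp : 0 < t by rewrite lt_def tn.
have H : (fun n : nat => t ^+ n : R) @ \oo --> (0 : R) by apply: cvg_expr; rewrite ger0_norm.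
have /cvgrPdist_le/(_ e e0) [m _ Hm] := H.
exists m; have := Hm m (leqnn m) => /=; rewrite sub0r normrN ger0_norm//.
by rewrite exprn_ge0.
Qed.

Variables (q rho delta C : R) (K : R -> R -> R[i]).
Hypotheses (q1 : 1 < q) (rho1 : 1 < rho) (delta0 : 0 < delta) (C0 : 0 < C).
Hypothesis Ksize : forall x y, x != y -> normc (K x y) <= C / `|x - y|.
Hypothesis Kx : forall x y z, 2 * `|x - z| < `|x - y| ->
  normc (K x y - K z y) <= C * `|x - z| `^ delta / `|x - y| `^ (1 + delta).
Hypothesis Ky : forall x y z, 2 * `|x - z| < `|x - y| ->
  normc (K y x - K y z) <= C * `|x - z| `^ delta / `|x - y| `^ (1 + delta).
Variables (p : R) (w : R -> R) (Cw : R).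
Hypotheses (p1 : 1 < p) (Aw : Ap_ball p w Cw).

Let q1' : 1 <= q. Proof. exact: ltW. Qed.
Let rho0 : 0 < rho. Proof. exact: lt_trans ltr01 rho1. Qed.
Let p0 : 0 < p. Proof. exact: lt_trans ltr01 p1. Qed.
Let w0 x : 0 < w x := Ap_gt0 Aw x.
Let mw : measurable_fun setT w := Ap_meas Aw.
Let mwE (D : set R) : measurable_fun D (fun x => (w x)%:E).
Proof. by apply/measurable_EFinP; exact: (measurable_funTS mw). Qed.
Let wE0 x : (0 <= (w x)%:E)%E. Proof. by rewrite lee_fin ltW. Qed.
(** The share of the w-mass of a ball that [Ap_subset] grants to any subset of at least half its
    length. *)
Let kappa := (Cw * 2 `^ p)^-1.
Let kappa0 : 0 < kappa.
Proof. by rewrite invr_gt0 mulr_gt0 ?powR_gt0// (Ap_const_gt0 Aw). Qed.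

Section majorized.
Variables (U : R -> \bar R) (B : R).
Hypotheses (B0 : 0 < B) (mU : measurable_fun setT U) (U0 : forall x, (0 <= U x)%E).
Hypothesis HU : forall c r x : R, 0 < r -> ball c r x ->
  (\int[mu]_(y in ball c r) U y <= (B * r)%:E * U x)%E.
Variables (N : nat) (C1 : R).
Hypotheses (C10 : 0 <= C1) (weak : weak_type q rho K (cst 1) N C1).
Variable (f : nat -> R -> R[i]).
Hypotheses (nf : forall k, nice (f k)).
Hypothesis FU : forall y, ((vec_norm rho N f y)%:E <= U y)%E.
Local Notation T := (vec_op q rho K N).

Let T0 g x : (0 <= T g x)%E. Proof. exact: lpe_ge0. Qed.
Let mT g : (forall k, nice (g k)) -> measurable_fun setT (T g).
Proof. by move=> ng; exact: (measurable_vec_op q1' rho1 delta0 C0 Ksize Kx Ky N ng). Qed.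

(* The balls [ball c r] are the components of the level set [l < T f]: as the operator is lower semicontinuous and [T f (c - r) <= l], the far part of [f] stays below [(1 + beta) l] on the ball, and the near part is handled by the unweighted weak type estimate and the [A_p] condition. *)
Lemma good_lambda_component (l beta gamma c r : R) : 0 < l -> 0 < beta -> 0 < gamma -> 0 < r ->
  smooth_const q rho delta C B * gamma <= beta -> 8 * C1 * B * gamma <= beta ->
  (T f (c - r) <= l%:E)%E ->
  (\int[mu]_(x in [set x | [/\ ball c r x, ((1 + 2 * beta) * l)%:E < T f x & U x <= (gamma * l)%:E]]) (w x)%:E
   <= (1 - kappa)%:E * \int[mu]_(x in ball c r) (w x)%:E)%E.
Proof.
move=> l0 b0 g0 r0 Hs Hw Tl; set E := [set x | _].
have mB : measurable (ball c r) by exact: measurable_ball.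
have mTf : measurable_fun setT (T f) by exact: mT.
have mE : measurable E.
  have -> : E = ball c r `&` [set x | ((1 + 2 * beta) * l)%:E < T f x]%E `\` [set x | (gamma * l)%:E < U x]%E.
    apply/seteqP; split => x /=; first by move=> [h1 h2 h3]; split => //; apply/negP; rewrite -leNgt.
    by move=> [[h1 h2] /negP]; rewrite -leNgt => h3; split.
  apply: measurableD; last exact: measurable_lt mU.
  by apply: measurableI => //; exact: measurable_lt mTf.
have EB : E `<=` ball c r by move=> x [].
have mA : measurable (ball c r `\` E) by exact: measurableD.
have AB : ball c r `\` E `<=` ball c r by exact: subDsetl.
have dv := Ap_doubling p1 Aw.
have WE := wintE dv c r.
have muB : mu (ball c r) = (2 * r)%:E by rewrite lebesgue_ball// ltW.
(* At most half of the ball, whose length is 2 r; the A_p condition then gives the complement the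
   share [kappa] of the weight. *)
have muE : (mu E <= r%:E)%E.
  have [->|/set0P[x1 Ex1]] := eqVneq E set0; first by rewrite measure0 lee_fin ltW.
  pose h := 2 * r; pose a := c - r.
  have h0 : 0 < h by rewrite mulr_gt0.
  have near_a x : ball c r x -> `|x - a| < h.
    rewrite ball_R/= !ltr_norml /a /h => /andP[e1 e2]; apply/andP; split; lra.
  pose f1 k y : R[i] := if ~~ (3 * h < `|a - y|) then f k y else 0.
  pose f2 k y : R[i] := if 3 * h < `|a - y| then f k y else 0.
  have nf1 k : nice (f1 k).
    apply: nice_if; last exact: nf.
    rewrite [X in measurable X](_ : _ = ~` outside a (3 * h)).
      by apply: measurableC; exact: measurable_outside.
    by apply/seteqP; split => y /= /negP.
  have nf2 k : nice (f2 k).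
    by apply: nice_if; [exact: measurable_outside|exact: nf].
  have fE : f = (fun k y => f1 k y + f2 k y).
    apply/funext => k; apply/funext => y; rewrite /f1 /f2.
    by case: (3 * h < `|a - y|) => /=; rewrite ?addr0 ?add0r.
  have gl0 : 0 < gamma * l by exact: mulr_gt0.
  have sub : E `<=` [set x | ((beta * l)%:E < T f1 x)%E].
    move=> x [Bx lT Ux]; apply: contrapT => /negP; rewrite -leNgt => T1.
    have T2 : (T f2 x <= (l + beta * l)%:E)%E.
      apply: (le_trans (@vec_op_smooth_le R q rho delta C K q1 rho1 delta0 C0 Ksize Kx Ky U B B0 mU U0 HU
        N f a h x (gamma * l) nf h0 (near_a x Bx) Ux FU)).
      rewrite EFinD; apply: leeD => //; rewrite lee_fin mulrA.
      by apply: ler_wpM2r => //; exact: ltW.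
    have : (T f x <= ((1 + 2 * beta) * l)%:E)%E.
      rewrite fE; apply: (le_trans (vec_opD q1' rho1 delta0 C0 Ksize Ky N x nf1 nf2)).
      have -> : ((1 + 2 * beta) * l)%:E = ((beta * l)%:E + (l + beta * l)%:E)%E.
        by rewrite -EFinD; congr (_%:E); ring.
      exact: (leeD T1 T2).
    by rewrite leNgt lT.
  have bl0 : 0 < beta * l by exact: mulr_gt0.
  have := weak nf1 bl0 => H.
  (* The near part lives in the ball of radius 4 h about [a], which contains the point [x1] of E;
     there U is at most gamma l, and [HU] bounds the mass. *)
  have F1 : (\int[mu]_y (vec_norm rho N f1 y * cst 1 y)%:E <= (4 * B * h * (gamma * l))%:E)%E.
    have h4 : 0 < 4 * h by rewrite mulr_gt0.
    have [Bx1 _ Ux1] := Ex1.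
    have Bx : ball a (4 * h) x1.
      by rewrite ball_R/= distrC; have := near_a x1 Bx1 => ?; lra.
    apply: (@le_trans _ _ (\int[mu]_(y in ball a (4 * h)) U y)%E).
      rewrite [leRHS]integral_mkcond; apply: (@int_le _ _ R mu setT) => y _.
        by rewrite patchE; case: ifP.
      rewrite mulr1 patchE; case: ifPn => [_|hy].
        apply: le_trans (FU y); rewrite lee_fin; apply: le_lpn => // k _.
        apply/andP; split; first exact: normc_ge0.
        by rewrite /f1; case: (~~ _); [exact: lexx|rewrite Normc.normc0; exact: normc_ge0].
      rewrite lee_fin /vec_norm /lpn big1 ?powR0 ?gt_eqF ?invr_gt0// => k _.
      have -> : f1 k y = 0.
        rewrite /f1; case: ifPn => //; rewrite -leNgt => h3; exfalso.
        move: hy; rewrite notin_setE ball_R/=; apply.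
        by apply: (le_lt_trans h3); rewrite ltr_pM2r// ltr_nat.
      by rewrite Normc.normc0 powR0 ?gt_eqF.
    apply: (le_trans (HU h4 Bx)).
    apply: (@le_trans _ _ ((B * (4 * h))%:E * (gamma * l)%:E)%E).
      by apply: lee_wpmul2l => //; rewrite lee_fin mulr_ge0// ltW.
    by rewrite -EFinM lee_fin le_eqVlt; apply/orP; left; apply/eqP; ring.
  have mS : measurable [set x | ((beta * l)%:E < T f1 x)%E] by exact: measurable_lt (mT nf1).
  apply: (@le_trans _ _ (mu [set x | ((beta * l)%:E < T f1 x)%E])).
    by apply: le_measure => //; rewrite inE.
  have -> : mu [set x | ((beta * l)%:E < T f1 x)%E] =
      (\int[mu]_(x in [set x | ((beta * l)%:E < T f1 x)%E]) (cst 1 x)%:E)%E.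
    by rewrite -[LHS]mul1e -(integral_cst mu mS).
  apply: (le_trans H).
  apply: (@le_trans _ _ ((C1 / (beta * l))%:E * (4 * B * h * (gamma * l))%:E)%E).
    by apply: lee_wpmul2l => //; rewrite lee_fin divr_ge0// ltW.
  rewrite -EFinM lee_fin /h.
  have -> : C1 / (beta * l) * (4 * B * (2 * r) * (gamma * l)) = (8 * C1 * B * gamma) / beta * r.
    by field; rewrite !gt_eqF.
  by rewrite -[leRHS]mul1r; apply: ler_wpM2r; [exact: ltW|rewrite ler_pdivrMr// mul1r].
have muA : r <= fine (mu (ball c r `\` E)).
  have fA : mu (ball c r `\` E) \is a fin_num.
    rewrite ge0_fin_numE//; apply: (@le_lt_trans _ _ (mu (ball c r))); last by rewrite muB ltry.
    by apply: le_measure => //; rewrite inE.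
  rewrite -lee_fin fineK//.
  have : (mu (ball c r) <= mu E + mu (ball c r `\` E))%E.
    have {1}-> : ball c r = E `|` (ball c r `\` E) by rewrite setDUK.
    exact: measureU2.
  rewrite muB; move: muE fA; case: (mu E) (mu (ball c r `\` E)) => [e| |] [d| |]// muE _.
    by rewrite -EFinD !lee_fin in muE *; lra.
have WA : wint w (ball c r) <= Cw * 2 `^ p * wint w (ball c r `\` E).
  have H := Ap_subset p1 Aw mA AB r0.
  have rp : 0 < r `^ p by exact: powR_gt0.
  have wB0 : 0 < wint w (ball c r) by exact: (wint_gt0 dv c r0).
  rewrite -(ler_pM2l rp).
  apply: (@le_trans _ _ (fine (mu (ball c r `\` E)) `^ p * wint w (ball c r))).
    apply: ler_wpM2r; first exact: ltW.
    by apply: le_powR; [exact: ltW|exact: ltW|exact: muA].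
  apply: (le_trans H); rewrite powRM ?(ltW r0)//.
  by rewrite le_eqVlt; apply/orP; left; apply/eqP; ring.
have wAE : (wint w (ball c r `\` E))%:E = (\int[mu]_(x in ball c r `\` E) (w x)%:E)%E.
  rewrite /wint fineK// ge0_fin_numE; last by apply: integral_ge0 => x _; exact: wE0.
  apply: (@le_lt_trans _ _ (\int[mu]_(x in ball c r) (w x)%:E)%E); last exact: (dbl_fin dv).
  by apply: ge0_subset_integral; [exact: mA|exact: mB|exact: mwE|move=> x _; exact: wE0|exact: AB].
have : (\int[mu]_(x in E) (w x)%:E + \int[mu]_(x in ball c r `\` E) (w x)%:E <=
    \int[mu]_(x in ball c r) (w x)%:E)%E.
  apply: integral_disjoint_le.
  - exact: mE.
  - exact: mA.
  - exact: mwE.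
  - exact: wE0.
  - exact: EB.
  - exact: AB.
  - by move=> x Ex [_].
rewrite -wAE -WE => H.
rewrite -EFinM.
have kW : kappa * wint w (ball c r) <= wint w (ball c r `\` E).
  by rewrite /kappa mulrC ler_pdivrMr ?mulr_gt0 ?powR_gt0 ?(Ap_const_gt0 Aw)// mulrC.
move: H; rewrite -leeBrDr// -EFinB => H; apply: (le_trans H); rewrite lee_fin.
by rewrite mulrBl mul1r; lra.
Qed.

(** Where U <= gamma l the component estimate is summed over the components of {T f > l}. This set
    is bounded since, by [vec_op_far], T f decays away from the support of f. *)
Lemma good_lambda (l beta gamma : R) : 0 < l -> 0 < beta -> 0 < gamma ->
  smooth_const q rho delta C B * gamma <= beta -> 8 * C1 * B * gamma <= beta ->
  (\int[mu]_(x in [set x | ((1 + 2 * beta) * l)%:E < T f x]) (w x)%:E <=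
   (Num.max 0 (1 - kappa))%:E * \int[mu]_(x in [set x | l%:E < T f x]) (w x)%:E +
   \int[mu]_(x in [set x | (gamma * l)%:E < U x]) (w x)%:E)%E.
Proof.
move=> l0 b0 g0 Hs Hw.
have [M0 [r0 [M00 r00 FM Fr]]] := vec_norm_bounded rho1 N nf.
pose I := fine (\int[mu]_y (vec_norm rho N f y)%:E).
have I0 : 0 <= I by apply: fine_ge0; apply: integral_ge0 => y _; rewrite lee_fin vec_norm_ge0.
have IE : (\int[mu]_y (vec_norm rho N f y)%:E = I%:E)%E.
  rewrite fineK// ge0_fin_numE ?(vec_norm_integrable rho1 N nf)//.
  by apply: integral_ge0 => y _; rewrite lee_fin vec_norm_ge0.
have mTf : measurable_fun setT (T f) by exact: mT.
pose Om := [set x | (l%:E < T f x)%E].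
have oOm : open Om by exact: (@open_vec_op R q rho delta C K q1' rho1 delta0 C0 Ksize Kx Ky N f l nf).
have mOm : measurable Om by exact: measurable_lt mTf.
have bOm y : Om y -> `|y| <= r0 + (2 * C * I / l + 1).
  move=> Oy; rewrite leNgt; apply/negP => ly.
  have d0 : 0 < 2 * C * I / l + 1 by rewrite ltr_wpDl// divr_ge0 ?mulr_ge0// ltW.
  have : (T f y <= (2 * C / (2 * C * I / l + 1))%:E * \int[mu]_z (vec_norm rho N f z)%:E)%E.
    apply: (vec_op_far q1' rho1 delta0 C0 Ksize Ky nf d0) => k z kN yz.
    have rz : r0 < `|z|.
      by have := ler_distD z y 0; rewrite !subr0 => ?; lra.
    apply: (@Normc.eq0_normc R); apply: le_anti; rewrite normc_ge0 andbT -(Fr z rz).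
    exact: normc_le_vec_norm.
  apply/negP; rewrite -ltNge IE -EFinM; apply: le_lt_trans Oy; rewrite lee_fin.
  rewrite mulrAC ler_pdivrMr// mulrDr mulr1 mulrCA mulfV ?gt_eqF// mulr1.
  by rewrite lerDl ltW.
have [c [r [rj0 tB OmE Hend]]] := open_components oOm bOm.
pose Ej j := [set x | [/\ ball (c j) (r j) x, (((1 + 2 * beta) * l)%:E < T f x)%E & (U x <= (gamma * l)%:E)%E]].
have mEj j : measurable (Ej j).
  have -> : Ej j = ball (c j) (r j) `&` [set x | ((1 + 2 * beta) * l)%:E < T f x]%E `\` [set x | (gamma * l)%:E < U x]%E.
    apply/seteqP; split => x /=; first by move=> [h1 h2 h3]; split => //; apply/negP; rewrite -leNgt.
    by move=> [[h1 h2] /negP]; rewrite -leNgt => h3; split.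
  apply: measurableD; last exact: measurable_lt mU.
  by apply: measurableI; [exact: measurable_ball|exact: measurable_lt mTf].
have mB j : measurable (ball (c j) (r j)) by exact: measurable_ball.
have tE : trivIset setT Ej.
  by move=> i j _ _ [y [[Bi _ _] [Bj _ _]]]; exact: (tB i j Logic.I Logic.I (ex_intro _ y (conj Bi Bj))).
have theta0 : 0 <= Num.max 0 (1 - kappa) by rewrite le_max lexx.
have sub : [set x | (((1 + 2 * beta) * l)%:E < T f x)%E] `<=`
    (\bigcup_j Ej j) `|` [set x | ((gamma * l)%:E < U x)%E].
  move=> x /= lT; case: (boolP (U x <= (gamma * l)%:E)%E) => Ux; last first.
    by right; rewrite /= ltNge.
  have : Om x.
    apply: le_lt_trans lT; rewrite lee_fin -[leLHS]mul1r; apply: ler_wpM2r; first exact: ltW.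
    by rewrite lerDl mulr_ge0// ltW.
  by rewrite OmE => -[j _ Bj]; left; exists j.
have mUl : measurable [set x | ((gamma * l)%:E < U x)%E] by exact: measurable_lt mU.
have mbig : measurable (\bigcup_j Ej j) by apply: bigcup_measurable.
apply: (@le_trans _ _ (\int[mu]_(x in (\bigcup_j Ej j) `|` [set x | ((gamma * l)%:E < U x)%E]) (w x)%:E)%E).
  apply: ge0_subset_integral.
  - exact: measurable_lt mTf.
  - exact: measurableU.
  - exact: mwE.
  - by move=> x _; exact: wE0.
  - exact: sub.
apply: (@le_trans _ _ (\int[mu]_(x in \bigcup_j Ej j) (w x)%:E +
    \int[mu]_(x in [set x | ((gamma * l)%:E < U x)%E]) (w x)%:E)%E).
  by apply: ge0_integral_setU_le; [exact: mbig|exact: mUl|exact: mwE|exact: wE0].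
apply: leeD; last exact: lexx.
rewrite ge0_integral_bigcup//; last exact: mwE.
apply: (@le_trans _ _ (\sum_(j <oo) ((Num.max 0 (1 - kappa))%:E * \int[mu]_(x in ball (c j) (r j)) (w x)%:E))%E).
  apply: lee_nneseries => [j *|j *]; first by apply: integral_ge0 => x _; exact: wE0.
  have [rj|rj] := ltP 0 (r j); last first.
    have -> : Ej j = set0.
      by apply/seteqP; split => x //= -[]; rewrite ball_nonpos.
    by rewrite integral_set0 mule_ge0 ?integral_ge0// lee_fin.
  have Tl : (T f (c j - r j) <= l%:E)%E.
    have [nO _] := Hend j rj; rewrite leNgt; apply/negP => h; exact: (nO h).
  apply: (le_trans (good_lambda_component l0 b0 g0 rj Hs Hw Tl)).
  apply: lee_wpmul2r; first exact: integral_ge0.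
  by rewrite lee_fin le_max lexx orbT.
rewrite nneseriesZl; last by move=> j _; exact: integral_ge0.
apply: lee_wpmul2l; first by rewrite lee_fin.
by rewrite -/Om OmE ge0_integral_bigcup//; exact: mwE.
Qed.

(** One step gains only the fixed factor 1 - kappa, which need not outweigh the 2^p lost in doubling
    the level. The level is therefore doubled in m small steps, each gaining this factor. *)
Lemma good_lambda_iter (l beta gamma : R) m : 0 < l -> 0 < beta -> 0 < gamma ->
  smooth_const q rho delta C B * gamma <= beta -> 8 * C1 * B * gamma <= beta ->
  (\int[mu]_(x in [set x | ((1 + 2 * beta) ^+ m * l)%:E < T f x]) (w x)%:E <=
   (Num.max 0 (1 - kappa) ^+ m)%:E * \int[mu]_(x in [set x | l%:E < T f x]) (w x)%:E +
   m%:R%:E * \int[mu]_(x in [set x | (gamma * l)%:E < U x]) (w x)%:E)%E.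
Proof.
move=> l0 b0 g0 Hs Hw.
set th := Num.max 0 _.
have th0 : 0 <= th by rewrite le_max lexx.
have th1 : th <= 1 by rewrite ge_max ler01 lerBlDr lerDl ltW.
have b1 : 1 <= 1 + 2 * beta by rewrite lerDl mulr_ge0// ltW.
have bp0 : 0 < 1 + 2 * beta := lt_le_trans ltr01 b1.
have iw0 (X : set R) : (0 <= \int[mu]_(x in X) (w x)%:E)%E by exact: integral_ge0.
elim: m => [|m IH].
  by rewrite !expr0 mul1r mul1e mul0e adde0 lexx.
have lm0 : 0 < (1 + 2 * beta) ^+ m * l by rewrite mulr_gt0// exprn_gt0.
rewrite [(1 + 2 * beta) ^+ m.+1]exprS -mulrA.
apply: (le_trans (good_lambda lm0 b0 g0 Hs Hw)); rewrite -/th.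
apply: (@le_trans _ _ (th%:E * ((th ^+ m)%:E * \int[mu]_(x in [set x | l%:E < T f x]) (w x)%:E +
   m%:R%:E * \int[mu]_(x in [set x | (gamma * l)%:E < U x]) (w x)%:E) +
   \int[mu]_(x in [set x | (gamma * l)%:E < U x]) (w x)%:E)%E).
  apply: leeD; first by apply: lee_wpmul2l => //; rewrite lee_fin.
  apply: ge0_subset_integral.
  - exact: measurable_lt mU.
  - exact: measurable_lt mU.
  - exact: mwE.
  - by move=> x _; exact: wE0.
  move=> x /= hx; apply: le_lt_trans hx; rewrite lee_fin; apply: ler_wpM2l; first exact: ltW.
  by rewrite -[leLHS]mul1r; apply: ler_wpM2r; [exact: ltW|exact: exprn_ege1].
rewrite ge0_muleDr ?mule_ge0// ?lee_fin ?exprn_ge0//.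
rewrite muleA -EFinM -exprS -addeA; apply: leeD => //.
rewrite -natr1 EFinD ge0_muleDl ?lee_fin// mul1e; apply: leeD => //.
rewrite -[leRHS]mul1e; apply: lee_wpmul2r; first by rewrite mule_ge0// lee_fin.
by rewrite lee_fin.
Qed.

(** The size of the kernel and [HU] on the ball of radius 2 |x| about 0, which contains [x] and the
    support. It supplies the a priori finiteness that absorption needs. *)
Lemma vec_op_far_le (r0 x : R) : (forall y, r0 < `|y| -> vec_norm rho N f y = 0) ->
  0 < r0 -> 2 * r0 < `|x| -> (T f x <= (8 * C * B)%:E * U x)%E.
Proof.
move=> Fr r00 hx; have x0 : 0 < `|x| by apply: lt_trans hx; rewrite mulr_gt0.
have d0 : 0 < `|x| / 2 by rewrite divr_gt0.
have x2 : 0 < 2 * `|x| by rewrite mulr_gt0.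
have : (T f x <= (2 * C / (`|x| / 2))%:E * \int[mu]_z (vec_norm rho N f z)%:E)%E.
  apply: (vec_op_far q1' rho1 delta0 C0 Ksize Ky nf d0) => k z kN yz.
  have rz : r0 < `|z|.
    by have := ler_distD z x 0; rewrite !subr0 => ?; lra.
  apply: (@Normc.eq0_normc R); apply: le_anti; rewrite normc_ge0 andbT -(Fr z rz).
  exact: normc_le_vec_norm.
move=> H; apply: (le_trans H).
have Bx : ball 0 (2 * `|x|) x by rewrite ball_R/= sub0r normrN; lra.
have c0 : 0 <= 2 * C / (`|x| / 2) by rewrite divr_ge0 ?mulr_ge0// ltW.
apply: (@le_trans _ _ ((2 * C / (`|x| / 2))%:E * ((B * (2 * `|x|))%:E * U x))%E).
  apply: lee_wpmul2l; first by rewrite lee_fin.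
  apply: le_trans (HU x2 Bx); rewrite [leRHS]integral_mkcond; apply: (@int_le _ _ R mu setT) => y _.
    by rewrite patchE; case: ifP.
  rewrite patchE; case: ifPn => // hy; rewrite lee_fin Fr//.
  by move: hy; rewrite notin_setE ball_R/= sub0r normrN => /negP; rewrite -leNgt => ?; lra.
rewrite muleA -EFinM; apply: lee_wpmul2r => //; rewrite lee_fin le_eqVlt; apply/orP; left; apply/eqP.
by field; rewrite gt_eqF.
Qed.

End majorized.
End good_lambda.

(** * Strong type (p, p) from the good-lambda inequality *)

Section strong_type.
Context {R : realType}.
Local Notation mu := (@lebesgue_measure R).
Variables (q rho delta C : R) (K : R -> R -> R[i]).
Hypotheses (q1 : 1 < q) (rho1 : 1 < rho) (delta0 : 0 < delta) (C0 : 0 < C).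
Hypothesis Ksize : forall x y, x != y -> normc (K x y) <= C / `|x - y|.
Hypothesis Kx : forall x y z, 2 * `|x - z| < `|x - y| ->
  normc (K x y - K z y) <= C * `|x - z| `^ delta / `|x - y| `^ (1 + delta).
Hypothesis Ky : forall x y z, 2 * `|x - z| < `|x - y| ->
  normc (K y x - K y z) <= C * `|x - z| `^ delta / `|x - y| `^ (1 + delta).
Variables (p : R) (w : R -> R) (Cw : R).
Hypotheses (p1 : 1 < p) (Aw : Ap_ball p w Cw).

Let q1' : 1 <= q. Proof. exact: ltW. Qed.
Let p0 : 0 < p. Proof. exact: lt_trans ltr01 p1. Qed.
Let w0 x : 0 < w x := Ap_gt0 Aw x.
Let mw : measurable_fun setT w := Ap_meas Aw.
Let mwE (D : set R) : measurable_fun D (fun x => (w x)%:E).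
Proof. by apply/measurable_EFinP; exact: (measurable_funTS mw). Qed.
Let wE0 x : (0 <= (w x)%:E)%E. Proof. by rewrite lee_fin ltW. Qed.

Lemma level_factor : exists (m : nat) (beta : R), [/\ 0 < beta, (1 + 2 * beta) ^+ m = 2 &
  2 `^ p * Num.max 0 (1 - (Cw * 2 `^ p)^-1) ^+ m <= 2^-1].
Proof.
have Cw0 : 0 < Cw by exact: (Ap_const_gt0 Aw).
set th := Num.max _ _.
have th0 : 0 <= th by rewrite le_max lexx.
have th1 : th < 1 by rewrite gt_max ltr01/= ltrBlDr ltrDl invr_gt0 mulr_gt0 ?powR_gt0.
have p20 : 0 < 2 `^ p :> R by exact: powR_gt0.
have [m0 Hm0] : exists m : nat, th ^+ m <= 2^-1 / 2 `^ p.
  by apply: expr_small => //; rewrite divr_gt0.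
(* The successor keeps m nonzero, so that 2 has an m-th root. *)
pose m := m0.+1; pose b : R := 2 `^ (m%:R)^-1.
have bm : b ^+ m = 2.
  by rewrite -powR_mulrn ?powR_ge0// /b -powRrM mulVf ?pnatr_eq0// powRr1.
have b1 : 1 < b.
  rewrite ltNge; apply/negP => b1; have : b ^+ m <= 1 by apply: exprn_ile1 => //; exact: powR_ge0.
  by rewrite bm; lra.
exists m, ((b - 1) / 2); split.
- by rewrite divr_gt0// subr_gt0.
- have -> : 1 + 2 * ((b - 1) / 2) = b by lra.
  exact: bm.
- rewrite mulrC -ler_pdivlMr//; apply: le_trans Hm0.
  by rewrite /m exprS -[leRHS]mul1r; apply: ler_wpM2r; [exact: exprn_ge0|exact: ltW].
Qed.

Lemma sum_upper_levels (U : R -> \bar R) (l : R) J : measurable_fun setT U ->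
  (forall x, 0 <= U x)%E -> 0 < l ->
  (\sum_(j < J) (((l * 2 ^+ j) `^ p)%:E *
      \int[mu]_(x in [set x | ((l * 2 ^+ j)%:E < U x)%E]) (w x)%:E) <=
   ((1 - 2 `^ (- p))^-1)%:E * \int[mu]_x (U x `^ p * (w x)%:E))%E.
Proof.
move=> mU U0 l0; set cs := (1 - _)^-1.
have cs0 : 0 <= cs by rewrite invr_ge0 subr_ge0 ltW// two_powRN_lt1.
pose g (j : nat) (x : R) : \bar R := if ((l * 2 ^+ j)%:E < U x)%E then ((l * 2 ^+ j) `^ p)%:E else 0%E.
have g0 j x : (0 <= g j x)%E by rewrite /g; case: ifP => // _; rewrite lee_fin powR_ge0.
have mg j : measurable_fun setT (g j).
  apply: measurable_fun_ifT => //; apply: (measurable_fun_bool true); rewrite setTI.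
  exact: measurable_lt mU.
have gw0 j x : (0 <= g j x * (w x)%:E)%E by exact: mule_ge0.
have mgw j : measurable_fun setT (fun x => (g j x * (w x)%:E)%E).
  by apply: emeasurable_funM; [exact: mg|exact: mwE].
apply: (@le_trans _ _ (\sum_(j < J) \int[mu]_x (g j x * (w x)%:E))%E).
  apply: lee_sum => j _; rewrite -ge0_integralZl_EFin; last 4 first.
  - exact: measurable_lt mU.
  - by move=> x _; exact: wE0.
  - exact: mwE.
  - exact: powR_ge0.
  rewrite [leLHS]integral_mkcond; apply: (@int_le _ _ R mu setT) => x _; first exact: gw0.
  rewrite patchE; case: ifPn => [|_]; last exact: gw0.
  by rewrite inE/= /g => ->.
rewrite -ge0_integral_sum; last 3 first.
- exact: measurableT.
- by move=> j; exact: mgw.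
- by move=> j x _; exact: gw0.
have UP0 x : (0 <= U x `^ p * (w x)%:E)%E by rewrite mule_ge0// poweR_ge0.
rewrite -ge0_integralZl_EFin; last 4 first.
- exact: measurableT.
- by move=> x _; exact: UP0.
- by apply: emeasurable_funM; [exact: measurableT_comp (measurable_poweR _) mU|exact: mwE].
- exact: cs0.
apply: int_le => x _; first by rewrite mule_ge0// lee_fin.
rewrite -ge0_sume_distrl; last by move=> j _; exact: g0.
rewrite muleA; apply: lee_wpmul2r => //.
apply: le_trans (le_nneseries J (g0 ^~ x)) _.
exact: (sum_levels_lee p0 l0 (U0 x)).
Qed.

(** Summed over the levels e 2^j, the good-lambda inequality bounds the level sum of T f by half of
    itself plus terms in [U]. Half is absorbed in a finite partial sum: the weight of {T f > e} is
    finite, because T f <= c U off a ball and w is locally integrable. As e tends to 0 the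
    contribution of that ball disappears. *)
Lemma strong_type_of_weak_type (C1 : R) : 0 <= C1 -> exists2 D, 0 <= D &
  forall N, weak_type q rho K (cst 1) N C1 -> strong_type q rho K p w N D.
Proof.
move=> C10.
have [B [D [B0 D0 maj]]] := A1_majorant p1 Aw.
have [m [beta [b0 bm thm]]] := level_factor.
pose SC := smooth_const q rho delta C B.
(* Small enough for both conditions of [good_lambda]. *)
pose gamma := beta / (1 + `|SC| + 8 * C1 * B).
have CB0 : 0 <= 8 * C1 * B by rewrite !mulr_ge0// ltW.
have k0 : 0 < 1 + `|SC| + 8 * C1 * B.
  by have := normr_ge0 SC => ?; lra.
have g0 : 0 < gamma by exact: divr_gt0.
have gS : SC * gamma <= beta.
  rewrite /gamma mulrA ler_pdivrMr// mulrC; apply: ler_wpM2l; first exact: ltW.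
  by have := ler_norm SC; lra.
have gC : 8 * C1 * B * gamma <= beta.
  rewrite /gamma mulrA ler_pdivrMr// mulrC; apply: ler_wpM2l; first exact: ltW.
  by have := normr_ge0 SC; lra.
pose c := 8 * C * B; have c0 : 0 < c by rewrite !mulr_gt0.
pose cs : R := (1 - 2 `^ (- p))^-1.
have cs0 : 0 <= cs by rewrite invr_ge0 subr_ge0 ltW// two_powRN_lt1.
pose P2 : R := 2 `^ p; have P20 : 0 < P2 by exact: powR_gt0.
pose c4 := c `^ p + P2 * (2 * (c `^ p + P2 * m%:R * (gamma `^ p)^-1 * cs)).
have gp0 : 0 < gamma `^ p by exact: powR_gt0.
have cp0 : 0 < c `^ p by exact: powR_gt0.
have gpV : 0 <= (gamma `^ p)^-1 by rewrite invr_ge0 ltW.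
have k2 : 0 <= P2 * m%:R * (gamma `^ p)^-1 := mulr_ge0 (mulr_ge0 (ltW P20) (ler0n R m)) gpV.
have k1 : 0 <= P2 * m%:R * (gamma `^ p)^-1 * cs := mulr_ge0 k2 cs0.
have c40 : 0 < c4.
  by rewrite /c4 ltr_pwDl// mulr_ge0 ?(ltW P20)// mulr_ge0// addr_ge0// ltW.
exists (c4 * D); first by rewrite mulr_ge0// ltW.
move=> N weak f nf.
have [M0 [r0 [M00 r00 FM Fr]]] := vec_norm_bounded rho1 N nf.
pose F := vec_norm rho N f.
have F0 x : (0 <= (F x)%:E)%E by rewrite lee_fin vec_norm_ge0.
have mF : measurable_fun setT (fun x => (F x)%:E).
  by apply/measurable_EFinP; apply: measurable_vec_norm => k; have [] := nf k.
have [U [mU FU HU UP]] := maj (fun x => (F x)%:E) mF F0.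
have U0 x : (0 <= U x)%E by exact: le_trans (F0 x) (FU x).
have T0 x : (0 <= vec_op q rho K N f x)%E by exact: lpe_ge0.
have mT : measurable_fun setT (vec_op q rho K N f).
  exact: (measurable_vec_op q1' rho1 delta0 C0 Ksize Kx Ky N nf).
have far x := @vec_op_far_le R q rho delta C K q1 rho1 delta0 C0 Ksize Ky U B U0 HU N f nf FU r0 x Fr r00.
have iter l l0 := @good_lambda_iter R q rho delta C K q1 rho1 delta0 C0 Ksize Kx Ky p w Cw p1 Aw
  U B B0 mU U0 HU N C1 C10 weak f nf FU l beta gamma m l0 b0 g0 gS gC.
move: (vec_op q rho K N f) T0 mT far iter => T T0 mT far iter.
suff H : (\int[mu]_x (T x `^ p * (w x)%:E) <= c4%:E * \int[mu]_x (U x `^ p * (w x)%:E))%E.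
  apply: (le_trans H); rewrite EFinM -muleA; apply: lee_wpmul2l; first by rewrite lee_fin ltW.
  apply: (le_trans UP); apply: lee_wpmul2l; first by rewrite lee_fin.
  apply: int_le => x _; first by rewrite lee_fin mulr_ge0 ?powR_ge0// ltW.
  by rewrite poweR_EFin -EFinM lexx.
have UP0 x : (0 <= U x `^ p * (w x)%:E)%E by rewrite mule_ge0// poweR_ge0.
have mUp : measurable_fun setT (fun x => (U x `^ p * (w x)%:E)%E).
  by apply: emeasurable_funM; [exact: measurableT_comp (measurable_poweR _) mU|exact: mwE].
have IX0 : (0 <= \int[mu]_x (U x `^ p * (w x)%:E))%E by exact: integral_ge0.
have [Xoo|Xfin] := eqVneq (\int[mu]_x (U x `^ p * (w x)%:E))%E +oo%E.
  by rewrite Xoo gt0_muley ?leey// lte_fin.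
have [X XE X0] : exists2 X : R, (\int[mu]_x (U x `^ p * (w x)%:E) = X%:E)%E & 0 <= X.
  move: IX0 Xfin; case: (\int[mu]_x (U x `^ p * (w x)%:E))%E => [X| |]// X0 _.
  by exists X => //; rewrite -lee_fin.
have dv := Ap_doubling p1 Aw.
pose near : set R := ball (0 : R) (3 * r0).
have mn : measurable near by exact: measurable_ball.
pose W := wint w near.
have WE : (W%:E = \int[mu]_(x in near) (w x)%:E)%E by exact: (wintE dv).
have W0 : 0 <= W by apply: fine_ge0; exact: integral_ge0.
have farU x : x \notin near -> (T x `^ p <= (c `^ p)%:E * U x `^ p)%E.
  rewrite notin_setE /near ball_R/= sub0r normrN => /negP; rewrite -leNgt => hx.
  have Tx : (T x <= c%:E * U x)%E by apply: (far x) => //; lra.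
  apply: (le_trans (le_poweR (ltW p0) (T0 x) Tx)).
  by rewrite poweRM ?lee_fin ?(ltW c0)// poweR_EFin.
pose nw x : \bar R := ((\1_near x)%:E * (w x)%:E)%E.
have nw0 x : (0 <= nw x)%E by rewrite mule_ge0// lee_fin.
have mnw : measurable_fun setT nw.
  by apply: emeasurable_funM; [apply/measurable_EFinP; exact: measurable_indic|exact: mwE].
have nwE : (\int[mu]_x nw x = W%:E)%E.
  rewrite WE [RHS]integral_mkcond; apply: eq_integral => x _; rewrite patchE /nw indicE.
  by case: (x \in near); rewrite ?mul1e ?mul0e.
have base (e : R) : 0 < e -> (\int[mu]_x ((e `^ p)%:E * nw x + (c `^ p)%:E * (U x `^ p * (w x)%:E)) =
    (e `^ p * W + c `^ p * X)%:E)%E.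
  move=> e0; rewrite ge0_integralD; last 5 first.
  - exact: measurableT.
  - by move=> x _; rewrite mule_ge0// lee_fin powR_ge0.
  - exact: measurable_funeM.
  - by move=> x _; rewrite mule_ge0// lee_fin powR_ge0.
  - exact: measurable_funeM.
  rewrite ge0_integralZl_EFin; last 4 first.
  - exact: measurableT.
  - by move=> x _; exact: nw0.
  - exact: mnw.
  - exact: powR_ge0.
  rewrite ge0_integralZl_EFin; last 4 first.
  - exact: measurableT.
  - by move=> x _; exact: UP0.
  - exact: mUp.
  - exact: powR_ge0.
  by rewrite nwE XE -!EFinM -EFinD.
pose lev (e : R) j := (\int[mu]_(x in [set x | ((e * 2 ^+ j)%:E < T x)%E]) (w x)%:E)%E.
have lev0 e j : (0 <= lev e j)%E by exact: integral_ge0.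
have mlev (e : R) j : measurable [set x | ((e * 2 ^+ j)%:E < T x)%E] by exact: measurable_lt mT.
have bg0 (e : R) x : (0 <= (e `^ p)%:E * nw x + (c `^ p)%:E * (U x `^ p * (w x)%:E))%E.
  by rewrite adde_ge0// mule_ge0// lee_fin powR_ge0.
have lev_base (e : R) : 0 < e -> ((e `^ p)%:E * lev e 0%N <= (e `^ p * W + c `^ p * X)%:E)%E.
  move=> e0; rewrite -base// /lev -ge0_integralZl_EFin; last 4 first.
  - exact: mlev.
  - by move=> x _; exact: wE0.
  - exact: mwE.
  - exact: powR_ge0.
  rewrite [leLHS]integral_mkcond; apply: (@int_le _ _ R mu setT) => x _; first exact: bg0.
  rewrite patchE; case: ifPn => [|_]; last exact: bg0.
  rewrite inE/= expr0 mulr1 => eT.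
  have [xn|xn] := boolP (x \in near).
    by rewrite /nw indicE xn mul1e; apply: leeDl; rewrite mule_ge0// lee_fin powR_ge0.
  have n0 : (0 <= (e `^ p)%:E * nw x)%E by rewrite mule_ge0// lee_fin powR_ge0.
  apply: (le_trans _ (leeDr _ n0)).
  rewrite muleA; apply: lee_wpmul2r => //; apply: le_trans (farU x xn).
  by rewrite -poweR_EFin; apply: le_poweR; [exact: ltW|rewrite lee_fin ltW|exact: ltW].
have levS (e : R) J : 0 < e ->
    (\sum_(j < J) (((e * 2 ^+ j) `^ p)%:E * lev e j) <=
     (2 * (e `^ p * W + c `^ p * X + P2 * m%:R * (gamma `^ p)^-1 * cs * X))%:E)%E.
  move=> e0; have ep0 : 0 < e `^ p by exact: powR_gt0.
  have l0fin : (lev e 0%N < +oo)%E.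
    have := lev_base e e0; have := lev0 e 0%N; case: (lev e 0%N) => [z| |]//.
    - by move=> _ _; exact: ltry.
    - by move=> _; rewrite gt0_muley// lte_fin.
  have levfin j : (lev e j < +oo)%E.
    apply: le_lt_trans l0fin; apply: ge0_subset_integral.
    - exact: mlev.
    - exact: mlev.
    - exact: mwE.
    - by move=> x _; exact: wE0.
    - move=> x /=; rewrite expr0 mulr1 => h; apply: le_lt_trans h; rewrite lee_fin.
      by rewrite -[leLHS]mulr1; apply: ler_wpM2l; [exact: ltW|apply: exprn_ege1; rewrite ler1n].
  pose a j : R := (e * 2 ^+ j) `^ p.
  have a0 j : 0 <= a j by exact: powR_ge0.
  have aS j : a j.+1 = P2 * a j.
    have ej : 0 <= e * 2 ^+ j by rewrite mulr_ge0 ?exprn_ge0// ltW.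
    have -> : a j.+1 = (2 * (e * 2 ^+ j)) `^ p by rewrite /a exprS mulrCA.
    by rewrite powRM.
  have S0 : (0 <= \sum_(j < J) ((a j)%:E * lev e j))%E.
    by apply: sume_ge0 => j _; rewrite mule_ge0// lee_fin.
  have Sfin : (\sum_(j < J) ((a j)%:E * lev e j) < +oo)%E.
    by apply: lte_sum_pinfty => j _; rewrite lte_mul_pinfty// lee_fin.
  rewrite EFinM; apply: le_half_absorb => //.
  pose up j := (\int[mu]_(x in [set x | ((gamma * (e * 2 ^+ j))%:E < U x)%E]) (w x)%:E)%E.
  have up0 j : (0 <= up j)%E by exact: integral_ge0.
  have stepS (j : nat) : ((a j.+1)%:E * lev e j.+1 <=
      (2^-1)%:E * ((a j)%:E * lev e j) + (P2 * m%:R * (gamma `^ p)^-1)%:E *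
        (((gamma * e * 2 ^+ j) `^ p)%:E * up j))%E.
    have ej0 : 0 < e * 2 ^+ j by rewrite mulr_gt0// exprn_gt0.
    have := iter _ ej0; rewrite bm.
    have -> : 2 * (e * 2 ^+ j) = e * 2 ^+ j.+1 by rewrite exprS mulrCA.
    rewrite -/(lev e j.+1) -/(lev e j) -/(up j) => H.
    apply: (le_trans (lee_wpmul2l _ H)); first by rewrite lee_fin.
    set th := Num.max 0 _ in thm *.
    have th0 : 0 <= th ^+ m by rewrite exprn_ge0// le_max lexx.
    rewrite ge0_muleDr ?mule_ge0// ?lee_fin// aS; apply: leeD.
      rewrite !muleA -!EFinM; apply: lee_wpmul2r => //; rewrite lee_fin.
      by rewrite mulrAC; apply: ler_wpM2r.
    rewrite !muleA -!EFinM; apply: lee_wpmul2r => //; rewrite lee_fin.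
    have -> : (gamma * e * 2 ^+ j) `^ p = gamma `^ p * a j.
      by rewrite -mulrA powRM// ?ltW.
    rewrite le_eqVlt; apply/orP; left; apply/eqP; field; rewrite gt_eqF//.
  have shift : (\sum_(j < J) ((a j)%:E * lev e j) <=
      (a 0%N)%:E * lev e 0%N + \sum_(j < J) ((a j.+1)%:E * lev e j.+1))%E.
    apply: (@le_trans _ _ (\sum_(j < J.+1) ((a j)%:E * lev e j))%E).
      by rewrite big_ord_recr/=; apply: leeDl; rewrite mule_ge0// lee_fin.
    by rewrite big_ord_recl.
  apply: (le_trans shift).
  apply: (@le_trans _ _ ((e `^ p * W + c `^ p * X)%:E + ((2^-1)%:E * \sum_(j < J) ((a j)%:E * lev e j) +
     (P2 * m%:R * (gamma `^ p)^-1)%:E * (cs * X)%:E))%E).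
    apply: leeD.
      by have := lev_base e e0; rewrite /a expr0 mulr1.
    apply: (@le_trans _ _ (\sum_(j < J) ((2^-1)%:E * ((a j)%:E * lev e j) +
        (P2 * m%:R * (gamma `^ p)^-1)%:E * (((gamma * e * 2 ^+ j) `^ p)%:E * up j)))%E).
      by apply: lee_sum => j _; exact: stepS.
    rewrite big_split/= -!ge0_sume_distrr; last 2 first.
    - by move=> j _; rewrite mule_ge0// lee_fin powR_ge0.
    - by move=> j _; rewrite mule_ge0// lee_fin.
    apply: leeD => //; apply: lee_wpmul2l.
      by rewrite lee_fin.
    have ge0' : 0 < gamma * e by exact: mulr_gt0.
    have := sum_upper_levels J mU U0 ge0'; rewrite XE -EFinM => H; apply: le_trans H.
    apply: lee_sum => j _; rewrite /up mulrA; exact: lexx.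
  rewrite addeCA addeC -EFinM -EFinD; apply: leeD => //; rewrite lee_fin.
  by rewrite le_eqVlt; apply/orP; left; apply/eqP; ring.
apply/lee_addgt0Pr => eta eta0.
pose W' := W + P2 * (2 * W).
have W'0 : 0 <= W' by rewrite addr_ge0// mulr_ge0 ?(ltW P20)// mulr_ge0.
(* [W'] collects the coefficients of e^p in the final bound, so that they contribute at most eta. *)
pose e := (eta / (W' + 1)) `^ p^-1.
have W'1 : 0 < W' + 1 by rewrite ltr_wpDl.
have e0 : 0 < e by rewrite powR_gt0// divr_gt0.
have eW : e `^ p * W' <= eta.
  rewrite /e powRVK ?gt_eqF//; last by rewrite divr_ge0// ltW.
  by rewrite mulrAC ler_pdivrMr//; apply: ler_wpM2l; [exact: ltW|lra].
pose h j x : \bar R := if ((e * 2 ^+ j)%:E < T x)%E then ((2 * (e * 2 ^+ j)) `^ p)%:E else 0%E.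
have h0 j x : (0 <= h j x)%E by rewrite /h; case: ifP => // _; rewrite lee_fin powR_ge0.
have mh j : measurable_fun setT (h j).
  apply: measurable_fun_ifT => //; apply: (measurable_fun_bool true); rewrite setTI.
  exact: mlev.
have hw0 j x : (0 <= h j x * (w x)%:E)%E by exact: mule_ge0.
have mhw j : measurable_fun setT (fun x => (h j x * (w x)%:E)%E).
  by apply: emeasurable_funM; [exact: mh|exact: mwE].
have hs0 x : (0 <= \sum_(j <oo) (h j x * (w x)%:E))%E by exact: nneseries_ge0.
apply: (@le_trans _ _ (\int[mu]_x (((e `^ p)%:E * nw x + (c `^ p)%:E * (U x `^ p * (w x)%:E)) +
    \sum_(j <oo) (h j x * (w x)%:E)))%E).
  apply: int_le => x _; first exact: adde_ge0.
  case: (boolP (e%:E < T x)%E) => eT.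
    apply: (@le_trans _ _ (\sum_(j <oo) (h j x * (w x)%:E))%E); last exact: leeDr.
    apply: (@le_trans _ _ ((\sum_(j <oo) h j x) * (w x)%:E)%E).
      by apply: lee_wpmul2r => //; exact: le_sum_levels.
    by apply: nneseries_mulr_le.
  apply: (le_trans _ (leeDl _ (hs0 x))).
  have [xn|xn] := boolP (x \in near).
    have n0 : (0 <= (c `^ p)%:E * (U x `^ p * (w x)%:E))%E by rewrite mule_ge0// lee_fin powR_ge0.
    apply: (le_trans _ (leeDl _ n0)); rewrite /nw indicE xn mul1e; apply: lee_wpmul2r => //.
    by rewrite -poweR_EFin; apply: le_poweR; [exact: ltW|exact: T0|rewrite leNgt].
  have n0 : (0 <= (e `^ p)%:E * nw x)%E by rewrite mule_ge0// lee_fin powR_ge0.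
  apply: (le_trans _ (leeDr _ n0)).
  by rewrite muleA; apply: lee_wpmul2r => //; exact: farU.
rewrite ge0_integralD; last 5 first.
- exact: measurableT.
- by move=> x _; exact: bg0.
- by apply: emeasurable_funD; exact: measurable_funeM.
- by move=> x _; exact: hs0.
- by apply: ge0_emeasurable_sum => [j x _ _|j _]; [exact: hw0|exact: mhw].
rewrite base// integral_nneseries//.
apply: (@le_trans _ _ ((e `^ p * W + c `^ p * X)%:E + (P2 * (2 * (e `^ p * W + c `^ p * X + P2 * m%:R * (gamma `^ p)^-1 * cs * X)))%:E)%E).
  apply: leeD => //; apply: nneseries_le => [j|J]; first exact: integral_ge0.
  rewrite EFinM; apply: (@le_trans _ _ (P2%:E * \sum_(j < J) (((e * 2 ^+ j) `^ p)%:E * lev e j))%E); last first.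
    by apply: lee_wpmul2l; [rewrite lee_fin ltW|exact: levS].
  rewrite ge0_sume_distrr; last by move=> j _; rewrite mule_ge0// lee_fin powR_ge0.
  apply: lee_sum => j _; rewrite muleA -EFinM -powRM//; last by rewrite mulr_ge0 ?exprn_ge0// ltW.
  rewrite /lev -ge0_integralZl_EFin; last 4 first.
  - exact: mlev.
  - by move=> x _; exact: wE0.
  - exact: mwE.
  - exact: powR_ge0.
  rewrite integral_if_lt; apply: int_le => x _.
    by case: ifP => // _; rewrite mule_ge0// lee_fin powR_ge0.
  by rewrite /h; case: ifP => // _; rewrite mul0e.
rewrite XE -EFinM -!EFinD lee_fin /c4.
have -> : e `^ p * W + c `^ p * X + P2 * (2 * (e `^ p * W + c `^ p * X + P2 * m%:R * (gamma `^ p)^-1 * cs * X)) =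
  (c `^ p + P2 * (2 * (c `^ p + P2 * m%:R * (gamma `^ p)^-1 * cs))) * X + e `^ p * W' by rewrite /W'; ring.
by rewrite lerD2l.
Qed.

End strong_type.

(** * General functions and weights *)

Section lower_limits.
Context {R : realType}.
Local Notation mu := (@lebesgue_measure R).

Lemma le_limn_einf (a : \bar R) (u : nat -> \bar R) : (forall n, 0 <= u n)%E ->
  lsc_along \oo a u -> (a <= limn_einf u)%E.
Proof.
move=> u0 au; have lE : limn_einf u = ereal_sup (range (einfs u)).
  rewrite limn_einf_lim; apply/cvg_lim => //.
  by apply: ereal_nondecreasing_cvgn; exact: nondecreasing_einfs.
have e0 n : (0 <= einfs u n)%E by apply: le_ereal_inf_tmp => _ [k _ <-]; exact: u0.
have eL n : (einfs u n <= limn_einf u)%E by rewrite lE; apply: ereal_sup_ubound; exists n.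
rewrite leNgt; apply/negP => La.
have [l Ll la] := real_between (le_trans (e0 0%N) (eL 0%N)) La.
have [N _ HN] := au l la.
have : (l%:E <= limn_einf u)%E.
  apply: le_trans (eL N); apply: le_ereal_inf_tmp => _ [k Nk <-].
  exact/ltW/HN.
by rewrite leNgt Ll.
Qed.

Lemma limn_einf_le (u : nat -> \bar R) (X : \bar R) : (forall n, u n <= X)%E ->
  (limn_einf u <= X)%E.
Proof.
move=> uX; rewrite limn_einf_lim; apply: lime_le; first exact: is_cvg_einfs.
apply: nearW => n; apply: le_trans (uX n).
by apply: ereal_inf_lbound; exists n => /=.
Qed.

(** H is the lower limit of the h n. It is a measurable majorant of every function that is lower
    semicontinuous along the sequence, and in this form the bounds pass from bounded functions of
    compact support to general ones. *)
Lemma fatou_bound (h : nat -> R -> \bar R) (X : \bar R) :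
  (forall n, measurable_fun setT (h n)) -> (forall n x, 0 <= h n x)%E ->
  (forall n, \int[mu]_x h n x <= X)%E ->
  exists H : R -> \bar R, [/\ measurable_fun setT H, (forall x, 0 <= H x)%E,
    (\int[mu]_x H x <= X)%E & forall x a, lsc_along \oo a (h ^~ x) -> (a <= H x)%E].
Proof.
move=> mh h0 hX; exists (fun x => limn_einf (h ^~ x)); split.
- apply: measurableT_comp => //; apply: measurable_fun_limn_esup => n.
  exact: measurableT_comp.
- move=> x; apply: le_limn_einf => // l l0; apply: nearW => n.
  exact: lt_le_trans l0 (h0 n x).
- apply: (le_trans (@fatou _ _ _ mu _ measurableT h mh (fun n x _ => h0 n x))).
  exact: limn_einf_le.
- by move=> x a; exact: le_limn_einf.
Qed.

Lemma lt_lpe_series (rho : R) (A : nat -> \bar R) (l : R) : 0 < rho ->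
  (l%:E < (\sum_(0 <= k <oo) A k `^ rho) `^ rho^-1)%E ->
  exists N, (l%:E < lpe rho N A)%E.
Proof.
move=> rho0 h; have [l0|l0] := ltP l 0.
  exists 0%N; apply: (@lt_le_trans _ _ 0%E); first by rewrite lte_fin.
  exact: lpe_ge0.
apply: contrapT => H; move: h; apply/negP; rewrite -leNgt.
have lE : l%:E = ((l `^ rho)%:E `^ rho^-1)%E.
  by rewrite poweR_EFin powRK ?gt_eqF.
rewrite lE; apply: le_poweR; first by rewrite invr_ge0 ltW.
  by apply: nneseries_ge0 => k _ _; exact: poweR_ge0.
apply: nneseries_le => [k|N]; first exact: poweR_ge0.
rewrite -lpeK// -poweR_EFin; apply: le_poweR; [exact: ltW|exact: lpe_ge0|].
by rewrite leNgt; apply/negP => h; apply: H; exists N.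
Qed.

Lemma lpe_le_series (rho : R) (A : nat -> \bar R) N : 0 < rho ->
  (lpe rho N A <= (\sum_(0 <= k <oo) A k `^ rho) `^ rho^-1)%E.
Proof.
move=> rho0; apply: le_poweR; first by rewrite invr_ge0 ltW.
  exact: sume_poweR_ge0.
by apply: le_nneseries => k; exact: poweR_ge0.
Qed.

Lemma lpe_mono (rho : R) (A : nat -> \bar R) (m n : nat) : 0 < rho -> (m <= n)%N ->
  (lpe rho m A <= lpe rho n A)%E.
Proof.
move=> rho0 mn; apply: le_poweR; first by rewrite invr_ge0 ltW.
  exact: sume_poweR_ge0.
rewrite -(subnKC mn) big_split_ord/=; apply: leeDl.
by apply: sume_ge0 => k _; exact: poweR_ge0.
Qed.

End lower_limits.

Section approximation.
Context {R : realType}.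
Local Notation mu := (@lebesgue_measure R).
Variables (q rho delta C : R) (K : R -> R -> R[i]).
Hypotheses (q1 : 1 <= q) (rho1 : 1 < rho) (delta0 : 0 < delta) (C0 : 0 < C).
Hypothesis Ksize : forall x y, x != y -> normc (K x y) <= C / `|x - y|.
Hypothesis Ky : forall x y z, 2 * `|x - z| < `|x - y| ->
  normc (K y x - K y z) <= C * `|x - z| `^ delta / `|x - y| `^ (1 + delta).

Let rho0 : 0 < rho. Proof. exact: lt_trans ltr01 rho1. Qed.

Definition small_at (n : nat) (f : R -> R[i]) (y : R) : bool :=
  (normc (f y) <= n%:R) && (`|y| <= n%:R).

Definition cut_off (n : nat) (f : R -> R[i]) (y : R) : R[i] :=
  if small_at n f y then f y else 0.

Lemma measurable_small_at n f : cmeasurable f -> measurable [set y | small_at n f y].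
Proof.
move=> mf; have -> : [set y | small_at n f y] =
    (fun y => normc (f y)) @^-1` [set` `]-oo, n%:R]] `&` (fun y : R => `|y|) @^-1` [set` `]-oo, n%:R]].
  apply/seteqP; split => y; rewrite /small_at /= !in_itv/=.
    by move=> /andP[].
  by move=> [-> ->].
apply: measurableI; rewrite -[X in measurable X]setTI.
  by apply: (cmeasurable_normc mf) => //; exact: measurable_itv.
by apply: (@normr_measurable R setT) => //; exact: measurable_itv.
Qed.

Lemma nice_cut_off n f : cmeasurable f -> nice (cut_off n f).
Proof.
move=> mf; split.
  exact: (cmeasurable_if (measurable_small_at n mf) mf).
exists (n%:R + 1), (n%:R + 1); split.
- by rewrite ltr_wpDl// ler0n.
- by rewrite ltr_wpDl// ler0n.
- move=> y; rewrite /cut_off; case: ifPn => [/andP[h _]|_].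
    by apply: (le_trans h); rewrite lerDl.
  by rewrite Normc.normc0 addr_ge0// ler0n.
- move=> y h; rewrite /cut_off /small_at; case: ifP => // /andP[_ h2].
  exfalso; move: (lt_le_trans h h2); apply/negP; rewrite -leNgt; lra.
Qed.

Lemma normc_cut_off_le n f y : normc (cut_off n f y) <= normc (f y).
Proof. by rewrite /cut_off; case: ifP => // _; rewrite Normc.normc0 normc_ge0. Qed.

Lemma small_at_near f y : \forall n \near \oo, small_at n f y.
Proof.
have h1 : \forall n \near \oo, normc (f y) <= n%:R by exact: nbhs_infty_ger.
have h2 : \forall n \near \oo, `|y| <= n%:R by exact: nbhs_infty_ger.
by near=> n; apply/andP; split; near: n.
Unshelve. all: by end_near. Qed.

Lemma measurable_cut_off_diff (x t : R) n f : cmeasurable f ->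
  measurable_fun (outside x t) (fun y => (normc (f y - cut_off n f y) / `|x - y|)%:E).
Proof.
move=> mf.
apply/measurable_EFinP; apply: measurable_funM; last exact: measurable_invdist.
apply: measurable_normc; apply: cmeasurable_on.
have -> : (fun y => f y - cut_off n f y) = (fun y => if ~~ small_at n f y then f y else 0).
  by apply/funext => y; rewrite /cut_off; case: ifP; rewrite ?subrr ?subr0.
apply: (@cmeasurable_if R (fun y => ~~ small_at n f y) f) => //.
have -> : [set y | ~~ small_at n f y] = ~` [set y | small_at n f y].
  by apply/seteqP; split => y /= /negP.
by apply: measurableC; exact: measurable_small_at.
Qed.

Lemma truncated_cut_off_diff (t : R) f x n : 0 < t -> admissible_fun f ->
  ((normc (truncated K t f x - truncated K t (cut_off n f) x))%:E <=
   (2 * C)%:E * \int[mu]_(y in outside x t) (normc (f y - cut_off n f y) / `|x - y|)%:E)%E.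
Proof.
move=> t0 af; have [mf _] := af.
have nc := nice_cut_off n mf.
have mO := measurable_outside x t.
have i1 : cintegrable (outside x t) (fun y => K x y * f y).
  exact: (@kernel_integrable R delta C K delta0 C0 Ksize Ky x t f t0 af).
have i2 : cintegrable (outside x t) (fun y => K x y * cut_off n f y).
  exact: (@kernel_integrable R delta C K delta0 C0 Ksize Ky x t _ t0 (nice_admissible nc)).
rewrite /truncated -/(outside x t) -(cintegralB mO i1 i2).
apply: (le_trans (cintegral_le mO (cintegrable_cmeas (cintegrableB mO i1 i2)))).
have g0 y : (0 <= (normc (f y - cut_off n f y) / `|x - y|)%:E)%E.
  by rewrite lee_fin divr_ge0 ?normc_ge0.
have mg := @measurable_cut_off_diff x t n f mf.
rewrite EFinM -muleA; apply: lee_wpmul2l => //.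
rewrite -ge0_integralZl_EFin; last 4 first.
- exact: mO.
- by move=> y _; exact: g0.
- exact: mg.
- exact: ltW.
apply: int_le => y oy; first by rewrite mule_ge0// lee_fin ltW.
rewrite -EFinM lee_fin -mulrBr.
exact: (kernel_mul_le Ksize (fun y => f y - cut_off n f y) (outside_neq (ltW t0) oy)).
Qed.

(** Dominated convergence: at each point the cut-off eventually equals f, and |f| / |x - y|
    dominates the differences. *)
Lemma truncated_cut_off_near (t e : R) f x : 0 < t -> 0 < e -> admissible_fun f ->
  \forall n \near \oo, normc (truncated K t f x - truncated K t (cut_off n f) x) <= e.
Proof.
move=> t0 e0 af; have [mf If] := af.
pose D := outside x t; have mD : measurable D := measurable_outside x t.
pose g n y := (normc (f y - cut_off n f y) / `|x - y|)%:E.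
have d0 (z : R[i]) y : 0 <= normc z / `|x - y| by rewrite divr_ge0 ?normc_ge0.
have mg n : measurable_fun D (g n).
  exact: (@measurable_cut_off_diff x t n f mf).
have mF : measurable_fun D (fun y => (normc (f y) / `|x - y|)%:E).
  apply/measurable_EFinP; apply: measurable_funM; last exact: measurable_invdist.
  by apply: measurable_normc; exact: cmeasurable_on.
have iF : mu.-integrable D (fun y => (normc (f y) / `|x - y|)%:E).
  apply/integrableP; split => //; apply: le_lt_trans (If x t t0).
  apply: int_le => y _; first by rewrite lee_fin.
  by rewrite abse_EFin ger0_norm.
have lim0 : (\int[mu]_(y in D) g n y)%E @[n --> \oo] --> (\int[mu]_(y in D) (cst 0%E y))%E.
  apply: (@dominated_cvg _ _ _ mu D mD g (cst 0%E) (fun y => (normc (f y) / `|x - y|)%:E)) => //.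
  - move=> y _; apply: cvg_near_cst.
    apply: filterS (small_at_near f y) => n fn.
    by rewrite /g /cut_off fn subrr Normc.normc0 mul0r.
  - move=> n y _; rewrite /g abse_EFin ger0_norm// lee_fin; apply: ler_wpM2r; first by rewrite invr_ge0.
    by rewrite /cut_off; case: ifP => _; rewrite ?subrr ?subr0 ?Normc.normc0 ?normc_ge0.
rewrite integral_cst//= mul0e in lim0.
have C20 : 0 < 2 * C by exact: mulr_gt0.
have near_e : \forall n \near \oo, (\int[mu]_(y in D) g n y < (e / (2 * C))%:E)%E.
  apply: (lim0 [set z | (z < (e / (2 * C))%:E)%E]); apply: open_nbhs_nbhs; split.
    exact: open_ereal_lt_ereal.
  by rewrite /= lte_fin divr_gt0.
apply: filterS near_e => n hn.
rewrite -lee_fin; apply: (le_trans (truncated_cut_off_diff x n t0 af)).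
have -> : e = (2 * C) * (e / (2 * C)) by rewrite mulrC divfK// gt_eqF.
by rewrite [leRHS]EFinM; apply: lee_wpmul2l; [rewrite lee_fin ltW|exact: ltW].
Qed.

(** A strict lower bound for the series already holds for finitely many functions, and it survives a
    late enough cut-off. One index n serves as the number of functions and as the cut-off level. *)
Lemma lt_vec_op_cut_off (f : nat -> R -> R[i]) x (l : R) : (forall k, admissible_fun (f k)) ->
  (l%:E < (\sum_(0 <= k <oo) variation_op q K (f k) x `^ rho) `^ rho^-1)%E ->
  \forall n \near \oo, (l%:E < vec_op q rho K n (fun k => cut_off n (f k)) x)%E.
Proof.
move=> af /(lt_lpe_series rho0) [N lN].
have H := @lsc_along_lpe R nat \oo eventually_filter q rho N (fun k t => truncated K t (f k) x)
  (fun n k t => truncated K t (cut_off n (f k)) x) q1 rho0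
  (fun k t e t0 e0 => truncated_cut_off_near x t0 e0 (af k)) l lN.
apply: filterS (filterI H (nbhs_infty_ge N)) => n [h Nn].
by apply: (lt_le_trans h); exact: lpe_mono.
Qed.

End approximation.

(** * Positive representatives of weights, and absolute convergence of the truncations *)

Section regular_weights.
Context {R : realType}.
Local Notation mu := (@lebesgue_measure R).

(* A representative of [w] that is positive everywhere, not only almost everywhere. *)
Definition regular (w : R -> R) (x : R) : R := if 0 < w x then w x else 1.

Lemma regular_gt0 w x : 0 < regular w x.
Proof. by rewrite /regular; case: ifP. Qed.

Lemma weight_measurable (w : R -> R) : weight w -> measurable_fun setT w.
Proof. by move=> [[mw _ _] _]. Qed.

Lemma measurable_weight_pos (w : R -> R) : weight w -> measurable [set x | 0 < w x].
Proof.
move=> /weight_measurable mw.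
have -> : [set x | 0 < w x] = setT `&` w @^-1` [set` `]0, +oo[].
  by rewrite setTI; apply/seteqP; split => x; rewrite /= in_itv/= andbT.
by apply: mw => //; exact: measurable_itv.
Qed.

Lemma measurable_regular (w : R -> R) : weight w -> measurable_fun setT (regular w).
Proof.
move=> ww; apply: measurable_fun_ifT => //; last exact: weight_measurable.
apply: (measurable_fun_bool true); rewrite setTI.
exact: measurable_weight_pos.
Qed.

Lemma ae_regular (w : R -> R) : weight w -> \forall x \ae mu, regular w x = w x.
Proof. by move=> [_ w0]; apply: (ae_mono _ w0) => x; rewrite /regular => ->. Qed.

Lemma integral_regular (w : R -> R) (g : R -> \bar R) (h : R -> R) (D : set R) : weight w -> measurable D ->
  measurable_fun setT g -> measurable_fun setT h ->
  (\int[mu]_(x in D) (g x * (h (w x))%:E) = \int[mu]_(x in D) (g x * (h (regular w x))%:E))%E.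
Proof.
move=> ww mD mg mh; apply: ae_eq_integral => //.
- apply: emeasurable_funM; first exact: measurable_funTS.
  apply/measurable_EFinP; apply: measurable_funTS; apply: measurableT_comp => //.
  exact: weight_measurable.
- apply: emeasurable_funM; first exact: measurable_funTS.
  apply/measurable_EFinP; apply: measurable_funTS; apply: measurableT_comp => //.
  exact: measurable_regular.
- by apply: (ae_mono _ (ae_regular ww)) => x -> _.
Qed.

Lemma integral_regular1 (w : R -> R) (D : set R) : weight w -> measurable D ->
  (\int[mu]_(x in D) (w x)%:E = \int[mu]_(x in D) (regular w x)%:E)%E.
Proof.
move=> ww mD.
have := @integral_regular w (cst 1%E) idfun D ww mD (measurable_cst _) (@measurable_id _ _ _).
under eq_integral do rewrite mul1e.
by under [in X in _ = X -> _]eq_integral do rewrite mul1e.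
Qed.

Lemma bounded_ball_itv (c r : R) : bounded_set [set` `](c - r), (c + r)[].
Proof.
exists (`|c| + `|r|); split; first exact: num_real.
move=> M hM y /=; rewrite in_itv/= => /andP[y1 y2].
apply: ltW; apply: le_lt_trans hM.
have := ler_norm c; have := ler_norm (- c); have := ler_norm r.
by rewrite normrN ler_norml => *; apply/andP; split; lra.
Qed.

Lemma weight_int_lty (w : R -> R) c r : weight w -> (\int[mu]_(x in ball c r) (w x)%:E < +oo)%E.
Proof.
move=> ww; have mw := weight_measurable ww; have [[_ _ Hw] _] := ww.
have mB : measurable (ball c r) by exact: measurable_ball.
have H := Hw [set` `[(c - r), (c + r)]] (fun x _ => I) (@segment_compact R (c - r) (c + r)).
apply: le_lt_trans H.
rewrite [leLHS]integral_mkcond [leRHS]integral_mkcond; apply: int_le => x _.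
  by rewrite patchE; case: ifP => // _; rewrite lee_fin.
rewrite !patchE; case: ifPn => [|_].
  rewrite inE ball_R ltr_norml => /andP[h1 h2].
  have -> : x \in [set` `[(c - r), (c + r)]].
    by rewrite inE/= in_itv/=; apply/andP; split; lra.
  by rewrite lee_fin ler_norm.
by case: ifP => // _; rewrite lee_fin.
Qed.

Lemma A1_regular (w : R -> R) : A1 w -> exists A, A1_ball (regular w) A.
Proof.
move=> [ww [C HC]]; exists (Num.max C 1); split.
- exact: measurable_regular.
- exact: regular_gt0.
- move=> c r; rewrite -integral_regular1//; last exact: measurable_ball.
  exact: weight_int_lty.
- by rewrite lt_max ltr01 orbT.
apply: (ae_mono _ (ae_and (ae_and HC (ae_regular ww)) ww.2)) => x [[Hx ->] wx] c r r0 Bx.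
have mB : measurable (ball c r) by exact: measurable_ball.
rewrite -integral_regular1//.
have I1 : (iavg w (ball c r) <= (C * w x)%:E)%E.
  apply: le_trans Hx; apply: ereal_sup_ubound; exists `](c - r), (c + r)[ => /=.
    split.
    - by move: Bx; rewrite ball_R ltr_norml in_itv/= => /andP[? ?]; apply/andP; split; lra.
    - exact: bounded_ball_itv.
    - by rewrite -ball_itv lebesgue_ball ?ltW// lte_fin mulr_gt0.
  by rewrite -ball_itv.
have r20 : 0 < 2 * r by rewrite mulr_gt0.
have le1 : (\int[mu]_(y in ball c r) (w y)%:E <= \int[mu]_(y in ball c r) `|(w y)%:E|)%E.
  by apply: int_le => y _; [exact: abse_ge0|rewrite abse_EFin lee_fin ler_norm].
apply: (le_trans le1).
have -> : (\int[mu]_(y in ball c r) `|(w y)%:E| = (2 * r)%:E * iavg w (ball c r))%E.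
  rewrite /iavg lebesgue_ball ?ltW// inver gt_eqF// muleA -EFinM mulfV ?gt_eqF//.
  by rewrite mul1e.
apply: (le_trans (lee_wpmul2l _ I1)); first by rewrite lee_fin ltW.
rewrite -EFinM lee_fin mulrCA -mulrA; apply: ler_wpM2r; first by rewrite mulr_ge0 ?ltW.
by rewrite le_max lexx.
Qed.

Lemma Ap_regular (p : R) (w : R -> R) : 1 < p -> Ap p w -> exists C, Ap_ball p (regular w) C.
Proof.
move=> p1 [ww [C HC]]; have p10 : 0 < p - 1 by rewrite subr_gt0.
have mr := measurable_regular ww.
have mB c r : measurable (ball c r : set R) by exact: measurable_ball.
have dE c r : (\int[mu]_(x in ball c r) (w x `^ (- (p - 1)^-1))%:E =
    \int[mu]_(x in ball c r) (dual_weight p (regular w) x)%:E)%E.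
  have := @integral_regular w (cst 1%E) (fun z => z `^ (- (p - 1)^-1)) (ball c r) ww (mB c r)
    (measurable_cst _) (measurable_powR _).
  under eq_integral do rewrite mul1e.
  by under [in X in _ = X -> _]eq_integral do rewrite mul1e.
have xfin c r : (\int[mu]_(x in ball c r) (regular w x)%:E < +oo)%E.
  by rewrite -integral_regular1//; exact: weight_int_lty.
have bound c r : 0 < r -> ((\int[mu]_(x in ball c r) (regular w x)%:E) *
    (\int[mu]_(x in ball c r) (dual_weight p (regular w) x)%:E) `^ (p - 1) <= (C * (2 * r) `^ p)%:E)%E.
  move=> r0; have := HC `](c - r), (c + r)[ (bounded_ball_itv c r).
  by rewrite -ball_itv (lebesgue_ball c (ltW r0)) poweR_EFin -EFinM dE (integral_regular1 ww (mB c r)).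
(* An infinite dual mass would make the A_p product infinite, since the mass of the positive weight
   is not 0. *)
have dfin c r : (\int[mu]_(x in ball c r) (dual_weight p (regular w) x)%:E < +oo)%E.
  have [r0|r0] := ltP 0 r; last by rewrite ball_nonpos// integral_set0.
  rewrite ltey; apply/eqP => H; have := bound c r r0; rewrite H poweRyr ?gt_eqF//.
  by rewrite gt0_muley// ball_int_gt0//; exact: regular_gt0.
exists C; split => //; first exact: regular_gt0.
move=> c r r0; have := bound c r r0.
have -> : (\int[mu]_(x in ball c r) (regular w x)%:E = (wint (regular w) (ball c r))%:E)%E.
  rewrite /wint fineK// ge0_fin_numE//; apply: integral_ge0 => y _.
  by rewrite lee_fin ltW// regular_gt0.
have -> : (\int[mu]_(x in ball c r) (dual_weight p (regular w) x)%:E =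
    (wint (dual_weight p (regular w)) (ball c r))%:E)%E.
  rewrite /wint fineK// ge0_fin_numE//; apply: integral_ge0 => y _.
  by rewrite lee_fin powR_ge0.
by rewrite poweR_EFin -EFinM lee_fin.
Qed.

Lemma A1_ball_cst1 : A1_ball (cst 1 : R -> R) 1.
Proof.
have H c r : 0 < r -> (\int[mu]_(y in ball c r) (cst 1 y : R)%:E = (2 * r)%:E)%E.
  move=> r0; have mB : measurable (ball c r) by exact: measurable_ball.
  by rewrite -(lebesgue_ball c (ltW r0)) -[RHS]mul1e -(integral_cst mu mB).
split => //.
  move=> c r; have [r0|r0] := ltP 0 r; last by rewrite ball_nonpos// integral_set0.
  by rewrite H// ltry.
by apply: aeW => x c r r0 _; rewrite H// mul1r mulr1.
Qed.

(** The ball of radius 2 |x - y| about [x] contains y and the ball of radius t. By A_1, for almost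
    every y outside radius t, 1 / |x - y| is at most 4 A v(y) / m, where m is the mass of the ball
    of radius t. *)
Lemma A1_admissible v A (f : R -> R[i]) : A1_ball v A -> cmeasurable f ->
  (\int[mu]_y (normc (f y) * v y)%:E < +oo)%E -> admissible_fun f.
Proof.
move=> Av mf fv; split => // x t t0.
have A0 : 0 < A := A1_const Av; have v0 y : 0 < v y := A1_gt0 Av y.
have mv : measurable_fun setT v := A1_meas Av.
pose m := fine (\int[mu]_(y in ball x t) (v y)%:E).
have mE : (m%:E = \int[mu]_(y in ball x t) (v y)%:E)%E.
  rewrite /m fineK// ge0_fin_numE ?(A1_fin Av)//; apply: integral_ge0 => y _.
  by rewrite lee_fin ltW.
have m0 : 0 < m by rewrite -lte_fin mE; exact: ball_int_gt0.
have mO := measurable_outside x t.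
have mn : measurable_fun (outside x t) (fun y => normc (f y)).
  by apply: measurable_normc; exact: cmeasurable_on.
have k0 : 0 < 4 * A / m by rewrite divr_gt0// mulr_gt0.
have fv0 y : (0 <= (normc (f y) * v y)%:E)%E by rewrite lee_fin mulr_ge0 ?normc_ge0// ltW.
have mfv : measurable_fun setT (fun y => (normc (f y) * v y)%:E).
  by apply/measurable_EFinP; apply: measurable_funM => //; exact: cmeasurable_normc.
apply: (@le_lt_trans _ _ (\int[mu]_(y in outside x t) ((4 * A / m)%:E * (normc (f y) * v y)%:E))%E).
  apply: ae_ge0_le_integral.
  - exact: mO.
  - by move=> y _; rewrite lee_fin divr_ge0 ?normc_ge0.
  - by apply/measurable_EFinP; apply: measurable_funM => //; exact: measurable_invdist.
  - by move=> y _; rewrite mule_ge0// lee_fin ltW.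
  - by apply: measurable_funeM; exact: measurable_funTS.
  - apply: (ae_mono _ (A1_le Av)) => y Hy oy; have d0 : 0 < `|x - y| := lt_trans t0 oy.
    have d20 : 0 < 2 * `|x - y| by rewrite mulr_gt0.
    have By : ball x (2 * `|x - y|) y by rewrite ball_R; lra.
    have mle : m <= 4 * A * `|x - y| * v y.
      rewrite -lee_fin mE; apply: (@le_trans _ _ (\int[mu]_(z in ball x (2 * `|x - y|)%R) (v z)%:E)%E).
        apply: ge0_subset_integral.
        - exact: measurable_ball.
        - exact: measurable_ball.
        - by apply/measurable_EFinP; exact: measurable_funTS.
        - by move=> z _; rewrite lee_fin ltW.
        - by apply: le_ball; rewrite /outside/= in oy; lra.
      apply: (le_trans (Hy x _ d20 By)); rewrite lee_fin le_eqVlt; apply/orP; left.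
      by apply/eqP; ring.
    rewrite -EFinM lee_fin ler_pdivrMr// mulrC.
    have -> : `|x - y| * (4 * A / m * (normc (f y) * v y)) =
      normc (f y) * ((4 * A * `|x - y| * v y) / m) by ring.
    rewrite -[leLHS]mulr1; apply: ler_wpM2l; first exact: normc_ge0.
    by rewrite ler_pdivlMr// mul1r.
rewrite ge0_integralZl_EFin; last 4 first.
- exact: mO.
- by move=> y _; exact: fv0.
- exact: measurable_funTS.
- exact: ltW.
rewrite lte_mul_pinfty// ?lee_fin ?ltW//; apply: le_lt_trans fv.
by apply: ge0_subset_integral.
Qed.

(** By Young's inequality 1 / |x - y| has to be integrable to the conjugate power against the dual
    weight, off a ball about [x]. It is dominated there by a multiple of the Rubio de Francia
    majorant of the indicator of that ball, formed for the dual weight. *)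
Lemma Ap_admissible p w Cw (f : R -> R[i]) : 1 < p -> Ap_ball p w Cw -> cmeasurable f ->
  (\int[mu]_y (normc (f y) `^ p * w y)%:E < +oo)%E -> admissible_fun f.
Proof.
move=> p1 Aw mf fw; split => // x t t0.
have p0 : 0 < p := lt_trans ltr01 p1; have p10 : 0 < p - 1 by rewrite subr_gt0.
have w0 y : 0 < w y := Ap_gt0 Aw y; have mw : measurable_fun setT w := Ap_meas Aw.
pose p' := p / (p - 1); pose sg := dual_weight p w.
have p'1 : 1 < p' by rewrite /p' ltr_pdivlMr// mul1r ltrBlDr ltrDl.
have p'0 : 0 < p' := lt_trans ltr01 p'1.
have [B [D [B0 D0 maj]]] := A1_majorant p'1 (Ap_ball_dual p1 Aw).
have mB : measurable (ball x t) by exact: measurable_ball.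
pose h (y : R) : \bar R := (\1_(ball x t) y)%:E.
have mh : measurable_fun setT h by apply/measurable_EFinP; exact: measurable_indic.
have h0 y : (0 <= h y)%E by rewrite lee_fin.
have [U [mU hU HU UP]] := maj h mh h0.
have U0 y : (0 <= U y)%E := le_trans (h0 y) (hU y).
have sg0 y : 0 < sg y by exact: powR_gt0.
have msg : measurable_fun setT sg by apply: measurableT_comp (measurable_powR _) _.
have Ufin : (\int[mu]_y (U y `^ p' * (sg y)%:E) < +oo)%E.
  apply: (le_lt_trans UP); rewrite lte_mul_pinfty// ?lee_fin//.
  apply: le_lt_trans (Ap_dual_fin Aw x t); rewrite [leRHS]integral_mkcond.
  apply: (@int_le _ _ R mu setT) => y _; first by rewrite patchE; case: ifP => // _; rewrite lee_fin ltW ?sg0.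
  rewrite patchE /h indicE; case: ifPn => yB.
    by rewrite poweR_EFin powR1 mul1e.
  by rewrite poweR_EFin powR0 ?gt_eqF// mul0e.
pose k := B / t; have k0 : 0 < k by exact: divr_gt0.
have invle y : outside x t y -> ((`|x - y|^-1)%:E <= k%:E * U y)%E.
  move=> oy; have d0 : 0 < `|x - y| := lt_trans t0 oy.
  have d20 : 0 < 2 * `|x - y| by rewrite mulr_gt0.
  have By : ball x (2 * `|x - y|) y by rewrite ball_R; lra.
  have H1 : ((2 * t)%:E <= (B * (2 * `|x - y|))%:E * U y)%E.
    apply: le_trans (HU _ _ _ d20 By).
    have -> : ((2 * t)%:E = \int[mu]_z h z)%E.
      by rewrite -(lebesgue_ball x (ltW t0)) /h integral_indic// setIT.
    rewrite [leRHS]integral_mkcond; apply: (@int_le _ _ R mu setT) => z _.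
      by rewrite patchE; case: ifP.
    rewrite patchE; case: ifPn => // zn.
    have zt : (z \in (ball x t : set R)) = false.
      apply/negP => zB; move: zn; apply/negP; rewrite negbK; apply/mem_set.
      move: zB; rewrite inE; apply: le_ball.
      by rewrite /outside/= in oy; lra.
    by rewrite /h indicE zt.
  have c0 : (0 <= ((2 * t * `|x - y|)^-1)%R%:E)%E by rewrite lee_fin invr_ge0 !mulr_ge0// ltW.
  have := lee_wpmul2l c0 H1.
  rewrite muleA -!EFinM.
  have -> : (2 * t * `|x - y|)^-1 * (2 * t) = `|x - y|^-1 by field; rewrite !gt_eqF.
  have -> : (2 * t * `|x - y|)^-1 * (B * (2 * `|x - y|)) = k by rewrite /k; field; rewrite !gt_eqF.
  by [].
have mO := measurable_outside x t.
have kp0 : 0 <= k `^ p' := powR_ge0 _ _.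
have young y : outside x t y -> ((normc (f y) / `|x - y|)%:E <=
    (normc (f y) `^ p * w y)%:E + (k `^ p')%:E * (U y `^ p' * (sg y)%:E))%E.
  move=> oy; have := invle y oy; have := U0 y; case: (U y) => [u| |]//; last first.
    move=> _ _; rewrite poweRyr ?gt_eqF// gt0_mulye ?lte_fin ?sg0//.
    by rewrite gt0_muley ?lte_fin ?powR_gt0// addey// leey.
  rewrite !lee_fin => u0 Hu.
  have ku0 : 0 <= k * u by rewrite mulr_ge0// ltW.
  pose a := normc (f y) * w y `^ p^-1; pose b := k * u * w y `^ (- p^-1).
  have a0 : 0 <= a by rewrite mulr_ge0 ?normc_ge0// powR_ge0.
  have b0 : 0 <= b by rewrite mulr_ge0// powR_ge0.
  have pp : p^-1 + p'^-1 = 1 by rewrite /p'; field; rewrite !gt_eqF.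
  have Y := conjugate_powR a0 b0 p0 p'0 pp.
  have ab : a * b = normc (f y) * (k * u).
    rewrite /a /b powRN mulrACA mulfV ?mulr1// gt_eqF// powR_gt0//.
  have ap : a `^ p = normc (f y) `^ p * w y.
    by rewrite /a powRM ?normc_ge0 ?powR_ge0// powRVK ?gt_eqF// ltW.
  have bp : b `^ p' = k `^ p' * (u `^ p' * sg y).
    rewrite /b powRM ?powR_ge0// powRM ?(ltW k0)// -mulrA; congr (_ * (_ * _)).
    rewrite -powRrM /sg /dual_weight; congr (_ `^ _).
    by rewrite /p'; field; rewrite !gt_eqF.
  apply: (@le_trans _ _ (a * b)).
    by rewrite ab; apply: ler_wpM2l => //; exact: normc_ge0.
  apply: (le_trans Y); rewrite ap bp; apply: lerD.
    rewrite ler_pdivrMr// -[leLHS]mulr1; apply: ler_wpM2l; last exact: ltW.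
    by rewrite mulr_ge0 ?powR_ge0// ltW.
  rewrite ler_pdivrMr// -[leLHS]mulr1; apply: ler_wpM2l; last exact: ltW.
  by rewrite !mulr_ge0 ?powR_ge0// ltW.
have fw0 y : (0 <= (normc (f y) `^ p * w y)%:E)%E.
  by rewrite lee_fin mulr_ge0 ?powR_ge0// ltW.
have mfw : measurable_fun setT (fun y => (normc (f y) `^ p * w y)%:E).
  apply/measurable_EFinP; apply: measurable_funM => //.
  by apply: measurableT_comp (measurable_powR _) _; exact: cmeasurable_normc.
have Us0 y : (0 <= U y `^ p' * (sg y)%:E)%E by rewrite mule_ge0 ?poweR_ge0// lee_fin ltW.
have mUs : measurable_fun setT (fun y => (U y `^ p' * (sg y)%:E)%E).
  apply: emeasurable_funM; first exact: measurableT_comp (measurable_poweR _) mU.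
  exact/measurable_EFinP.
apply: (@le_lt_trans _ _ (\int[mu]_y ((normc (f y) `^ p * w y)%:E +
    (k `^ p')%:E * (U y `^ p' * (sg y)%:E)))%E).
  rewrite [leLHS]integral_mkcond; apply: (@int_le _ _ R mu setT) => y _.
    by rewrite adde_ge0// mule_ge0.
  rewrite patchE; case: ifPn => [|_]; last by rewrite adde_ge0// mule_ge0.
  by rewrite inE; exact: young.
rewrite ge0_integralD; last 5 first.
- exact: measurableT.
- by move=> y _; exact: fw0.
- exact: mfw.
- by move=> y _; rewrite mule_ge0.
- exact: measurable_funeM.
rewrite ge0_integralZl_EFin; last 4 first.
- exact: measurableT.
- by move=> y _; exact: Us0.
- exact: mUs.
- exact: kp0.
by rewrite lte_add_pinfty// lte_mul_pinfty.
Qed.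

End regular_weights.

(** * From the scalar hypothesis to series of functions *)

Section assembly.
Context {R : realType}.
Local Notation mu := (@lebesgue_measure R).
Variables (q rho delta C : R) (K : R -> R -> R[i]).
Hypotheses (q1 : 1 < q) (rho1 : 1 < rho) (delta0 : 0 < delta) (C0 : 0 < C).
Hypothesis Ksize : forall x y, x != y -> normc (K x y) <= C / `|x - y|.
Hypothesis Kx : forall x y z, 2 * `|x - z| < `|x - y| ->
  normc (K x y - K z y) <= C * `|x - z| `^ delta / `|x - y| `^ (1 + delta).
Hypothesis Ky : forall x y z, 2 * `|x - z| < `|x - y| ->
  normc (K y x - K y z) <= C * `|x - z| `^ delta / `|x - y| `^ (1 + delta).

Let rho0 : 0 < rho. Proof. exact: lt_trans ltr01 rho1. Qed.
Let q1' : 1 <= q. Proof. exact: ltW. Qed.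

Lemma vec_op1E f x : vec_op q rho K 1 f x = variation_op q K (f 0%N) x.
Proof.
rewrite /vec_op /lpe big_ord1 poweRK ?gt_eqF//.
exact: (variation_norm_ge0 q1').
Qed.

Lemma vec_norm1E f x : vec_norm rho 1 f x = normc (f 0%N x).
Proof. by rewrite /vec_norm /lpn big_ord1 powRK ?gt_eqF// normc_ge0. Qed.

Lemma nice_powR_lty (p : R) (f : R -> R[i]) : 0 < p -> nice f ->
  (\int[mu]_x (normc (f x) `^ p)%:E < +oo)%E.
Proof.
move=> p0 [mf [M [r [M0 r0 fM fr]]]].
have mp : measurable_fun setT (fun x => normc (f x) `^ p).
  by apply: measurableT_comp (measurable_powR _) _; exact: cmeasurable_normc.
have ng : nice (fun x => Complex (normc (f x) `^ p) 0).
  split; first by split => //; exact: measurable_cst.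
  exists (M `^ p), r; split => //; first exact: powR_gt0.
    move=> y; rewrite normc_real ger0_norm ?powR_ge0//.
    by apply: le_powR; [exact: ltW|exact: normc_ge0|exact: fM].
  by move=> y /fr ->; rewrite Normc.normc0 powR0 ?gt_eqF.
apply: le_lt_trans (nice_integrable ng); apply: int_le => x _.
  by rewrite lee_fin normc_ge0.
by rewrite lee_fin normc_real ler_norm.
Qed.

Lemma strong_type_of_type_pp (p : R) : 1 < p -> type_pp p (variation_op q K) ->
  exists2 D, 0 <= D & strong_type q rho K p (cst 1) 1 D.
Proof.
move=> p1 [D HD]; have p0 : 0 < p := lt_trans ltr01 p1.
exists (Num.max D 0); first by rewrite le_max lexx orbT.
move=> f nf.
have fin := nice_powR_lty p0 (nf 0%N).
have fLp : in_Lp p (cst 1) (f 0%N).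
  split; first by have [] := nf 0%N.
  by under eq_integral do rewrite mulr1.
have := HD _ fLp.
under [X in (_ <= _ * X)%E -> _]eq_integral do rewrite -[normc _ `^ p]mulr1.
move=> H.
under eq_integral do rewrite vec_op1E mule1.
under [X in (_ <= _ * X)%E]eq_integral do rewrite vec_norm1E.
apply: (le_trans H); apply: lee_wpmul2r; last by rewrite lee_fin le_max lexx.
by apply: integral_ge0 => x _; rewrite lee_fin mulr_ge0 ?powR_ge0.
Qed.

(** At exponent rho both sides are sums over the components, so the scalar inequality adds up with
    the same constant. *)
Lemma strong_type_vector (D : R) : 0 <= D -> strong_type q rho K rho (cst 1) 1 D ->
  forall N, strong_type q rho K rho (cst 1) N D.
Proof.
move=> D0 H N f nf.
have mV k : measurable_fun setT (fun x => (variation_op q K (f k) x `^ rho)%E).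
  apply: measurableT_comp (measurable_poweR _) _.
  have -> : variation_op q K (f k) = vec_op q rho K 1 (fun=> f k).
    by apply/funext => x; rewrite vec_op1E.
  exact: (measurable_vec_op q1' rho1 delta0 C0 Ksize Kx Ky 1 (fun=> nf k)).
have mn k : measurable_fun setT (fun x => (normc (f k x) `^ rho)%:E).
  apply/measurable_EFinP; apply: measurableT_comp (measurable_powR _) _.
  by apply: cmeasurable_normc; have [] := nf k.
have Hk k : (\int[mu]_x (variation_op q K (f k) x `^ rho) <=
    D%:E * \int[mu]_x (normc (f k x) `^ rho)%:E)%E.
  have := H (fun=> f k) (fun=> nf k).
  under eq_integral do rewrite vec_op1E mule1.
  by under [X in (_ <= _ * X)%E -> _]eq_integral do rewrite vec_norm1E mulr1.
under eq_integral do rewrite mule1 /vec_op lpeK//.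
under [X in (_ <= _ * X)%E]eq_integral do rewrite mulr1 /vec_norm lpnK// -sumEFin.
rewrite ge0_integral_sum; last 3 first.
- exact: measurableT.
- by move=> k; exact: mV.
- by move=> k x _; exact: poweR_ge0.
rewrite ge0_integral_sum; last 3 first.
- exact: measurableT.
- by move=> k; exact: mn.
- by move=> k x _; rewrite lee_fin powR_ge0.
rewrite ge0_sume_distrr; last first.
  by move=> k _; apply: integral_ge0 => x _; rewrite lee_fin powR_ge0.
by apply: lee_sum => k _; exact: Hk.
Qed.

Lemma weak_type_unweighted (p : R) : 1 < p -> type_pp p (variation_op q K) ->
  exists2 D, 0 <= D & forall N, weak_type q rho K (cst 1) N D.
Proof.
move=> p1 /(strong_type_of_type_pp p1) [D1 D10 H1].
have [D2 D20 H2] := @weak_type_of_strong_type R q rho delta C K q1 rho1 delta0 C0 Ksize Kx Ky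
  (cst 1) 1 A1_ball_cst1 p D1 p1 D10.
have [D3 D30 H3] := @strong_type_of_weak_type R q rho delta C K q1 rho1 delta0 C0 Ksize Kx Ky
  rho (cst 1) 1 rho1 (A1_Ap_ball A1_ball_cst1 rho1) D2 D20.
have [D4 D40 H4] := @weak_type_of_strong_type R q rho delta C K q1 rho1 delta0 C0 Ksize Kx Ky
  (cst 1) 1 A1_ball_cst1 rho D3 rho1 D30.
exists D4 => // N; apply: H4; apply: strong_type_vector => //.
by apply: H3; apply: H2.
Qed.

Lemma vec_norm_cut_off_le N n (f : nat -> R -> R[i]) x :
  ((vec_norm rho N (fun k => cut_off n (f k)) x)%:E <=
   (\sum_(0 <= k <oo) (normc (f k x) `^ rho)%:E) `^ rho^-1)%E.
Proof.
apply: (@le_trans _ _ (lpe rho N (fun k => (normc (f k x))%:E))).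
  rewrite lpe_EFin lee_fin; apply: le_lpn => // k _.
  by rewrite normc_ge0 normc_cut_off_le.
apply: le_trans (lpe_le_series _ _ rho0) _.
by under eq_eseriesr do rewrite poweR_EFin.
Qed.

Lemma measurable_series_norm (r : R) (f : nat -> R -> R[i]) : (forall k, cmeasurable (f k)) ->
  measurable_fun setT (fun x => ((\sum_(0 <= k <oo) (normc (f k x) `^ rho)%:E) `^ r)%E).
Proof.
move=> mf; apply: measurableT_comp (measurable_poweR _) _.
apply: ge0_emeasurable_sum => [k x _ _|k _]; first by rewrite lee_fin powR_ge0.
apply/measurable_EFinP; apply: measurableT_comp (measurable_powR _) _.
exact: cmeasurable_normc.
Qed.

Lemma lsc_along_mulr (I : Type) (F : set_system I) {FF : Filter F} (c : R) a (A : I -> \bar R) :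
  0 < c -> lsc_along F a A -> lsc_along F (a * c%:E)%E (fun i => A i * c%:E)%E.
Proof.
move=> c0 lA l.
have -> : l%:E = ((l / c)%:E * c%:E)%E by rewrite -EFinM divfK// gt_eqF.
rewrite lte_pmul2r// ?lte_fin// => /lA; apply: filterS => i.
by rewrite lte_pmul2r// lte_fin.
Qed.

Variable v : R -> R.
Hypotheses (mv : measurable_fun setT v) (v0 : forall x, 0 < v x).

Let mvE (D : set R) : measurable_fun D (fun x => (v x)%:E).
Proof. by apply/measurable_EFinP; exact: (measurable_funTS mv). Qed.

Lemma strong_type_series (p D : R) (f : nat -> R -> R[i]) : 1 < p -> 0 <= D ->
  (forall N, strong_type q rho K p v N D) -> (forall k, admissible_fun (f k)) ->
  exists H : R -> \bar R, [/\ measurable_fun setT H, (forall x, 0 <= H x)%E,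
   (\int[mu]_x H x <=
     D%:E * \int[mu]_x ((\sum_(0 <= k <oo) (normc (f k x) `^ rho)%:E) `^ (p / rho) * (v x)%:E))%E &
   forall x, ((\sum_(0 <= k <oo) variation_op q K (f k) x `^ rho) `^ (p / rho) * (v x)%:E <= H x)%E].
Proof.
move=> p1 D0 st af; have p0 : 0 < p := lt_trans ltr01 p1.
have nc n k : nice (cut_off n (f k)) by apply: nice_cut_off; have [] := af k.
pose T n := vec_op q rho K n (fun k => cut_off n (f k)).
have T0 n x : (0 <= T n x)%E by exact: lpe_ge0.
have mT n : measurable_fun setT (T n).
  exact: (measurable_vec_op q1' rho1 delta0 C0 Ksize Kx Ky n (nc n)).
have powE (X : \bar R) : (X `^ (p / rho) = (X `^ rho^-1) `^ p)%E by rewrite mulrC poweRrM.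
have [|||H [mH H0 IH HH]] := @fatou_bound R (fun n x => T n x `^ p * (v x)%:E)%E
  (D%:E * \int[mu]_x ((\sum_(0 <= k <oo) (normc (f k x) `^ rho)%:E) `^ (p / rho) * (v x)%:E))%E.
- by move=> n; apply: emeasurable_funM; [exact: measurableT_comp (measurable_poweR _) (mT n)|exact: mvE].
- by move=> n x; rewrite mule_ge0 ?poweR_ge0// lee_fin ltW.
- move=> n; apply: (le_trans (st n _ (nc n))); apply: lee_wpmul2l; first by rewrite lee_fin.
  apply: int_le => x _; first by rewrite mule_ge0 ?poweR_ge0// lee_fin ltW.
  rewrite EFinM; apply: lee_wpmul2r; first by rewrite lee_fin ltW.
  rewrite powE -poweR_EFin; apply: le_poweR; first exact: ltW.
    by rewrite lee_fin vec_norm_ge0.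
  exact: vec_norm_cut_off_le.
exists H; split => // x; apply: HH; apply: lsc_along_mulr => //; rewrite powE.
apply: lsc_along_poweR => //; first exact: poweR_ge0.
by move=> l; apply: (lt_vec_op_cut_off q1' rho1 delta0 C0 Ksize Ky).
Qed.

Lemma weak_type_series (D l : R) (f : nat -> R -> R[i]) : 0 <= D -> 0 < l ->
  (forall N, weak_type q rho K v N D) -> (forall k, admissible_fun (f k)) ->
  exists H : R -> \bar R, [/\ measurable_fun setT H, (forall x, 0 <= H x)%E,
   (\int[mu]_x H x <=
     (D / l)%:E * \int[mu]_x ((\sum_(0 <= k <oo) (normc (f k x) `^ rho)%:E) `^ rho^-1 * (v x)%:E))%E &
   forall x, (l%:E < (\sum_(0 <= k <oo) variation_op q K (f k) x `^ rho) `^ rho^-1)%E ->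
     ((v x)%:E <= H x)%E].
Proof.
move=> D0 l0 wt af.
have nc n k : nice (cut_off n (f k)) by apply: nice_cut_off; have [] := af k.
pose T n := vec_op q rho K n (fun k => cut_off n (f k)).
have mT n : measurable_fun setT (T n).
  exact: (measurable_vec_op q1' rho1 delta0 C0 Ksize Kx Ky n (nc n)).
have [|||H [mH H0 IH HH]] := @fatou_bound R (fun n x => if (l%:E < T n x)%E then (v x)%:E else 0%E)
  ((D / l)%:E * \int[mu]_x ((\sum_(0 <= k <oo) (normc (f k x) `^ rho)%:E) `^ rho^-1 * (v x)%:E))%E.
- move=> n; apply: measurable_fun_ifT => //; apply: (measurable_fun_bool true); rewrite setTI.
  exact: measurable_lt.
- by move=> n x; case: ifP => // _; rewrite lee_fin ltW.
- move=> n; rewrite -integral_if_lt; apply: (le_trans (wt n _ l (nc n) l0)).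
  apply: lee_wpmul2l; first by rewrite lee_fin divr_ge0// ltW.
  apply: int_le => x _; first by rewrite mule_ge0 ?poweR_ge0// lee_fin ltW.
  rewrite EFinM; apply: lee_wpmul2r; first by rewrite lee_fin ltW.
  exact: vec_norm_cut_off_le.
exists H; split => // x lx; apply: HH => m mv'.
have := lt_vec_op_cut_off q1' rho1 delta0 C0 Ksize Ky af lx.
by apply: filterS => n ln; rewrite /T ln.
Qed.

End assembly.

(** The majorant [H] is made infinite on the null set where w is not positive. Its integral does not
    change, and the comparison with [F], of which no measurability is assumed, then holds
    everywhere. *)
Lemma int_le_of_weight {R : realType} (w : R -> R) (F H : R -> \bar R) : weight w ->
  measurable_fun setT H -> (forall x, 0 <= H x)%E -> (forall x, 0 < w x -> (F x <= H x)%E) ->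
  (\int[lebesgue_measure]_x F x <= \int[lebesgue_measure]_x H x)%E.
Proof.
move=> ww mH H0 FH.
pose H' x : \bar R := if 0 < w x then H x else +oo%E.
have -> : (\int[lebesgue_measure]_x H x = \int[lebesgue_measure]_x H' x)%E.
  apply: ae_eq_integral => //.
    apply: measurable_fun_ifT => //; apply: (measurable_fun_bool true); rewrite setTI.
    exact: measurable_weight_pos.
  by have [_ w0] := ww; apply: (ae_mono _ w0) => x wx _; rewrite /H' wx.
apply: int_le => x _; rewrite /H'; case: ifPn => // [wx|_]; last by rewrite leey.
exact: FH.
Qed.

Theorem theorem4p2 (R : realType) (q rho : R) (K : R -> R -> R[i]) (p0 : R) :
  2 < q -> 1 < rho -> standard_kernel K ->
  1 < p0 -> type_pp p0 (variation_op q K) ->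
  (forall w : R -> R, A1 w ->
    exists C1 : R, forall (f : nat -> R -> R[i]) (lambda : R),
      (forall k, in_Lp 1 w (f k)) -> 0 < lambda ->
      (wmeas w
         [set x | ((\sum_(0 <= k <oo) variation_op q K (f k) x `^ rho)
                     `^ rho^-1 > lambda%:E)%E]
       <= (C1 / lambda)%:E *
          \int[lebesgue_measure]_x
             ((\sum_(0 <= k <oo) (normc (f k x) `^ rho)%:E) `^ rho^-1
              * (w x)%:E))%E) /\
  (forall (p : R) (w : R -> R), 1 < p -> Ap p w ->
    exists C2 : R, forall f : nat -> R -> R[i],
      (forall k, in_Lp p w (f k)) ->
      (\int[lebesgue_measure]_x
          ((\sum_(0 <= k <oo) variation_op q K (f k) x `^ rho) `^ (p / rho)
           * (w x)%:E)
       <= C2%:E *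
          \int[lebesgue_measure]_x
             ((\sum_(0 <= k <oo) (normc (f k x) `^ rho)%:E) `^ (p / rho)
              * (w x)%:E))%E).
Proof.
move=> q2 rho1 [delta [C [delta0 C0 Ksize Kx Ky]]] p01 tp.
have q1 : 1 < q by apply: lt_trans q2; rewrite ltr1n.
have [D1 D10 wt] := weak_type_unweighted q1 rho1 delta0 C0 Ksize Kx Ky p01 tp.
have LpE (p : R) (w : R -> R) (f : R -> R[i]) : weight w -> in_Lp p w f ->
    (\int[lebesgue_measure]_y (normc (f y) `^ p * regular w y)%:E < +oo)%E.
  move=> ww [mf]; under eq_integral do rewrite EFinM.
  have mp : measurable_fun setT (fun y => (normc (f y) `^ p)%:E).
    apply/measurable_EFinP; apply: measurableT_comp (measurable_powR _) _.
    exact: cmeasurable_normc.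
  rewrite (@integral_regular R w _ idfun setT ww measurableT mp (@measurable_id _ _ _)).
  by under eq_integral do rewrite -EFinM.
split=> [w Aw|p w p1 Aw].
  have ww : weight w by have [] := Aw.
  have [A Av] := A1_regular Aw.
  (* An A_1 weight belongs to A_rho, so the strong type (rho, rho) holds with this weight; it is the
     input for the weighted weak type. *)
  have [D2 D20 H2] := @strong_type_of_weak_type R q rho delta C K q1 rho1 delta0 C0 Ksize Kx Ky
    rho (regular w) A rho1 (A1_Ap_ball Av rho1) D1 D10.
  have [D3 D30 H3] := @weak_type_of_strong_type R q rho delta C K q1 rho1 delta0 C0 Ksize Kx Ky
    (regular w) A Av rho D2 rho1 D20.
  exists D3 => f l fL l0.
  have af k : admissible_fun (f k).
    apply: (A1_admissible Av); first by have [] := fL k.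
    have := LpE 1 w (f k) ww (fL k).
    by under eq_integral do rewrite powRr1 ?normc_ge0//.
  have [H [mH H0 IH HH]] := @weak_type_series R q rho delta C K q1 rho1 delta0 C0 Ksize Kx Ky
    (regular w) (measurable_regular ww) (regular_gt0 w) D3 l f D30 l0 (fun N => H3 N (H2 N (wt N))) af.
  have mS := @measurable_series_norm R rho rho^-1 f (fun k => (af k).1).
  rewrite (@integral_regular R w _ idfun setT ww measurableT mS (@measurable_id _ _ _)).
  apply: le_trans IH; rewrite /wmeas integral_mkcond.
  apply: (int_le_of_weight ww mH H0) => x wx; rewrite patchE; case: ifPn => // xE.
  move: xE; rewrite inE/= => /HH; by rewrite /regular wx.
have ww : weight w by have [] := Aw.
have [A Av] := Ap_regular p1 Aw.
have [D2 D20 H2] := @strong_type_of_weak_type R q rho delta C K q1 rho1 delta0 C0 Ksize Kx Ky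
  p (regular w) A p1 Av D1 D10.
exists D2 => f fL.
have af k : admissible_fun (f k).
  apply: (Ap_admissible p1 Av); first by have [] := fL k.
  exact: LpE.
have [H [mH H0 IH HH]] := @strong_type_series R q rho delta C K q1 rho1 delta0 C0 Ksize Kx Ky
  (regular w) (measurable_regular ww) (regular_gt0 w) p D2 f p1 D20 (fun N => H2 N (wt N)) af.
have mS := @measurable_series_norm R rho (p / rho) f (fun k => (af k).1).
rewrite (@integral_regular R w _ idfun setT ww measurableT mS (@measurable_id _ _ _)).
apply: le_trans IH; apply: (int_le_of_weight ww mH H0) => x wx.
by have := HH x; rewrite /regular wx.
Qed.
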